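(* Let $\underline G$ be a Drinfeld $A$-module of rank two over $K$. If $p\neq2$, then $\underline G(\tilde K)_{\rm tor}$ is finite.
   Context: $q$ is a power of the prime $p$, $Q=\mathbb F_q(t)$, $A=\mathbb F_q[t]$, $\infty$ the place $1/t$. $F=\mathbb F_q(\theta)$ with $\gamma:A\to F$, $\gamma(t)=\theta$; $F\subset F^{sep}\subset F^{alg}$, and $K$ a finite extension of $F$ in $F^{alg}$. A Drinfeld $A$-module of rank $r$ over $K$ is an $\mathbb F_q$-algebra homomorphism $\phi:A\to K\{\tau\}$ ($\tau\lambda=\lambda^q\tau$), $\phi_a=\gamma(a)+\cdots+\lambda_a\tau^{r\deg a}$ with $\lambda_a\neq0$; $\underline G(S)$ is $S$ with $A$-action via $\phi$ ($\tau(x)=x^q$), and $\underline G(S)_{\rm tor}$ its torsion. The Carlitz module $\underline C$ over $F$ is $\Phi_t=\theta+\tau$. $\tilde F=F(\underline C(F^{sep})_{\rm tor})$ and $\tilde K=K\tilde F$. *)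

(* Defs.v *)
From HB Require Import structures.
From mathcomp Require Import all_boot all_order all_algebra all_field.
Set Implicit Arguments. Unset Strict Implicit. Unset Printing Implicit Defensive.
Import GRing.Theory.
Local Open Scope ring_scope.

(* Setting: Fq a finite field with q elements, L an algebraically closed field
   (playing the role of F^alg) with an embedding iota : Fq -> L and an element
   theta transcendental over Fq; F = Fq(theta) is a subfield of L. *)

Section Drinfeld.
Variables (Fq : finFieldType) (L : closedFieldType) (iota : {rmorphism Fq -> L}) (theta : L).

Definition gammaA (a : {poly Fq}) : L := (map_poly iota a).[theta].

Definition inF (x : L) : Prop :=
  exists a b : {poly Fq}, b != 0 /\ x = gammaA a / gammaA b.

Definition is_subfield (P : L -> Prop) : Prop :=
  [/\ P 0, P 1,
      (forall x y, P x -> P y -> P (x - y)),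
      (forall x y, P x -> P y -> P (x * y)) &
      (forall x, P x -> P x^-1)].

Definition gen_field (S : L -> Prop) (x : L) : Prop :=
  forall P, is_subfield P -> (forall s, S s -> P s) -> P x.

Definition separable_over_F (x : L) : Prop :=
  exists P : {poly L}, P != 0 /\ (forall i, inF P`_i) /\ root P x /\ separable_poly P.

Definition algebraic_over_F (x : L) : Prop :=
  exists P : {poly L}, P != 0 /\ (forall i, inF P`_i) /\ root P x.

Definition finite_ext_of_F (K : L -> Prop) : Prop :=
  is_subfield K /\ (forall x, inF x -> K x) /\
  exists (n : nat) (s : 'I_n -> L), (forall i, K (s i)) /\
    forall x, K x -> exists c : 'I_n -> L, (forall i, inF (c i)) /\ x = \sum_(i < n) c i * s i.

(* Action of phi_a on L for the Fq-algebra homomorphism phi : A -> L{tau}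
   determined by phi_t (given as the additive map x |-> phi_t(x)):
   phi_a = sum_i a_i phi_t^i, with tau(x) = x^q. *)
Definition phi_act (phit : L -> L) (a : {poly Fq}) (x : L) : L :=
  \sum_(i < size a) iota a`_i * iter i phit x.

Definition rank2_t (q : nat) (g1 g2 : L) (x : L) : L :=
  theta * x + g1 * x ^+ q + g2 * x ^+ (q ^ 2).

Definition carlitz_t (q : nat) (x : L) : L := theta * x + x ^+ q.

Definition is_torsion (phit : L -> L) (x : L) : Prop :=
  exists a : {poly Fq}, a != 0 /\ phi_act phit a x = 0.

Definition Ftilde (q : nat) (x : L) : Prop :=
  gen_field (fun y => inF y \/ (separable_over_F y /\ is_torsion (carlitz_t q) y)) x.

Definition Ktilde (q : nat) (K : L -> Prop) (x : L) : Prop :=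
  gen_field (fun y => K y \/ Ftilde q y) x.

End Drinfeld.

(* Main.v *)
(* Write T for the torsion of G over K(C_tor). Let S be the N-th power of a Frobenius lift at
   a place P, with N fixed such that S is trivial on K. For a prime v <> P of A and a suitable
   place of K above v, S agrees on T[v^oo] with an element of the inertia group at v whose
   Carlitz character is P^N: the group of F(C_tor) over F is abelian, so an automorphism can
   be moved between places, and only its value on C[v^oo] is seen by T[v^oo].
   The local structure at v (multiplicative, good ordinary or good supersingular reduction,
   together with the Weil pairing into C) then forces a relation between S and P^N that is
   independent of the level:
   - not supersingular at v: S (S x - x) = P^N (S x - x);
   - v-torsion, good reduction at v: S^2 x = P^N x, or S^e - P^(N m) and
     S^e - P^(N (e - m)) multiply to 0, by tame inertia;
   - supersingular at v: S^(2 l N) x = P^(N l N) x with l bounded, because the inertia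
     orbit of a point of order v^k has about |A/v|^(2k) elements.
   Reduced modulo P, S becomes a power of the Frobenius; if the reduction at P is ordinary,
   the relation becomes a nonzero polynomial equation, so it has boundedly many solutions,
   while reduction is injective on v-power torsion. Hence T[v^oo] is finite for every v and
   T[v] = 0 for almost all v. An ordinary P exists because p <> 2. *)
Require Import Defs.
From HB Require Import structures.
From mathcomp Require Import all_boot all_order all_algebra all_field.
From mathcomp Require Import pgroup abelian finfield.
From mathcomp Require Import boolp classical_sets.
From mathcomp Require Import zify ring lra.
Set Implicit Arguments. Unset Strict Implicit. Unset Printing Implicit Defensive.
Import Order.TTheory GRing.Theory Num.Theory.
Local Open Scope ring_scope.

(** No Galois group is constructed. Its elements are replaced by endomorphisms of [L] fixing F,
    obtained by Zorn, and congruences for them are only claimed on finite lists stable under all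
    such endomorphisms. A place is a rational valued valuation of the whole of [L]. In equal
    characteristic its residue field is realised inside [L] by the elements algebraic over [Fq], so
    the reduction of a module is again a module over [L].

    The exponent N is a product of three factors: one makes a power fix the generators of K and some
    auxiliary constants, q - 1 kills the scalar of [Fq] by which inertia moves nonintegral torsion
    at a multiplicative place, and p kills the unipotent action of inertia on torsion prime to the
    place. The bound on l is a pigeonhole: an orbit fills a fixed fraction of its torsion level, so
    among boundedly many injective images of it two must meet.

    That p is odd enters twice: it makes an antisymmetric self-adjoint pairing alternating, and it
    gives square roots of elements congruent to 1 modulo t. *)

Record setting := Setting {
  sFq : finFieldType; sL : closedFieldType;
  siota : {rmorphism sFq -> sL}; stheta : sL; spc : nat;
  spcP : spc \in [pchar sFq]; spc2 : spc != 2%N;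
  strans : forall a : {poly sFq}, gammaA siota stheta a = 0 -> a = 0;
  salg : forall x, algebraic_over_F siota stheta x }.

(** The constant term is a field of its own rather than [theta], so that reductions modulo a place
    fit the same type; rank one modules are the case [dg2 = 0]. *)
Record dmodule (L : Type) := Dmod { dth : L; dg1 : L; dg2 : L }.

Definition shift (L : nmodType) (c : nat -> L) k := if k is k'.+1 then c k' else 0.

(** * Torsion of Drinfeld modules *)

Section Basics.
Variable X : setting.
Local Notation Fq := (sFq X).
Local Notation L := (sL X).
Local Notation iota := (siota X).
Local Notation theta := (stheta X).
Local Notation pc := (spc X).
Definition qq := #|Fq|.
Local Notation q := qq.

Lemma q_gt1 : (1 < q)%N.
Proof. exact: finNzRing_gt1. Qed.

Lemma q_gt0 : (0 < q)%N.
Proof. exact: ltnW q_gt1. Qed.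

Lemma qX_gt0 n : (0 < q ^ n)%N.
Proof. by rewrite expn_gt0 q_gt0. Qed.

Lemma pcharL : pc \in [pchar L].
Proof. exact: (rmorph_pchar iota (spcP X)). Qed.

Lemma pc_prime : prime pc.
Proof. exact: pcharf_prime pcharL. Qed.

Lemma qq_ppart n : [pchar L].-nat (q ^ n)%N.
Proof.
have pn : pc.-nat q.
  have := abelem_pgroup (fin_ring_pchar_abelem (spcP X)).
  by rewrite /pgroup cardsT.
rewrite pnatX; apply/orP; left.
by rewrite (eq_pnat _ (pcharf_eq pcharL)).
Qed.

Lemma ppow_ppart n : [pchar L].-nat (pc ^ n)%N.
Proof.
rewrite pnatX; apply/orP; left.
by rewrite (eq_pnat _ (pcharf_eq pcharL)) pnat_id // pc_prime.
Qed.

Lemma exprDq n (x y : L) : (x + y) ^+ (q ^ n) = x ^+ (q ^ n) + y ^+ (q ^ n).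
Proof. exact: exprDn_pchar (qq_ppart n). Qed.

Lemma exprNq n (x : L) : (- x) ^+ (q ^ n) = - x ^+ (q ^ n).
Proof. exact: exprNn_pchar (qq_ppart n). Qed.

Lemma exprBq n (x y : L) : (x - y) ^+ (q ^ n) = x ^+ (q ^ n) - y ^+ (q ^ n).
Proof. by rewrite exprDq exprNq. Qed.

Lemma expr0q n : 0 ^+ (q ^ n) = 0 :> L.
Proof. by rewrite expr0n; case: (q ^ n)%N (qX_gt0 n). Qed.

Lemma exprDp n (x y : L) : (x + y) ^+ (pc ^ n) = x ^+ (pc ^ n) + y ^+ (pc ^ n).
Proof. exact: exprDn_pchar (ppow_ppart n). Qed.

Lemma exprBp n (x y : L) : (x - y) ^+ (pc ^ n) = x ^+ (pc ^ n) - y ^+ (pc ^ n).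
Proof. by rewrite exprDp (exprNn_pchar _ (ppow_ppart n)). Qed.

Lemma expr_sumq n I (r : seq I) P (F : I -> L) :
  (\sum_(i <- r | P i) F i) ^+ (q ^ n) = \sum_(i <- r | P i) F i ^+ (q ^ n).
Proof. exact: (big_morph (fun x => x ^+ (q ^ n)) (exprDq n) (expr0q n)). Qed.

Lemma cFq_q (a : Fq) n : a ^+ (q ^ n) = a.
Proof. by elim: n => [|n IH]; rewrite ?expr1 // expnS exprM expf_card IH. Qed.

Lemma iota_q (a : Fq) n : iota a ^+ (q ^ n) = iota a.
Proof. by rewrite -rmorphXn cFq_q. Qed.

Lemma iota_inj0 (a : Fq) : (iota a == 0) = (a == 0).
Proof. exact: fmorph_eq0. Qed.

Definition dt (D : dmodule L) : L -> L := rank2_t (dth D) q (dg1 D) (dg2 D).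
Definition act (D : dmodule L) := phi_act iota (dt D).

Lemma dtE D x : dt D x = dth D * x + dg1 D * x ^+ q + dg2 D * x ^+ (q ^ 2).
Proof. by []. Qed.

Lemma dtD D x y : dt D (x + y) = dt D x + dt D y.
Proof. by rewrite !dtE (exprDq 2) (exprDq 1); ring. Qed.

Lemma dtZ D c x : dt D (iota c * x) = iota c * dt D x.
Proof. by rewrite !dtE !exprMn (iota_q c 1) iota_q; ring. Qed.

Lemma dt0 D : dt D 0 = 0.
Proof. by rewrite dtE (expr0q 2) (expr0q 1); ring. Qed.

Lemma iter_dtD D i x y : iter i (dt D) (x + y) = iter i (dt D) x + iter i (dt D) y.
Proof. by elim: i => //= i ->; rewrite dtD. Qed.

Lemma iter_dtZ D i c x : iter i (dt D) (iota c * x) = iota c * iter i (dt D) x.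
Proof. by elim: i => //= i ->; rewrite dtZ. Qed.

Lemma act_wide D n (a : {poly Fq}) x : (size a <= n)%N ->
  act D a x = \sum_(i < n) iota a`_i * iter i (dt D) x.
Proof.
move=> le_an; rewrite /act /phi_act (big_ord_widen _ (fun i => iota a`_i * iter i (dt D) x) le_an).
rewrite [RHS](bigID (fun i : 'I_n => (i < size a)%N)) /= [X in _ = _ + X]big1 ?addr0 //.
by move=> i; rewrite -leqNgt => /(nth_default 0) ->; rewrite rmorph0 mul0r.
Qed.

Lemma actDl D a b x : act D (a + b) x = act D a x + act D b x.
Proof.
set n := maxn (size a) (size b).
rewrite !(@act_wide D n) ?leq_maxl ?leq_maxr ?size_polyD ?(leq_trans (size_polyD _ _)) //.
rewrite -big_split /=; apply: eq_bigr => i _.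
by rewrite coefD rmorphD mulrDl.
Qed.

Lemma actZl D c a x : act D (c *: a) x = iota c * act D a x.
Proof.
rewrite !(@act_wide D (size a)) ?size_scale_leq // mulr_sumr.
by apply: eq_bigr => i _; rewrite coefZ rmorphM mulrA.
Qed.

Lemma act0l D x : act D 0 x = 0.
Proof. by rewrite /act /phi_act size_poly0 big_ord0. Qed.

Lemma actNl D a x : act D (- a) x = - act D a x.
Proof. by rewrite -scaleN1r actZl rmorphN rmorph1 mulN1r. Qed.

Lemma actBl D a b x : act D (a - b) x = act D a x - act D b x.
Proof. by rewrite actDl actNl. Qed.

Lemma actDr D a x y : act D a (x + y) = act D a x + act D a y.
Proof.
rewrite /act /phi_act -big_split /=; apply: eq_bigr => i _.
by rewrite iter_dtD mulrDr.
Qed.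

Lemma actZr D c a x : act D a (iota c * x) = iota c * act D a x.
Proof.
rewrite /act /phi_act mulr_sumr; apply: eq_bigr => i _.
by rewrite iter_dtZ mulrCA.
Qed.

Lemma act0r D a : act D a 0 = 0.
Proof. by move: (actZr D 0 a 0); rewrite rmorph0 !mul0r. Qed.

Lemma actNr D a x : act D a (- x) = - act D a x.
Proof. by rewrite -mulN1r -(rmorph1 iota) -rmorphN actZr rmorphN rmorph1 mulN1r. Qed.

Lemma actBr D a x y : act D a (x - y) = act D a x - act D a y.
Proof. by rewrite actDr actNr. Qed.

Lemma actC D c x : act D c%:P x = iota c * x.
Proof.
rewrite (@act_wide D 1) ?size_polyC_leq1 // big_ord1 coefC eqxx //.
Qed.

Lemma act1 D x : act D 1 x = x.
Proof. by rewrite -[1]/(1%:P) actC rmorph1 mul1r. Qed.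

Lemma actX D x : act D 'X x = dt D x.
Proof.
by rewrite (@act_wide D 2) ?size_polyX // big_ord_recr big_ord1 /= !coefX rmorph0 mul0r add0r rmorph1 mul1r.
Qed.

Lemma actXM D a x : act D ('X * a) x = dt D (act D a x).
Proof.
rewrite mulrC (@act_wide D (size a).+1) ?size_polyMX_leq //; last first.
  have [->|a0] := eqVneq a 0; first by rewrite mul0r size_poly0.
  by rewrite size_mulX.
rewrite big_ord_recl coefMX eqxx rmorph0 mul0r add0r.
rewrite /act /phi_act.
rewrite (big_morph (dt D) (dtD D) (dt0 D)); apply: eq_bigr => i _.
by rewrite coefMX /= dtZ.
Qed.

Lemma actM D a b x : act D (a * b) x = act D a (act D b x).
Proof.
elim/poly_ind: a x => [|a c IH] x; first by rewrite mul0r !act0l.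
by rewrite mulrDl !actDl mul_polyC actZl actC -mulrA mulrCA actXM IH (mulrC a) actXM.
Qed.

Lemma actCA D a b x : act D a (act D b x) = act D b (act D a x).
Proof. by rewrite -!actM mulrC. Qed.

Lemma act_dvd D (a b : {poly Fq}) x : a %| b -> act D a x = 0 -> act D b x = 0.
Proof. by case/dvdpP => c -> ax; rewrite actM ax act0r. Qed.

Lemma act_hom (f : {rmorphism L -> L}) D a x : (forall c, f (iota c) = iota c) ->
  f (act D a x) = act (Dmod (f (dth D)) (f (dg1 D)) (f (dg2 D))) a (f x).
Proof.
move=> fi; rewrite /act /phi_act rmorph_sum /=; apply: eq_bigr => i _.
rewrite rmorphM fi; congr (_ * _).
by elim: (val i) => //= j IH; rewrite !dtE /= !rmorphD !rmorphM !rmorphXn /= IH.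
Qed.

(** The coefficient of tau^k in phi_t^i, from phi_t^(i+1) = phi_t phi_t^i. *)
Fixpoint cf (D : dmodule L) i : nat -> L :=
  if i is i'.+1 then fun k => dth D * cf D i' k + dg1 D * (shift (cf D i') k) ^+ q
       + dg2 D * (shift (shift (cf D i')) k) ^+ (q ^ 2)
  else fun k => (k == 0%N)%:R.

(** The coefficient of tau^k in phi_a. *)
Definition ca D (a : {poly Fq}) k := \sum_(i < size a) iota a`_i * cf D i k.

Lemma cf_big D i k : (2 * i < k)%N -> cf D i k = 0.
Proof.
elim: i k => [|i IH] [|[|k]] //= lt.
by rewrite !IH ?(expr0q 2) ?(expr0q 1) ?mulr0 ?addr0 //; lia.
Qed.

Lemma iter_dtE D i x n : (2 * i < n)%N ->
  iter i (dt D) x = \sum_(k < n) cf D i k * x ^+ (q ^ k).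
Proof.
elim: i n => [|i IH] n lt.
  case: n lt => // n _; rewrite big_ord_recl /= mul1r expr1 big1 ?addr0 // => j _.
  by rewrite /= mul0r.
case: n lt => [|[|n]] lt; [lia|lia|].
rewrite iterS dtE /=.
under eq_bigr do rewrite !mulrDl.
rewrite !big_split /=; congr (_ + _ + _).
- rewrite (IH n.+2) ?mulr_sumr; last lia.
  by apply: eq_bigr => k _; rewrite mulrA.
- rewrite big_ord_recl /= (expr0q 1) mulr0 mul0r add0r (IH n.+1); last lia.
  rewrite (expr_sumq 1) mulr_sumr; apply: eq_bigr => k _.
  by rewrite /= exprMn -exprM -mulrA -expnSr.
- rewrite 2!big_ord_recl /= (expr0q 2) !mulr0 !mul0r !add0r (IH n); last lia.
  rewrite (expr_sumq 2) mulr_sumr; apply: eq_bigr => k _.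
  by rewrite /= exprMn -exprM -mulrA -expnD addn2.
Qed.

Lemma ca_big D (a : {poly Fq}) k : (2 * size a <= k.+1)%N -> ca D a k = 0.
Proof.
move=> le; rewrite /ca big1 // => i _; rewrite cf_big ?mulr0 //.
by have := ltn_ord i; lia.
Qed.

Lemma actE D (a : {poly Fq}) x n : (2 * size a <= n.+1)%N ->
  act D a x = \sum_(k < n) ca D a k * x ^+ (q ^ k).
Proof.
move=> le; rewrite /act /phi_act.
under eq_bigr => i _.
  rewrite (@iter_dtE D i x n); last by have := ltn_ord i; lia.
  rewrite mulr_sumr; over.
rewrite exchange_big /=; apply: eq_bigr => k _.
by rewrite /ca mulr_suml; apply: eq_bigr => i _; rewrite mulrA.
Qed.

(** The exponent stays unspecified: later only the fact that the top coefficient is a power of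
    [dg2 D] matters, as it is then nonzero, or a unit when [dg2 D] is one. *)
Lemma cf_top D i : exists e, cf D i (2 * i) = dg2 D ^+ e.
Proof.
elim: i => [|i [e IH]]; first by exists 0%N.
rewrite mulnS add2n /= (@cf_big D i (2 * i).+2) ?(@cf_big D i (2 * i).+1) //.
exists (1 + e * q ^ 2)%N.
by rewrite IH (expr0q 1) !mulr0 !add0r exprD exprM expr1.
Qed.

Lemma cf_rk1_big D i k : dg2 D = 0 -> (i < k)%N -> cf D i k = 0.
Proof.
move=> g0; elim: i k => [|i IH] [|k] //= lt.
by rewrite !IH ?g0 ?(expr0q 1) ?mulr0 ?mul0r ?addr0 //; lia.
Qed.

Lemma cf_rk1_top D i : dg2 D = 0 -> exists e, cf D i i = dg1 D ^+ e.
Proof.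
move=> g0; elim: i => [|i [e IH]]; first by exists 0%N.
rewrite /= (@cf_rk1_big D i i.+1) // g0.
exists (1 + e * q)%N.
by rewrite IH mulr0 mul0r add0r addr0 exprD exprM expr1.
Qed.

Lemma ca_top D (a : {poly Fq}) : a != 0 ->
  exists e, ca D a (2 * (size a).-1) = iota (lead_coef a) * dg2 D ^+ e.
Proof.
move=> a0; have := size_poly_gt0 a; rewrite a0 /ca lead_coefE.
case: (size a) => // s _; rewrite big_ord_recr /= big1 ?add0r => [|i _].
  by have [e ->] := cf_top D s; exists e.
by rewrite cf_big ?mulr0 //; have := ltn_ord i; lia.
Qed.

Lemma ca_rk1_big D (a : {poly Fq}) k : dg2 D = 0 -> (size a <= k)%N -> ca D a k = 0.
Proof.
move=> g0 le; rewrite /ca big1 // => i _; rewrite cf_rk1_big ?mulr0 //.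
by have := ltn_ord i; lia.
Qed.

Lemma ca_rk1_top D (a : {poly Fq}) : a != 0 -> dg2 D = 0 ->
  exists e, ca D a (size a).-1 = iota (lead_coef a) * dg1 D ^+ e.
Proof.
move=> a0 g0; have := size_poly_gt0 a; rewrite a0 /ca lead_coefE.
case: (size a) => // s _; rewrite big_ord_recr /= big1 ?add0r => [|i _].
  by have [e ->] := cf_rk1_top s g0; exists e.
by rewrite cf_rk1_big ?mulr0 //; have := ltn_ord i; lia.
Qed.

Lemma cf0 D i : cf D i 0 = dth D ^+ i.
Proof. by elim: i => //= i ->; rewrite (expr0q 2) (expr0q 1) !mulr0 !addr0 exprS. Qed.

Lemma ca0 D a : ca D a 0 = (map_poly iota a).[dth D].
Proof.
rewrite horner_coef size_map_poly /ca; apply: eq_bigr => i _.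
by rewrite cf0 coef_map.
Qed.

(** This is phi_t^(i+1) = phi_t^i phi_t, the recursion on the side opposite to the one defining
    [cf]. *)
Lemma cf_right D i k : cf D i.+1 k = cf D i k * dth D ^+ (q ^ k)
  + shift (fun j => cf D i j * dg1 D ^+ (q ^ j)) k
  + shift (shift (fun j => cf D i j * dg2 D ^+ (q ^ j))) k.
Proof.
elim: i k => [|i IH] k.
  case: k => [|[|k]] /=; rewrite ?(expr0q 2) ?(expr0q 1) ?expr1n ?expr1 ?mulr0 ?mul0r ?addr0 ?add0r ?mulr1 ?mul1r //.
  by case: k => [|k] /=; rewrite ?expr1n ?expr1 ?(expr0q 2) ?mulr1 ?mul1r ?mulr0 ?mul0r.
have E k' : cf D i.+1 k' = dth D * cf D i k' + dg1 D * (shift (cf D i) k') ^+ q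
       + dg2 D * (shift (shift (cf D i)) k') ^+ (q ^ 2) by [].
have -> : cf D i.+2 k = dth D * cf D i.+1 k + dg1 D * (shift (cf D i.+1) k) ^+ q
       + dg2 D * (shift (shift (cf D i.+1)) k) ^+ (q ^ 2) by [].
move: (cf D i.+1) IH E => c IH E.
case: k => [|[|k]]; rewrite /shift.
- rewrite {1}(IH 0%N) (E 0%N) /shift !(expr0q 1, expr0q 2); ring.
- rewrite {1}(IH 1%N) {1}(IH 0%N) (E 0%N) (E 1%N) /shift.
  rewrite !(exprDq 1, exprDq 2, expr0q 1, expr0q 2, exprMn) -!exprM -?expnSr ?muln1 ?mul1n; ring.
- rewrite {1}(IH k.+2) {1}(IH k.+1) {1}(IH k) (E k.+2) (E k.+1) (E k) /shift.
  case: k => [|[|k]]; rewrite !(exprDq 1, exprDq 2, expr0q 1, expr0q 2, exprMn) -!exprM -?expnSr -?expnD ?addn2 ?muln1 ?mul1n; ring.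
Qed.

End Basics.

Section Torsion.
Variable X : setting.
Local Notation Fq := (sFq X).
Local Notation L := (sL X).
Local Notation iota := (siota X).
Local Notation theta := (stheta X).
Local Notation pc := (spc X).
Local Notation q := (qq X).
Implicit Types (a b v : {poly Fq}) (x y z : L) (D : dmodule L).

(** Compare the coefficients of tau^k in phi_t phi_a = phi_a phi_t. Where the first factor is a
    unit, this controls each coefficient of phi_a by the two preceding ones; the divisibility of
    coefficients of phi_b modulo b rests on it. *)
Lemma ca_comm D a k : (dth D ^+ (q ^ k) - dth D) * ca D a k =
  dg1 D * (shift (ca D a) k) ^+ q + dg2 D * (shift (shift (ca D a)) k) ^+ (q ^ 2)
  - shift (fun j => ca D a j * dg1 D ^+ (q ^ j)) k
  - shift (shift (fun j => ca D a j * dg2 D ^+ (q ^ j))) k.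
Proof.
have sE (c : nat -> nat -> L) (f : nat -> L -> L) (n : nat) k' :
   (forall j, f j 0 = 0) -> (forall j y z, f j (y + z) = f j y + f j z) ->
   (forall j u y, f j (iota u * y) = iota u * f j y) ->
   shift (fun j => f j (\sum_(i < n) iota a`_i * c i j)) k' =
   \sum_(i < n) iota a`_i * shift (fun j => f j (c i j)) k'.
  move=> f0 fD fZ; case: k' => [|k'] /=.
    by rewrite big1 // => i _; rewrite mulr0.
  rewrite (big_morph (f k') (fD k') (f0 k')); by apply: eq_bigr => i _; rewrite fZ.
rewrite /ca; set n := size a.
have -> : (shift (fun k0 => \sum_(i < n) iota a`_i * cf D i k0) k) ^+ q =
   \sum_(i < n) iota a`_i * (shift (cf D i) k) ^+ q.
  case: k => [|k] /=; last first.
    by rewrite (expr_sumq 1); apply: eq_bigr => i _; rewrite exprMn (iota_q _ 1).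
  by rewrite (expr0q _ 1) big1 // => i _; rewrite mulr0.
have -> : (shift (shift (fun k0 => \sum_(i < n) iota a`_i * cf D i k0)) k) ^+ (q ^ 2) =
   \sum_(i < n) iota a`_i * (shift (shift (cf D i)) k) ^+ (q ^ 2).
  case: k => [|[|k]] /=; last first.
  - by rewrite (expr_sumq 2); apply: eq_bigr => i _; rewrite exprMn (iota_q _ 2).
  - by rewrite (expr0q _ 2) big1 // => i _; rewrite mulr0.
  - by rewrite (expr0q _ 2) big1 // => i _; rewrite mulr0.
have -> : shift (fun j => (\sum_(i < n) iota a`_i * cf D i j) * dg1 D ^+ (q ^ j)) k =
   \sum_(i < n) iota a`_i * shift (fun j => cf D i j * dg1 D ^+ (q ^ j)) k.
  rewrite (sE (cf D) (fun j y => y * dg1 D ^+ (q ^ j))) // => *; rewrite ?mul0r ?mulrDl //.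
  by rewrite mulrA.
have -> : shift (shift (fun j => (\sum_(i < n) iota a`_i * cf D i j) * dg2 D ^+ (q ^ j))) k =
   \sum_(i < n) iota a`_i * shift (shift (fun j => cf D i j * dg2 D ^+ (q ^ j))) k.
  case: k => [|k] /=; first by rewrite big1 // => i _; rewrite mulr0.
  rewrite (sE (cf D) (fun j y => y * dg2 D ^+ (q ^ j))) // => *; rewrite ?mul0r ?mulrDl //.
  by rewrite mulrA.
rewrite !mulr_sumr -big_split /= -!sumrB; apply: eq_bigr => i _.
have E : dth D * cf D i k + dg1 D * (shift (cf D i) k) ^+ q
   + dg2 D * (shift (shift (cf D i)) k) ^+ (q ^ 2) = _ := cf_right D i k.
set A := shift (fun j => cf D i j * dg1 D ^+ (q ^ j)) k in E *.
set B := shift (shift (fun j => cf D i j * dg2 D ^+ (q ^ j))) k in E *.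
have -> : A = dth D * cf D i k + dg1 D * (shift (cf D i) k) ^+ q
   + dg2 D * (shift (shift (cf D i)) k) ^+ (q ^ 2) - cf D i k * dth D ^+ (q ^ k) - B by rewrite E; ring.
ring.
Qed.

Definition ga D a : L := (map_poly iota a).[dth D].

Lemma gaX D a n : ga D (a ^+ n) = ga D a ^+ n.
Proof. by rewrite /ga rmorphXn horner_exp. Qed.

Definition Pa D a : {poly L} := \sum_(k < (2 * size a).+1) ca D a k *: 'X^(q ^ k).

Lemma horner_Pa D a x : (Pa D a).[x] = act D a x.
Proof.
rewrite (@actE _ D a x (2 * size a).+1); last by lia.
by rewrite horner_sum; apply: eq_bigr => k _; rewrite !hornerE.
Qed.

Lemma natq0 k : (0 < k)%N -> (q ^ k)%:R = 0 :> L.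
Proof.
case: k => // k _; apply/eqP; rewrite -(dvdn_pcharf (pcharL X)).
have /p_natP [e E] : pc.-nat (q ^ k.+1)%N.
  by rewrite -(eq_pnat _ (pcharf_eq (pcharL X))); exact: qq_ppart.
rewrite E; case: e E => [E|e _]; last by rewrite expnS dvdn_mulr.
have := ltn_exp2l 0 k.+1 (q_gt1 X).
by rewrite E expn0 ltnn.
Qed.

(** All exponents q^k with k > 0 vanish in characteristic p; torsion polynomials are therefore
    separable as soon as a does not vanish at [dth D]. *)
Lemma deriv_Pa D a : (Pa D a)^`() = (ga D a)%:P.
Proof.
rewrite /Pa linear_sum /= big_ord_recl big1 ?addr0 => [|k _].
  by rewrite derivZ derivXn expn0 /= expr0 mulr1n ca0 -mul_polyC mulr1.
by rewrite derivZ derivXn -mulr_natr -polyC_natr natq0 // mulr0 scaler0.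
Qed.

Lemma size_sumXq n (c : nat -> L) : c n != 0 ->
  size (\sum_(k < n.+1) c k *: 'X^(q ^ k)) = (q ^ n).+1.
Proof.
move=> cn; rewrite big_ord_recr /= addrC size_polyDl size_scale // size_polyXn //.
apply: (leq_ltn_trans (size_sum _ _ _)); rewrite ltnS; apply/bigmax_leqP => i _.
apply: (leq_trans (size_scale_leq _ _)).
by rewrite size_polyXn ltn_exp2l ?q_gt1.
Qed.

Lemma Pa_cut D a n : (forall k, (n < k)%N -> ca D a k = 0) ->
  Pa D a = \sum_(k < n.+1) ca D a k *: 'X^(q ^ k).
Proof.
move=> cut; have E m1 m2 : (forall k, (m1 <= k)%N -> ca D a k = 0) -> (m1 <= m2)%N ->
   \sum_(k < m2) ca D a k *: 'X^(q ^ k) = \sum_(k < m1) ca D a k *: 'X^(q ^ k).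
  move=> c0 le; rewrite [RHS](big_ord_widen _ (fun k => ca D a k *: 'X^(q ^ k)) le).
  rewrite (bigID (fun i : 'I_m2 => (i < m1)%N)) /= [X in _ + X = _]big1 ?addr0 //.
  by move=> i; rewrite -leqNgt => /c0 ->; rewrite scale0r.
case: (leqP n (2 * size a)) => le; first by rewrite /Pa (@E n.+1).
rewrite /Pa (@E (2 * size a).+1 n.+1) //; last by lia.
by move=> k lk; apply: ca_big; lia.
Qed.

Lemma size_Pa2 D a : a != 0 -> dg2 D != 0 -> size (Pa D a) = (q ^ (2 * (size a).-1)).+1.
Proof.
move=> a0 g0; have sa : (0 < size a)%N by rewrite size_poly_gt0.
rewrite (@Pa_cut D a (2 * (size a).-1)); last by move=> k lk; apply: ca_big; lia.
apply: size_sumXq; have [e ->] := ca_top D a0.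
by rewrite mulf_neq0 ?expf_neq0 // iota_inj0 lead_coef_eq0.
Qed.

Lemma size_Pa1 D a : a != 0 -> dg2 D = 0 -> dg1 D != 0 -> size (Pa D a) = (q ^ (size a).-1).+1.
Proof.
move=> a0 g2 g0; have sa : (0 < size a)%N by rewrite size_poly_gt0.
rewrite (@Pa_cut D a (size a).-1); last by move=> k lk; apply: ca_rk1_big => //; lia.
apply: size_sumXq; have [e ->] := ca_rk1_top a0 g2.
by rewrite mulf_neq0 ?expf_neq0 // iota_inj0 lead_coef_eq0.
Qed.

Lemma sep_roots (f : {poly L}) (c : L) : f^`() = c%:P -> c != 0 ->
  exists s, [/\ uniq s, size s = (size f).-1 & forall x, (x \in s) = root f x].
Proof.
move=> df c0.
have f0 : f != 0 by apply/eqP => f0; move: df; rewrite f0 deriv0 => /esym/eqP; rewrite polyC_eq0 (negbTE c0).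
have [r fE] := closed_field_poly_normal f.
have lf : lead_coef f != 0 by rewrite lead_coef_eq0.
exists r; split.
- rewrite -separable_prod_XsubC.
  have : separable_poly f.
    by rewrite unlock /= df -alg_polyC coprimepZr // coprimep1.
  by move=> sf; apply: dvdp_separable sf; rewrite [X in _ %| X]fE dvdpZr.
- by rewrite [in RHS]fE size_scale // size_prod_XsubC.
- by move=> x; rewrite fE rootZ // root_prod_XsubC.
Qed.

Definition rk D := if dg2 D == 0 then 1%N else 2%N.

Lemma tors_ex D a : a != 0 -> ga D a != 0 -> (dg2 D != 0) || (dg1 D != 0) ->
  exists s, [/\ uniq s, size s = (q ^ (rk D * (size a).-1))%N &
    forall x, (x \in s) = (act D a x == 0)].
Proof.
move=> a0 g0 g12; have [s [us ss sE]] := sep_roots (deriv_Pa D a) g0.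
exists s; split => //; last by move=> x; rewrite sE /root horner_Pa.
rewrite ss /rk; case: eqP g12 => [g2 /= g1|/eqP g2 _]; last by rewrite size_Pa2.
by rewrite size_Pa1 // mul1n.
Qed.

Lemma irr_coprime v a : irreducible_poly v -> ~~ (v %| a) -> coprimep v a.
Proof.
move=> [sv irr] nva; apply/coprimepP => d dv da.
apply: contraNT nva => nd; have dE : d %= v by apply: irr => //; rewrite size_poly_eq1.
by rewrite -(eqp_dvdl a dE).
Qed.

Lemma bezout1 a b : coprimep a b -> exists u w, u * a + w * b = 1.
Proof.
move=> /Bezout_eq1_coprimepP [[u w] /= E]; by exists u, w.
Qed.

Lemma irr_neq0 v : irreducible_poly v -> v != 0.
Proof. by case=> sv _; rewrite -size_poly_gt0 ltnW. Qed.

Lemma act_coprime0 D a b x : coprimep a b -> act D a x = 0 -> act D b x = 0 -> x = 0.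
Proof.
move=> /bezout1 [u [w E]] ax bx.
by rewrite -[x](act1 D) -E actDl !actM ax bx !act0r addr0.
Qed.

Lemma order_dvd D v k x a : irreducible_poly v -> act D (v ^+ k.+1) x = 0 ->
  act D (v ^+ k) x != 0 -> act D a x = 0 -> v ^+ k.+1 %| a.
Proof.
move=> iv xk xk1 ax.
suff H j : (j <= k.+1)%N -> v ^+ j %| a by apply: H.
elim: j => [|j IH] le; first by rewrite expr0 dvd1p.
have /dvdpP [a' aE] := IH (ltnW le).
have [/dvdpP [a'' E]|nv] := boolP (v %| a').
  by rewrite aE E -mulrA -exprS dvdp_mull.
case/eqP: xk1; have /bezout1 [u [w E]] : coprimep (v ^+ k.+1) a'.
  by apply: coprimep_expl; apply: irr_coprime.
have vj : act D (v ^+ j) x = 0.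
  have -> : v ^+ j = (u * v ^+ j) * v ^+ k.+1 + w * a by rewrite -[LHS]mul1r -E aE; ring.
  by rewrite actDl actM (actM D w) xk ax !act0r addr0.
by apply: (act_dvd _ vj); rewrite dvdp_exp2l.
Qed.

Definition polys n : seq {poly Fq} := [seq rVpoly r | r : 'rV[Fq]_n].

Lemma mem_polys n a : (a \in polys n) = (size a <= n)%N.
Proof.
apply/mapP/idP => [[r _ ->]|le]; first exact: size_poly.
by exists (poly_rV a); rewrite ?mem_enum // poly_rV_K.
Qed.

Lemma uniq_polys n : uniq (polys n).
Proof. by rewrite map_inj_uniq ?enum_uniq //; exact: (can_inj rVpolyK). Qed.

Lemma size_polys n : size (polys n) = (q ^ n)%N.
Proof. by rewrite size_map -cardE card_mx mul1n. Qed.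

Lemma size_exp_pred v k : v != 0 -> (size (v ^+ k)).-1 = (k * (size v).-1)%N.
Proof. by move=> v0; rewrite size_exp mulnC. Qed.

Lemma size_vk v k : v != 0 -> size (v ^+ k) = (k * (size v).-1).+1.
Proof.
move=> v0; have := size_exp_pred k v0.
have : (0 < size (v ^+ k))%N by rewrite size_poly_gt0 expf_neq0.
by case: (size _) => // n _ /= ->.
Qed.

Lemma multiples_uniq D v k x : irreducible_poly v -> act D (v ^+ k.+1) x = 0 ->
  act D (v ^+ k) x != 0 -> {in polys (k.+1 * (size v).-1) &, injective (act D ^~ x)}.
Proof.
move=> iv xk xk1 a b; rewrite !mem_polys => sa sb E.
apply/eqP; rewrite -subr_eq0; apply/eqP; apply: contraTeq isT => ab.
have : v ^+ k.+1 %| a - b by apply: (order_dvd iv xk xk1); rewrite actBl E subrr.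
move/dvdp_leq => /(_ ab); rewrite size_vk ?irr_neq0 // => lt.
suff : (size (a - b)%R <= k.+1 * (size v).-1)%N by move=> le; move: (leq_trans lt le); rewrite ltnn.
by apply: (leq_trans (size_polyD _ _)); rewrite size_polyN geq_max sa sb.
Qed.

Lemma act_mod D v k x a : v != 0 -> act D (v ^+ k) x = 0 ->
  exists2 b, b \in polys (k * (size v).-1) & act D a x = act D b x.
Proof.
move=> v0 xk; exists (a %% v ^+ k).
  by rewrite mem_polys -ltnS -size_vk // ltn_modp expf_neq0.
by rewrite {1}(divp_eq a (v ^+ k)) actDl actM xk act0r add0r.
Qed.

Lemma uniq_sub_eq (T : eqType) (s1 s2 : seq T) : uniq s1 -> {subset s1 <= s2} ->
  (size s2 <= size s1)%N -> s1 =i s2.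
Proof. by move=> u1 s12 le; have [] := uniq_min_size u1 s12 le. Qed.

(** A point of exact order v^(k+1) has q^((k+1) deg v) distinct multiples, so they exhaust any list
    of at most that size containing them. *)
Lemma cyclic_of_size D v k x (s : seq L) : irreducible_poly v -> act D (v ^+ k.+1) x = 0 ->
  act D (v ^+ k) x != 0 -> (size s <= q ^ (k.+1 * (size v).-1))%N ->
  (forall a, act D a x \in s) -> forall y, y \in s -> exists a, y = act D a x.
Proof.
move=> iv xk xk1 ss sE y ys.
have E : [seq act D a x | a <- polys (k.+1 * (size v).-1)] =i s.
  apply: uniq_sub_eq.
  - by rewrite map_inj_in_uniq ?uniq_polys //; exact: multiples_uniq.
  - by move=> z /mapP [a _ ->].
  - by rewrite size_map size_polys.
by move: ys; rewrite -E => /mapP [a _ ->]; exists a.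
Qed.

End Torsion.

(** * The Weil pairing with values in Carlitz torsion *)

Section Weil.
Variable X : setting.
Local Notation Fq := (sFq X).
Local Notation L := (sL X).
Local Notation iota := (siota X).
Local Notation theta := (stheta X).
Local Notation pc := (spc X).
Local Notation q := (qq X).
Implicit Types (a b v : {poly Fq}) (x y z : L) (D : dmodule L).

Definition moore x y : L := x * y ^+ q - x ^+ q * y.
(** The numbers a_(i+j+1) are the coefficients of the Bezoutian (a(S) - a(T)) / (S - T). Letting S
    act by phi_t on x and T by phi_t on y inside the Moore determinant gives the Weil pairing in
    rank two. *)
Definition weil D a x y : L := \sum_(i < size a) \sum_(j < size a)
  iota a`_(i + j).+1 * moore (iter i (dt D) x) (iter j (dt D) y).

Lemma mooreDl x x' y : moore (x + x') y = moore x y + moore x' y.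
Proof. by rewrite /moore (exprDq 1); ring. Qed.
Lemma mooreDr x y y' : moore x (y + y') = moore x y + moore x y'.
Proof. by rewrite /moore (exprDq 1); ring. Qed.
Lemma mooreC x y : moore y x = - moore x y.
Proof. by rewrite /moore; ring. Qed.
Lemma mooreZl c x y : moore (iota c * x) y = iota c * moore x y.
Proof. by rewrite /moore exprMn (iota_q c 1); ring. Qed.
Lemma mooreZr c x y : moore x (iota c * y) = iota c * moore x y.
Proof. by rewrite /moore exprMn (iota_q c 1); ring. Qed.

Lemma weilC D a x y : weil D a y x = - weil D a x y.
Proof.
rewrite /weil exchange_big /= -sumrN; apply: eq_bigr => i _.
rewrite -sumrN; apply: eq_bigr => j _.
by rewrite mooreC addnC mulrN.
Qed.

Lemma eq_opp_eq0 (z : L) : z = - z -> z = 0.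
Proof.
move/eqP; rewrite -subr_eq0 opprK -mulr2n -mulr_natl mulf_eq0 => /orP [|/eqP //].
rewrite -(dvdn_pcharf (pcharL X)) dvdn_prime2 ?(pc_prime X) // => /eqP E.
by have := spc2 X; rewrite E.
Qed.

Lemma weilDl D a x x' y : weil D a (x + x') y = weil D a x y + weil D a x' y.
Proof.
rewrite /weil -big_split; apply: eq_bigr => i _ /=; rewrite -big_split; apply: eq_bigr => j _ /=.
by rewrite iter_dtD mooreDl mulrDr.
Qed.

Lemma weilDr D a x y y' : weil D a x (y + y') = weil D a x y + weil D a x y'.
Proof. by rewrite weilC weilDl opprD -!weilC. Qed.

Lemma weilZl D a c x y : weil D a (iota c * x) y = iota c * weil D a x y.
Proof.
rewrite /weil mulr_sumr; apply: eq_bigr => i _ /=; rewrite mulr_sumr; apply: eq_bigr => j _ /=.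
by rewrite iter_dtZ mooreZl mulrCA.
Qed.

Lemma weilZr D a c x y : weil D a x (iota c * y) = iota c * weil D a x y.
Proof. by rewrite weilC weilZl -mulrN -weilC. Qed.

Lemma weil0l D a y : weil D a 0 y = 0.
Proof. by rewrite -(mul0r 0) -(rmorph0 iota) weilZl rmorph0 !mul0r. Qed.
Lemma weil0r D a x : weil D a x 0 = 0.
Proof. by rewrite weilC weil0l oppr0. Qed.
Lemma weilNl D a x y : weil D a (- x) y = - weil D a x y.
Proof. by apply/eqP; rewrite -addr_eq0 -weilDl addNr weil0l. Qed.
Lemma weilNr D a x y : weil D a x (- y) = - weil D a x y.
Proof. by rewrite weilC weilNl -weilC. Qed.

(* Abel summation: both Hecke equivariance identities below are telescoping sums of this form. *)
Lemma telescope_square n (a : nat -> L) (f : nat -> nat -> L) : (forall k, (n <= k)%N -> a k = 0) ->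
  \sum_(i < n) \sum_(j < n) a (i + j).+1 * (f i.+1 j - f i j.+1) =
  \sum_(k < n) a k * (f k 0%N - f 0%N k).
Proof.
move=> a0.
have E (g : nat -> nat -> L) : \sum_(i < n) \sum_(j < n) a (i + j).+1 * g i j =
   \sum_(k < n) \sum_(i < k) a k * g i (k - i.+1)%N.
  have E1 (i : 'I_n) : \sum_(j < n) a (i + j).+1 * g i j = \sum_(k < n | (i < k)%N) a k * g i (k - i.+1)%N.
    rewrite -(big_mkord xpredT (fun j => a (i + j).+1 * g i j)).
    rewrite (@big_cat_nat _ _ _ (n - i.+1)) //= ?leq_subr // [X in _ + X]big1_seq ?addr0; last first.
      by move=> j /andP [_]; rewrite mem_index_iota => /andP [lj _]; rewrite a0 ?mul0r //; lia.
    rewrite -(big_mkord (fun k => i < k)%N (fun k => a k * g i (k - i.+1)%N)).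
    rewrite [RHS](@big_cat_nat _ _ _ i.+1) //= [X in _ = X + _]big1_seq ?add0r; last first.
      by move=> j /andP [l1]; rewrite mem_index_iota => /andP [_ l2]; exfalso; lia.
    rewrite -{2}[i.+1]add0n big_addn [RHS]big_mkcond /=.
    by apply: eq_bigr => j _; rewrite (_ : (i < j + i.+1)%N) ?addnK; [congr (a _ * _); lia|lia].
  under eq_bigr => i _ do rewrite E1.
  rewrite (exchange_big_dep xpredT) //=; apply: eq_bigr => k _.
  rewrite (big_ord_widen n (fun i => a k * g i (k - i.+1)%N)) //.
  exact: ltnW.
rewrite (E (fun i j => f i.+1 j - f i j.+1)); apply: eq_bigr => k _.
rewrite -mulr_sumr; congr (_ * _).
case: k => [[|k] lk] /=; first by rewrite big_ord0 subrr.
rewrite -(big_mkord xpredT (fun i => f i.+1 (k.+1 - i.+1)%N - f i (k.+1 - i.+1).+1)).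
rewrite (@telescope_sumr_eq _ _ _ (fun i => f i (k.+1 - i)%N)) // ?subnn ?subn0 // => i /andP [_ li].
by congr (_ - f _ _); lia.
Qed.

(** Multiplying the Bezoutian by S - T leaves a(S) - a(T), which kills pairs of a-torsion points. *)
Lemma weil_dt D a x y : act D a x = 0 -> act D a y = 0 ->
  weil D a (dt D x) y = weil D a x (dt D y).
Proof.
move=> ax ay; apply/eqP; rewrite -subr_eq0; apply/eqP.
rewrite /weil -sumrB.
have aB k : (size a <= k)%N -> iota a`_k = 0 by move=> lk; rewrite nth_default // rmorph0.
have := @telescope_square (size a) (fun k => iota a`_k)
  (fun i j => moore (iter i (dt D) x) (iter j (dt D) y)) aB.
have m0 z : moore 0 z = 0 by rewrite /moore (expr0q _ 1) !mul0r subrr.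
have m0' z : moore z 0 = 0 by rewrite mooreC m0 oppr0.
have act_sum : \sum_(k < size a) iota a`_k * (moore (iter k (dt D) x) (iter 0 (dt D) y)
    - moore (iter 0 (dt D) x) (iter k (dt D) y)) = moore (act D a x) y - moore x (act D a y).
  rewrite /act /phi_act.
  rewrite (big_morph (moore ^~ y) (fun x1 x2 => mooreDl x1 x2 y) (m0 y)).
  rewrite (big_morph (moore x) (mooreDr x) (m0' x)) -sumrB; apply: eq_bigr => k _.
  by rewrite mulrBr mooreZl mooreZr.
rewrite act_sum ax ay m0 m0' subrr => E.
rewrite -[RHS]E; apply: eq_bigr => i _; rewrite -sumrB; apply: eq_bigr => j _.
by rewrite -!iterSr -mulrBr.
Qed.

Lemma weil_act D a b x y : act D a x = 0 -> act D a y = 0 ->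
  weil D a (act D b x) y = weil D a x (act D b y).
Proof.
elim/poly_ind: b x y => [|b c IH] x y ax ay; first by rewrite !act0l weil0l weil0r.
rewrite !actDl !actC (mulrC b) !actM !actX weilDl weilDr weil_dt //; last by rewrite actCA ax act0r.
rewrite weilZl weilZr IH //; last by rewrite -(actX D) actCA ay act0r.
by rewrite -!(actX D) actCA.
Qed.

(** Self-adjointness and antisymmetry make the value its own opposite, and the characteristic is not
    2. *)
Lemma weil_self D a b x : act D a x = 0 -> weil D a x (act D b x) = 0.
Proof. by move=> ax; apply: eq_opp_eq0; rewrite -weilC weil_act. Qed.

(** The pairing takes values in the rank one module theta - g2 tau, the determinant of [D]. *)
Lemma weil_psi D a x y : act D a x = 0 -> act D a y = 0 ->
  dth D * weil D a x y - dg2 D * weil D a x y ^+ q = weil D a (dt D x) y.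
Proof.
move=> ax ay; apply/eqP; rewrite -subr_eq0; apply/eqP.
rewrite /weil (expr_sumq 1) !mulr_sumr -!sumrB.
have aB k : (size a <= k)%N -> iota a`_k = 0 by move=> lk; rewrite nth_default // rmorph0.
have := @telescope_square (size a) (fun k => iota a`_k)
  (fun i j => iter i (dt D) x ^+ q * iter j (dt D) y) aB.
have -> : \sum_(k < size a) iota a`_k * (iter k (dt D) x ^+ q * iter 0 (dt D) y
    - iter 0 (dt D) x ^+ q * iter k (dt D) y) = act D a x ^+ q * y - x ^+ q * act D a y.
  rewrite /act /phi_act (expr_sumq 1) mulr_suml mulr_sumr -sumrB; apply: eq_bigr => k _ /=.
  by rewrite exprMn (iota_q _ 1); ring.
rewrite ax ay (expr0q _ 1) mul0r mulr0 subrr => E.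
rewrite -[RHS]E; apply: eq_bigr => i _.
rewrite (expr_sumq 1) !mulr_sumr -!sumrB; apply: eq_bigr => j _.
rewrite exprMn (iota_q _ 1) -!iterSr /moore.
rewrite (exprBq 1) !exprMn -!exprM !mulnn !iterS.
move: (iter i (dt D) x) (iter j (dt D) y) (iota _) => u w k.
have Ez z : dg2 D * z ^+ (q ^ 2) = dt D z - dth D * z - dg1 D * z ^+ q by rewrite dtE; ring.
have -> : dg2 D * (k * (u ^+ q * w ^+ (q ^ 2) - u ^+ (q ^ 2) * w ^+ q)) =
  k * (u ^+ q * (dg2 D * w ^+ (q ^ 2)) - (dg2 D * u ^+ (q ^ 2)) * w ^+ q) by ring.
rewrite !Ez; ring.
Qed.

Definition CD D : dmodule L := Dmod (dth D) 1 0.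

(** Division by a c with c^(q-1) = -1/g2 is an isomorphism from the determinant module to the
    Carlitz module. *)
Lemma weil_carl D c a b x y : c != 0 -> dg2 D * c ^+ q = - c ->
  act D a x = 0 -> act D a y = 0 ->
  act (CD D) b (weil D a x y / c) = weil D a (act D b x) y / c.
Proof.
move=> c0 cE + ay; elim/poly_ind: b x => [|b k IH] x ax.
  by rewrite !act0l weil0l mul0r.
rewrite !actDl !actC (mulrC b) !actM !actX weilDl weilZl mulrDl IH // -weil_psi //; last by rewrite actCA ax act0r.
rewrite mulrA; congr (_ + _).
set z := weil _ _ _ _; rewrite dtE /= mul1r mul0r addr0 expr_div_n.
have cq : c ^+ q != 0 by rewrite expf_neq0.
have -> : dg2 D = - c / c ^+ q by rewrite -cE mulfK.
by field; rewrite c0 cq.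
Qed.

Lemma weil_hom (f : {rmorphism L -> L}) D a x y : (forall c, f (iota c) = iota c) ->
  f (dth D) = dth D -> f (dg1 D) = dg1 D -> f (dg2 D) = dg2 D ->
  f (weil D a x y) = weil D a (f x) (f y).
Proof.
move=> fi f0 f1 f2.
have it i z : f (iter i (dt D) z) = iter i (dt D) (f z).
  by elim: i => //= i IH; rewrite !dtE /= !rmorphD !rmorphM !rmorphXn /= IH f0 f1 f2.
rewrite /weil rmorph_sum; apply: eq_bigr => i _; rewrite rmorph_sum; apply: eq_bigr => j _ /=.
by rewrite rmorphM fi /moore rmorphB !rmorphM !rmorphXn /= !it.
Qed.

(** For fixed nonzero y the pairing is a polynomial in x of degree q^(2 deg a - 1), too small to
    vanish at all q^(2 deg a) points of a-torsion. *)
Lemma weil_nondeg D a y : (1 < size a)%N -> dg2 D != 0 -> ga D a != 0 ->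
  act D a y = 0 -> y != 0 -> exists2 x, act D a x = 0 & weil D a x y != 0.
Proof.
move=> sa g2 ga0 ay y0; apply: contrapT => H.
have W0 x : act D a x = 0 -> weil D a x y = 0.
  by move=> ax; apply: contrapT => /eqP W; apply: H; exists x.
have a0 : a != 0 by rewrite -size_poly_gt0 ltnW.
pose n := (size a).-2; have sn : size a = n.+2 by rewrite /n; lia.
clearbody n.
pose w k := \sum_(i < size a) \sum_(j < size a) iota a`_(i + j).+1 *
   (cf D i k * iter j (dt D) y ^+ q - shift (cf D i) k ^+ q * iter j (dt D) y).
have WE x : weil D a x y = \sum_(k < (2 * size a).+1) w k * x ^+ (q ^ k).
  rewrite /w; under [RHS]eq_bigr => k _ do rewrite mulr_suml.
  rewrite exchange_big /=; apply: eq_bigr => i _.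
  under [RHS]eq_bigr => k _ do rewrite mulr_suml.
  rewrite exchange_big /=; apply: eq_bigr => j _.
  under [RHS]eq_bigr => k _ do rewrite -mulrA.
  rewrite -mulr_sumr; congr (_ * _); rewrite /moore.
  under [RHS]eq_bigr => k _ do rewrite mulrBl mulrAC (mulrAC (_ ^+ q)).
  rewrite sumrB -!mulr_suml -(@iter_dtE _ D i x (2 * size a).+1); last by case: i => i /= li; lia.
  congr (_ - _ * _); rewrite big_ord_recl /= (expr0q _ 1) mul0r add0r.
  rewrite (@iter_dtE _ D i x (2 * size a)); last by have := ltn_ord i; lia.
  rewrite (expr_sumq 1); apply: eq_bigr => k _.
  by rewrite exprMn -exprM /= -expnSr.
have wbig k : (2 * n.+1 <= k)%N -> w k = 0.
  move=> lk; rewrite /w big1 // => i _; rewrite big1 // => j _.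
  have [li|li] := leqP (size a) (i + j).+1; first by rewrite nth_default // rmorph0 mul0r.
  rewrite cf_big; last lia.
  case: k lk => [|k] lk /=; first by lia.
  by rewrite cf_big ?(expr0q _ 1) ?mul0r ?subrr ?mulr0 //; move: (nat_of_ord i) (nat_of_ord j) li => i' j'; rewrite sn; lia.
(* Only i = n, j = 0 contribute in top degree: the term is minus the leading coefficient of a, times
   the q-th power of the leading coefficient of phi_t^n, times y. *)
have wtop : w (2 * n).+1 != 0.
  rewrite /w sn big_ord_recr /= [X in _ + X]big1 ?addr0; last first.
    by move=> j _; rewrite nth_default ?rmorph0 ?mul0r // sn; lia.
  rewrite big_ord_recr /= [X in X + _]big1 ?add0r; last first.
    move=> i _; rewrite big1 // => j _; have := ltn_ord i; rewrite /= => li.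
    by rewrite !cf_big ?(expr0q _ 1) ?mul0r ?subrr ?mulr0 //; lia.
  rewrite big_ord_recl [X in _ + X]big1 ?addr0; last first.
    by move=> j _; rewrite nth_default ?rmorph0 ?mul0r // sn /= /bump /=; lia.
  rewrite cf_big ?mul0r ?sub0r; last lia.
  have [e ->] := cf_top D n; rewrite addn0 mulf_neq0 //.
    by rewrite iota_inj0; have := a0; rewrite -lead_coef_eq0 lead_coefE sn.
  by rewrite oppr_eq0 mulf_neq0 // !expf_neq0.
have [s [us ss sE]] : exists s, [/\ uniq s, size s = (q ^ (rk D * (size a).-1))%N &
    forall x, (x \in s) = (act D a x == 0)] by apply: tors_ex; rewrite ?g2.
pose f := \sum_(k < (2 * n).+2) w k *: 'X^(q ^ k) : {poly L}.
have sf : size f = (q ^ (2 * n).+1).+1 by apply: size_sumXq.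
have f0 : f != 0 by rewrite -size_poly_gt0 sf.
have := max_poly_roots f0 _ us; rewrite sf ss /rk (negbTE g2) sn ltnS leqNgt.
rewrite ltn_exp2l ?q_gt1 // (_ : ((2 * n).+1 < 2 * n.+2.-1)%N); last by lia.
case/(_ _)/notF; apply/allP => x; rewrite sE => /eqP /W0; rewrite WE => E.
rewrite rootE /f horner_sum; apply/eqP; rewrite -[RHS]E.
rewrite (big_ord_widen_cond _ xpredT (fun k => (w k *: 'X^(q ^ k)).[x]) (_ : (2 * n).+2 <= (2 * size a).+1)%N); last by lia.
rewrite (bigID (fun i : 'I_(2 * size a).+1 => (i < (2 * n).+2)%N) xpredT) /=.
rewrite [X in _ = _ + X]big1 ?addr0; last by move=> i; rewrite -leqNgt => li; rewrite wbig ?mul0r //; lia.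
by apply: eq_bigr => k _; rewrite !hornerE.
Qed.

Section Perp.
Variables (D : dmodule L) (v : {poly Fq}) (c : L) (k : nat).
Hypotheses (iv : irreducible_poly v) (g2 : dg2 D != 0) (gv : ga D v != 0).
Hypotheses (c0 : c != 0) (cE : dg2 D * c ^+ q = - c).
Local Notation vk := (v ^+ k.+1).
Local Notation W := (weil D vk).

Lemma size_vk_gt1 : (1 < size vk)%N.
Proof.
case: iv => sv _; rewrite size_vk ?irr_neq0 // ltnS muln_gt0 /=.
by case: (size v) sv => [|[]].
Qed.

(** A count: pairing with x takes at least q^N values, N = (k+1) deg v, on q^(2N) points, so at most
    q^N points pair to zero with x. The multiples of x are already that many. *)
Lemma weil_perp x y : act D vk x = 0 -> act D (v ^+ k) x != 0 -> act D vk y = 0 ->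
  W x y = 0 -> exists a, y = act D a x.
Proof.
move=> xk xk1 yk Wxy.
have v0 := irr_neq0 iv.
have vk0 : vk != 0 by rewrite expf_neq0.
have gvk : ga D vk != 0 by rewrite gaX expf_neq0.
have [z zk Wz] : exists2 z, act D vk z = 0 & W z (act D (v ^+ k) x) != 0.
  by apply: weil_nondeg => //; [exact: size_vk_gt1|rewrite actCA xk act0r].
pose C := CD D; pose om := W x z / c.
have CW b y' : act D vk y' = 0 -> act C b (W x y' / c) = W x (act D b y') / c.
  by move=> y'k; rewrite weil_carl // weil_act.
have omk : act C vk om = 0 by rewrite CW // zk weil0r mul0r.
have omk1 : act C (v ^+ k) om != 0.
  by rewrite CW // mulf_neq0 ?invr_eq0 // -weil_act // weilC oppr_eq0.
have [s [us ss sE]] : exists s, [/\ uniq s, size s = (q ^ (rk D * (size vk).-1))%N &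
    forall x, (x \in s) = (act D vk x == 0)] by apply: tors_ex; rewrite ?g2.
have [s' [us' ss' sE']] : exists s, [/\ uniq s, size s = (q ^ (rk C * (size vk).-1))%N &
    forall x, (x \in s) = (act C vk x == 0)] by apply: tors_ex; rewrite ?oner_neq0 ?orbT.
have rkC : rk C = 1%N by rewrite /rk eqxx.
have rkD : rk D = 2%N by rewrite /rk (negbTE g2).
rewrite rkC mul1n size_exp_pred // in ss'; rewrite rkD size_exp_pred // in ss.
set N := (k.+1 * (size v).-1)%N in ss ss'.
pose Ker := [seq y' <- s | W x y' == 0].
have inKer a : act D a x \in Ker.
  rewrite mem_filter sE actCA xk act0r eqxx andbT; apply/eqP.
  exact: weil_self.
have yKer : y \in Ker by rewrite mem_filter sE yk Wxy !eqxx.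
apply: (cyclic_of_size iv xk xk1 _ inKer) => //.
(* Distinct multiples of z pair differently with x, so the translates of the kernel by them are
   disjoint. *)
have inj : uniq [seq y1 + act D a z | y1 <- Ker, a <- polys X N].
  apply: allpairs_uniq; rewrite ?filter_uniq ?uniq_polys //.
  move=> [y1 a] [y2 b] /allpairsP [[y1' a'] /= [K1 A1 [-> ->]]] /allpairsP [[y2' b'] /= [K2 A2 [-> ->]]] /= E.
  have [W1 W2] : W x y1' = 0 /\ W x y2' = 0.
    by move: K1 K2; rewrite !mem_filter => /andP [/eqP -> _] /andP [/eqP -> _].
  have : act C a' om = act C b' om.
    rewrite !CW //; congr (_ / _).
    by rewrite -[LHS]add0r -W1 -weilDr E weilDr W2 add0r.
  move/(multiples_uniq iv omk omk1) => /(_ A1 A2) E'; rewrite E' in E *.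
  by move/addIr: E => ->.
have : (size [seq (y1 + act D a z)%R | y1 <- Ker, a <- polys X N] <= size s)%N.
  apply: uniq_leq_size => // u /allpairsP [[y1 a] /= [K1 A1 ->]].
  move: K1; rewrite mem_filter !sE actDr actCA zk act0r addr0 => /andP [_ ->] //.
rewrite size_allpairs size_polys ss mul2n -addnn expnD leq_pmul2r //.
by rewrite qX_gt0.
Qed.

End Perp.

End Weil.

(** * Subfields and extension of homomorphisms *)

Section Subrings.
Variable X : setting.
Local Notation Fq := (sFq X).
Local Notation L := (sL X).
Local Notation iota := (siota X).
Local Notation theta := (stheta X).
Local Notation pc := (spc X).
Local Notation q := (qq X).
Local Notation inF := (inF iota theta).
Implicit Types (k : L -> Prop) (p g m : {poly L}).

Definition subr k := [/\ k 1, forall x y, k x -> k y -> k (x - y),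
  forall x y, k x -> k y -> k (x * y) & forall x, inF x -> k x].
Definition over k p := forall i, k p`_i.

Lemma gammaE a : gammaA iota theta a = (map_poly iota a).[theta]. Proof. by []. Qed.

Lemma gammaM a b : gammaA iota theta (a * b) = gammaA iota theta a * gammaA iota theta b.
Proof. by rewrite /gammaA rmorphM hornerM. Qed.
Lemma gammaD a b : gammaA iota theta (a + b) = gammaA iota theta a + gammaA iota theta b.
Proof. by rewrite /gammaA rmorphD hornerD. Qed.
Lemma gammaB a b : gammaA iota theta (a - b) = gammaA iota theta a - gammaA iota theta b.
Proof. by rewrite /gammaA rmorphB hornerD hornerN. Qed.
Lemma gamma1 : gammaA iota theta 1 = 1.
Proof. by rewrite /gammaA rmorph1 hornerC. Qed.
Lemma gamma0 : gammaA iota theta 0 = 0.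
Proof. by rewrite /gammaA rmorph0 horner0. Qed.
Lemma gammaC c : gammaA iota theta c%:P = iota c.
Proof. by rewrite /gammaA map_polyC hornerC. Qed.
Lemma gammaXt : gammaA iota theta 'X = theta.
Proof. by rewrite /gammaA map_polyX hornerX. Qed.
Lemma gammaXn a n : gammaA iota theta (a ^+ n) = gammaA iota theta a ^+ n.
Proof. by rewrite /gammaA rmorphXn horner_exp. Qed.
Lemma gamma_neq0 a : a != 0 -> gammaA iota theta a != 0.
Proof. by apply: contra => /eqP /strans ->. Qed.

Lemma inF_gamma a : inF (gammaA iota theta a).
Proof. by exists a, 1; rewrite oner_neq0 gamma1 divr1. Qed.

Lemma inF_subfield : is_subfield inF.
Proof.
split.
- by rewrite -gamma0; exact: inF_gamma.
- by rewrite -gamma1; exact: inF_gamma.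
- move=> _ _ [a [b [b0 ->]]] [c [d [d0 ->]]]; exists (a * d - c * b), (b * d).
  split; first by rewrite mulf_neq0.
  by rewrite gammaB !gammaM; field; rewrite !gamma_neq0.
- move=> _ _ [a [b [b0 ->]]] [c [d [d0 ->]]]; exists (a * c), (b * d).
  split; first by rewrite mulf_neq0.
  by rewrite !gammaM; field; rewrite !gamma_neq0.
- move=> _ [a [b [b0 ->]]]; have [->|a0] := eqVneq a 0.
    by rewrite gamma0 mul0r invr0 -gamma0; exact: inF_gamma.
  by exists b, a; split => //; rewrite invf_div.
Qed.

Lemma subr_inF : subr inF.
Proof. by have [F0 F1 FB FM _] := inF_subfield. Qed.

Section Over.
Variables (k : L -> Prop) (kS : subr k).

Lemma sb1 : k 1. Proof. by case: kS. Qed.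
Lemma sbB x y : k x -> k y -> k (x - y). Proof. by case: kS => _ H _ _; apply: H. Qed.
Lemma sbM x y : k x -> k y -> k (x * y). Proof. by case: kS => _ _ H _; apply: H. Qed.
Lemma sbF x : inF x -> k x. Proof. by case: kS => _ _ _; apply. Qed.
Lemma sb0 : k 0. Proof. by rewrite -(subrr 1); apply: sbB; exact: sb1. Qed.
Lemma sbN x : k x -> k (- x). Proof. by rewrite -sub0r => kx; apply: sbB => //; exact: sb0. Qed.
Lemma sbD x y : k x -> k y -> k (x + y).
Proof. by move=> kx ky; rewrite -(opprK y); apply: sbB => //; exact: sbN. Qed.
Lemma sbX x n : k x -> k (x ^+ n).
Proof. by move=> kx; elim: n => [|n IH]; rewrite ?expr0 ?exprS; [exact: sb1|exact: sbM]. Qed.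
Lemma sb_sum I (r : seq I) (P : pred I) (f : I -> L) :
  (forall i, P i -> k (f i)) -> k (\sum_(i <- r | P i) f i).
Proof. by move=> H; apply: big_ind => //; [exact: sb0|exact: sbD]. Qed.

Lemma sb_horner g x : over k g -> k x -> k g.[x].
Proof. by move=> kg kx; rewrite horner_coef; apply: sb_sum => i _; apply: sbM => //; exact: sbX. Qed.

(** A ring between F and [L] is a field because [L] is algebraic over F: the inverse of x is a
    polynomial in x over F. *)
Lemma sbV x : k x -> k x^-1.
Proof.
have [->|x0] := eqVneq x 0; first by rewrite invr0.
move=> kx; have [p [p0 [pF px]]] := salg x.
(* Dividing the equation of x by a power of the variable makes its constant term nonzero. *)
have [p' [p'0 pF' px']] : exists p' : {poly L}, [/\ p'`_0 != 0, (forall i, inF p'`_i) & p'.[x] = 0].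
  have [m [r r0 pE]] := multiplicity_XsubC p 0; rewrite p0 /= in r0.
  rewrite subr0 in pE; exists r; split.
  - by rewrite -horner_coef0.
  - by move=> i; have := pF (i + m)%N; rewrite pE coefMXn ltnNge leq_addl addnK.
  - by move: px; rewrite rootE pE hornerM hornerXn mulf_eq0 expf_eq0 (negbTE x0) andbF orbF => /eqP.
have kp : over k p' by move=> i; apply: sbF.
pose g := \poly_(i < size p') (p'`_i.+1) : {poly L}.
have pE : p' = (p'`_0)%:P + g * 'X.
  apply/polyP => i; rewrite coefD coefC coefMX /g coef_poly; case: i => [|i] /=; first by rewrite addr0.
  by rewrite add0r; case: ltnP => // le; rewrite nth_default // (leq_trans le).
have -> : x^-1 = - (p'`_0)^-1 * g.[x].
  have E : p'`_0 + g.[x] * x = 0 by move: px'; rewrite {1}pE hornerD hornerC hornerMX.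
  have -> : p'`_0 = - (g.[x] * x) by apply/eqP; rewrite -addr_eq0 E.
  have gx : g.[x] != 0.
    by apply: contraNneq p'0 => gx; move: E; rewrite gx mul0r addr0 => ->.
  by rewrite invrN opprK invfM mulrAC mulVf ?mul1r.
apply: sbM; last first.
  by apply: sb_horner => // i; rewrite coef_poly; case: ifP => _ //; exact: sb0.
apply: sbN; apply: sbF; have [_ _ _ _ H] := inF_subfield; exact: H.
Qed.

Lemma subr_subfield : is_subfield k.
Proof. by split; [exact: sb0|exact: sb1|exact: sbB|exact: sbM|exact: sbV]. Qed.

Lemma overB p g : over k p -> over k g -> over k (p - g).
Proof. by move=> kp kg i; rewrite coefB; apply: sbB. Qed.
Lemma overD p g : over k p -> over k g -> over k (p + g).
Proof. by move=> kp kg i; rewrite coefD; apply: sbD. Qed.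
Lemma overM p g : over k p -> over k g -> over k (p * g).
Proof. by move=> kp kg i; rewrite coefM; apply: sb_sum => j _; apply: sbM. Qed.
Lemma overC c : k c -> over k c%:P.
Proof. by move=> kc i; rewrite coefC; case: eqP => _ //; exact: sb0. Qed.
Lemma overX : over k 'X.
Proof. by move=> i; rewrite coefX; case: eqP => _; [exact: sb1|exact: sb0]. Qed.
Lemma overXn n : over k 'X^n.
Proof. by move=> i; rewrite coefXn; case: eqP => _; [exact: sb1|exact: sb0]. Qed.
Lemma overZ c p : k c -> over k p -> over k (c *: p).
Proof. by move=> kc kp i; rewrite coefZ; apply: sbM. Qed.
Lemma over1 : over k 1. Proof. exact: (overC sb1). Qed.
Lemma over0 : over k 0. Proof. exact: (overC sb0). Qed.
Lemma over_exp p n : over k p -> over k (p ^+ n).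
Proof. by move=> kp; elim: n => [|n IH]; rewrite ?expr0 ?exprS; [exact: over1|exact: overM]. Qed.
Lemma over_sum I (r : seq I) (P : pred I) (f : I -> {poly L}) :
  (forall i, P i -> over k (f i)) -> over k (\sum_(i <- r | P i) f i).
Proof. by move=> H; apply: big_ind => //; [exact: over0|exact: overD]. Qed.
Lemma over_prod I (r : seq I) (P : pred I) (f : I -> {poly L}) :
  (forall i, P i -> over k (f i)) -> over k (\prod_(i <- r | P i) f i).
Proof. by move=> H; apply: big_ind => //; [exact: over1|exact: overM]. Qed.

Lemma over_divmod p d : over k p -> over k d -> d != 0 ->
  exists u r, [/\ over k u, over k r, p = u * d + r & (size r < size d)%N].
Proof.
move=> kp kd d0; have [n] := ubnP (size p); elim: n p kp => // n IH p kp le.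
case: (ltnP (size p) (size d)) => [lt|ge].
  by exists 0, p; split => //; [exact: over0|rewrite mul0r add0r].
have p0 : p != 0 by rewrite -size_poly_gt0 (leq_trans _ ge) // size_poly_gt0.
pose h := (lead_coef p / lead_coef d) *: 'X^(size p - size d) : {poly L}.
have kh : over k h by apply: overZ; [apply: sbM; [exact: kp|apply: sbV; exact: kd]|exact: overXn].
have ld : lead_coef d != 0 by rewrite lead_coef_eq0.
have hd0 : h != 0 by rewrite scaler_eq0 mulf_eq0 invr_eq0 !lead_coef_eq0 (negbTE p0) (negbTE d0) -size_poly_eq0 size_polyXn.
have sh : size (h * d) = size p.
  rewrite size_mul // /h size_scale ?size_polyXn; last by rewrite mulf_neq0 ?invr_eq0 ?lead_coef_eq0.
  by rewrite addSn /= subnK.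
have lh : lead_coef (h * d) = lead_coef p.
  by rewrite lead_coefM lead_coefZ lead_coefXn mulr1 divfK.
have sph : (size (p - h * d)%R < n)%N.
  rewrite ltnS in le; apply: (leq_trans _ le).
  have sp : (0 < size p)%N by rewrite size_poly_gt0.
  rewrite -(prednK sp) ltnS; apply/leq_sizeP => j lj; rewrite coefB.
  have [->|nj] := eqVneq j (size p).-1.
    by rewrite -lead_coefE -lh lead_coefE sh subrr.
  have lj' : (size p <= j)%N by move/eqP: nj; lia.
  by rewrite !nth_default ?subrr ?sh.
have [u [r [ku kr E sr]]] := IH _ (overB kp (overM kh kd)) sph.
exists (u + h), r; split => //; first exact: overD.
by rewrite mulrDl addrAC -E subrK.
Qed.

Lemma minpoly_ex z : exists m, [/\ over k m, m \is monic, m.[z] = 0, (1 < size m)%N &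
  forall g, over k g -> g.[z] = 0 -> exists2 h, over k h & g = h * m].
Proof.
pose Q n := `[< exists p, [/\ over k p, p != 0, p.[z] = 0 & size p = n] >].
have exQ : exists n, Q n.
  have [p [p0 [pF pz]]] := salg z; exists (size p); apply/asboolP; exists p; split => //.
    by move=> i; apply: sbF.
  exact/eqP.
case: (ex_minnP exQ) => n /asboolP [p [kp p0 pz sp]] minn.
have lp : lead_coef p != 0 by rewrite lead_coef_eq0.
pose m := (lead_coef p)^-1 *: p.
have km : over k m by apply: overZ => //; apply: sbV; exact: kp.
have mm : m \is monic by rewrite monicE lead_coefZ mulVf.
have m0 : m != 0 := monic_neq0 mm.
have mz : m.[z] = 0 by rewrite hornerZ pz mulr0.
have sm : size m = n by rewrite size_scale ?invr_eq0.
exists m; split => //.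
  rewrite ltnNge; apply/negP => le; move: mz; rewrite (size1_polyC le) hornerC => c0.
  by move: m0; rewrite (size1_polyC le) c0 eqxx.
move=> g kg gz; have [u [r [ku kr E sr]]] := over_divmod kg km m0.
exists u => //; suff r0 : r = 0 by rewrite E r0 addr0.
apply/eqP; apply: contraTT sr => r0; rewrite -leqNgt sm; apply: minn; apply/asboolP.
exists r; split => //; by move: gz; rewrite E hornerD hornerM mz mulr0 add0r.
Qed.

Definition adj z x := exists2 g, over k g & x = g.[z].

Lemma adj_subr z : subr (adj z).
Proof.
split.
- by exists 1; [exact: over1|rewrite hornerC].
- by move=> _ _ [g kg ->] [h kh ->]; exists (g - h); [exact: overB|rewrite hornerD hornerN].
- by move=> _ _ [g kg ->] [h kh ->]; exists (g * h); [exact: overM|rewrite hornerM].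
- by move=> x Fx; exists x%:P; [apply: overC; exact: sbF|rewrite hornerC].
Qed.

Lemma adj_k z x : k x -> adj z x.
Proof. by move=> kx; exists x%:P; [exact: overC|rewrite hornerC]. Qed.

Lemma adj_z z : adj z z.
Proof. by exists 'X; [exact: overX|rewrite hornerX]. Qed.

End Over.

Local Open Scope classical_set_scope.
(** Zorn on graphs of partial homomorphisms. That z' satisfies every equation of z over k is what
    makes the initial graph, defined on k[z], functional. *)
Lemma extend_hom k z z' : subr k -> (forall g, over k g -> g.[z] = 0 -> g.[z'] = 0) ->
  exists f : {rmorphism L -> L}, (forall x, k x -> f x = x) /\ f z = z'.
Proof.
move=> kS H.
pose G0 : set (L * L) := fun w => exists g, [/\ over k g, w.1 = g.[z] & w.2 = g.[z']].
pose good (G : set (L * L)) := [/\ G0 `<=` G,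
  forall x y x' y', G (x, y) -> G (x', y') -> G (x - x', y - y'),
  forall x y x' y', G (x, y) -> G (x', y') -> G (x * x', y * y') &
  forall y, G (0, y) -> y = 0].
pose P (G : set (L * L)) := G = set0 \/ good G.
have G0good : good G0.
  split => //.
  - move=> x y x' y' [g [kg /= -> ->]] [h [kh /= -> ->]]; exists (g - h).
    by split; [exact: overB|rewrite hornerD hornerN|rewrite hornerD hornerN].
  - move=> x y x' y' [g [kg /= -> ->]] [h [kh /= -> ->]]; exists (g * h).
    by split; [exact: overM|rewrite hornerM|rewrite hornerM].
  - by move=> y [g [kg /= E ->]]; apply: H.
have [F FP tF|A [PA Amax]] := @Zorn_bigcup _ P.
  have [E|] := pselect (forall Y, F Y -> Y = set0).
    left; rewrite -subset0 => w [Y FY Yw]; by move: Yw; rewrite (E Y FY).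
  move=> /existsNP [Y /not_implyP [FY /eqP Y0]]; right.
  have gd Z : F Z -> Z = set0 \/ good Z by move/FP.
  have gY : good Y by case: (gd Y FY) => // E; rewrite E eqxx in Y0.
  have two (w w' : L * L) : (\bigcup_(Z in F) Z) w -> (\bigcup_(Z in F) Z) w' ->
     exists Z, [/\ F Z, good Z, Z w & Z w'].
    move=> [Z1 F1 Zw1] [Z2 F2 Zw2].
    have [s|s] := tF Z1 Z2 F1 F2.
      exists Z2; split => //; last exact: s.
      by case: (gd Z2 F2) => // E; rewrite E in Zw2.
    exists Z1; split => //; last exact: s.
    by case: (gd Z1 F1) => // E; rewrite E in Zw1.
  split.
  - by move=> w G0w; exists Y => //; case: gY => + _ _ _; apply.
  - move=> x y x' y' h1 h2; have [Z [FZ [_ gB _ _] Z1 Z2]] := two _ _ h1 h2.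
    by exists Z => //; apply: gB.
  - move=> x y x' y' h1 h2; have [Z [FZ [_ _ gM _] Z1 Z2]] := two _ _ h1 h2.
    by exists Z => //; apply: gM.
  - by move=> y h1; have [Z [FZ [_ _ _ gf] Z1 _]] := two _ _ h1 h1; apply: gf.
have gA : good A.
  case: PA => // E; exfalso; apply: (Amax G0); last by right.
  rewrite E; split; first by [].
  by move=> /(_ (1, 1)); apply; exists 1; split; [exact: over1|rewrite hornerC|rewrite hornerC].
have [AG0 AB AM Af] := gA.
pose D x := exists y, A (x, y).
have Ak x : k x -> A (x, x).
  by move=> kx; apply: AG0; exists x%:P; split; [exact: overC|rewrite hornerC|rewrite hornerC].
have DS : subr D.
  split.
  - by exists 1; apply: Ak; exact: (sb1 kS).
  - by move=> x y [x' Ax] [y' Ay]; exists (x' - y'); apply: AB.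
  - by move=> x y [x' Ax] [y' Ay]; exists (x' * y'); apply: AM.
  - by move=> x Fx; exists x; apply: Ak; exact: (sbF kS).
have [f fP] : exists f : L -> L, forall x, D x -> A (x, f x).
  exists (fun x => if pselect (D x) is left h then projT1 (cid h) else 0) => x Dx.
  by case: pselect => // h; exact: (projT2 (cid h)).
have fE x y : A (x, y) -> f x = y.
  move=> Axy; have Afx := fP x (ex_intro _ y Axy).
  by apply/eqP; rewrite -subr_eq0; apply/eqP; apply: Af; rewrite -(subrr x); apply: AB.
have fB x y : D x -> D y -> f (x - y) = f x - f y by move=> Dx Dy; apply: fE; apply: AB; apply: fP.
have fM x y : D x -> D y -> f (x * y) = f x * f y by move=> Dx Dy; apply: fE; apply: AM; apply: fP.
have f0 : f 0 = 0 by apply: fE; apply: Ak; exact: (sb0 kS).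
have f1 : f 1 = 1 by apply: fE; apply: Ak; exact: (sb1 kS).
have fD x y : D x -> D y -> f (x + y) = f x + f y.
  move=> Dx Dy; have {1}-> : x + y = x - (0 - y) by ring.
  have D0 := sb0 DS; have D0y : D (0 - y) by exact: (sbB DS).
  by rewrite fB // fB // f0; ring.
have tot u : D u.
  have [m [km mm mu sm mP]] := minpoly_ex DS u.
  pose pf (p : {poly L}) := \poly_(i < size p) f p`_i.
  have pfE p i : (pf p)`_i = f p`_i.
    by rewrite coef_poly; case: ltnP => // le; rewrite nth_default.
  have fsum n (c : 'I_n -> L) : (forall i, D (c i)) -> f (\sum_i c i) = \sum_i f (c i).
    elim: n c => [|n IH] c Dc; first by rewrite !big_ord0.
    have DSum : D (\sum_(i < n) c (lift ord0 i)) by apply: (sb_sum DS) => i _; apply: Dc.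
    by rewrite !big_ord_recl fD ?IH //; apply: Dc.
  have pfM p r : over D p -> over D r -> pf (p * r) = pf p * pf r.
    move=> kp kr; apply/polyP => i; rewrite pfE !coefM fsum.
      by apply: eq_bigr => j _; rewrite fM // !pfE.
    by move=> j; apply: (sbM DS).
  have pfB p r : over D p -> over D r -> pf (p - r) = pf p - pf r.
    by move=> kp kr; apply/polyP => i; rewrite pfE !coefB fB // !pfE.
  have pfC c : pf c%:P = (f c)%:P.
    by apply/polyP => i; rewrite pfE !coefC; case: eqP.
  have spm : size (pf m) = size m.
    rewrite size_poly_eq // -lead_coefE (monicP mm) f1; exact: oner_neq0.
  have /closed_rootP [u' /eqP mu'] : size (pf m) != 1%N by rewrite spm; lia.
  pose G' : set (L * L) := fun w => exists g, [/\ over D g, w.1 = g.[u] & w.2 = (pf g).[u']].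
  have AG' : A `<=` G'.
    move=> [x y] Axy; have Dx : D x by exists y.
    exists x%:P; rewrite pfC !hornerC /= (fE _ _ Axy); split => //; exact: (overC DS).
  have gG' : good G'.
    split; first exact: subset_trans AG0 AG'.
    - move=> x y x' y' [g [kg /= -> ->]] [h [kh /= -> ->]]; exists (g - h).
      by rewrite pfB //= !hornerD !hornerN; split => //; exact: (overB DS).
    - move=> x y x' y' [g [kg /= -> ->]] [h [kh /= -> ->]]; exists (g * h).
      by rewrite pfM //= !hornerM; split => //; exact: (overM DS).
    - move=> y [g [kg /= E ->]]; have [h kh ->] := mP g kg (esym E).
      by rewrite pfM // hornerM mu' mulr0.
  have /(_ (u, u')) AG : G' `<=` A.
    apply: contrapT => nG; apply: (Amax G'); last by right.
    by split.
  exists u'; apply: AG; exists 'X; split; rewrite /= ?hornerX //; first exact: (overX DS).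
  have -> : pf 'X = 'X; last by rewrite hornerX.
  by apply/polyP => i; rewrite pfE coefX; case: eqP.
pose fa := GRing.isZmodMorphism.Build _ _ f (fun x y => fB x y (tot x) (tot y)).
pose fm := GRing.isMonoidMorphism.Build _ _ f (f1, fun x y => fM x y (tot x) (tot y)).
pose fr : {rmorphism L -> L} := HB.pack f fa fm.
exists fr; split => [x kx|]; first by apply: fE; exact: Ak.
by apply: fE; apply: AG0; exists 'X; split; rewrite ?hornerX //; exact: (overX kS).
Qed.

Local Close Scope classical_set_scope.

Definition fixes k (f : {rmorphism L -> L}) := forall x, k x -> f x = x.

(** All conjugates of c coincide, so its minimal polynomial is a power of X - c. This takes the
    place of the fixed field theorem, inseparability being allowed. *)
Lemma fix_pinsep k c : subr k -> (forall f, fixes k f -> f c = c) ->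
  exists j, k (c ^+ (pc ^ j)).
Proof.
move=> kS H; have [m [km mm mc sm mP]] := minpoly_ex kS c.
have Hr c' : root m c' -> c' = c.
  move=> /rootP mc'; have [f [fk <-]] : exists f : {rmorphism L -> L}, (forall x, k x -> f x = x) /\ f c = c'.
    apply: extend_hom => // g kg /(mP g kg) [h _ ->]; by rewrite hornerM mc' mulr0.
  exact: H.
have [r mE] := closed_field_poly_normal m.
rewrite (monicP mm) scale1r in mE.
have rE : r = nseq (size r) c.
  apply/all_pred1P; apply/allP => c' rc' /=; apply/eqP/Hr.
  by rewrite mE root_prod_XsubC.
have {}mE : m = ('X - c%:P) ^+ size r.
  by rewrite {1}mE rE big_nseq size_nseq -Monoid.iteropE.
set n := size r in mE.
have n0 : (0 < n)%N by move: sm; rewrite mE size_exp_XsubC ltnS.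
have [j [n' [nE nc]]] : exists j n', n = (pc ^ j * n')%N /\ ~~ (pc %| n')%N.
  have [n' cn nE] := pfactor_coprime (pc_prime X) n0.
  by exists (logn pc n), n'; rewrite mulnC -prime_coprime ?pc_prime.
have {}mE : m = ('X^(pc ^ j) - (c ^+ (pc ^ j))%:P) ^+ n'.
  rewrite mE nE exprM; congr (_ ^+ _).
  have pcP : [pchar {poly L}].-nat (pc ^ j)%N.
    rewrite pnatX; apply/orP; left; have pp : pc \in [pchar {poly L}] := rmorph_pchar polyC (pcharL X).
    by rewrite (eq_pnat _ (pcharf_eq pp)) pnat_id // pc_prime.
  by rewrite exprDn_pchar // exprNn_pchar // rmorphXn.
exists j.
have n'0 : (0 < n')%N by move: n0; rewrite nE muln_gt0 => /andP [].
(* The coefficient following the leading one in powers of X^(p^j) is -n' c^(p^j), and n' is prime to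
   p. *)
have := km (pc ^ j * n'.-1)%N; rewrite mE.
have -> : ('X^(pc ^ j) - (c ^+ (pc ^ j))%:P : {poly L}) ^+ n' =
  ((('X - (c ^+ (pc ^ j))%:P) ^+ n' : {poly L}) \Po 'X^(pc ^ j)).
  by rewrite (rmorphXn (comp_poly 'X^(pc ^ j))) /= comp_polyB comp_polyX comp_polyC.
have pj : (0 < pc ^ j)%N by rewrite expn_gt0 prime_gt0 ?pc_prime.
rewrite coef_comp_poly_Xn // dvdn_mulr // mulKn //.
have -> : (('X - (c ^+ (pc ^ j))%:P) ^+ n' : {poly L})`_n'.-1 = - (n'%:R * c ^+ (pc ^ j)).
  have := @coefPn_prod_XsubC _ (nseq n' (c ^+ (pc ^ j))).
  rewrite size_nseq -lt0n n'0 => /(_ isT); rewrite !big_nseq -!Monoid.iteropE => ->.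
  by congr (- _); rewrite mulr_natl.
move=> kk; have nn : (n'%:R : L) != 0 by rewrite -(dvdn_pcharf (pcharL X)).
have -> : c ^+ (pc ^ j) = - ((n'%:R)^-1 * - (n'%:R * c ^+ (pc ^ j))) by field.
apply: (sbN kS); apply: (sbM kS) => //; apply: (sbV kS).
by elim: (n') => [|i IH]; rewrite ?mulrS; [exact: (sb0 kS)|apply: (sbD kS) => //; exact: (sb1 kS)].
Qed.

End Subrings.

(** Values are rational because [L] contains ramified extensions of every index; the normalisation
    is value 1 at b. The value at 0 is arbitrary, so each law is restricted to nonzero arguments,
    and the ultrametric inequality is written as a disjunction instead of a minimum. *)
Record place (X : setting) (b : {poly sFq X}) := Place {
  pw :> sL X -> rat;
  pwM : forall x y, x != 0 -> y != 0 -> pw (x * y) = pw x + pw y;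
  pwU : forall x y, x != 0 -> y != 0 -> x + y != 0 -> pw x <= pw (x + y) \/ pw y <= pw (x + y);
  pwb : pw (gammaA (siota X) (stheta X) b) = 1;
  pwA : forall a, ~~ (b %| a) -> pw (gammaA (siota X) (stheta X) a) = 0 }.

(** * Places above a prime of A *)

Section PlaceExistence.
Variable X : setting.
Local Notation Fq := (sFq X).
Local Notation L := (sL X).
Local Notation iota := (siota X).
Local Notation theta := (stheta X).
Local Notation pc := (spc X).
Local Notation q := (qq X).
Local Notation inF := (inF iota theta).
Local Notation gamma := (gammaA iota theta).
Variables (b : {poly Fq}) (ib : irreducible_poly b).
Local Notation be := (gamma b).

Lemma be_neq0 : be != 0.
Proof. by apply: gamma_neq0; exact: irr_neq0. Qed.

(** Subrings containing A in which b is not invertible; a maximal one is a valuation ring whose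
    maximal ideal contains b. *)
Let ring_no (R : L -> Prop) := [/\ forall a, R (gamma a),
  forall x y, R x -> R y -> R (x - y), forall x y, R x -> R y -> R (x * y) & ~ R be^-1].

Local Open Scope classical_set_scope.
Let max_ring : exists R : set L, ring_no R /\ forall R' : set L, ring_no R' -> R `<=` R' -> R' `<=` R.
Proof.
pose R0 : set L := fun x => exists a, x = gamma a.
have gR0 : ring_no R0.
  split.
  - by move=> a; exists a.
  - by move=> _ _ [a ->] [c ->]; exists (a - c); rewrite gammaB.
  - by move=> _ _ [a ->] [c ->]; exists (a * c); rewrite gammaM.
  - move=> [a E]; have : gamma (a * b - 1) = 0.
      by rewrite gammaB gammaM gamma1 -E mulVf ?subrr ?be_neq0.
    move/strans/eqP; rewrite subr_eq0 => /eqP E1.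
    have : b %| 1 by rewrite -E1 dvdp_mull.
    by rewrite dvdp1; case: ib => sb _ /eqP sb1; rewrite sb1 in sb.
pose P (R : set L) := R = set0 \/ ring_no R.
have [F FP tF|A [PA Amax]] := @Zorn_bigcup _ P.
  have [E|] := pselect (forall Y, F Y -> Y = set0).
    left; rewrite -subset0 => w [Y FY Yw]; by move: Yw; rewrite (E Y FY).
  move=> /existsNP [Y /not_implyP [FY /eqP Y0]]; right.
  have gY : ring_no Y by case: (FP Y FY) => // E; rewrite E eqxx in Y0.
  have two x x' : (\bigcup_(Z in F) Z) x -> (\bigcup_(Z in F) Z) x' ->
     exists Z, [/\ F Z, ring_no Z, Z x & Z x'].
    move=> [Z1 F1 Zw1] [Z2 F2 Zw2].
    have [s|s] := tF Z1 Z2 F1 F2.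
      exists Z2; split => //; last exact: s.
      by case: (FP Z2 F2) => // E; rewrite E in Zw2.
    exists Z1; split => //; last exact: s.
    by case: (FP Z1 F1) => // E; rewrite E in Zw1.
  split.
  - by move=> a; exists Y => //; case: gY.
  - move=> x y h1 h2; have [Z [FZ [_ gB _ _] Z1 Z2]] := two _ _ h1 h2.
    by exists Z => //; apply: gB.
  - move=> x y h1 h2; have [Z [FZ [_ _ gM _] Z1 Z2]] := two _ _ h1 h2.
    by exists Z => //; apply: gM.
  - by move=> h1; have [Z [FZ [_ _ _ gf] Z1 _]] := two _ _ h1 h1; apply: gf.
have gA : ring_no A.
  case: PA => // E; exfalso; apply: (Amax R0); last by right.
  rewrite E; split; first by [].
  by move=> /(_ (gamma 0)); apply; exists 0.
exists A; split => // R' gR' AR'; apply: contrapT => nR; apply: (Amax R'); last by right.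
by split.
Qed.
Local Close Scope classical_set_scope.

Section ValuationRing.
Variable R : L -> Prop.
Hypotheses (RA : forall a, R (gamma a)) (RB : forall x y, R x -> R y -> R (x - y))
  (RM : forall x y, R x -> R y -> R (x * y)) (Rb : ~ R be^-1).

Let R0 : R 0. Proof. by rewrite -gamma0. Qed.
Let R1 : R 1. Proof. by rewrite -gamma1. Qed.
Let RD x y : R x -> R y -> R (x + y).
Proof. by move=> Rx Ry; rewrite -[y]opprK -[- y]sub0r; apply: RB => //; apply: RB. Qed.
Let RX x n : R x -> R (x ^+ n).
Proof. by move=> Rx; elim: n => [|n IH]; rewrite ?expr0 ?exprS //; apply: RM. Qed.
Let Rsum n (f : 'I_n -> L) : (forall i, R (f i)) -> R (\sum_i f i).
Proof. by move=> H; apply: big_ind. Qed.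

Hypothesis Rmax : forall R' : L -> Prop, ring_no R' -> (forall x, R x -> R' x) -> forall x, R' x -> R x.

(** By maximality, adjoining x to [R] must make b invertible. *)
Let notR x : ~ R x -> exists2 g : {poly L}, over R g & be^-1 = g.[x].
Proof.
move=> nRx; apply: contrapT => H; apply: nRx.
pose R' y := exists2 g : {poly L}, over R g & y = g.[x].
apply: (Rmax (R' := R')).
- split.
  + by move=> a; exists (gamma a)%:P; [move=> i; rewrite coefC; case: eqP|rewrite hornerC].
  + move=> _ _ [g kg ->] [h kh ->]; exists (g - h); last by rewrite hornerD hornerN.
    by move=> i; rewrite coefB; apply: RB.
  + move=> _ _ [g kg ->] [h kh ->]; exists (g * h); last by rewrite hornerM.
    by move=> i; rewrite coefM; apply: Rsum => j; apply: RM.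
  + exact: H.
- by move=> y Ry; exists y%:P; [move=> i; rewrite coefC; case: eqP|rewrite hornerC].
- by exists 'X; [move=> i; rewrite coefX; case: eqP|rewrite hornerX].
Qed.

(** If u = 1 - b r had no inverse in [R], then 1/b would be a polynomial in 1/u. Multiplying by a
    power of u, which is again 1 modulo b, would put 1/b in [R]. *)
Let unit1 r : R r -> 1 - be * r != 0 /\ R (1 - be * r)^-1.
Proof.
move=> Rr; have u0 : 1 - be * r != 0.
  rewrite subr_eq0; apply/eqP => E; apply: Rb.
  by rewrite -[be^-1]mulr1 E mulKf ?be_neq0.
split => //; apply: contrapT => /notR [g kg E]; apply: Rb.
set u := 1 - be * r in u0 E.
have Hu n : exists2 s, R s & u ^+ n = 1 - be * s.
  elim: n => [|n [s Rs IH]]; first by exists 0; rewrite ?mulr0 ?subr0.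
  exists (r + s - r * be * s); last by rewrite exprS IH /u; ring.
  by apply: RB; [apply: RD|apply: RM => //; apply: RM].
have [s Rs us] := Hu (size g).
have : R (u ^+ (size g) * be^-1).
  rewrite E horner_coef mulr_sumr; apply: Rsum => i.
  rewrite mulrCA exprVn -expfB_cond; last by rewrite (negbTE u0); exact: (ltnW (ltn_ord i)).
  apply: RM => //; apply: RX; apply: RB => //; exact: RM.
rewrite us mulrBl mul1r mulrAC divff ?be_neq0 // mul1r => H.
by rewrite -[be^-1](subrK s); apply: RD.
Qed.

(** Take shortest expressions of 1/b as polynomials in x and in the inverse of x; the longer of the
    two can be shortened by means of the other. *)
Let val_ring x : R x \/ R x^-1.
Proof.
apply: contrapT => /not_orP [nx nxi].
have x0 : x != 0 by apply/eqP => x0; apply: nx; rewrite x0.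
have ex y : ~ R y -> exists s, `[< exists g : {poly L}, [/\ over R g, be^-1 = g.[y] & size g = s] >].
  by move=> /notR [g kg E]; exists (size g); apply/asboolP; exists g.
case: (ex_minnP (ex x nx)) => s /asboolP [g [kg gx sg]] mins.
case: (ex_minnP (ex _ nxi)) => t /asboolP [h [kh hx sh]] mint.
have key y s' t' (g' h' : {poly L}) : y != 0 -> over R g' -> over R h' -> be^-1 = g'.[y] ->
    be^-1 = h'.[y^-1] -> size g' = s' -> size h' = t' ->
    (forall n, `[< exists g : {poly L}, [/\ over R g, be^-1 = g.[y] & size g = n] >] -> (s' <= n)%N) ->
    (t' <= s')%N -> False.
  move=> {x nx nxi x0 ex s g kg gx sg mins t h kh hx sh mint}.
  move: s' t' g' h' => s t g h x0 kg kh gx hx sg sh mins le.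
  case: s sg mins le => [/eqP|n] sg mins le.
    by move: gx; rewrite size_poly_eq0 in sg; rewrite (eqP sg) horner0 => /eqP; rewrite invr_eq0 (negbTE be_neq0).
  pose kl := \poly_(i < n) h`_(n - i) : {poly L}.
  have [u0 Ru] := unit1 (kh 0%N).
  set u := 1 - be * h`_0 in u0 Ru.
  have E1 : y ^+ n = be * (h`_0 * y ^+ n + kl.[y]).
    have -> : h`_0 * y ^+ n + kl.[y] = y ^+ n * h.[y^-1].
      have -> : y ^+ n * h.[y^-1] = \sum_(i < n.+1) h`_(n - i) * y ^+ i.
        rewrite (@horner_coef_wide _ n.+1 h); last by rewrite sh.
        rewrite mulr_sumr (reindex_inj rev_ord_inj) /=; apply: eq_bigr => i _.
        rewrite subSS mulrCA exprVn -expfB_cond; last by rewrite (negbTE x0); exact: leq_subr.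
        by rewrite subKn // -ltnS.
      by rewrite big_ord_recr /= subnn addrC horner_poly.
    by rewrite -hx mulrCA divff ?be_neq0 // mulr1.
  (* The n-th power of y is thus a combination of lower ones, which is substituted in the leading
     term of [g]. *)
  have E2 : y ^+ n = be * u^-1 * kl.[y].
    have E3 : u * y ^+ n = be * kl.[y] by rewrite /u mulrBl mul1r {1}E1; ring.
    by apply: (mulfI u0); rewrite E3 -(mulrA be) (mulrCA u) mulVKf.
  pose g2 := \poly_(i < n) g`_i + (g`_n * be * u^-1) *: kl : {poly L}.
  have Eg : be^-1 = g2.[y].
    rewrite gx (@horner_coef_wide _ n.+1 g) ?sg // big_ord_recr /= E2 hornerD hornerZ horner_poly.
    by rewrite !mulrA.
  have kg2 : over R g2.
    move=> i; rewrite coefD coefZ !coef_poly; apply: RD; first by case: ifP.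
    by case: ifP => _; rewrite ?mulr0 //; apply: RM => //; apply: RM => //; apply: RM.
  have := mins (size g2) (asboolT (ex_intro _ g2 (And3 kg2 Eg (erefl _)))).
  suff : (size g2 <= n)%N by move=> l1 l2; move: (leq_trans l2 l1); rewrite ltnn.
  rewrite (leq_trans (size_polyD _ _)) // geq_max size_poly /=.
  by rewrite (leq_trans (size_scale_leq _ _)) ?size_poly.
case: (leqP t s) => le.
  exact: (key x s t g h x0 kg kh gx hx sg sh mins le).
apply: (key x^-1 t s h g _ kh kg hx _ sh sg mint (ltnW le)); first by rewrite invr_eq0.
by rewrite invrK.
Qed.

Let U x := R x /\ R x^-1.
Let nU : ~ U be. Proof. by case. Qed.
Let UM x y : U x -> U y -> U (x * y).
Proof. by move=> [x1 x2] [y1 y2]; split; rewrite ?invfM; apply: RM. Qed.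
Let UV x : U x -> U x^-1.
Proof. by move=> [x1 x2]; split => //; rewrite invrK. Qed.
Let UX x n : U x -> U (x ^+ n).
Proof. by move=> [x1 x2]; split; rewrite -?exprVn; apply: RX. Qed.
Let UA a : ~~ (b %| a) -> U (gamma a).
Proof.
move=> nba; split => //; have [u [w E]] := bezout1 (irr_coprime ib nba).
have := congr1 gamma E; rewrite gammaD !gammaM gamma1 => E1.
have [h0 h1] := unit1 (RA u).
have E2 : 1 - be * gamma u = gamma w * gamma a by rewrite -E1; ring.
have a0 : gamma a != 0 by apply: contraNneq h0 => a0; rewrite E2 a0 mulr0.
have w0 : gamma w != 0 by apply: contraNneq h0 => a0'; rewrite E2 a0' mul0r.
have -> : (gamma a)^-1 = gamma w * (1 - be * gamma u)^-1 by rewrite E2 invfM mulrA divff // mul1r.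
exact: RM.
Qed.

Let U_be (z : int) : U (be ^ z) -> z = 0.
Proof.
have pos n : ~ R (be ^+ n.+1)^-1.
  move=> H; apply: Rb; have -> : be^-1 = be ^+ n * (be ^+ n.+1)^-1.
    by rewrite exprS invfM mulrCA divff ?mulr1 // expf_neq0 // be_neq0.
  by apply: RM => //; apply: RX.
case: z => [[|n]|n] // [h1 h2]; exfalso; first exact: (pos n).
by apply: (pos n); rewrite NegzE -exprnN in h1.
Qed.

Let U_inF f : inF f -> f != 0 -> exists z : int, U (f * be ^ z).
Proof.
have aux (x y n : nat) : (1 < y)%N -> (0 < x)%N -> ((x + y).-1 < n.+1)%N -> (x < n)%N by lia.
have gA (a : {poly Fq}) : a != 0 -> exists n : nat, U (gamma a / be ^+ n).
  have [n] := ubnP (size a); elim: n a => // n IH a le a0.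
  have [/dvdpP [c]|nba] := boolP (b %| a); last by exists 0%N; rewrite expr0 divr1; apply: UA.
  move: c => c; change {poly Fq} in c; move=> E.
  have c0 : c != 0 by apply: contraNneq a0 => c0; rewrite E c0 mul0r.
  have [|//|m Um] := IH c.
    move: le; rewrite E size_mul ?(irr_neq0 ib) //; case: ib => sb _.
    have sc : (0 < size c)%N by rewrite size_poly_gt0.
    exact: aux.
  exists m.+1; rewrite E gammaM exprSr invfM mulrACA divff ?be_neq0 // mulr1 //.
move=> [a [c [c0 ->]]] f0.
have a0 : a != 0 by apply: contraNneq f0 => ->; rewrite gamma0 mul0r.
have [n Un] := gA a a0; have [m Um] := gA c c0.
exists (m%:Z - n%:Z).
have -> : gamma a / gamma c * be ^ (m%:Z - n%:Z) = (gamma a / be ^+ n) * (gamma c / be ^+ m)^-1.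
  by rewrite expfzDr ?be_neq0 // -exprnP -invr_expz -exprnP; field; rewrite !expf_neq0 ?be_neq0 // gamma_neq0.
by apply: UM => //; apply: UV.
Qed.

Let assoc x y := U (x / y).
Let assocC x y : assoc x y -> assoc y x.
Proof. by move=> H; rewrite /assoc -invf_div; apply: UV. Qed.
Let assocT y x z : y != 0 -> assoc x y -> assoc y z -> assoc x z.
Proof.
move=> y0 h1 h2; rewrite /assoc; have -> : x / z = (x / y) * (y / z); last exact: UM.
by rewrite mulrA mulfVK.
Qed.

Let sum_dom x y : x != 0 -> y != 0 -> ~ assoc x y -> x + y != 0 /\ (assoc (x + y) x \/ assoc (x + y) y).
Proof.
have key x' y' : x' != 0 -> y' != 0 -> R (x' / y') -> ~ assoc x' y' -> x' + y' != 0 /\ assoc (x' + y') y'.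
  move=> {x y} x0 y0; rename x' into x; rename y' into y => Rxy nas.
  have nR : ~ R (x / y)^-1 by move=> H; apply: nas; split.
  have s0 : x + y != 0.
    apply/eqP => E; apply: nR; have -> : x = - y by apply/eqP; rewrite -addr_eq0 E.
    by rewrite mulNr divff // invrN invr1 -sub0r; apply: RB.
  split => //; split; first by rewrite mulrDl divff //; apply: RD.
  apply: contrapT => nRi; rewrite invf_div in nR.
  case: (val_ring (x / (x + y))) => H.
    apply: nRi; rewrite invf_div; have -> : y / (x + y) = 1 - x / (x + y) by field.
    exact: RB.
  apply: nR; rewrite invf_div in H; have -> : y / x = (x + y) / x - 1 by field.
  exact: RB.
move=> x0 y0 nas; case: (val_ring (x / y)) => H.
  by have [s0 s1] := key x y x0 y0 H nas; split => //; right.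
have [||s0 s1] := key y x y0 x0; first by rewrite -invf_div.
  by move=> /assocC.
by rewrite addrC; split => //; left.
Qed.

(** In an algebraic equation of x over F two nonzero terms must differ by a unit, since otherwise
    the sum would not vanish. Comparing them makes some power of x a unit times b^z, and z/n is the
    valuation of x. *)
Let ex_exp x : x != 0 -> exists n (z : int), (0 < n)%N /\ U (x ^+ n * be ^ (- z)).
Proof.
move=> x0; have [p [p0 [pF px]]] := salg x.
pose t i := p`_i * x ^+ i.
have t0 i : (t i == 0) = (p`_i == 0) by rewrite /t mulf_eq0 expf_eq0 (negbTE x0) andbF orbF.
have [i [j [lij pi pj tij]]] : exists i j, [/\ (i < j)%N, p`_i != 0, p`_j != 0 & assoc (t i) (t j)].
  apply: contrapT => H.
  have S n : (forall i, (i < n)%N -> p`_i = 0) /\ \sum_(i < n) t i = 0 \/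
     \sum_(i < n) t i != 0 /\ exists i, [/\ (i < n)%N, p`_i != 0 & assoc (\sum_(i < n) t i) (t i)].
    elim: n => [|n IH]; first by left; rewrite big_ord0.
    rewrite big_ord_recr /=; have [pn|pn] := eqVneq p`_n 0.
      have -> : t n = 0 by apply/eqP; rewrite t0 pn.
      rewrite addr0; case: IH => [[h ->]|[h [i [li pi ai]]]].
        left; split => // i; rewrite ltnS leq_eqVlt => /orP [/eqP -> //|]; exact: h.
      by right; split => //; exists i; split => //; rewrite ltnW.
    case: IH => [[h ->]|[h [i [li pi ai]]]].
      right; rewrite add0r t0; split => //; exists n; split => //.
      by rewrite /assoc divff ?t0 //; split; rewrite ?invr1.
    have [||s0 [a1|a1]] := sum_dom h (_ : t n != 0); first by rewrite t0.
    - move=> a2; apply: H; exists i, n; split => //.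
      by apply: (assocT h) => //; exact: assocC.
    - right; split => //; exists i; split => //; first by rewrite ltnW.
      exact: (assocT h).
    - by right; split => //; exists n.
  have [[h _]|[h _]] := S (size p).
    have E : p`_(size p).-1 = 0 by apply: h; rewrite prednK ?size_poly_gt0.
    by move: p0; rewrite -lead_coef_eq0 lead_coefE E eqxx.
  by case/eqP: h; move/rootP: px; rewrite horner_coef.
have [zi Ui] := U_inF (pF i) pi; have [zj Uj] := U_inF (pF j) pj.
exists (j - i)%N, (zj - zi); split; first by rewrite subn_gt0.
have bz z : be ^ z != 0 by rewrite expfz_neq0 ?be_neq0.
have xi : x ^+ i != 0 by rewrite expf_neq0.
have -> : x ^+ (j - i) * be ^ (- (zj - zi)) = (p`_i * be ^ zi) / (p`_j * be ^ zj) / (t i / t j).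
  rewrite opprB expfzDr ?be_neq0 // -invr_expz; have := bz zi; have := bz zj.
  move: (be ^ zi) (be ^ zj) => y y' y0 y0'.
  rewrite /t (_ : x ^+ j = x ^+ (j - i) * x ^+ i); last by rewrite -exprD subnK // ltnW.
  have := expf_neq0 (j - i) x0; move: (x ^+ (j - i)) (x ^+ i) xi => u u' u'0 u0.
  by field; rewrite ?u'0 ?pi ?pj ?y0 ?y0' ?u0.
by apply: UM; [apply: UM => //; apply: UV|apply: UV].
Qed.

Let exp_uniq x n m (z z' : int) : x != 0 -> U (x ^+ n * be ^ (- z)) -> U (x ^+ m * be ^ (- z')) ->
  z * m%:Z = z' * n%:Z.
Proof.
move=> x0 U1 U2; apply/eqP; rewrite -subr_eq0; apply/eqP; apply: U_be.
have xn k : x ^+ k != 0 by rewrite expf_neq0.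
have bz k : be ^ k != 0 by rewrite expfz_neq0 ?be_neq0.
have -> : be ^ (z * m%:Z - z' * n%:Z) = ((x ^+ m * be ^ (- z')) ^+ n) / ((x ^+ n * be ^ (- z)) ^+ m).
  rewrite expfzDr ?be_neq0 // -mulNr !exprMn -!exprM (mulnC n) !exprnP -!exprz_exp.
  rewrite !exprz_exp (mulNr z) -invr_expz.
  have := bz (z * m%:Z); have := bz (- z' * n%:Z); move: (be ^ _) (be ^ _) => y y' y0 y0'.
  have := xn (m * n)%N; rewrite exprnP; move: (x ^ _) => u u0.
  by field; rewrite ?u0 ?y0 ?y0'.
by apply: UM; [apply: UX|apply: UV; apply: UX].
Qed.

Let has_w x (r : rat) := exists n (z : int), [/\ (0 < n)%N, U (x ^+ n * be ^ (- z)) & r = z%:~R / n%:R].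
Let w x : rat := if pselect (exists r, has_w x r) is left h then projT1 (cid h) else 0.

Let wE x n (z : int) : x != 0 -> (0 < n)%N -> U (x ^+ n * be ^ (- z)) -> w x = z%:~R / n%:R.
Proof.
move=> x0 n0 Uz; rewrite /w; case: pselect => [h|nh]; last first.
  by exfalso; apply: nh; exists (z%:~R / n%:R), n, z.
case: (cid h) => r /= [m [z' [m0 Uz' ->]]].
have E := exp_uniq x0 Uz Uz'.
have nn : n%:R != 0 :> rat by rewrite pnatr_eq0 -lt0n.
have mm : m%:R != 0 :> rat by rewrite pnatr_eq0 -lt0n.
apply: (mulIf nn); apply: (mulIf mm); rewrite divfK // mulrAC divfK //.
have := congr1 (fun i : int => i%:~R : rat) E; by rewrite !intrM.
Qed.

Let wM x y : x != 0 -> y != 0 -> w (x * y) = w x + w y.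
Proof.
move=> x0 y0; have [n [z [n0 Uz]]] := ex_exp x0; have [m [z' [m0 Uz']]] := ex_exp y0.
rewrite (wE x0 n0 Uz) (wE y0 m0 Uz') (@wE _ (n * m) (z * m%:Z + z' * n%:Z)) ?mulf_neq0 ?muln_gt0 ?n0 //.
  rewrite intrD !intrM -!pmulrn natrM; have nn : n%:R != 0 :> rat by rewrite pnatr_eq0 -lt0n.
  have mm : m%:R != 0 :> rat by rewrite pnatr_eq0 -lt0n.
  by field; rewrite ?nn ?mm.
have -> : (x * y) ^+ (n * m) * be ^ (- (z * m%:Z + z' * n%:Z)) =
    (x ^+ n * be ^ (- z)) ^+ m * (y ^+ m * be ^ (- z')) ^+ n.
  rewrite !exprMn -!exprM (mulnC m) mulrACA; congr (_ * _).
  by rewrite opprD -!mulNr expfzDr ?be_neq0 // !exprnP !exprz_exp.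
by apply: UM; apply: UX.
Qed.

Let w_ge0 x : x != 0 -> R x -> 0 <= w x.
Proof.
move=> x0 Rx; have [n [z [n0 Uz]]] := ex_exp x0; rewrite (wE x0 n0 Uz).
apply: divr_ge0; last by rewrite ler0n.
case: z Uz => [z|z] [_ Uz]; first by rewrite ler0z.
exfalso; apply: Rb; rewrite NegzE opprK -exprnP in Uz.
have -> : be^-1 = be ^+ z * x ^+ n * (x ^+ n * be ^+ z.+1)^-1.
  by rewrite exprSr; field; rewrite !expf_neq0 ?be_neq0 // be_neq0.
by apply: RM => //; apply: RM; apply: RX.
Qed.

Lemma place_of_ring : place b.
Proof.
have w1 : w 1 = 0 by rewrite (@wE 1 1%N 0) ?oner_neq0 ?mul0r // expr1 oppr0 expr0z mulr1; split; rewrite ?invr1.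
have wU x y : x != 0 -> y != 0 -> x + y != 0 -> w x <= w (x + y) \/ w y <= w (x + y).
  have key x' y' : x' != 0 -> y' != 0 -> x' + y' != 0 -> R (x' / y') -> w y' <= w (x' + y').
    move=> x0 y0 s0 H; have -> : x' + y' = y' * (x' / y' + 1) by field.
    rewrite wM //; first by rewrite lerDl; apply: w_ge0; [|apply: RD];
      rewrite // -(divff y0) -mulrDl mulf_neq0 // invr_eq0.
    by rewrite -(divff y0) -mulrDl mulf_neq0 // invr_eq0.
  move=> x0 y0 s0; case: (val_ring (x / y)) => H; first by right; apply: key.
  by left; rewrite addrC; apply: key => //; [rewrite addrC|rewrite -invf_div].
have wb : w be = 1.
  rewrite (@wE be 1%N 1) ?be_neq0 ?divr1 // expr1 exprN1 divff ?be_neq0 //.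
  by split; rewrite ?invr1.
have wA a : ~~ (b %| a) -> w (gamma a) = 0.
  move=> nba; have a0 : a != 0 by apply: contraNneq nba => ->; rewrite dvdp0.
  by rewrite (@wE (gamma a) 1%N 0) ?gamma_neq0 // ?mul0r // expr1 oppr0 expr0z mulr1; apply: UA.
exact: (Place wM wU wb wA).
Qed.

End ValuationRing.

Lemma place_ex : place b.
Proof.
have [R [[RA RB RM Rb] Rmax]] := cid max_ring.
apply: (@place_of_ring R) => // R' gR' RR'; exact: Rmax.
Qed.

End PlaceExistence.

(** * Valuation calculus and the constants of [L] *)

Section PlaceTheory.
Variable X : setting.
Local Notation Fq := (sFq X).
Local Notation L := (sL X).
Local Notation iota := (siota X).
Local Notation theta := (stheta X).
Local Notation pc := (spc X).
Local Notation q := (qq X).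
Local Notation inF := (inF iota theta).
Local Notation gamma := (gammaA iota theta).

(** The elements algebraic over [Fq]. They form a field that maps isomorphically onto the residue
    field of every place. *)
Definition const (c : L) := exists2 m, (0 < m)%N & c ^+ (q ^ m) = c.

Lemma const_iter (c : L) m k : c ^+ (q ^ m) = c -> c ^+ (q ^ (m * k)) = c.
Proof. by move=> E; elim: k => [|k IH]; rewrite ?muln0 ?expr1 // mulnS expnD exprM E. Qed.

Lemma const2 c d : const c -> const d -> exists m, [/\ (0 < m)%N, c ^+ (q ^ m) = c & d ^+ (q ^ m) = d].
Proof.
move=> [m m0 E] [n n0 E']; exists (m * n)%N; split; first by rewrite muln_gt0 m0.
  exact: const_iter.
by rewrite mulnC; exact: const_iter.
Qed.

Lemma constB c d : const c -> const d -> const (c - d).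
Proof. by move=> /const2 H /H [m [m0 E E']]; exists m; rewrite // exprBq E E'. Qed.
Lemma constM c d : const c -> const d -> const (c * d).
Proof. by move=> /const2 H /H [m [m0 E E']]; exists m; rewrite // exprMn E E'. Qed.
Lemma const_iota a : const (iota a).
Proof. by exists 1%N => //; exact: iota_q. Qed.
Lemma const0 : const 0. Proof. by rewrite -(rmorph0 iota); exact: const_iota. Qed.
Lemma const1 : const 1. Proof. by rewrite -(rmorph1 iota); exact: const_iota. Qed.
Lemma constD c d : const c -> const d -> const (c + d).
Proof. by move=> cc cd; rewrite -[d]opprK -[- d]sub0r; apply: constB => //; apply: constB => //; exact: const0. Qed.
Lemma constX c n : const c -> const (c ^+ n).
Proof. by move=> cc; elim: n => [|n IH]; rewrite ?exprS; [exact: const1|exact: constM]. Qed.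
Lemma const_sum I (r : seq I) (P : pred I) (f : I -> L) :
  (forall i, P i -> const (f i)) -> const (\sum_(i <- r | P i) f i).
Proof. by move=> H; apply: big_ind => //; [exact: const0|exact: constD]. Qed.

Lemma const_seq (s : seq L) : (forall c, c \in s -> const c) ->
  exists2 m, (0 < m)%N & forall c, c \in s -> c ^+ (q ^ m) = c.
Proof.
elim: s => [|c s IH] H; first by exists 1%N.
have [m m0 E] := IH (fun d ds => H d (mem_behead (s := c :: s) ds)).
have [n n0 E'] := H c (mem_head c s).
exists (m * n)%N; first by rewrite muln_gt0 m0.
move=> d; rewrite inE => /orP [/eqP ->|ds]; last by apply: const_iter; exact: E.
by rewrite mulnC; exact: const_iter.
Qed.

(** A power of Frobenius fixes the coefficients and so maps roots to roots; its orbit of y repeats,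
    and injectivity makes it periodic. *)
Lemma const_root (f : {poly L}) y : f != 0 -> (forall i, const f`_i) -> f.[y] = 0 -> const y.
Proof.
move=> f0 fc fy.
have [m m0 mE] : exists2 m, (0 < m)%N & forall c, c \in (f : seq L) -> c ^+ (q ^ m) = c.
  by apply: const_seq => c /(nthP 0) [i _ <-].
have step z : f.[z] = 0 -> f.[z ^+ (q ^ m)] = 0.
  move=> fz; rewrite horner_coef.
  have -> : \sum_(i < size f) f`_i * (z ^+ (q ^ m)) ^+ i = (\sum_(i < size f) f`_i * z ^+ i) ^+ (q ^ m).
    rewrite expr_sumq; apply: eq_bigr => i _; rewrite exprMn (mE f`_i) ?mem_nth //.
    by rewrite -!exprM mulnC.
  by rewrite -horner_coef fz expr0q.
have it k : f.[y ^+ (q ^ (m * k))] = 0.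
  elim: k => [|k IH]; first by rewrite muln0 expr1.
  by rewrite mulnS addnC expnD exprM; apply: step.
pose g k := y ^+ (q ^ (m * k)).
have nus : ~ uniq (mkseq g (size f)).
  move=> us; have := max_poly_roots f0 _ us; rewrite size_mkseq ltnn => H.
  suff : false by []; apply: H; apply/allP => z /mapP [k _ ->]; apply/rootP; exact: it.
have [i [j [lij E]]] : exists i j, (i < j)%N /\ y ^+ (q ^ (m * i)) = y ^+ (q ^ (m * j)).
  apply: contrapT => H'; apply: nus; apply/mkseq_uniqP => i j _ _ E; apply/eqP; rewrite eqn_leq.
  apply/andP; split; rewrite leqNgt; apply/negP => l; apply: H'; first by exists j, i.
  by exists i, j.
exists (m * (j - i))%N; first by rewrite muln_gt0 m0 subn_gt0.
apply/eqP; rewrite -subr_eq0; have : (y ^+ (q ^ (m * (j - i))) - y) ^+ (q ^ (m * i)) = 0.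
  by rewrite exprBq -exprM -expnD -mulnDr subnK ?(ltnW lij) // E subrr.
by move/eqP; rewrite expf_eq0 => /andP [].
Qed.

Section OnePlace.
Variables (b : {poly Fq}) (ib : irreducible_poly b) (w : place b).

Lemma w1 : w 1 = 0.
Proof.
have := pwM w (oner_neq0 L) (oner_neq0 L); rewrite mul1r => /eqP.
by rewrite -subr_eq0 opprD addrA subrr sub0r oppr_eq0 => /eqP.
Qed.

Lemma wX x n : x != 0 -> w (x ^+ n) = n%:R * w x.
Proof.
move=> x0; elim: n => [|n IH]; first by rewrite expr0 w1 mul0r.
by rewrite exprS pwM ?expf_neq0 // IH -natr1 mulrDl mul1r addrC.
Qed.

Lemma wV x : x != 0 -> w x^-1 = - w x.
Proof.
move=> x0; apply/eqP; rewrite -addr_eq0 -pwM ?invr_eq0 // mulVf // w1 //.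
Qed.

Lemma wdiv x y : x != 0 -> y != 0 -> w (x / y) = w x - w y.
Proof. by move=> x0 y0; rewrite pwM ?invr_eq0 // wV. Qed.

Lemma wN x : w (- x) = w x.
Proof.
have [->|x0] := eqVneq x 0; first by rewrite oppr0.
rewrite -mulN1r pwM ?oppr_eq0 ?oner_neq0 //.
suff -> : w (- 1) = 0 by rewrite add0r.
have := wX 2 (_ : (-1 : L) != 0); rewrite oppr_eq0 oner_neq0 => /(_ isT).
by rewrite sqrrN expr1n w1 => /esym/eqP; rewrite mulf_eq0 => /orP [//|/eqP].
Qed.

(** The first disjunct encodes infinite valuation at 0. Below, [vint] is the valuation ring and [ml]
    its maximal ideal. *)
Definition vge (r : rat) x := (x == 0) || (r <= w x).
Definition vgt (r : rat) x := (x == 0) || (r < w x).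
Definition vint x := vge 0 x.
Definition ml x := vgt 0 x.

Lemma vge0 r : vge r 0. Proof. by rewrite /vge eqxx. Qed.
Lemma vgt0 r : vgt r 0. Proof. by rewrite /vgt eqxx. Qed.
Lemma vgeE r x : x != 0 -> vge r x = (r <= w x). Proof. by rewrite /vge => /negbTE ->. Qed.
Lemma vgtE r x : x != 0 -> vgt r x = (r < w x). Proof. by rewrite /vgt => /negbTE ->. Qed.
Lemma vgtW r x : vgt r x -> vge r x.
Proof. by rewrite /vge /vgt => /orP [->//|/ltW ->]; rewrite orbT. Qed.
Lemma vge_le r s x : r <= s -> vge s x -> vge r x.
Proof. by rewrite /vge => le /orP [->//|/(le_trans le) ->]; rewrite orbT. Qed.
Lemma vgt_lt r s x : r < s -> vge s x -> vgt r x.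
Proof. by rewrite /vge /vgt => le /orP [->//|/(lt_le_trans le) ->]; rewrite orbT. Qed.

Lemma vge_w x : vge (w x) x. Proof. by rewrite /vge lexx orbT. Qed.

Lemma vgeN r x : vge r (- x) = vge r x. Proof. by rewrite /vge oppr_eq0 wN. Qed.
Lemma vgtN r x : vgt r (- x) = vgt r x. Proof. by rewrite /vgt oppr_eq0 wN. Qed.

Lemma vgeD r x y : vge r x -> vge r y -> vge r (x + y).
Proof.
have [->|x0] := eqVneq x 0; first by rewrite add0r.
have [->|y0] := eqVneq y 0; first by rewrite addr0.
have [->|s0] := eqVneq (x + y) 0; first by rewrite vge0.
rewrite !vgeE // => h1 h2; have [h|h] := pwU w x0 y0 s0; exact: le_trans h.
Qed.
Lemma vgtD r x y : vgt r x -> vgt r y -> vgt r (x + y).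
Proof.
have [->|x0] := eqVneq x 0; first by rewrite add0r.
have [->|y0] := eqVneq y 0; first by rewrite addr0.
have [->|s0] := eqVneq (x + y) 0; first by rewrite vgt0.
rewrite !vgtE // => h1 h2; have [h|h] := pwU w x0 y0 s0; exact: lt_le_trans h.
Qed.
Lemma vgeB r x y : vge r x -> vge r y -> vge r (x - y).
Proof. by move=> h1 h2; apply: vgeD => //; rewrite vgeN. Qed.
Lemma vgtB r x y : vgt r x -> vgt r y -> vgt r (x - y).
Proof. by move=> h1 h2; apply: vgtD => //; rewrite vgtN. Qed.
Lemma vge_sum r I (s : seq I) (P : pred I) (f : I -> L) :
  (forall i, P i -> vge r (f i)) -> vge r (\sum_(i <- s | P i) f i).
Proof. by move=> H; apply: (big_ind (vge r)) => //; [exact: vge0|exact: vgeD]. Qed.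
Lemma vgt_sum r I (s : seq I) (P : pred I) (f : I -> L) :
  (forall i, P i -> vgt r (f i)) -> vgt r (\sum_(i <- s | P i) f i).
Proof. by move=> H; apply: (big_ind (vgt r)) => //; [exact: vgt0|exact: vgtD]. Qed.
Lemma vgeM r s x y : vge r x -> vge s y -> vge (r + s) (x * y).
Proof.
have [->|x0] := eqVneq x 0; first by rewrite mul0r !vge0.
have [->|y0] := eqVneq y 0; first by rewrite mulr0 !vge0.
by rewrite !vgeE ?mulf_neq0 // pwM //; exact: lerD.
Qed.
Lemma vgtM r s x y : vge r x -> vgt s y -> vgt (r + s) (x * y).
Proof.
have [->|x0] := eqVneq x 0; first by rewrite mul0r ?vge0 !vgt0.
have [->|y0] := eqVneq y 0; first by rewrite mulr0 !vgt0.
by rewrite vgeE // !vgtE ?mulf_neq0 // pwM //; exact: ler_ltD.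
Qed.
Lemma w_dom x y : x != 0 -> vgt (w x) y -> x + y != 0 /\ w (x + y) = w x.
Proof.
move=> x0 h; have s0 : x + y != 0.
  apply/eqP => /eqP; rewrite addr_eq0 => /eqP E; move: h.
  by rewrite -vgtN -E vgtE // ltxx.
split => //; apply/eqP; rewrite eq_le; apply/andP; split.
  rewrite leNgt; apply/negP => lt; have : vgt (w x) (x + y - y).
    by apply: vgtB => //; rewrite vgtE.
  by rewrite addrK vgtE // ltxx.
have : vge (w x) (x + y) by apply: vgeD; [exact: vge_w|exact: vgtW].
by rewrite vgeE.
Qed.
Lemma vge_exp r x n : vge r x -> vge (n%:R * r) (x ^+ n).
Proof.
move=> h; elim: n => [|n IH]; first by rewrite mul0r expr0 vgeE ?oner_neq0 // w1.
by rewrite exprS -natr1 mulrDl mul1r addrC; apply: vgeM.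
Qed.

Lemma vint0 : vint 0. Proof. exact: vge0. Qed.
Lemma vint1 : vint 1. Proof. by rewrite /vint vgeE ?oner_neq0 // w1. Qed.
Lemma vintD x y : vint x -> vint y -> vint (x + y). Proof. exact: vgeD. Qed.
Lemma vintB x y : vint x -> vint y -> vint (x - y). Proof. exact: vgeB. Qed.
Lemma vintN x : vint (- x) = vint x. Proof. exact: vgeN. Qed.
Lemma vintM x y : vint x -> vint y -> vint (x * y).
Proof. by move=> h1 h2; have := vgeM h1 h2; rewrite addr0. Qed.
Lemma vintX x n : vint x -> vint (x ^+ n).
Proof. by move=> h; elim: n => [|n IH]; rewrite ?exprS; [exact: vint1|exact: vintM]. Qed.
Lemma vint_sum I (s : seq I) (P : pred I) (f : I -> L) :
  (forall i, P i -> vint (f i)) -> vint (\sum_(i <- s | P i) f i).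
Proof. exact: vge_sum. Qed.
Lemma ml_int x : ml x -> vint x. Proof. exact: vgtW. Qed.
Lemma mlM x y : vint x -> ml y -> ml (x * y).
Proof. by move=> h1 h2; have := vgtM h1 h2; rewrite addr0. Qed.
Lemma mlD x y : ml x -> ml y -> ml (x + y). Proof. exact: vgtD. Qed.
Lemma mlB x y : ml x -> ml y -> ml (x - y). Proof. exact: vgtB. Qed.
Lemma mlN x : ml (- x) = ml x. Proof. exact: vgtN. Qed.
Lemma ml_sum I (s : seq I) (P : pred I) (f : I -> L) :
  (forall i, P i -> ml (f i)) -> ml (\sum_(i <- s | P i) f i).
Proof. exact: vgt_sum. Qed.
Lemma ml1 : ml 1 = false. Proof. by rewrite /ml vgtE ?oner_neq0 // w1 ltxx. Qed.
Lemma ml_exp x n : (0 < n)%N -> ml (x ^+ n) = ml x.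
Proof.
move=> n0; have [->|x0] := eqVneq x 0; first by rewrite expr0n (gtn_eqF n0).
by rewrite /ml !vgtE ?expf_neq0 // wX // pmulr_rgt0 // ltr0n.
Qed.
Lemma vint_exp x n : (0 < n)%N -> vint (x ^+ n) = vint x.
Proof.
move=> n0; have [->|x0] := eqVneq x 0; first by rewrite expr0n (gtn_eqF n0).
by rewrite /vint !vgeE ?expf_neq0 // wX // pmulr_rge0 // ltr0n.
Qed.
Lemma vintNV x : ~~ vint x -> ml x^-1.
Proof.
have [->|x0] := eqVneq x 0; first by rewrite vint0.
by rewrite /vint /ml vgeE // vgtE ?invr_eq0 // wV // oppr_gt0 ltNge.
Qed.
Lemma ml_prime x y : vint x -> vint y -> ml (x * y) -> ml x || ml y.
Proof.
have [->|x0] := eqVneq x 0; first by rewrite /ml vgt0.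
have [->|y0] := eqVneq y 0; first by rewrite /ml vgt0 orbT.
rewrite /vint /ml !vgeE // !vgtE ?mulf_neq0 // pwM // => h1 h2 h3.
case: (ltP 0 (w x)) => //= h4; case: ltP => // h5; lra.
Qed.

Lemma vint_gamma a : vint (gamma a).
Proof.
have [n] := ubnP (size a); elim: n a => // n IH a le.
have [->|a0] := eqVneq a 0; first by rewrite gamma0 vint0.
have [/dvdpP [c E]|nba] := boolP (b %| a); last by rewrite /vint vgeE ?gamma_neq0 // (pwA w).
rewrite E gammaM; apply: vintM; last by rewrite /vint vgeE ?gamma_neq0 ?(irr_neq0 ib) // pwb ler01.
apply: IH; have c0 : c != 0 by apply: contraNneq a0 => c0; rewrite E c0 mul0r.
have aux (x y m : nat) : (1 < y)%N -> (0 < x)%N -> ((x + y).-1 < m.+1)%N -> (x < m)%N by lia.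
by move: le; rewrite E size_mul ?(irr_neq0 ib) //; apply: aux; [case: ib|rewrite size_poly_gt0].
Qed.
Lemma vint_iota a : vint (iota a). Proof. by rewrite -(gammaC (X := X)) vint_gamma. Qed.
Lemma vint_theta : vint theta. Proof. by rewrite -(gammaXt X) vint_gamma. Qed.
Lemma ml_gamma a : ml (gamma a) = (b %| a).
Proof.
have [/dvdpP [c ->]|nba] := boolP (b %| a).
  rewrite gammaM; apply: mlM; first exact: vint_gamma.
  by rewrite /ml vgtE ?gamma_neq0 ?(irr_neq0 ib) // pwb ltr01.
have a0 : a != 0 by apply: contraNneq nba => ->; rewrite dvdp0.
by rewrite /ml vgtE ?gamma_neq0 // (pwA w) // ltxx.
Qed.

Lemma w_inF f : inF f -> f != 0 -> exists z : ssrint.int, w f = z%:~R.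
Proof.
have gA (a : {poly Fq}) : a != 0 -> exists n : nat, w (gamma a) = n%:R.
  have [n] := ubnP (size a); elim: n a => // n IH a le a0.
  have [/dvdpP [c E]|nba] := boolP (b %| a); last by exists 0%N; rewrite pwA.
  have c0 : c != 0 by apply: contraNneq a0 => c0; rewrite E c0 mul0r.
  have [||m Em] := IH c => //.
    have aux (x y m : nat) : (1 < y)%N -> (0 < x)%N -> ((x + y).-1 < m.+1)%N -> (x < m)%N by lia.
    by move: le; rewrite E size_mul ?(irr_neq0 ib) //; apply: aux; [case: ib|rewrite size_poly_gt0].
  by exists m.+1; rewrite E gammaM pwM ?gamma_neq0 ?(irr_neq0 ib) // Em pwb -natr1.
move=> [a [c [c0 ->]]] f0.
have a0 : a != 0 by apply: contraNneq f0 => ->; rewrite gamma0 mul0r.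
have [n En] := gA a a0; have [m Em] := gA c c0.
by exists (n%:Z - m%:Z); rewrite wdiv ?gamma_neq0 // En Em rmorphB /= -!pmulrn.
Qed.

Lemma const_w c : const c -> c != 0 -> w c = 0.
Proof.
move=> [m m0 E] c0; have := wX (q ^ m) c0; rewrite E => /eqP.
rewrite -[X in X == _]mul1r -subr_eq0 -mulrBl mulf_eq0 => /orP [|/eqP //].
rewrite subr_eq0 (@eqr_nat _ 1) => /eqP E1.
by have := ltn_exp2l 0 m (q_gt1 X); rewrite m0 -E1 expn0 ltnn.
Qed.
Lemma const_int c : const c -> vint c.
Proof. by move=> cc; have [->|c0] := eqVneq c 0; rewrite ?vint0 // /vint vgeE // const_w. Qed.
Lemma const_ml c : const c -> ml c = (c == 0).
Proof.
move=> cc; have [->|c0] := eqVneq c 0; first by rewrite /ml vgt0.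
by rewrite /ml vgtE // const_w // ltxx.
Qed.

Lemma ml_prod (s : seq L) y : vint y -> (forall c, c \in s -> vint c) -> ml (\prod_(c <- s) (y - c)) ->
  exists2 c, c \in s & ml (y - c).
Proof.
move=> iy; elim: s => [|c s IH] H; first by rewrite big_nil ml1.
have ic : vint c := H c (mem_head _ _).
have is' d : d \in s -> vint d by move=> ds; apply: H; rewrite inE ds orbT.
rewrite big_cons => /ml_prime; case/(_ _ _)/orP.
- exact: vintB.
- rewrite big_seq; elim/big_ind: _ => [|x z|d ds]; [exact: vint1|exact: vintM|].
  by apply: vintB => //; exact: is'.
- by exists c; rewrite ?mem_head.
- by move/(IH is') => [d ds md]; exists d; rewrite // inE ds orbT.
Qed.

End OnePlace.

End PlaceTheory.

(** * Residues as constants, and reduction of modules *)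

Section Residue.
Variable X : setting.
Local Notation Fq := (sFq X).
Local Notation L := (sL X).
Local Notation iota := (siota X).
Local Notation theta := (stheta X).
Local Notation pc := (spc X).
Local Notation q := (qq X).
Local Notation inF := (inF iota theta).
Local Notation gamma := (gammaA iota theta).
Variables (b : {poly Fq}) (ib : irreducible_poly b) (w : place b).
Local Notation vint := (vint w).
Local Notation ml := (ml w).

Definition intp (p : {poly L}) := forall i, vint p`_i.

Lemma ml_horner (p : {poly L}) x y : intp p -> vint x -> vint y -> ml (x - y) -> ml (p.[x] - p.[y]).
Proof.
move=> ip ix iy mxy; rewrite !horner_coef -sumrB; apply: ml_sum => i _.
rewrite -mulrBr; apply: mlM; first exact: ip.
rewrite subrXX mulrC; apply: mlM => //; apply: vint_sum => j _.
by apply: vintM; apply: vintX.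
Qed.

Lemma intp_iota (a : {poly Fq}) : intp (map_poly iota a).
Proof. by move=> i; rewrite coef_map; exact: vint_iota. Qed.

Lemma ml_roots (f : {poly L}) y : f != 0 -> (forall i, const f`_i) -> vint y -> ml f.[y] ->
  exists2 c, const c & ml (y - c).
Proof.
move=> f0 fc iy.
have [r fE] := closed_field_poly_normal f.
have rc c : c \in r -> const c.
  move=> cr; apply: (const_root f0 fc); rewrite fE hornerZ.
  by have /rootP -> : root (\prod_(z <- r) ('X - z%:P)) c; rewrite ?mulr0 // root_prod_XsubC.
have l0 : lead_coef f != 0 by rewrite lead_coef_eq0.
rewrite fE hornerZ horner_prod; under eq_bigr do rewrite hornerXsubC.
have ipr : vint (\prod_(c <- r) (y - c)).
  rewrite big_seq; apply: (big_ind vint) => [|x z|c cr]; [exact: vint1|exact: vintM|].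
  by apply: vintB => //; apply: const_int; exact: rc.
move=> /ml_prime; case/(_ _ ipr)/orP.
- by apply: const_int; exact: fc.
- by rewrite const_ml; [rewrite (negbTE l0)|exact: fc].
- by case/(ml_prod iy (fun c cr => const_int w (rc c cr))) => c cr mc; exists c => //; exact: rc.
Qed.

Lemma map_iota_eq0 (a : {poly Fq}) : (map_poly iota a == 0) = (a == 0).
Proof. exact: map_poly_eq0. Qed.

Lemma res_theta : exists2 be, const be & ml (theta - be).
Proof.
apply: (@ml_roots (map_poly iota b)).
- by rewrite map_iota_eq0 irr_neq0.
- by move=> i; rewrite coef_map; exact: const_iota.
- exact: vint_theta.
- by have := ml_gamma ib w b; rewrite dvdpp.
Qed.

(** An equation of y with coefficients in A, not all divisible by b, reduces to a nonzero polynomial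
    over the constants, and y is congruent to one of its roots. *)
Lemma res_ex y : vint y -> exists2 c, const c & ml (y - c).
Proof.
move=> iy; have [be cb mb] := res_theta.
have [p [p0 [pF py]]] := salg y.
have [n [a [Ea [i0 li0 ai0]]]] : exists n (a : nat -> {poly Fq}),
   \sum_(i < n) gamma (a i) * y ^+ i = 0 /\ exists2 i, (i < n)%N & a i != 0.
  have [C C0 CE] : exists2 C, C != 0 & forall i, (i < size p)%N -> exists e, p`_i * gamma C = gamma e.
    elim: (size p) => [|n [C C0 IH]]; first by exists 1; rewrite ?oner_neq0.
    have [a [c [c0 E]]] := pF n; exists (c * C); first by rewrite mulf_neq0.
    move=> i; rewrite ltnS leq_eqVlt => /orP [/eqP ->|/IH [e Ee]].
      by exists (a * C); rewrite E !gammaM mulrA divfK // gamma_neq0.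
    by exists (c * e); rewrite !gammaM mulrCA Ee.
  have [e eE] : exists e : nat -> {poly Fq}, forall i, (i < size p)%N -> p`_i * gamma C = gamma (e i).
    exists (fun i => if pselect (exists e, p`_i * gamma C = gamma e) is left h then projT1 (cid h) else 0).
    move=> i li; case: pselect => [h|nh]; last by case: nh; exact: CE.
    exact: (projT2 (cid h)).
  exists (size p), e; split.
    have E : \sum_(i < size p) p`_i * y ^+ i * gamma C = 0.
      by rewrite -mulr_suml -horner_coef (rootP py) mul0r.
    by rewrite -[RHS]E; apply: eq_bigr => i _; rewrite mulrAC eE.
  have sp : (0 < size p)%N by rewrite size_poly_gt0.
  exists (size p).-1; first by rewrite prednK.
  apply: contraNneq p0 => e0; have := eE (size p).-1; rewrite prednK // => /(_ (leqnn _)).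
  by rewrite e0 gamma0 -lead_coefE => /eqP; rewrite mulf_eq0 (negbTE (gamma_neq0 C0)) orbF lead_coef_eq0.
(* Removing the common power of b keeps the reduced equation nonzero. *)
have [e [a' [aE [j lj nj]]]] : exists (e : nat) (a' : nat -> {poly Fq}), (forall i, (i < n)%N -> a i = b ^+ e * a' i) /\
    exists2 i, (i < n)%N & ~~ (b %| a' i).
  have [N] := ubnP (size (a i0)); elim: N a ai0 {Ea} => // N IH a ai0 le.
  have [H|] := pselect (forall i, (i < n)%N -> b %| a i); last first.
    move=> /existsNP [i /not_implyP [li /negP ni]]; exists 0%N, a.
    by split; [move=> k _; rewrite expr0 mul1r|exists i].
  pose a1 i := a i %/ b.
  have a1E i : (i < n)%N -> a i = b * a1 i by move=> li; rewrite mulrC divpK //; exact: H.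
  have a10 : a1 i0 != 0 by apply: contraNneq ai0 => E; rewrite a1E // E mulr0.
  have [|e [a' [aE H']]] := IH a1 a10.
    have aux (x y' m : nat) : (1 < y')%N -> (0 < x)%N -> ((x + y').-1 < m.+1)%N -> (x < m)%N by lia.
    by move: le; rewrite a1E // mulrC size_mul ?(irr_neq0 ib) //; apply: aux; [case: ib|rewrite size_poly_gt0].
  exists e.+1, a'; split => // i li.
  by rewrite a1E // aE // exprS mulrA.
have E' : \sum_(i < n) gamma (a' i) * y ^+ i = 0.
  have ge : gamma (b ^+ e) != 0 by rewrite gamma_neq0 // expf_neq0 // irr_neq0.
  apply: (mulfI ge); rewrite mulr0 -[RHS]Ea mulr_sumr; apply: eq_bigr => i _.
  by rewrite aE // gammaM mulrA.
have cc i : const (map_poly iota (a' i)).[be].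
  rewrite horner_coef; apply: const_sum => k _; apply: constM; last exact: constX.
  by rewrite coef_map; exact: const_iota.
have mc i : ml (gamma (a' i) - (map_poly iota (a' i)).[be]).
  by apply: ml_horner => //; [exact: intp_iota|exact: vint_theta|exact: const_int].
pose f := \poly_(i < n) (map_poly iota (a' i)).[be] : {poly L}.
apply: (@ml_roots f) => //.
- apply/eqP => f0; have := mc j; have : f`_j = 0 by rewrite f0 coef0.
  rewrite coef_poly lj => ->; rewrite subr0 (ml_gamma ib); exact/negP.
- by move=> i; rewrite coef_poly; case: ifP => _ //; exact: const0.
- rewrite horner_poly; set S := \sum_(i < n) _.
  have -> : S = - (\sum_(i < n) gamma (a' i) * y ^+ i - S) by rewrite E' sub0r opprK.
  rewrite mlN /S -sumrB; apply: ml_sum => i _.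
  by rewrite -mulrBl mulrC; apply: mlM => //; exact: vintX.
Qed.

(** The residue is represented by its unique constant in [L]; nonintegral elements get the default
    0. *)
Definition red y := if pselect (vint y) is left h then projT1 (cid2 (res_ex h)) else 0.

Lemma redP y : vint y -> const (red y) /\ ml (y - red y).
Proof. by move=> iy; rewrite /red; case: pselect => // h; case: cid2. Qed.

Lemma red_uniq y c : vint y -> const c -> ml (y - c) -> red y = c.
Proof.
move=> iy cc mc; have [cr mr] := redP iy; apply/eqP; rewrite -subr_eq0.
rewrite -(const_ml w (constB cr cc)); have -> : red y - c = (y - c) - (y - red y) by ring.
exact: mlB.
Qed.

Lemma red_const c : const c -> red c = c.
Proof. by move=> cc; apply: red_uniq; [exact: const_int|by []|rewrite subrr /ml vgt0]. Qed.
Lemma red0 : red 0 = 0. Proof. exact: (red_const (const0 X)). Qed.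
Lemma red1 : red 1 = 1. Proof. exact: (red_const (const1 X)). Qed.
Lemma red_iota c : red (iota c) = iota c. Proof. exact: (red_const (const_iota c)). Qed.

Lemma redD x y : vint x -> vint y -> red (x + y) = red x + red y.
Proof.
move=> ix iy; have [cx mx] := redP ix; have [cy my] := redP iy.
apply: red_uniq; [exact: vintD|exact: constD|].
by have -> : x + y - (red x + red y) = (x - red x) + (y - red y) by [ring]; exact: mlD.
Qed.
Lemma redM x y : vint x -> vint y -> red (x * y) = red x * red y.
Proof.
move=> ix iy; have [cx mx] := redP ix; have [cy my] := redP iy.
apply: red_uniq; [exact: vintM|exact: constM|].
have -> : x * y - red x * red y = x * (y - red y) + red y * (x - red x) by ring.
by apply: mlD; apply: mlM => //; exact: const_int.
Qed.
Lemma redN x : vint x -> red (- x) = - red x.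
Proof.
move=> ix; apply/eqP; rewrite -addr_eq0 -redD ?vintN // addNr red0 //.
Qed.
Lemma redB x y : vint x -> vint y -> red (x - y) = red x - red y.
Proof. by move=> ix iy; rewrite redD ?vintN // redN. Qed.
Lemma redX x n : vint x -> red (x ^+ n) = red x ^+ n.
Proof. by move=> ix; elim: n => [|n IH]; rewrite ?red1 // !exprS redM ?IH //; exact: vintX. Qed.
Lemma red_sum I (s : seq I) (f : I -> L) : (forall i, vint (f i)) ->
  red (\sum_(i <- s) f i) = \sum_(i <- s) red (f i).
Proof.
move=> H; elim: s => [|i s IH]; first by rewrite !big_nil red0.
by rewrite !big_cons redD ?IH //; apply: vint_sum.
Qed.
Lemma red_eq0 x : vint x -> (red x == 0) = ml x.
Proof.
move=> ix; have [cx mx] := redP ix; rewrite -(const_ml w cx).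
apply/idP/idP => h; first by rewrite -(subrK (red x) x); exact: mlD.
by have -> : red x = x - (x - red x) by [ring]; exact: mlB.
Qed.
Lemma red_eq x y : vint x -> vint y -> (red x == red y) = ml (x - y).
Proof. by move=> ix iy; rewrite -subr_eq0 -redB // red_eq0 //; exact: vintB. Qed.
Lemma red_isconst x : const (red x).
Proof.
have [ix|nix] := boolP (vint x); first by case: (redP ix).
by rewrite /red; case: pselect => [h|_]; [rewrite h in nix|exact: const0].
Qed.

Definition redp (p : {poly L}) := \poly_(i < size p) red p`_i.

Lemma coef_redp p i : (redp p)`_i = red p`_i.
Proof. by rewrite coef_poly; case: ltnP => // le; rewrite nth_default // red0. Qed.

Lemma intpM p r : intp p -> intp r -> intp (p * r).
Proof. by move=> ip ir i; rewrite coefM; apply: vint_sum => j _; apply: vintM. Qed.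
Lemma intpB p r : intp p -> intp r -> intp (p - r).
Proof. by move=> ip ir i; rewrite coefB; apply: vintB. Qed.

Lemma intpC c : vint c -> intp c%:P.
Proof. by move=> ic i; rewrite coefC; case: eqP => // _; exact: vint0. Qed.
Lemma intp1 : intp 1. Proof. exact: (intpC (vint1 w)). Qed.

Lemma redpM p r : intp p -> intp r -> redp (p * r) = redp p * redp r.
Proof.
move=> ip ir; apply/polyP => i; rewrite coef_redp !coefM red_sum.
  by apply: eq_bigr => j _; rewrite redM // !coef_redp.
by move=> j; apply: vintM.
Qed.

Lemma redp1 : redp 1 = 1.
Proof. by apply/polyP => i; rewrite coef_redp !coef1; case: eqP => _; rewrite ?red1 ?red0. Qed.

Lemma redp_horner p x : intp p -> vint x -> red p.[x] = (redp p).[red x].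
Proof.
move=> ip ix; rewrite horner_coef red_sum; last by move=> i; apply: vintM => //; exact: vintX.
rewrite (@horner_coef_wide _ (size p)); last exact: size_poly.
by apply: eq_bigr => i _; rewrite redM ?redX ?coef_redp //; exact: vintX.
Qed.

Lemma redp_eq0 (p : {poly L}) : (forall i, ml p`_i) -> redp p = 0.
Proof.
move=> H; apply/polyP => i; rewrite coef_redp coef0; apply/eqP; rewrite red_eq0 //.
exact: ml_int.
Qed.

Definition intD (D : dmodule L) := [/\ vint (dth D), vint (dg1 D) & vint (dg2 D)].
Definition redd (D : dmodule L) := Dmod (red (dth D)) (red (dg1 D)) (red (dg2 D)).

Lemma shift_int (c : nat -> L) : (forall k, vint (c k)) -> forall k, vint (shift c k).
Proof. by move=> H [|k] //=; exact: vint0. Qed.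

Lemma cf_int D i k : intD D -> vint (cf D i k).
Proof.
move=> [h0 h1 h2]; elim: i k => [|i IH] k /=; first by case: eqP => _; [exact: vint1|exact: vint0].
by apply: vintD; [apply: vintD|]; apply: vintM => //; try apply: vintX; do ?apply: shift_int.
Qed.

Lemma ca_int D a k : intD D -> vint (ca D a k).
Proof. by move=> iD; apply: vint_sum => i _; apply: vintM; [exact: vint_iota|exact: cf_int]. Qed.

Lemma red_shift (c : nat -> L) k : red (shift c k) = shift (fun j => red (c j)) k.
Proof. by case: k => //=; exact: red0. Qed.

Lemma shift_ext (c c' : nat -> L) k : c =1 c' -> shift c k = shift c' k.
Proof. by move=> H; case: k => [|k] /=. Qed.

Lemma red_cf D i k : intD D -> red (cf D i k) = cf (redd D) i k.
Proof.
move=> iD; have [h0 h1 h2] := iD; elim: i k => [|i IH] k /=.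
  by case: eqP => _; rewrite ?red1 ?red0.
have ic j : vint (cf D i j) by exact: cf_int.
have is1 j : vint (shift (cf D i) j) by exact: shift_int.
have is2 j : vint (shift (shift (cf D i)) j) by exact: shift_int.
rewrite !redD ?redM ?redX ?red_shift //; last 6 first.
- exact: vintX.
- exact: vintX.
- exact: vintM.
- by apply: vintM => //; exact: vintX.
- by apply: vintD; apply: vintM => //; exact: vintX.
- by apply: vintM => //; exact: vintX.
congr (_ * _ + _ * _ ^+ _ + _ * _ ^+ _) => //; first by exact: shift_ext.
by apply: shift_ext => j; rewrite red_shift; apply: shift_ext.
Qed.

Lemma red_ca D a k : intD D -> red (ca D a k) = ca (redd D) a k.
Proof.
move=> iD; rewrite /ca red_sum; last by move=> i; apply: vintM; [exact: vint_iota|exact: cf_int].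
by apply: eq_bigr => i _; rewrite redM ?red_iota ?red_cf //; [exact: vint_iota|exact: cf_int].
Qed.

Lemma intp_Pa D a : intD D -> intp (Pa D a).
Proof.
move=> iD i; rewrite /Pa coef_sum; apply: vint_sum => k _; rewrite coefZ; apply: vintM; first exact: ca_int.
by rewrite coefXn; case: eqP => _; [exact: vint1|exact: vint0].
Qed.

Lemma act_int D a x : intD D -> vint x -> vint (act D a x).
Proof.
move=> iD ix; rewrite -horner_Pa horner_coef; apply: vint_sum => i _.
by apply: vintM; [exact: intp_Pa|exact: vintX].
Qed.

Lemma red_act D a x : intD D -> vint x -> red (act D a x) = act (redd D) a (red x).
Proof.
move=> iD ix; rewrite !(@actE _ _ a _ (2 * size a).+1); try lia.
rewrite red_sum; last by move=> k; apply: vintM; [exact: ca_int|exact: vintX].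
by apply: eq_bigr => k _; rewrite redM ?redX ?red_ca //; [exact: ca_int|exact: vintX].
Qed.

Lemma act_ml D a x : intD D -> ml x -> ml (act D a x).
Proof.
move=> iD mx; have ix := ml_int mx.
rewrite -red_eq0 ?red_act //; last exact: act_int.
by move: mx; rewrite -red_eq0 // => /eqP ->; rewrite act0r.
Qed.

End Residue.

(** * Frobenius lifts *)

Section Homs.
Variable X : setting.
Local Notation Fq := (sFq X).
Local Notation L := (sL X).
Local Notation iota := (siota X).
Local Notation theta := (stheta X).
Local Notation pc := (spc X).
Local Notation q := (qq X).
Local Notation inF := (inF iota theta).
Local Notation gamma := (gammaA iota theta).
Local Notation hom := {rmorphism L -> L}.

Definition hcomp (f g : hom) : hom := GRing.RMorphism.clone L L (f \o g) _.
Lemma hcompE f g x : hcomp f g x = f (g x). Proof. by []. Qed.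
Definition hid : hom := GRing.RMorphism.clone L L idfun _.
Fixpoint hit n (f : hom) : hom := if n is n'.+1 then hcomp f (hit n' f) else hid.
Lemma hitE n f x : hit n f x = iter n f x.
Proof. by elim: n => //= n IH; rewrite -IH. Qed.

Definition fixF (f : hom) := fixes inF f.

Lemma fix_iota f c : fixF f -> f (iota c) = iota c.
Proof. by move=> H; rewrite -(gammaC (X := X)); apply: H; exact: inF_gamma. Qed.
Lemma fix_gamma f a : fixF f -> f (gamma a) = gamma a.
Proof. by move=> H; apply: H; exact: inF_gamma. Qed.
Lemma fix_theta f : fixF f -> f theta = theta.
Proof. by move=> H; rewrite -(gammaXt X); apply: fix_gamma. Qed.
Lemma fixes_subr k f : subr k -> fixes k f -> fixF f.
Proof. by move=> kS H x Fx; apply: H; apply: (sbF kS). Qed.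
Lemma fixes_hcomp k f g : fixes k f -> fixes k g -> fixes k (hcomp f g).
Proof. by move=> hf hg x kx; rewrite hcompE hg // hf. Qed.
Lemma fixes_hit k n f : fixes k f -> fixes k (hit n f).
Proof. by move=> hf; elim: n => [|n IH] /=; [move=> x _|exact: fixes_hcomp]. Qed.

(** The finite stand-in for a normal extension of F; it makes congruences iterable along an
    endomorphism. *)
Definition closed (Z : seq L) := forall f, fixF f -> forall z, z \in Z -> f z \in Z.

Lemma clos_ex (s : seq L) : exists2 Z, closed Z & {subset s <= Z}.
Proof.
elim: s => [|x s [Z cZ sZ]]; first by exists [::].
have [p [p0 [pF px]]] := salg x; have [r pE] := closed_field_poly_normal p.
have l0 : lead_coef p != 0 by rewrite lead_coef_eq0.
have rE y : (y \in r) = root p y by rewrite pE rootZ // root_prod_XsubC.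
exists (r ++ Z).
  move=> f fF z; rewrite !mem_cat => /orP [|zZ]; last by rewrite cZ ?orbT.
  rewrite !rE => /rootP pz; apply/orP; left; apply/rootP.
  have fp : map_poly f p = p by apply/polyP => i; rewrite coef_map; exact: fF.
  by rewrite -{1}fp horner_map pz rmorph0.
move=> y; rewrite inE mem_cat => /orP [/eqP ->|/sZ ->]; last by rewrite orbT.
by rewrite rE px.
Qed.

Lemma hom_inj (f : hom) : injective f. Proof. exact: fmorph_inj. Qed.

(** An injective map of a finite list into itself has cycles no longer than the list. This factorial
    is the later [N0]. *)
Lemma closed_order Z f z : closed Z -> fixF f -> z \in Z -> iter (size Z)`! f z = z.
Proof.
move=> cZ fF zZ.
have itZ i : iter i f z \in Z by elim: i => //= i IH; apply: cZ.
have nus : ~ uniq (mkseq (fun i => iter i f z) (size Z).+1).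
  move=> us; have := uniq_leq_size us (s2 := Z); rewrite size_mkseq ltnn => H.
  by suff : false by []; apply: H => y /mapP [i _ ->].
have [i [j [lij lj E]]] : exists i j, [/\ (i < j)%N, (j <= size Z)%N & iter i f z = iter j f z].
  apply: contrapT => H'; apply: nus; apply/mkseq_uniqP => i j; rewrite !inE => li lj E; apply/eqP; rewrite eqn_leq.
  apply/andP; split; rewrite leqNgt; apply/negP => l; apply: H'; first by exists j, i.
  by exists i, j.
have {}E : iter (j - i) f z = z.
  have inj : injective (iter i f) by elim: (i) => [|n IH] x y //= /hom_inj /IH.
  by apply: inj; rewrite -iterD subnKC // ltnW.
have /dvdnP [k ->] : (j - i %| (size Z)`!)%N.
  by rewrite dvdn_fact // subn_gt0 lij (leq_trans (leq_subr _ _)).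
by elim: k => // k IH; rewrite mulSn iterD IH.
Qed.

Lemma frq_exists n : exists f : hom, forall x, f x = x ^+ (q ^ n).
Proof.
pose f (x : L) := x ^+ (q ^ n).
pose fa := GRing.isZmodMorphism.Build _ _ f (fun x y => exprBq n x y).
pose fm := GRing.isMonoidMorphism.Build _ _ f (expr1n _ _, fun x y => exprMn (q ^ n) x y).
by exists (HB.pack f fa fm : hom).
Qed.

Fixpoint allseqs (W : seq L) n : seq (seq L) :=
  if n is n'.+1 then [seq x :: s | x <- W, s <- allseqs W n'] else [:: [::]].

Lemma allseqsP (W : seq L) n (s : seq L) : size s = n -> {subset s <= W} -> s \in allseqs W n.
Proof.
elim: n s => [|n IH] [|x s] //= [ss] sW; apply/allpairsP; exists (x, s) => /=; split => //.
  by apply: sW; rewrite mem_head.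
by apply: IH => // y ys; apply: sW; rewrite inE ys orbT.
Qed.

Section Gen.
Variables (b : {poly Fq}) (ib : irreducible_poly b) (w : place b).
Local Notation vint := (vint w).
Local Notation ml := (ml w).
Local Notation red := (red ib w).
Local Notation redp := (redp ib w).

Lemma redp_prod_eq0 I (s : seq I) (G : I -> {poly L}) : (forall i, intp w (G i)) ->
  redp (\prod_(i <- s) G i) = \prod_(i <- s) redp (G i).
Proof.
move=> H; elim: s => [|i s IH]; first by rewrite !big_nil redp1.
rewrite !big_cons redpM ?IH //.
by apply: (big_ind (intp w)) => //; [exact: intp1|exact: intpM].
Qed.

Lemma ml_prodp (I : eqType) (s : seq I) (G : I -> {poly L}) : (forall i, intp w (G i)) ->
  (forall l, ml (\prod_(i <- s) G i)`_l) -> exists2 i, i \in s & forall l, ml (G i)`_l.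
Proof.
move=> H /(redp_eq0 ib); rewrite redp_prod_eq0 // => /eqP; rewrite prodf_seq_eq0.
move=> /hasP [i si /eqP E]; exists i => // l.
by rewrite -(red_eq0 ib) ?H // -coef_redp E coef0.
Qed.

Variables (k : L -> Prop) (kS : subr k) (f0 : hom) (n : nat) (f0F : fixF f0).
Hypothesis f0H : forall c, k c -> vint c -> vint (f0 c) /\ ml (f0 c - c ^+ (q ^ n)).
Variables (Z : seq L) (cZ : closed Z).

Let Hc c j : k (c ^+ (pc ^ j)) -> vint c -> vint (f0 c) /\ ml (f0 c - c ^+ (q ^ n)).
Proof.
move=> kc ic; have pj : (0 < pc ^ j)%N by rewrite expn_gt0 prime_gt0 ?pc_prime.
have [] := f0H kc; first by rewrite vint_exp.
rewrite rmorphXn vint_exp // => i1; rewrite exprAC -exprBp ml_exp //.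
Qed.

(* Replacing [z] by [t z] and [z * t z] with [t z = 1 / (z^(q^m) - z + 1)] makes every
   conjugate integral, while [t z] is a unit whenever [z] is integral. *)
Lemma gen_lift : exists h : hom, fixes k h /\
  forall z, z \in Z -> vint z -> vint (f0 (h z)) /\ ml (f0 (h z) - z ^+ (q ^ n)).
Proof.
have [m m0 mE] : exists2 m, (0 < m)%N & forall c, c \in [seq red z | z <- Z] -> c ^+ (q ^ m) = c.
  by apply: const_seq => c /mapP [z _ ->]; exact: red_isconst.
have {}mE z : z \in Z -> red z ^+ (q ^ m) = red z by move=> zZ; apply: mE; apply: map_f.
pose u (z : L) := z ^+ (q ^ m) - z + 1; pose t (z : L) := (u z)^-1.
have tint y : y \in Z -> [/\ u y != 0, vint (t y), vint (y * t y) & vint y -> ~~ ml (t y)].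
  move=> yZ; have [iy|niy] := boolP (vint y).
    have iu : vint (u y) by apply: vintD; [apply: vintB => //; exact: vintX|exact: vint1].
    have nmu : ~~ ml (u y).
      rewrite -(red_eq0 ib) // redD ?redB ?redX ?red1 ?mE ?vint1 ?vintB ?vintX //.
      by rewrite subrr add0r oner_neq0.
    have it : vint (t y).
      by apply: contraR nmu => /vintNV; rewrite invrK.
    have u0 : u y != 0 by apply: contraNneq nmu => ->; rewrite /ml vgt0.
    split => //; first exact: vintM.
    by move=> _; apply/negP => mt; have := mlM iu mt; rewrite divff // ml1.
  have y0 : y != 0 by apply: contraNneq niy => ->; exact: vint0.
  have wy : w y < 0 by rewrite ltNge; apply: contra niy; rewrite /vint vgeE.
  have Q1 : 1 < (q ^ m)%:R :> rat by rewrite ltr1n -(expn0 q) ltn_exp2l ?q_gt1.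
  have wQ : w (y ^+ (q ^ m)) = (q ^ m)%:R * w y by rewrite wX.
  have lt1 : (q ^ m)%:R * w y < w y by nra.
  have [] := @w_dom _ b w (y ^+ (q ^ m)) (1 - y) (expf_neq0 _ y0).
    rewrite wQ; apply: vgtB.
      by rewrite vgtE ?oner_neq0 // w1; nra.
    by rewrite vgtE.
  have -> : y ^+ (q ^ m) + (1 - y) = u y by rewrite /u; ring.
  rewrite wQ => u0 wu; split => //.
  - by rewrite /vint vgeE ?invr_eq0 // wV // wu; nra.
  - by rewrite /vint vgeE ?mulf_neq0 ?invr_eq0 // pwM ?invr_eq0 // wV // wu; lra.
have ft (f : hom) z : f (t z) = t (f z) by rewrite /t /u fmorphV rmorphD rmorphB rmorphXn rmorph1.
pose ys := [seq t z | z <- Z] ++ [seq z * t z | z <- Z].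
have ys_int y : y \in ys -> vint y.
  by rewrite mem_cat => /orP [/mapP [z zZ ->]|/mapP [z zZ ->]]; case: (tint z zZ).
have ys_cl f y : fixF f -> y \in ys -> f y \in ys.
  move=> fF; rewrite !mem_cat => /orP [/mapP [z zZ ->]|/mapP [z zZ ->]].
    by rewrite ft map_f // cZ.
  by apply/orP; right; rewrite rmorphM ft; apply: (map_f (fun z => z * t z)); exact: cZ.
(* Packing all the elements into the coefficients of one polynomial lets a single conjugate of it,
   hence a single [h], serve them all. *)
pose P0 : {poly L} := Poly ys.
have P0E (f : hom) : map_poly f P0 = Poly (map f ys).
  apply/polyP => i; rewrite coef_map /P0 !coef_Poly.
  have [l|l] := ltnP i (size ys); first by rewrite (nth_map 0).
  have -> : ys`_i = 0 by rewrite nth_default.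
  by apply: etrans (rmorph0 f) _; rewrite nth_default // size_map.
have P0int (f : hom) : fixF f -> intp w (map_poly f P0).
  move=> fF i; rewrite coef_map /P0 coef_Poly.
  have [l|l] := ltnP i (size ys); last by rewrite nth_default //; have := vint0 w; rewrite -{1}(rmorph0 f).
  by apply: ys_int; apply: ys_cl => //; exact: mem_nth.
pose O := undup [seq R <- [seq Poly s | s <- allseqs ys (size ys)] |
   `[< exists2 h, fixes k h & R = map_poly h P0 >]].
have OP R : R \in O <-> exists2 h, fixes k h & R = map_poly h P0.
  rewrite /O mem_undup mem_filter; split; first by case/andP => /asboolP.
  move=> H; apply/andP; split; first exact/asboolP.
  case: H => h hk ->; rewrite P0E map_f //; apply: allseqsP; rewrite ?size_map //.
  by move=> y /mapP [z zys ->]; apply: ys_cl => //; exact: fixes_subr hk.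
have Oint (f : hom) R : fixF f -> R \in O -> intp w (map_poly f R).
  move=> fF /OP [h hk ->].
  have -> : map_poly f (map_poly h P0) = map_poly (hcomp f h) P0 by rewrite -map_poly_comp.
  by apply: P0int; apply: fixes_hcomp => //; exact: fixes_subr hk.
(* The product over all conjugates is invariant, so its coefficients are purely inseparable over
   [k], where [f0] is known to act as the q^n-power modulo the place. *)
pose Pi : {poly {poly L}} := \prod_(R <- O) ('X - R%:P).
have Pih h : fixes k h -> map_poly (map_poly h) Pi = Pi.
  move=> hk; rewrite /Pi rmorph_prod /=.
  under eq_bigr do rewrite map_polyXsubC.
  rewrite -(big_map (map_poly h) xpredT (fun R => 'X - R%:P)); apply: perm_big.
  have uO : uniq [seq map_poly h R | R <- O].
    by rewrite map_inj_uniq ?undup_uniq //; apply: map_poly_inj.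
  apply: uniq_perm => //; first exact: undup_uniq.
  apply: uniq_sub_eq => //; last by rewrite size_map.
  move=> R /mapP [R' /OP [g gk ->] ->]; apply/OP; exists (hcomp h g); first exact: fixes_hcomp.
  by rewrite -map_poly_comp.
have PiI i : intp w Pi`_i.
  pose ipp (A : {poly {poly L}}) := forall i, intp w A`_i.
  suff : ipp Pi by apply.
  rewrite /Pi big_seq; apply: (big_ind ipp).
  - by move=> j; rewrite coef1; case: eqP => _ l; rewrite ?coef1 ?coef0; [case: eqP => _; rewrite ?vint1 ?vint0|exact: vint0].
  - move=> A B iA iB j l; rewrite coefM coef_sum; apply: vint_sum => r _.
    by apply: intpM.
  - move=> R RO j; rewrite coefB coefX coefC; apply: intpB.
      by case: eqP => _ l; rewrite ?coef1 ?coef0; [case: eqP => _; rewrite ?vint1 ?vint0|exact: vint0].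
    case: eqP => _ l; last by rewrite coef0 vint0.
    have hidF : fixF hid by move=> x.
    by have := Oint hid R hidF RO l; rewrite coef_map.
have PiH i l : vint (f0 (Pi`_i)`_l) /\ ml (f0 (Pi`_i)`_l - (Pi`_i)`_l ^+ (q ^ n)).
  have [j kj] : exists j, k ((Pi`_i)`_l ^+ (pc ^ j)).
    apply: fix_pinsep => // h hk; have := congr1 (fun A : {poly {poly L}} => (A`_i)`_l) (Pih h hk).
    by rewrite /= !coef_map.
  exact: (Hc kj (PiI i l)).
have [fr frE] := frq_exists n.
pose FP := map_poly fr P0.
have FPint : intp w FP.
  move=> l; rewrite coef_map /= frE; apply: vintX.
  have hidF : fixF hid by move=> x.
  by have := P0int hid hidF l; rewrite coef_map.
(* With the exact q^n-power in place of [f0] the product vanishes at [FP], because [P0] is one of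
   the conjugates; the two products differ by coefficients in the maximal ideal. *)
have mlprod l : ml (\prod_(R <- O) (FP - map_poly f0 R))`_l.
  have -> : \prod_(R <- O) (FP - map_poly f0 R) = (map_poly (map_poly f0) Pi).[FP].
    rewrite /Pi rmorph_prod horner_prod; apply: eq_bigr => R _.
    by rewrite /= map_polyXsubC hornerXsubC.
  have Fr0 : (map_poly (map_poly fr) Pi).[FP] = 0.
    rewrite /FP horner_map /Pi horner_prod.
    have : P0 \in O by apply/OP; exists hid => //; apply/polyP => i; rewrite coef_map.
    move=> P0O; rewrite (big_rem _ P0O) /= hornerXsubC subrr mul0r rmorph0 //.
  have -> : (map_poly (map_poly f0) Pi).[FP] = (map_poly (map_poly f0) Pi - map_poly (map_poly fr) Pi).[FP].
    by rewrite hornerD hornerN Fr0 subr0.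
  rewrite horner_coef coef_sum; apply: ml_sum => i _.
  rewrite coefM; apply: ml_sum => j _; rewrite mulrC; apply: mlM.
    have : intp w (FP ^+ i) by elim: (val i) => [|i' IH]; rewrite ?exprS; [exact: intp1|exact: intpM].
    by apply.
  by rewrite coefB !coef_map coefB !coef_map /= frE; case: (PiH i j).
have [R RO RE] : exists2 R, R \in O & forall l, ml (FP - map_poly f0 R)`_l.
  pose G R := if R \in O then FP - map_poly f0 R else 0.
  have GE : \prod_(R <- O) (FP - map_poly f0 R) = \prod_(R <- O) G R.
    by rewrite big_seq [RHS]big_seq; apply: eq_bigr => R RO; rewrite /G RO.
  have [R|l|R RO H] := @ml_prodp _ O G.
  - rewrite /G; case: ifP => [RO|_]; first by apply: intpB => //; exact: Oint.
    by move=> i; rewrite coef0 vint0.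
  - by rewrite -GE; exact: mlprod.
  - by exists R => // l; have := H l; rewrite /G RO.
have [h hk ER] := (OP R).1 RO; exists h; split => // z zZ iz.
have HR y : y \in ys -> ml (y ^+ (q ^ n) - f0 (h y)).
  move=> yys; have := RE (index y ys); rewrite ER coefB !coef_map /P0 coef_Poly /= nth_index // frE //.
have [u0 it izt nmt] := tint z zZ.
have h1 : ml (t z ^+ (q ^ n) - f0 (h (t z))) by apply: HR; rewrite mem_cat map_f.
have h2 : ml ((z * t z) ^+ (q ^ n) - f0 (h (z * t z))).
  by apply: HR; rewrite mem_cat (map_f (fun z => z * t z)) ?orbT.
have hF := fixes_subr kS hk.
have fhF : fixF (hcomp f0 h) by apply: fixes_hcomp.
have ifh y : y \in ys -> vint (f0 (h y)) by move=> yys; apply: ys_int; apply: (ys_cl (hcomp f0 h)).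
have it' : vint (f0 (h (t z))) by apply: ifh; rewrite mem_cat map_f.
have izt' : vint (f0 (h (z * t z))) by apply: ifh; rewrite mem_cat (map_f (fun z => z * t z)) ?orbT.
rewrite rmorphM rmorphM in h2 izt'.
set A := f0 (h z) in h2 izt' *; set B := f0 (h (t z)) in h1 h2 it' izt'.
(* For integral z the image of [t z] stays a unit, so the congruence for z follows from those for
   [z * t z] and [t z] by division. *)
have nmB : ~~ ml B.
  apply/negP => mB; have := mlD h1 mB; rewrite subrK ml_exp ?qX_gt0 // => mt.
  by have := nmt iz; rewrite mt.
have B0 : B != 0 by apply: contraNneq nmB => ->; rewrite /ml vgt0.
have wB : w B = 0.
  by apply/eqP; rewrite eq_le; move: nmB it'; rewrite /ml /vint vgtE // vgeE // -leNgt => -> ->.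
have iA : vint A.
  have [->|A0] := eqVneq A 0; first exact: vint0.
  by move: izt'; rewrite /vint !vgeE ?mulf_neq0 // pwM // wB addr0.
split => //; have : ml ((A - z ^+ (q ^ n)) * B).
  have -> : (A - z ^+ (q ^ n)) * B = - ((z * t z) ^+ (q ^ n) - A * B) + z ^+ (q ^ n) * (t z ^+ (q ^ n) - B).
    by rewrite exprMn; ring.
  by apply: mlD; [rewrite mlN|apply: mlM => //; exact: vintX].
have iAz : vint (A - z ^+ (q ^ n)) by apply: vintB => //; exact: vintX.
by move=> /(ml_prime iAz it') /orP [//|H]; rewrite H in nmB.
Qed.

End Gen.
End Homs.

(** * Ramification of Carlitz torsion *)

Section Unramified.
Variable X : setting.
Local Notation Fq := (sFq X).
Local Notation L := (sL X).
Local Notation iota := (siota X).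
Local Notation theta := (stheta X).
Local Notation pc := (spc X).
Local Notation q := (qq X).
Local Notation inF := (inF iota theta).
Local Notation gamma := (gammaA iota theta).
Local Notation hom := {rmorphism L -> L}.
Variables (b : {poly Fq}) (ib : irreducible_poly b) (w : place b).
Local Notation vint := (vint w).
Local Notation ml := (ml w).
Local Notation vge := (vge w).
Local Notation red := (red ib w).

Lemma nat_above (x : rat) : exists n : nat, x < n%:R.
Proof.
exists (Num.bound `|x|).
by rewrite (le_lt_trans (ler_norm x)) // archi_boundP.
Qed.

Lemma monic_divmod (R : L -> Prop) p d : R 0 -> (forall x y, R x -> R y -> R (x - y)) ->
  (forall x y, R x -> R y -> R (x * y)) -> over R p -> over R d -> d \is monic ->
  exists u r, [/\ over R u, over R r, p = u * d + r & (size r < size d)%N].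
Proof.
move=> R0 RB RM kp kd md; have d0 := monic_neq0 md.
have RD x y : R x -> R y -> R (x + y) by move=> Rx Ry; rewrite -[y]opprK; apply: (RB) => //; rewrite -[- y]sub0r; apply: RB.
have [n] := ubnP (size p); elim: n p kp => // n IH p kp le.
case: (ltnP (size p) (size d)) => [lt|ge].
  by exists 0, p; split => //; [move=> i; rewrite coef0|rewrite mul0r add0r].
have p0 : p != 0 by rewrite -size_poly_gt0 (leq_trans _ ge) // size_poly_gt0.
pose h := lead_coef p *: 'X^(size p - size d) : {poly L}.
have hdE : h * d = (lead_coef p *: d) * 'X^(size p - size d) by rewrite /h -scalerAl -scalerAl mulrC.
have khd : over R (h * d).
  by move=> i; rewrite hdE coefMXn; case: ifP => _ //; rewrite coefZ; apply: RM => //; exact: kp.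
have lp : lead_coef p != 0 by rewrite lead_coef_eq0.
have sh : size (h * d) = size p.
  by rewrite hdE size_mulXn ?scaler_eq0 ?negb_or ?lp // size_scale // subnK.
have lh : lead_coef (h * d) = lead_coef p.
  by rewrite hdE lead_coefM lead_coefXn mulr1 lead_coefZ (monicP md) mulr1.
have sph : (size (p - h * d)%R < n)%N.
  rewrite ltnS in le; apply: (leq_trans _ le).
  have sp : (0 < size p)%N by rewrite size_poly_gt0.
  rewrite -(prednK sp) ltnS; apply/leq_sizeP => j lj; rewrite coefB.
  have [->|nj] := eqVneq j (size p).-1.
    by rewrite -lead_coefE -lh lead_coefE sh subrr.
  have lj' : (size p <= j)%N by move/eqP: nj; lia.
  by rewrite !nth_default ?subrr ?sh.
have kph : over R (p - h * d) by move=> i; rewrite coefB; apply: RB.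
have [u [r [ku kr E sr]]] := IH _ kph sph.
exists (u + h), r; split => //.
  move=> i; rewrite coefD; apply: RD => //; rewrite coefZ coefXn.
  by case: eqP => _; rewrite ?mulr1 ?mulr0 //; exact: kp.
by rewrite mulrDl addrAC -E subrK.
Qed.

Lemma root_vint p z : p \is monic -> intp w p -> p.[z] = 0 -> vint z.
Proof.
move=> mp ip pz; apply: contraT => nz; exfalso.
have z0 : z != 0 by apply: contraNneq nz => ->; exact: vint0.
have wz : w z < 0 by rewrite ltNge; apply: contra nz; rewrite /vint vgeE.
have s0 : (0 < size p)%N by rewrite size_poly_gt0 monic_neq0.
have lc : p`_(size p).-1 = 1 by rewrite -lead_coefE (monicP mp).
move: pz lc; rewrite horner_coef; case: (size p) s0 => // n _; rewrite big_ord_recr /= => pz lc.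
move: pz; rewrite lc mul1r addrC; apply/eqP.
have [] // := @w_dom _ b w (z ^+ n) (\sum_(i < n) p`_i * z ^+ i) (expf_neq0 _ z0).
apply: vgt_sum => i _; rewrite -[w _]add0r; apply: vgtM; first exact: ip.
rewrite vgtE ?expf_neq0 // !wX //.
have : (i%:R : rat) < n%:R by rewrite ltr_nat.
by nra.
Qed.

(** Says that [w] is unramified on k, as the values on F are the integers. *)
Definition UnZ (k : L -> Prop) := forall f, k f -> f != 0 -> exists z : int, w f = z%:~R.

Lemma UnZ_inF : UnZ inF.
Proof. by move=> f Ff f0; exact: w_inF. Qed.

Lemma gb0 : gamma b != 0. Proof. by rewrite gamma_neq0 // irr_neq0. Qed.

Lemma unitM_ml x y : vint x -> vint y -> ~~ ml x -> ml (x * y) -> ml y.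
Proof. by move=> ix iy nx /(ml_prime ix iy) /orP [h|//]; rewrite h in nx. Qed.

Lemma unit_w x : vint x -> ~~ ml x -> x != 0 /\ w x = 0.
Proof.
move=> ix nx; have x0 : x != 0 by apply: contraNneq nx => ->; rewrite /ml vgt0.
split => //; apply/eqP; rewrite eq_le; move: nx ix; rewrite /ml /vint vgtE // vgeE // -leNgt.
by move=> -> ->.
Qed.

Section Step.
Variables (k : L -> Prop) (kS : subr k) (kZ : UnZ k) (s : L) (h : {poly L}).
Hypotheses (kh : over k h) (ih : intp w h) (mh : h \is monic) (hs : h.[s] = 0)
  (is_ : vint s) (dh : ~~ ml (h^`()).[s]).

Let R x := k x /\ vint x.
Let R0 : R 0. Proof. by split; [exact: (sb0 kS)|exact: vint0]. Qed.
Let RB x y : R x -> R y -> R (x - y).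
Proof. by move=> [k1 i1] [k2 i2]; split; [exact: (sbB kS)|exact: vintB]. Qed.
Let RM x y : R x -> R y -> R (x * y).
Proof. by move=> [k1 i1] [k2 i2]; split; [exact: (sbM kS)|exact: vintM]. Qed.
Let over_int g : over R g -> intp w g. Proof. by move=> H i; case: (H i). Qed.
Let overRM p r : over R p -> over R r -> over R (p * r).
Proof.
move=> kp kr i; rewrite coefM; apply: (big_ind R) => [//|x y Rx Ry|j _]; last by apply: RM; [exact: kp|exact: kr].
by rewrite -[y]opprK; apply: (RB) => //; rewrite -[- y]sub0r; apply: RB.
Qed.
Let overRB p r : over R p -> over R r -> over R (p - r).
Proof. by move=> kp kr i; rewrite coefB; apply: RB. Qed.
Let hornI g : intp w g -> vint g.[s].
Proof. by move=> ig; rewrite horner_coef; apply: vint_sum => i _; apply: vintM => //; exact: vintX. Qed.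

Let ml_div c : k c -> ml c -> exists2 c', R c' & c = gamma b * c'.
Proof.
move=> kc mc; exists ((gamma b)^-1 * c); last by rewrite mulVKf // gb0.
split; first by apply: (sbM kS) => //; apply: (sbV kS); apply: (sbF kS); exact: inF_gamma.
have [->|c0] := eqVneq c 0; first by rewrite mulr0 vint0.
have [z Ez] := kZ kc c0; move: mc; rewrite /ml /vint vgtE // vgeE ?mulf_neq0 ?invr_eq0 ?gb0 //.
rewrite pwM ?invr_eq0 ?gb0 // wV ?gb0 // pwb Ez ltr0z => z0.
by rewrite addrC subr_ge0 (ler_int _ 1) .
Qed.

Let mlp_div g : over k g -> (forall i, ml g`_i) -> exists2 g', over R g' & g = gamma b *: g'.
Proof.
move=> kg mg; have H i : exists c', R c' /\ g`_i = gamma b * c'.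
  by have [c' Rc E] := ml_div (kg i) (mg i); exists c'.
have [c cE] := choice H; exists (\poly_(i < size g) c i).
  by move=> i; rewrite coef_poly; case: ifP => _ //; case: (cE i).
apply/polyP => i; rewrite coefZ coef_poly; case: ltnP => li; first by case: (cE i).
by rewrite nth_default ?mulr0.
Qed.

Let exh1 : exists h1 : {poly L}, [/\ over R h1, h1 \is monic, ml h1.[s] &
  forall g : {poly L}, over R g -> g \is monic -> ml g.[s] -> (size h1 <= size g)%N].
Proof.
pose Q n := `[< exists g : {poly L}, [/\ over R g, g \is monic, ml g.[s] & size g = n] >].
have exQ : exists n, Q n.
  exists (size h); apply/asboolP; exists h; split; [|exact: mh| |by []].
    by move=> i; split; [exact: kh|exact: ih].
  by rewrite hs /ml vgt0.
case: (ex_minnP exQ) => n /asboolP [g [Rg mg gs sgE]] minn; rewrite -sgE in minn.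
exists g; split => // g' Rg' mg' gs'; apply: minn; apply/asboolP; by exists g'.
Qed.

(** Let [h1] be monic integral of least degree with h1(s) in the maximal ideal, and h = h2 h1 + h3.
    Minimality makes h3 divisible by b, so h1(s) h2(s) is a multiple of b, while h2(s) is a unit
    because h'(s) is one. Up to the unit B = h2, every g(s) in the maximal ideal is thus b times an
    integral value. *)
Lemma un_step_poly : exists B : {poly L}, [/\ over k B, intp w B, ~~ ml B.[s] &
  forall g, over k g -> intp w g -> ml g.[s] -> exists A, [/\ over k A, intp w A & g.[s] * B.[s] = gamma b * A.[s]]].
Proof.
have [h1 [Rh1 mh1 h1s min1]] := exh1.
have C1 g : over R g -> (size g < size h1)%N -> ml g.[s] -> forall i, ml g`_i.
  move=> Rg sg gs; apply: contrapT => /existsNP [i0 ni0].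
  have ni0' : ~~ ml g`_i0 by apply/negP.
  have ub i : ~~ ml g`_i -> (i <= size g)%N.
    by move=> ni; rewrite leqNgt; apply/negP => l; move: ni; rewrite nth_default ?(ltnW l) // /ml vgt0.
  case: (@ex_maxnP (fun i => ~~ ml g`_i) (size g)) => [||j nj maxj]; [by exists i0|by []|].
  have [gj0 wgj] := unit_w (over_int Rg j) nj.
  have Rgj : R (g`_j)^-1.
    split; first by apply: (sbV kS); case: (Rg j).
    by rewrite /vint vgeE ?invr_eq0 // wV // wgj oppr0.
  have lj : (j < size g)%N by rewrite ltnNge; apply/negP => l; rewrite nth_default ?eqxx in gj0.
  pose g' := \poly_(i < j.+1) (g`_i * (g`_j)^-1) : {poly L}.
  have sg' : size g' = j.+1 by rewrite size_poly_eq // divff // oner_neq0.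
  have mg' : g' \is monic by rewrite monicE lead_coefE sg' coef_poly ltnSn divff.
  have Rg' : over R g' by move=> i; rewrite coef_poly; case: ifP => _ //; apply: RM.
  have : ml g'.[s].
    rewrite horner_poly; under eq_bigr do rewrite mulrAC.
    rewrite -mulr_suml mulrC; apply: mlM; first by case: Rgj.
    move: gs; rewrite horner_coef -(big_mkord xpredT (fun i => g`_i * s ^+ i)).
    rewrite (@big_cat_nat _ _ _ j.+1) //= big_mkord => gs.
    set T := \sum_(j.+1 <= i < size g) _ in gs.
    rewrite -[X in ml X](addrK T); apply: mlB => //.
    rewrite /T big_nat_cond; apply: ml_sum => i /andP [/andP [li _] _].
    rewrite mulrC; apply: mlM; first exact: vintX.
    by apply: contraT => /maxj; rewrite leqNgt li.
  by move/(min1 _ Rg' mg'); rewrite sg'; lia.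
have RD x y : R x -> R y -> R (x + y) by move=> Rx Ry; rewrite -[y]opprK; apply: (RB) => //; rewrite -[- y]sub0r; apply: RB.
have Rh : over R h by move=> i; split; [exact: kh|exact: ih].
have [h2 [h3 [Rh2 Rh3 hE sh3]]] := monic_divmod R0 RB RM Rh Rh1 mh1.
have h3s : ml h3.[s].
  move: hs; rewrite hE hornerD hornerM addrC => /eqP; rewrite addr_eq0 => /eqP ->.
  by rewrite mlN; apply: mlM => //; apply: hornI; exact: over_int.
have mh3 := C1 h3 Rh3 sh3 h3s.
have [h3' Rh3' h3E] := mlp_div (fun i => (Rh3 i).1) mh3.
have ni2 : ~~ ml h2.[s].
  apply: contra dh => m2; rewrite hE derivD derivM !hornerD !hornerM.
  apply: mlD; [apply: mlD|].
  - apply: mlM => //; apply: hornI => i; rewrite coef_deriv -mulr_natr; apply: vintM; first by case: (Rh2 i.+1).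
    by rewrite -(rmorph_nat iota) vint_iota.
  - rewrite mulrC; apply: mlM => //; apply: hornI => i; rewrite coef_deriv -mulr_natr; apply: vintM; first by case: (Rh1 i.+1).
    by rewrite -(rmorph_nat iota) vint_iota.
  - rewrite horner_coef; apply: ml_sum => i _; rewrite mulrC; apply: mlM; first exact: vintX.
    rewrite coef_deriv -mulr_natl; apply: mlM => //.
    by rewrite -(rmorph_nat iota) vint_iota.
exists h2; split => //; [by move=> i; case: (Rh2 i)|exact: over_int|].
move=> g kg ig gs; have Rg : over R g by move=> i; split; [exact: kg|exact: ig].
have [g1 [g2 [Rg1 Rg2 gE sg2]]] := monic_divmod R0 RB RM Rg Rh1 mh1.
have g2s : ml g2.[s].
  have -> : g2 = g - g1 * h1 by rewrite gE addrAC subrr add0r.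
  rewrite hornerD hornerN hornerM; apply: mlB => //; apply: mlM => //; apply: hornI; exact: over_int.
have [g2' Rg2' g2E] := mlp_div (fun i => (Rg2 i).1) (C1 g2 Rg2 sg2 g2s).
have RA : over R (g2' * h2 - h3' * g1) by apply: overRB; apply: overRM.
exists (g2' * h2 - h3' * g1); split; [by move=> i; case: (RA i)|exact: over_int|].
have E1 : h2.[s] * h1.[s] = - (gamma b * h3'.[s]).
  by apply/eqP; rewrite -addr_eq0 -hs hE h3E hornerD hornerM hornerZ.
rewrite gE g2E hornerD !hornerM hornerZ hornerD hornerN !hornerM mulrDl.
have -> : g1.[s] * h1.[s] * h2.[s] = g1.[s] * (h2.[s] * h1.[s]) by ring.
rewrite E1; ring.
Qed.

(** By [un_step_poly] a nonunit can be divided by b inside k[s], up to a unit, which lowers its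
    valuation by exactly 1. *)
Lemma un_step : UnZ (adj k s).
Proof.
have [B [kB iB nB HB]] := un_step_poly.
have [B0 wB] := unit_w (hornI iB) nB.
have main N A : over k A -> intp w A -> A.[s] != 0 -> w A.[s] < N%:R -> exists z : int, w A.[s] = z%:~R.
  elim: N A => [|N IH] A kA iA A0 lt.
    by have := hornI iA; rewrite /vint vgeE // => ge; move: (le_lt_trans ge lt); rewrite ltxx.
  have [mA|nA] := boolP (ml A.[s]); last by exists 0; rewrite (unit_w (hornI iA) nA).2.
  have [A' [kA' iA' E]] := HB A kA iA mA.
  have A'0 : A'.[s] != 0.
    apply: contraTneq isT => A'0; move/eqP: E; rewrite A'0 mulr0 mulf_eq0 (negbTE A0) (negbTE B0) //.
  have wE : w A.[s] = 1 + w A'.[s].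
    have := congr1 (pw w) E; rewrite !pwM ?gb0 // wB addr0 pwb //.
  have [|z Ez] := IH A' kA' iA' A'0; first by move: lt; rewrite wE -natr1; lra.
  by exists (1 + z); rewrite wE Ez rmorphD.
move=> _ [g kg ->] g0.
have [e ie] : exists e : nat, forall i, vint (gamma b ^+ e * g`_i).
  have [e He] : exists e : nat, forall i, (i < size g)%N -> vint (gamma b ^+ e * g`_i).
    elim: (size g) => [|n [e IH]]; first by exists 0%N.
    have [e' He'] : exists e' : nat, vint (gamma b ^+ e' * g`_n).
      have [E|gn0] := eqVneq g`_n 0; first by exists 0%N; rewrite E mulr0 vint0.
      have [m Hm] := nat_above (- w g`_n); exists m.
      by rewrite /vint vgeE ?mulf_neq0 ?expf_neq0 ?gb0 // pwM ?expf_neq0 ?gb0 // wX ?gb0 // pwb; lra.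
    exists (e + e')%N => i; rewrite ltnS leq_eqVlt => /orP [/eqP ->|/IH H].
      by rewrite exprD -mulrA; apply: vintM => //; apply: vintX; exact: vint_gamma.
    by rewrite addnC exprD -mulrA; apply: vintM => //; apply: vintX; exact: vint_gamma.
  exists e => i; have [l|l] := ltnP i (size g); first exact: He.
  by rewrite nth_default // mulr0 vint0.
have kA : over k (gamma b ^+ e *: g).
  by apply: (overZ kS) => //; apply: (sbX kS); apply: (sbF kS); exact: inF_gamma.
have iA : intp w (gamma b ^+ e *: g) by move=> i; rewrite coefZ.
have A0 : (gamma b ^+ e *: g).[s] != 0 by rewrite hornerZ mulf_neq0 // expf_neq0 // gb0.
have [N lt] := nat_above (w (gamma b ^+ e *: g).[s]).
have [z Ez] := main N _ kA iA A0 lt.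
exists (z - e%:Z); move: Ez; rewrite hornerZ pwM ?expf_neq0 ?gb0 // wX ?gb0 // pwb rmorphB /= => <-.
by rewrite -pmulrn; lra.
Qed.

End Step.

End Unramified.

(** * Valuations of Carlitz torsion points *)

Section Carlitz.
Variable X : setting.
Local Notation Fq := (sFq X).
Local Notation L := (sL X).
Local Notation iota := (siota X).
Local Notation theta := (stheta X).
Local Notation pc := (spc X).
Local Notation q := (qq X).
Local Notation inF := (inF iota theta).
Local Notation gamma := (gammaA iota theta).
Local Notation hom := {rmorphism L -> L}.

Implicit Types (D : dmodule L) (a : {poly Fq}) (f : hom) (x y z : L).

Fixpoint KS (s : seq L) : L -> Prop := if s is z :: s' then adj (KS s') z else inF.

Lemma KS_subr s : subr (KS s).
Proof. elim: s => [|z s IH] /=; [exact: subr_inF|exact: adj_subr]. Qed.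

Lemma KS_mem s z : z \in s -> KS s z.
Proof.
elim: s => // y s IH; rewrite inE => /orP [/eqP ->|/IH h] /=; first exact: (adj_z (KS_subr s)).
exact: (adj_k (KS_subr s)).
Qed.

Lemma ca_sub k D (a : {poly Fq}) i : subr k -> k (dth D) -> k (dg1 D) -> k (dg2 D) -> k (ca D a i).
Proof.
move=> kS k0 k1 k2; have kc j : forall l, k (cf D j l).
  elim: j => [|j IH] l /=; first by case: eqP => _; [exact: sb1|exact: sb0].
  have sh (c : nat -> L) l' : (forall l, k (c l)) -> k (shift c l').
    by move=> H; case: l' => [|l'] //=; exact: sb0.
  have s1 : k (shift (cf D j) l) by apply: sh.
  have s2 : k (shift (shift (cf D j)) l) by apply: (sh) => l'; apply: sh.
  by apply: (sbD kS); [apply: (sbD kS)|]; apply: (sbM kS) => //; apply: (sbX kS).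
apply: (sb_sum kS) => j _; apply: (sbM kS) => //; apply: (sbF kS).
by rewrite -gammaC; apply: inF_gamma.
Qed.

Lemma Pa_over k D (a : {poly Fq}) : subr k -> k (dth D) -> k (dg1 D) -> k (dg2 D) -> over k (Pa D a).
Proof.
move=> kS k0 k1 k2; apply: (over_sum kS) => i _; apply: (overZ kS); last exact: overXn.
exact: ca_sub.
Qed.

Definition Cm : dmodule L := Dmod theta 1 0.

Lemma inF_theta : inF theta. Proof. by have := @inF_gamma X 'X; rewrite gammaXt. Qed.

Lemma ga_theta D a : dth D = theta -> ga D a = gamma a.
Proof. by move=> E; rewrite /ga E. Qed.

Lemma Pa_Cm_over k (a : {poly Fq}) : subr k -> over k (Pa Cm a).
Proof.
move=> kS; apply: Pa_over => //=; [|exact: sb1|exact: sb0].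
by apply: (sbF kS); exact: inF_theta.
Qed.

Lemma act_fix f D a x : fixF f -> f (dth D) = dth D -> f (dg1 D) = dg1 D -> f (dg2 D) = dg2 D ->
  f (act D a x) = act D a (f x).
Proof.
move=> fF E0 E1 E2; rewrite act_hom; last by move=> c; apply: fix_iota.
by rewrite E0 E1 E2; case: D {E0 E1 E2}.
Qed.

Lemma act_Cm f a x : fixF f -> f (act Cm a x) = act Cm a (f x).
Proof. by move=> fF; apply: act_fix; rewrite //= ?rmorph1 ?rmorph0 ?fix_theta. Qed.

Lemma lead_PaCm a : a != 0 -> lead_coef (Pa Cm a) = iota (lead_coef a).
Proof.
move=> a0; have [e E] := ca_rk1_top (D := Cm) a0 erefl.
rewrite /= expr1n mulr1 in E.
rewrite lead_coefE (size_Pa1 a0) ?oner_neq0 //= (@Pa_cut _ _ _ (size a).-1).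
  rewrite coef_sum (bigD1 ord_max) //= coefZ coefXn eqxx mulr1 E big1 ?addr0 // => i ni.
  rewrite coefZ coefXn [_ == _]eqn_exp2l ?q_gt1 // eq_sym; move: ni; rewrite -(inj_eq val_inj) /= => /negbTE ->.
  by rewrite mulr0.
by move=> k lk; apply: ca_rk1_big => //; move: lk; rewrite -size_poly_gt0 in a0; rewrite -(prednK a0).
Qed.

Section OnePlace.
Variables (b : {poly Fq}) (ib : irreducible_poly b) (w : place b).
Local Notation vint := (vint w).
Local Notation ml := (ml w).
Local Notation vge := (vge w).
Local Notation vgt := (vgt w).
Local Notation red := (red ib w).
Local Notation d := (size b).-1.

(** The derivative of C_M is the constant gamma(M), a unit at b, so [un_step] applies to each
    torsion point in turn. *)
Lemma un_tors M s : ~~ (b %| M) -> (forall z, z \in s -> act Cm M z = 0) -> UnZ w (KS s).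
Proof.
move=> bM; have M0 : M != 0 by apply: contraNneq bM => ->; rewrite dvdp0.
have lM : iota (lead_coef M) != 0 by rewrite iota_inj0 lead_coef_eq0.
elim: s => [|z s IH] H /=; first exact: UnZ_inF.
have Hs : forall y, y \in s -> act Cm M y = 0 by move=> y ys; apply: H; rewrite inE ys orbT.
pose h := iota (lead_coef M)^-1 *: Pa Cm M.
have lme : iota (lead_coef M)^-1 * iota (lead_coef M) = 1 by rewrite -rmorphM mulVf ?rmorph1 ?lead_coef_eq0.
have kS := KS_subr s.
have iC : intD w Cm by split; [exact: vint_theta|exact: vint1|exact: vint0].
have ih : intp w h by move=> i; rewrite coefZ; apply: vintM; [exact: vint_iota|exact: intp_Pa].
have mh : h \is monic by rewrite monicE /h lead_coefZ lead_PaCm ?lme.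
have hz : h.[z] = 0 by rewrite hornerZ horner_Pa H ?inE ?eqxx // mulr0.
apply: (@un_step _ b ib w (KS s) kS (IH Hs) z h) => //.
- by apply: (overZ kS); [apply: (sbF kS); rewrite -gammaC; apply: inF_gamma|exact: Pa_Cm_over].
- exact: (root_vint mh ih).
rewrite derivZ deriv_Pa ga_theta // hornerZ hornerC -gammaC -gammaM ml_gamma // mul_polyC dvdpZr //.
by rewrite invr_eq0 lead_coef_eq0.
Qed.

Lemma d_gt0 : (0 < d)%N. Proof. by case: ib => s _; move: s; case: (size b) => // -[]. Qed.

Lemma Sd : size b = d.+1. Proof. by rewrite prednK // size_poly_gt0 irr_neq0. Qed.

Lemma res_list : exists S : seq L, [/\ uniq S, size S = (q ^ d)%N, forall a, red (gamma a) \in S &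
  forall y, y \in S -> exists a, y = red (gamma a)].
Proof.
pose S := [seq red (gamma a) | a <- polys X d]; exists S; split.
- rewrite map_inj_in_uniq ?uniq_polys // => a1 a2; rewrite !mem_polys => s1 s2 /eqP.
  rewrite red_eq ?vint_gamma // -gammaB ml_gamma // => dv; apply/eqP; rewrite -subr_eq0.
  apply: contraTT dv => n0; apply/negP => /dvdp_leq -/(_ n0); rewrite Sd ltnNge => /negP; apply.
  by apply: leq_trans (size_polyD _ _) _; rewrite size_polyN geq_max s1 s2.
- by rewrite size_map size_polys.
- move=> a; apply/mapP; exists (a %% b).
    by rewrite mem_polys -ltnS -Sd ltn_modp irr_neq0.
  apply/eqP; rewrite red_eq ?vint_gamma // -gammaB ml_gamma // {1}(divp_eq a b) addrK.
  exact: dvdp_mull.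
- by move=> y /mapP [a _ ->]; exists a.
Qed.

(** Fermat in A/b: multiplication by r permutes the nonzero residues and so preserves their
    product. *)
Lemma res_frob a : red (gamma a) ^+ (q ^ d) = red (gamma a).
Proof.
have [S [uS sS S1 S2]] := res_list; set r := red _.
have [->|r0] := eqVneq r 0; first by rewrite expr0q.
pose S' := [seq y <- S | y != 0].
have uS' : uniq S' by rewrite filter_uniq.
have zS : 0 \in S by rewrite -(red0 ib w) -(gamma0 X).
have sS' : (size S').+1 = (q ^ d)%N.
  rewrite -sS /S' size_filter -(count_predC (fun y => y == 0)) -[RHS]addnC -addn1; congr (_ + _)%N.
  by rewrite -/(count_mem 0 S) count_uniq_mem // zS.
have pS : perm_eq [seq r * y | y <- S'] S'.
  have ur : uniq [seq r * y | y <- S'] by rewrite map_inj_uniq //; exact: mulfI.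
  apply: uniq_perm => //; apply: uniq_sub_eq => //; last by rewrite size_map.
  move=> yy /mapP [y]; rewrite mem_filter => /andP [y0 /S2 [a' Ey]] ->; rewrite mem_filter mulf_neq0 //=.
  by rewrite Ey -redM ?vint_gamma // -gammaM.
have E : \prod_(y <- [seq r * y | y <- S']) y = \prod_(y <- S') y by apply: perm_big.
rewrite big_map big_split /= big_const_seq count_predT iter_mulr_1 in E.
have P0 : \prod_(y <- S') y != 0.
  by rewrite prodf_seq_neq0; apply/allP => y; rewrite mem_filter => /andP [-> _].
have {E} E : r ^+ size S' = 1 by apply: (mulIf P0); rewrite mul1r.
by rewrite -sS' exprS E mulr1.
Qed.

Lemma gamma_frob a : ml (gamma a ^+ (q ^ d) - gamma a).
Proof.
rewrite -(red_eq ib) ?vint_gamma ?vintX ?vint_gamma // redX ?vint_gamma //.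
by rewrite res_frob.
Qed.

(** Otherwise the q^k-power would fix all q^d residues of A, more than X^(q^k) - X has roots. *)
Lemma theta_unit k : (0 < k < d)%N -> ~~ ml (theta ^+ (q ^ k) - theta).
Proof.
move=> /andP [k0 kd]; apply/negP => mt.
have [S [uS sS S1 S2]] := res_list.
have fr a : red (gamma a) ^+ (q ^ k) = red (gamma a).
  apply/eqP; rewrite -redX ?vint_gamma // red_eq ?vintX ?vint_gamma //.
  have -> : gamma a ^+ (q ^ k) = (map_poly iota a).[theta ^+ (q ^ k)].
    rewrite gammaE !horner_coef expr_sumq; apply: eq_bigr => i _.
    by rewrite exprMn coef_map /= iota_q -!exprM mulnC.
  by rewrite gammaE; apply: ml_horner => //; [exact: intp_iota|apply: vintX; exact: vint_theta|exact: vint_theta].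
have sp : size ('X^(q ^ k) - 'X : {poly L}) = (q ^ k).+1.
  have q1 : (1 < q ^ k)%N by rewrite -[X in (X < _)%N](exp1n k) ltn_exp2r ?q_gt1.
  by rewrite size_polyDl size_polyXn // size_polyN size_polyX.
have p0 : 'X^(q ^ k) - 'X != 0 :> {poly L} by rewrite -size_poly_gt0 sp.
have := max_poly_roots p0 _ uS; rewrite sp sS => H; have : (q ^ d < (q ^ k).+1)%N.
  apply: H; apply/allP => y /S2 [a ->]; rewrite rootE !hornerE fr subrr //.
by rewrite ltnS leq_exp2l ?q_gt1 // leqNgt kd.
Qed.

(** Induction with [ca_comm]: its right side is divisible by b, and its left factor is a unit by
    [theta_unit]. Modulo the place, phi_b therefore begins at tau^d. *)
Lemma ca_small D k : dth D = theta -> intD w D -> (k < d)%N -> vge 1 (ca D b k).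
Proof.
move=> Et iD; have [k'] := ubnP k; elim: k' k => // k' IH k lk kd.
have [->|k0] := posnP k.
  by rewrite ca0 Et -gammaE vgeE ?gb0 // pwb.
have s1 : vge 1 (shift (ca D b) k).
  by case: k lk kd {k0} => [|k] lk kd; [exact: vge0|apply: IH => //; apply: ltnW].
have s2 : vge 1 (shift (shift (ca D b)) k).
  case: k lk kd {k0 s1} => [|[|k]] lk kd; try exact: vge0.
  by apply: IH; [apply: ltnW|apply: ltnW; apply: ltnW].
have s3 : vge 1 (shift (fun j => ca D b j * dg1 D ^+ (q ^ j)) k).
  case: k {k0 s2} lk kd s1 => [|k] lk kd s1 /=; first exact: vge0.
  rewrite -[1]addr0; apply: vgeM => //; apply: vintX; by case: iD.
have s4 : vge 1 (shift (shift (fun j => ca D b j * dg2 D ^+ (q ^ j))) k).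
  case: k {k0 s1 s3} lk kd s2 => [|[|k]] lk kd s2 /=; try exact: vge0.
  rewrite -[1]addr0; apply: vgeM => //; apply: vintX; by case: iD.
have vp n y : (0 < n)%N -> vge 1 y -> vge 1 (y ^+ n).
  move=> n0 /(vge_exp n); apply: vge_le; rewrite mulr1 (ler_nat _ 1) //.
have [i0 i1 i2] := iD.
have : vge 1 ((dth D ^+ (q ^ k) - dth D) * ca D b k).
  rewrite ca_comm; do 2?apply: vgeB => //; apply: vgeD.
    by rewrite -[1]add0r; apply: vgeM => //; apply: vp => //; exact: q_gt0.
  by rewrite -[1]add0r; apply: vgeM => //; apply: vp => //; exact: qX_gt0.
have [u0 wu] := @unit_w _ b w (theta ^+ (q ^ k) - theta) (vintB (vintX _ (vint_theta ib w)) (vint_theta ib w)) (theta_unit (introT andP (conj k0 kd))).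
rewrite Et; have [->|c0] := eqVneq (ca D b k) 0; first by move=> _; exact: vge0.
by rewrite !vgeE ?mulf_neq0 // pwM // wu add0r.
Qed.

Local Notation Q := (q ^ d)%N.

Lemma Q_gt1 : (1 < Q)%N.
Proof. by rewrite -[X in (X < _)%N](exp1n d) ltn_exp2r ?q_gt1 // d_gt0. Qed.

Lemma intD_Cm : intD w Cm.
Proof. by split; [exact: vint_theta|exact: vint1|exact: vint0]. Qed.

Lemma act_Cm_b x : act Cm b x =
  gamma b * x + \sum_(1 <= k < d) ca Cm b k * x ^+ (q ^ k) + iota (lead_coef b) * x ^+ Q.
Proof.
rewrite -horner_Pa (@Pa_cut _ _ _ d); last first.
  by move=> k lk; apply: ca_rk1_big => //; rewrite Sd.
rewrite horner_sum big_ord_recr /= hornerZ hornerXn; congr (_ + _ * _); last first.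
  by have [e ->] := ca_rk1_top (D := Cm) (irr_neq0 ib) erefl; rewrite /= expr1n mulr1.
rewrite -(big_mkord xpredT (fun k => (ca Cm b k *: 'X^(q ^ k)).[x])) big_ltn ?d_gt0 //.
rewrite hornerZ hornerXn expn0 expr1 ca0 -gammaE; congr (_ + _).
by apply: eq_bigr => k _; rewrite hornerZ hornerXn.
Qed.

(* Newton polygon of [C_b(X) - y]: the two cases are [y = 0] and [0 < w y <= 1/(Q-1)]. *)
Lemma w_carl_step x : x != 0 -> let y := act Cm b x in
  (y = 0 \/ (y != 0 /\ 0 < w y /\ w y * (Q.-1)%:R <= 1)) ->
  (y = 0 -> w x * (Q.-1)%:R = 1) /\ (y != 0 -> w x * Q%:R = w y).
Proof.
move=> x0 y Hy.
have Q1 : (2%:R : rat) <= Q%:R by rewrite ler_nat Q_gt1.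
have QE : (Q.-1)%:R = Q%:R - 1 :> rat by have := natrB rat (ltnW Q_gt1); rewrite subn1.
set r := w x.
have l0 : iota (lead_coef b) != 0 by rewrite iota_inj0 lead_coef_eq0 irr_neq0.
have gx0 : gamma b * x != 0 by rewrite mulf_neq0 // gb0.
have wgx : w (gamma b * x) = 1 + r by rewrite pwM ?gb0 // pwb.
have lx0 : iota (lead_coef b) * x ^+ Q != 0 by rewrite mulf_neq0 // expf_neq0.
have wlx : w (iota (lead_coef b) * x ^+ Q) = Q%:R * r.
  by rewrite pwM ?expf_neq0 // wX // const_w ?add0r //; exact: const_iota.
have mid k : (0 < k < d)%N -> vge (1 + (q ^ k)%:R * r) (ca Cm b k * x ^+ (q ^ k)).
  move=> /andP [_ kd]; apply: vgeM; first exact: (ca_small _ intD_Cm).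
  by apply: vge_exp; exact: vge_w.
have qk k : (0 < k < d)%N -> (1 : rat) < (q ^ k)%:R /\ ((q ^ k)%:R : rat) < Q%:R.
  move=> /andP [k0 kd]; rewrite (ltr_nat _ 1) ltr_nat ltn_exp2l ?q_gt1 //; split => //.
  by rewrite -[X in (X < _)%N](exp1n k) ltn_exp2r ?q_gt1.
have yE : y = gamma b * x + \sum_(1 <= k < d) ca Cm b k * x ^+ (q ^ k) + iota (lead_coef b) * x ^+ Q.
  exact: act_Cm_b.
set T := gamma b * x + _ in yE.
have r0 : 0 < r.
  rewrite ltNge; apply/negP => r0.
  have vT : vgt (Q%:R * r) T.
    apply: vgtD; first by rewrite vgtE // wgx; nra.
    rewrite big_nat_cond; apply: vgt_sum => k; rewrite andbT => kk; apply: (vgt_lt _ (mid k kk)).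
    by have [q1 q2] := qk k kk; nra.
  rewrite -wlx in vT; have [y0 wy] := w_dom lx0 vT.
  rewrite addrC -yE wlx in y0 wy.
  case: Hy => [E|[_ [wy0 _]]]; first by rewrite E eqxx in y0.
  by move: wy0; rewrite wy; nra.
have [T0 wT] : T != 0 /\ w T = 1 + r.
  rewrite -wgx; apply: w_dom => //; rewrite big_nat_cond; apply: vgt_sum => k; rewrite andbT => kk.
  by apply: (vgt_lt _ (mid k kk)); rewrite wgx; have [q1 q2] := qk k kk; nra.
split => Y0.
  have E : T = - (iota (lead_coef b) * x ^+ Q) by apply/eqP; rewrite -addr_eq0 -yE Y0.
  have := congr1 (pw w) E; rewrite wN wT wlx QE; lra.
case: Hy => [E|[_ [wy0 wy1]]]; first by rewrite E eqxx in Y0.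
rewrite QE in wy1.
case: (ltgtP (1 + r) (Q%:R * r)) => [lt|gt|eq].
- have vl : vgt (w T) (iota (lead_coef b) * x ^+ Q) by rewrite vgtE // wT wlx.
  have [_ wy] := w_dom T0 vl; by rewrite -yE wT in wy; exfalso; rewrite wy in wy1; nra.
- have vT : vgt (w (iota (lead_coef b) * x ^+ Q)) T by rewrite wlx vgtE // wT.
  have [_ wy] := w_dom lx0 vT; by rewrite addrC -yE wlx in wy; rewrite wy mulrC.
- have : vge (1 + r) y by rewrite yE; apply: vgeD; rewrite vgeE // ?wT // wlx eq.
  by rewrite vgeE // => H; exfalso; nra.
Qed.

(** The value is 1/(Q - 1) at level b, the slope of C_b(X)/X, and each further division by b divides
    it by Q. *)
Lemma w_carl m x : act Cm (b ^+ m.+1) x = 0 -> act Cm (b ^+ m) x != 0 ->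
  w x * (Q ^ m * Q.-1)%:R = 1.
Proof.
have Q1 : (1%:R : rat) <= (Q.-1)%:R by rewrite ler_nat; have := Q_gt1; lia.
elim: m x => [|m IH] x.
  rewrite expr1 expr0 act1 => E x0; rewrite mul1n.
  by have [H _] := w_carl_step x0 (or_introl E); apply: H.
rewrite exprSr actM => E0 E1; have x0 : x != 0 by apply: contraNneq E1 => ->; rewrite act0r.
rewrite exprSr actM in E1; have := IH _ E0 E1; set y := act Cm b x => wy.
have y0 : y != 0 by apply: contraNneq E1; rewrite -/y => ->; rewrite act0r.
have Qm : (1%:R : rat) <= (Q ^ m)%:R by rewrite ler_nat expn_gt0 ltnW // Q_gt1.
rewrite natrM in wy.
have AB0 : (0 : rat) < (Q ^ m)%:R * (Q.-1)%:R by apply: mulr_gt0; lra.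
have wyp : 0 < w y by rewrite -(pmulr_lgt0 _ AB0) wy.
have wB : 0 < w y * (Q.-1)%:R by apply: mulr_gt0 => //; lra.
have wy1 : w y * (Q.-1)%:R <= 1 by rewrite mulrCA in wy; nra.
have [_ H] := w_carl_step x0 (or_intror (conj y0 (conj wyp wy1))).
by rewrite expnS -mulnA natrM natrM mulrA H.
Qed.
End OnePlace. End Carlitz.

(** * Total ramification of Carlitz torsion of level b^(m+1) *)

Section Inertia.
Variable X : setting.
Local Notation Fq := (sFq X).
Local Notation L := (sL X).
Local Notation iota := (siota X).
Local Notation theta := (stheta X).
Local Notation pc := (spc X).
Local Notation q := (qq X).
Local Notation inF := (inF iota theta).
Local Notation gamma := (gammaA iota theta).
Local Notation hom := {rmorphism L -> L}.
Local Notation Cm := (Cm X).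
Implicit Types (D : dmodule L) (a : {poly Fq}) (f : hom) (x y z : L).

Lemma int_of_rat (z z' : int) (n i j : nat) : z%:~R * n%:R + i%:R = z'%:~R * n%:R + j%:R :> rat ->
  z * n%:Z + i%:Z = z' * n%:Z + j%:Z.
Proof.
by move=> E; apply/eqP; rewrite -(eqr_int rat) !rmorphD !rmorphM /=; apply/eqP.
Qed.

Definition tlist D a (s : seq L) := uniq s /\ forall x, (x \in s) = (act D a x == 0).

Lemma carl_tors a : a != 0 -> exists2 s, tlist Cm a s & size s = (q ^ (size a).-1)%N.
Proof.
move=> a0; have [||s [us ss sE]] := @tors_ex X Cm a a0.
- by rewrite ga_theta // gamma_neq0.
- by rewrite /= oner_neq0 orbT.
by exists s; rewrite // ss /rk /= eqxx mul1n.
Qed.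

Section OnePlace.
Variables (b : {poly Fq}) (ib : irreducible_poly b) (w : place b).
Local Notation vint := (vint w).
Local Notation ml := (ml w).
Local Notation vge := (vge w).
Local Notation vgt := (vgt w).
Local Notation red := (red ib w).
Local Notation d := (size b).-1.
Local Notation Q := (q ^ d)%N.

(** Without ties among nonzero terms the ultrametric inequality is an equality; the first
    alternative is the case with no nonzero term. *)
Lemma w_sum_distinct (I : eqType) (s : seq I) (f : I -> L) : uniq s ->
  (forall i j, i \in s -> j \in s -> f i != 0 -> f j != 0 -> w (f i) = w (f j) -> i = j) ->
  (forall i, i \in s -> f i = 0) \/
  [/\ \sum_(i <- s) f i != 0, exists i, [/\ i \in s, f i != 0 & w (\sum_(i <- s) f i) = w (f i)] &
      forall j, j \in s -> vge (w (\sum_(i <- s) f i)) (f j)].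
Proof.
elim: s => [|i0 s IH] /=; first by left.
move=> /andP [ni us] H; rewrite big_cons.
have [|Z|[S0 [i [is_ fi wi]] Hj]] := IH us.
- by move=> i j si sj; apply: H; rewrite inE ?si ?sj orbT.
- rewrite (_ : \sum_(i <- s) f i = 0); last by rewrite big_seq big1.
  rewrite addr0; have [E|fi0] := eqVneq (f i0) 0.
    by left => i; rewrite inE => /orP [/eqP ->|/Z].
  right; split => //; first by exists i0; rewrite inE eqxx.
  by move=> j; rewrite inE => /orP [/eqP ->|/Z ->]; [exact: vge_w|exact: vge0].
have [E|fi0] := eqVneq (f i0) 0.
  rewrite E add0r; right; split => //; first by exists i; rewrite inE is_ orbT.
  by move=> j; rewrite inE => /orP [/eqP ->|/Hj //]; rewrite E; exact: vge0.
right; set S := \sum_(i <- s) f i in S0 wi Hj *.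
case: (ltgtP (w (f i0)) (w S)) => [lt|gt|E].
- have [T0 wT] : f i0 + S != 0 /\ w (f i0 + S) = w (f i0) by apply: w_dom => //; rewrite vgtE.
  split => //; first by exists i0; rewrite inE eqxx.
  move=> j; rewrite wT inE => /orP [/eqP ->|/Hj]; first exact: vge_w.
  by apply: vge_le; apply: ltW.
- have [T0 wT] : S + f i0 != 0 /\ w (S + f i0) = w S by apply: w_dom => //; rewrite vgtE.
  rewrite addrC; split => //; first by exists i; rewrite inE is_ orbT wT.
  move=> j; rewrite wT inE => /orP [/eqP ->|]; last exact: Hj.
  by rewrite vgeE //; apply: ltW.
have e : i0 = i by apply: (H) => //; rewrite ?inE ?eqxx ?is_ ?orbT // E.
by rewrite e is_ in ni.
Qed.

Variable m : nat.
Local Notation Phi := (Q ^ m * Q.-1)%N.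

Lemma Phi_gt0 : (0 < Phi)%N.
Proof. by rewrite muln_gt0 expn_gt0 qX_gt0 /= -subn1 subn_gt0 Q_gt1. Qed.

Definition primt l := act Cm (b ^+ m.+1) l = 0 /\ act Cm (b ^+ m) l != 0.

Lemma w_prim l : primt l -> l != 0 /\ w l = (Phi%:R)^-1.
Proof.
move=> [l1 l2]; have l0 : l != 0 by apply: contraNneq l2 => ->; rewrite act0r.
split => //; have H := w_carl ib w l1 l2.
by apply: (mulIf (x := Phi%:R)); rewrite ?pnatr_eq0 -?lt0n ?Phi_gt0 // H mulVf // pnatr_eq0 -lt0n Phi_gt0.
Qed.

Lemma prim_act a l : ~~ (b %| a) -> primt l -> primt (act Cm a l).
Proof.
move=> ba [l1 l2]; split; first by rewrite actCA l1 act0r.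
apply: contraNneq l2; rewrite actCA => E; apply/eqP.
apply: (act_coprime0 (irr_coprime ib ba) _ E).
by rewrite -actM -exprS.
Qed.

Lemma prim_ex : exists l, primt l.
Proof.
have b0 := irr_neq0 ib.
have [s [us sE] ss] := carl_tors (expf_neq0 m.+1 b0).
have [s' [us' sE'] ss'] := carl_tors (expf_neq0 m b0).
have lt : (size s' < size s)%N.
  by rewrite ss ss' !size_exp_pred // ltn_exp2l ?q_gt1 // ltn_mul2r ltnSn (d_gt0 ib).
have /allPn [l ls nl] : ~~ all (mem s') s.
  apply: contraTN lt => /allP sub; rewrite -leqNgt; apply: uniq_leq_size => //.
exists l; split; first by apply/eqP; rewrite -sE.
by move: nl; rewrite /= sE'.
Qed.

Lemma prim_gen l y : primt l -> act Cm (b ^+ m.+1) y = 0 -> exists a, y = act Cm a l.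
Proof.
move=> [l1 l2] y0; have [s [us sE] ss] := carl_tors (expf_neq0 m.+1 (irr_neq0 ib)).
apply: (@cyclic_of_size X Cm b m l s ib l1 l2); last by rewrite sE y0.
  by rewrite ss size_exp_pred ?irr_neq0.
by move=> a; rewrite sE actCA l1 act0r.
Qed.

(** The analogue of a cyclotomic polynomial: C_b(X)/X composed with C_(b^m). *)
Lemma eis_poly : exists E : {poly L}, [/\ over inF E, E != 0, size E = Phi.+1 & forall l, primt l -> E.[l] = 0].
Proof.
have b0 := irr_neq0 ib.
have kS := subr_inF X.
pose e : {poly L} := \sum_(k < d.+1) ca Cm b k *: 'X^((q ^ k).-1).
have eX : e * 'X = Pa Cm b.
  rewrite (@Pa_cut _ _ _ d) => [|k lk]; last by apply: ca_rk1_big => //; rewrite (Sd ib).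
  rewrite mulr_suml; apply: eq_bigr => k _.
  by rewrite -scalerAl -exprSr (prednK (qX_gt0 X k)).
have sPb : size (Pa Cm b) = Q.+1 by rewrite size_Pa1 ?oner_neq0.
have e0 : e != 0 by apply: contraTneq isT => e0; have := size_poly0 L; rewrite -(mul0r 'X) -e0 eX sPb.
have se : size e = Q by have := size_mulX e0; rewrite eX sPb => -[].
pose P := Pa Cm (b ^+ m).
have sP : size P = (Q ^ m).+1.
  by rewrite size_Pa1 ?oner_neq0 ?expf_neq0 // size_exp_pred // -expnM mulnC.
have ko : over inF e.
  apply: (over_sum kS) => k _; apply: (overZ kS); last exact: overXn.
  by apply: ca_sub => //=; [exact: inF_theta|exact: sb1|exact: sb0].
have sc : size (e \Po P) = Phi.+1.
  have := size_comp_poly e P; rewrite sP se /= mulnC.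
  by case: (size _) => [|n /= ->] //= E; have := Phi_gt0; rewrite -E.
exists (e \Po P); split.
- rewrite comp_polyE; apply: (over_sum kS) => k _; apply: (overZ kS); first exact: ko.
  by apply: (over_exp kS); exact: Pa_Cm_over.
- by rewrite -size_poly_gt0 sc.
- by [].
move=> l [l1 l2]; rewrite horner_comp horner_Pa.
apply: (mulIf l2); rewrite mul0r -[X in _ * X]hornerX -hornerM eX horner_Pa -actM -exprS //.
Qed.

Section Eis.
Variables (k : L -> Prop) (kS : subr k) (kZ : UnZ w k) (l : L) (pl : primt l).

(** Coefficients in k have integral value and l has value 1/Phi, so terms of different degree below
    Phi have values distinct modulo the integers and cannot cancel. *)
Lemma eis_val g : over k g -> g != 0 -> (size g <= Phi)%N ->
  g.[l] != 0 /\ forall i, vge (w g.[l]) (g`_i * l ^+ i).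
Proof.
move=> kg g0 sg; have [l0 wl] := w_prim pl.
have P0 : (Phi%:R : rat) != 0 by rewrite pnatr_eq0 -lt0n Phi_gt0.
have dist (i j : 'I_(size g)) : i \in index_enum 'I_(size g) -> j \in index_enum 'I_(size g) ->
   g`_i * l ^+ i != 0 -> g`_j * l ^+ j != 0 -> w (g`_i * l ^+ i) = w (g`_j * l ^+ j) -> i = j.
  move=> _ _; rewrite !mulf_eq0 !negb_or => /andP [gi li] /andP [gj lj].
  have [z Ez] := kZ (kg i) gi; have [z' Ez'] := kZ (kg j) gj.
  rewrite !pwM // !wX // Ez Ez' wl => /(congr1 (fun r => r * Phi%:R)).
  rewrite !mulrDl !mulfVK // => E.
  have {}E : z * Phi%:Z + i%:Z = z' * Phi%:Z + j%:Z.
    exact: int_of_rat.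
  have li' : (i < Phi)%N by apply: leq_trans sg; exact: ltn_ord.
  have lj' : (j < Phi)%N by apply: leq_trans sg; exact: ltn_ord.
  apply: val_inj => /=.
  move: (nat_of_ord i) (nat_of_ord j) E li' lj' => i' j'; move: Phi => PP E l1 l2.
  have : (z - z') * PP%:Z = j'%:Z - i'%:Z by lia.
  by case: (z - z') => [[|n]|n]; nia.
have := @w_sum_distinct _ (index_enum 'I_(size g)) (fun i : 'I_(size g) => g`_i * l ^+ i)
   (index_enum_uniq _) dist.
rewrite -horner_coef; case => [Z|[S0 _ H]].
  have := Z (Ordinal (n := size g) (m := (size g).-1) ltac:(by rewrite prednK ?size_poly_gt0)) (mem_index_enum _).
  move=> /= /eqP; rewrite mulf_eq0 expf_eq0 (negbTE l0) andbF orbF -lead_coefE lead_coef_eq0.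
  by rewrite (negbTE g0).
split => // i; have [lt|ge] := ltnP i (size g); last by rewrite nth_default // mul0r vge0.
by have := H (Ordinal lt) (mem_index_enum _).
Qed.

(** By [eis_val] the remainder of g modulo the polynomial of [eis_poly] must be zero. Hence all
    generators of C[b^(m+1)] are conjugate over the unramified k. *)
Lemma eis_root g l' : over k g -> g.[l] = 0 -> primt l' -> g.[l'] = 0.
Proof.
move=> kg gl pl'; have [E [kE E0 sE rE]] := eis_poly.
have kE' : over k E by move=> i; apply: (sbF kS); exact: kE.
have [u [r [ku kr gE sr]]] := over_divmod kS kg kE' E0.
have r0 : r = 0.
  apply: contraTeq isT => r0; have [|nz _] := eis_val kr r0; first by move: sr; rewrite sE ltnS.
  by move: nz; rewrite -[r.[l]]add0r -{1}(mulr0 u.[l]) -{1}(rE _ pl) -hornerM -hornerD -gE gl eqxx.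
by rewrite gE r0 addr0 hornerM rE // mulr0.
Qed.

(** In the expansion of an integral c in powers of l, all terms of positive degree lie in the
    maximal ideal, and so do their images; only the constant term, fixed by f, is seen modulo the
    place. *)
Lemma eis_inertia f a c : fixes k f -> ~~ (b %| a) -> f l = act Cm a l ->
  adj k l c -> vint c -> vint (f c) /\ ml (f c - c).
Proof.
move=> fk ba fl [g kg cE] ic; have [E [kE E0 sE rE]] := eis_poly.
have kE' : over k E by move=> i; apply: (sbF kS); exact: kE.
have [u [r [ku kr gE sr]]] := over_divmod kS kg kE' E0.
rewrite sE ltnS in sr.
have {gE cE} cE : c = r.[l] by rewrite cE gE hornerD hornerM rE // mulr0 add0r.
have [r0|r0] := eqVneq r 0.
  by rewrite cE r0 horner0 rmorph0 subr0; split; [exact: vint0|exact: vgt0].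
have [l0 wl] := w_prim pl; have [l0' wl'] := w_prim (prim_act ba pl).
have [nz H] := eis_val kr r0 sr.
have wc : 0 <= w r.[l] by rewrite cE /vint vgeE // in ic.
have fcE : f c = \sum_(i < size r) r`_i * act Cm a l ^+ i.
  rewrite cE horner_coef rmorph_sum; apply: eq_bigr => i _.
  by rewrite rmorphM rmorphXn fl fk //; exact: kr.
have mlt (i : nat) : (0 < i < size r)%N -> ml (r`_i * l ^+ i) /\ ml (r`_i * act Cm a l ^+ i).
  move=> /andP [i0 ilt]; have [->|ri] := eqVneq r`_i 0; first by rewrite !mul0r /ml !vgt0.
  have li : l ^+ i != 0 by rewrite expf_neq0.
  have li' : act Cm a l ^+ i != 0 by rewrite expf_neq0.
  rewrite /ml !vgtE ?mulf_neq0 // !pwM // !wX // wl wl' -wl; suff: 0 < w r`_i + i%:R * w l by [].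
  have := H i; rewrite vgeE ?mulf_neq0 // pwM // wX // => le.
  have {le} : 0 <= w r`_i + i%:R * w l by apply: le_trans le.
  rewrite le_eqVlt => /orP [/eqP /esym e|//]; exfalso.
  have P0 : (Phi%:R : rat) != 0 by rewrite pnatr_eq0 -lt0n Phi_gt0.
  have [z Ez] := kZ (kr i) ri; move: e; rewrite Ez wl => /(congr1 (fun r => r * Phi%:R)).
  rewrite mulrDl mul0r mulfVK // => E'.
  have {}E' : z * Phi%:Z + i%:Z = 0 * Phi%:Z + 0%:Z by apply: int_of_rat; rewrite E' mul0r addr0.
  have ilt' : (i < Phi)%N by apply: leq_trans sr.
  move: E' ilt'; move: Phi => PP E1 l1; move: i0 {ilt ri li li'} => i0.
  by case: z E1 {Ez} => [n|n]; nia.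
have dE : ml (f c - c).
  rewrite fcE {1}cE horner_coef -sumrB; apply: ml_sum => -[i /= ilt] _.
  have [->|i0] := posnP i; first by rewrite !expr0 subrr /ml vgt0.
  by apply: mlB; case: (mlt i); rewrite ?i0.
by split => //; rewrite -[f c](subrK c); apply: vintD => //; exact: ml_int.
Qed.
End Eis.
End OnePlace.
End Inertia.

(** * Inertia and Frobenius elements *)

Section Lifts.
Variable X : setting.
Local Notation Fq := (sFq X).
Local Notation L := (sL X).
Local Notation iota := (siota X).
Local Notation theta := (stheta X).
Local Notation pc := (spc X).
Local Notation q := (qq X).
Local Notation inF := (inF iota theta).
Local Notation gamma := (gammaA iota theta).
Local Notation hom := {rmorphism L -> L}.
Local Notation Cm := (Cm X).
Implicit Types (D : dmodule L) (a M : {poly Fq}) (f : hom) (x y z : L) (Y Z : seq L).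

Section OnePlace.
Variables (b : {poly Fq}) (ib : irreducible_poly b) (w : place b).
Local Notation vint := (vint w).
Local Notation ml := (ml w).
Local Notation vge := (vge w).
Local Notation vgt := (vgt w).
Local Notation red := (red ib w).
Local Notation d := (size b).-1.
Local Notation Q := (q ^ d)%N.

(** The map fixing F(C[M]) and sending l to C_a(l) acts trivially on residues by [eis_inertia].
    Composing it with a map from [gen_lift], taken with exponent 0 over that field, extends the
    triviality to Z and keeps the action on Carlitz torsion. *)
Lemma inertia m M a Z : ~~ (b %| M) -> ~~ (b %| a) -> closed Z ->
  exists s : hom, [/\ fixF s, forall x, act Cm (b ^+ m) x = 0 -> s x = act Cm a x,
    forall x, act Cm M x = 0 -> s x = x &
    forall z, z \in Z -> vint z -> vint (s z) /\ ml (s z - z)].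
Proof.
move=> bM ba cZ; have [l pl] := prim_ex ib m.
have M0 : M != 0 by apply: contraNneq bM => ->; rewrite dvdp0.
have [T [uT TE] _] := carl_tors M0.
have kS := KS_subr T.
have kZ : UnZ w (KS T) by apply: (un_tors ib w bM) => z; rewrite TE => /eqP.
have [f0 [fk fl]] := extend_hom kS (fun g kg gl => eis_root ib kS kZ pl kg gl (prim_act ib ba pl)).
have fF : fixF f0 by exact: (fixes_subr kS).
have k1S := adj_subr kS l.
have [|h [hk hz]] := @gen_lift _ _ ib w (adj (KS T) l) k1S f0 0 fF _ Z cZ.
  move=> c kc ic; rewrite expn0 expr1; exact: (eis_inertia ib kS kZ pl fk ba fl).
have hF : fixF h by exact: (fixes_subr k1S).
exists (hcomp f0 h); split.
- exact: fixes_hcomp.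
- move=> x xm; have [|a' ->] := @prim_gen _ _ ib m l x pl; first by rewrite exprS actM xm act0r.
  rewrite hcompE (act_Cm _ _ hF) hk; last exact: (adj_z kS).
  by rewrite act_Cm // fl actCA.
- move=> x xM; have xT : KS T x by apply: KS_mem; rewrite TE xM.
  by rewrite hcompE hk ?fk //; exact: (adj_k kS).
- by move=> z zZ iz; rewrite hcompE; have [] := hz z zZ iz; rewrite expn0 expr1.
Qed.

Lemma inF_frob c : inF c -> vint c -> ml (c ^+ Q - c).
Proof.
move=> [a1 [a2 [a20 cE]]] ic.
have g0 : gcdp a1 a2 != 0 by rewrite gcdp_eq0 negb_and a20 orbT.
pose a1' := a1 %/ gcdp a1 a2; pose a2' := a2 %/ gcdp a1 a2.
have cp : coprimep a1' a2' by apply: coprimep_div_gcd; rewrite a20 orbT.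
have E1 : a1 = a1' * gcdp a1 a2 by rewrite divpK ?dvdp_gcdl.
have E2 : a2 = a2' * gcdp a1 a2 by rewrite divpK ?dvdp_gcdr.
have a2'0 : a2' != 0 by apply: contraNneq a20 => h; rewrite E2 h mul0r.
have {}cE : c * gamma a2' = gamma a1'.
  rewrite cE E1 [in gamma a2]E2 !gammaM -mulf_div divff ?gamma_neq0 // mulr1.
  by rewrite mulfVK // gamma_neq0.
have nb : ~~ (b %| a2').
  apply/negP => b2; have : ml (gamma a1') by rewrite -cE mulrC; rewrite mulrC; apply: mlM => //; rewrite ml_gamma.
  rewrite ml_gamma // => b1; have := coprimep_dvdl b2 cp; rewrite coprimep_sym => /(coprimep_dvdl b1).
  rewrite coprimepp => /eqP sb; by case: ib; rewrite sb.
have r2 : red (gamma a2') != 0 by rewrite red_eq0 ?vint_gamma // ml_gamma.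
rewrite -(red_eq ib) ?vintX // redX //; apply/eqP; apply: (mulIf r2).
have := congr1 red cE; rewrite redM ?vint_gamma // => E.
by rewrite E -{1}(res_frob ib w a2') -exprMn E res_frob.
Qed.

Lemma frobenius Z : closed Z -> exists s : hom, fixF s /\
  forall z, z \in Z -> vint z -> vint (s z) /\ ml (s z - z ^+ Q).
Proof.
move=> cZ; have [//||h [hk hz]] := @gen_lift _ _ ib w inF (@subr_inF X) (hid X) d _ _ Z cZ.
  by move=> c kc ic /=; split => //; rewrite -mlN opprB; apply: inF_frob.
by exists h.
Qed.

(** On the maximal ideal the linear term of phi_a dominates strictly. This is the injectivity of
    reduction on a-torsion. *)
Lemma ml_tors0 D a u : intD w D -> ~~ ml (ga D a) -> act D a u = 0 -> ml u -> u = 0.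
Proof.
move=> iD ga0 au mu; apply: contraTeq isT => u0; exfalso.
have gi : vint (ga D a) by have := ca_int ib a 0 iD; rewrite ca0.
have [g0 wg] := unit_w gi ga0.
have le2 : (2 * size a <= (2 * size a).+2)%N by exact: leqW (leqnSn _).
move/eqP: au; rewrite (actE D u le2) big_ord_recl expn0 expr1 ca0 -/(ga D a).
apply/negP; have gu0 : ga D a * u != 0 by rewrite mulf_neq0.
have wu : 0 < w u by move: mu; rewrite /ml vgtE.
apply: (proj1 (@w_dom _ b w _ _ gu0 _)).
apply: vgt_sum => k _; rewrite pwM // wg; apply: (@vgt_lt _ _ w _ (0 + (q ^ k.+1)%:R * w u)); last first.
  by apply: vgeM; [exact: ca_int|apply: vge_exp; exact: vge_w].
rewrite !add0r; have : (1 : rat) < (q ^ k.+1)%:R; last by nra.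
by rewrite (ltr_nat _ 1) -[X in (X < _)%N](exp1n k.+1) ltn_exp2r ?q_gt1.
Qed.

Lemma lead_Pa2 D a : a != 0 -> dg2 D != 0 -> exists e, lead_coef (Pa D a) = iota (lead_coef a) * dg2 D ^+ e.
Proof.
move=> a0 g20; have [e E] := ca_top D a0; exists e; rewrite -E.
rewrite lead_coefE size_Pa2 //= (@Pa_cut _ _ _ (2 * (size a).-1)).
  rewrite coef_sum (bigD1 ord_max) //= coefZ coefXn eqxx mulr1 big1 ?addr0 // => i ni.
  rewrite coefZ coefXn [_ == _]eqn_exp2l ?q_gt1 // eq_sym; move: ni; rewrite -(inj_eq val_inj) /= => /negbTE ->.
  by rewrite mulr0.
move=> k lk; apply: ca_big; move: lk; have := size_poly_gt0 a; rewrite a0.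
by move: (size a) => [|n] //= _; rewrite mulnS; lia.
Qed.

Lemma lead_tors_int D a x : intD w D -> vint (lead_coef (Pa D a))^-1 -> Pa D a != 0 -> act D a x = 0 -> vint x.
Proof.
move=> iD il P0 ax; apply: (@root_vint _ _ w ((lead_coef (Pa D a))^-1 *: Pa D a)).
- by rewrite monicE lead_coefZ mulVf // lead_coef_eq0.
- by move=> i; rewrite coefZ; apply: vintM => //; exact: intp_Pa.
- by rewrite hornerZ horner_Pa ax mulr0.
Qed.

Lemma vintV x : vint x -> ~~ ml x -> vint x^-1.
Proof. by move=> ix nx; have [x0 wx] := unit_w ix nx; rewrite /vint vgeE ?invr_eq0 // wV // wx oppr0. Qed.

Lemma tors_int D a x : intD w D -> ~~ ml (dg2 D) -> a != 0 -> act D a x = 0 -> vint x.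
Proof.
move=> iD n2 a0; have [_ _ i2] := iD; have [g20 _] := unit_w i2 n2.
have [e E] := lead_Pa2 a0 g20.
apply: lead_tors_int => //; last by rewrite -size_poly_gt0 size_Pa2.
rewrite E invfM; apply: vintM; first by rewrite -fmorphV vint_iota.
by rewrite -exprVn; apply: vintX; apply: vintV.
Qed.

Lemma carl_int a x : a != 0 -> act Cm a x = 0 -> vint x.
Proof.
move=> a0; apply: lead_tors_int; first exact: intD_Cm.
  by rewrite lead_PaCm // -fmorphV vint_iota.
by rewrite -lead_coef_eq0 lead_PaCm // iota_inj0 lead_coef_eq0.
Qed.

(** Both sides are congruent to x^Q, and reduction is injective on M-torsion. Since C_b reduces to
    its leading coefficient times tau^d, b has to be monic. *)
Lemma frob_carl s Z M x : fixF s -> (forall z, z \in Z -> vint z -> vint (s z) /\ ml (s z - z ^+ Q)) ->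
  b \is monic -> ~~ (b %| M) -> act Cm M x = 0 -> x \in Z -> s x = act Cm b x.
Proof.
move=> fF H mb bM xM xZ; have M0 : M != 0 by apply: contraNneq bM => ->; rewrite dvdp0.
have ix := carl_int M0 xM; have [is_ ms] := H x xZ ix.
apply/eqP; rewrite -subr_eq0; apply/eqP; apply: (@ml_tors0 Cm M) => //.
- exact: intD_Cm.
- by rewrite ga_theta // ml_gamma.
- by rewrite actBr -act_Cm // xM rmorph0 actCA xM act0r subrr.
have -> : s x - act Cm b x = (s x - x ^+ Q) - (act Cm b x - x ^+ Q) by ring.
apply: mlB => //; rewrite act_Cm_b // (monicP mb) rmorph1 mul1r addrK.
apply: mlD; first by rewrite mulrC; apply: mlM => //; rewrite ml_gamma.
rewrite big_nat_cond; apply: ml_sum => k; rewrite andbT => /andP [_ kd]; rewrite mulrC.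
apply: mlM; first exact: vintX.
by apply: (@vgt_lt _ _ w _ 1) => //; apply: (ca_small ib _ (intD_Cm ib w)).
Qed.

Lemma hom_carl s m : fixF s -> exists a, ~~ (b %| a) /\ forall y, act Cm (b ^+ m) y = 0 -> s y = act Cm a y.
Proof.
move=> fF; have [l pl] := prim_ex ib m; have [l1 l2] := pl.
have [|a aE] := @prim_gen _ _ ib m l (s l) pl; first by rewrite -act_Cm // l1 rmorph0.
exists a; split.
  apply: contra l2 => /dvdpP [c cE]; have : s (act Cm (b ^+ m) l) = 0.
    by rewrite act_Cm // aE cE -actM mulrCA -exprSr actM l1 act0r.
  by move/eqP; rewrite fmorph_eq0.
move=> y ym; have [|a' ->] := @prim_gen _ _ ib m l y pl; first by rewrite exprS actM ym act0r.
by rewrite act_Cm // aE actCA.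
Qed.
End OnePlace.

Lemma irr_factor M : (1 < size M)%N -> exists2 b, irreducible_poly b & b %| M.
Proof.
have [n] := ubnP (size M); elim: n M => // n IH M le sM.
case: (pselect (irreducible_poly M)) => [iM|nM]; first by exists M.
have /existsNP [c /not_implyP [sc /not_implyP [dc nc]]] : ~ forall c : {poly Fq}, size c != 1%N -> c %| M -> c %= M.
  by move=> H; apply: nM; split.
have M0 : M != 0 by rewrite -size_poly_gt0 ltnW.
have c0 : c != 0 by apply: contraTneq dc => ->; rewrite dvd0p.
have sc1 : (1 < size c)%N by move: sc; have := c0; rewrite -size_poly_gt0; case: (size c) => [|[]].
have lt : (size c < size M)%N.
  rewrite ltn_neqAle dvdp_leq // andbT; apply: contra_notN nc => /eqP E.
  by rewrite -dvdp_size_eqp // E.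
have [b ib bc] := IH c (leq_trans lt le) sc1.
by exists b => //; apply: dvdp_trans dc.
Qed.

Lemma vpart (b N : {poly Fq}) : irreducible_poly b -> N != 0 -> exists m N', N = b ^+ m * N' /\ ~~ (b %| N').
Proof.
move=> ib; have [n] := ubnP (size N); elim: n N => // n IH N sN N0.
have [bN|nN] := boolP (b %| N); last by exists 0%N, N; rewrite expr0 mul1r.
have /dvdpP [N1 E1] := bN; have N10 : N1 != 0 by apply: contraNneq N0 => h; rewrite E1 h mul0r.
have [|m [N' [E' nb]]] := IH N1 _ N10.
  rewrite E1 size_mul ?(irr_neq0 ib) // in sN.
  by move: sN; rewrite (Sd ib); have := d_gt0 ib; move: (size b).-1 (size N1) => *; lia.
by exists m.+1, N'; split => //; rewrite E1 E' exprS; ring.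
Qed.

Lemma factor_split M : (1 < size M)%N -> exists b m M', [/\ irreducible_poly b, M = b ^+ m.+1 * M',
  ~~ (b %| M') & (size M' < size M)%N].
Proof.
move=> sM; have [b ib bM] := irr_factor sM; exists b.
have M0 : M != 0 by rewrite -size_poly_gt0 ltnW.
have [m [M' [E nb]]] := vpart ib M0.
case: m E => [|m] E; first by rewrite E expr0 mul1r (negbTE nb) in bM.
exists m, M'; split => //.
have M'0 : M' != 0 by apply: contraNneq nb => ->; rewrite dvdp0.
rewrite E size_mul ?expf_neq0 ?(irr_neq0 ib) // size_vk ?(irr_neq0 ib) // mulSn.
have := d_gt0 ib; move: (size b).-1 (size M') (m * _)%N => *; lia.
Qed.

Lemma tors_ind D (P : L -> Prop) : P 0 -> (forall x y, P x -> P y -> P (x + y)) ->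
  (forall b m x, irreducible_poly b -> act D (b ^+ m) x = 0 -> P x) ->
  forall M x, M != 0 -> act D M x = 0 -> P x.
Proof.
move=> P0 PD Pb M; have [n] := ubnP (size M); elim: n M => // n IH M le x M0 xM.
case: (leqP (size M) 1) => sM.
  have E := size1_polyC sM; have c0 : M`_0 != 0 by rewrite -polyC_eq0 -E.
  move: xM; rewrite E actC => /eqP; rewrite mulf_eq0 iota_inj0 (negbTE c0) /= => /eqP ->.
  exact: P0.
have [b [m [M' [ib E nb lt]]]] := factor_split sM.
have cp : coprimep (b ^+ m.+1) M' by apply: coprimep_expl; apply: irr_coprime.
have [u [v uv]] := bezout1 cp.
have M'0 : M' != 0 by apply: contraNneq nb => ->; rewrite dvdp0.
rewrite -[x](act1 D) -uv actDl; apply: PD.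
  apply: (IH M') => //; first exact: leq_trans lt le.
  by rewrite actM actCA -(actM D M') mulrC -E xM act0r.
by apply: (Pb b m.+1) => //; rewrite actM actCA -(actM D (b ^+ _)) -E xM act0r.
Qed.

(** On each C[b^m] both maps are multiplication by elements of A. *)
Lemma carl_comm f f' M x : fixF f -> fixF f' -> M != 0 -> act Cm M x = 0 -> f (f' x) = f' (f x).
Proof.
move=> fF fF' M0 xM; apply: (tors_ind (P := fun x => f (f' x) = f' (f x)) _ _ _ M0 xM).
- by rewrite !rmorph0.
- by move=> y z Ey Ez; rewrite !rmorphD Ey Ez.
move=> b m y ib yb; have [a [_ aE]] := hom_carl ib m fF; have [a' [_ aE']] := hom_carl ib m fF'.
by rewrite (aE' y yb) (aE y yb) (act_Cm a' y fF) (act_Cm a y fF') (aE y yb) (aE' y yb) actCA.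
Qed.

(* [Kt Y] stands for [F(Y, C_tor)], possibly enlarged by a purely inseparable extension:
   only the Galois-theoretic description of its elements is needed. *)
Definition KM Y M x := forall f (f' : hom), fixF f -> fixF f' ->
  (forall y, y \in Y -> f y = f' y) -> (forall z, act Cm M z = 0 -> f z = f' z) -> f x = f' x.
Definition Kt Y x := exists2 M, M != 0 & KM Y M x.

Lemma Kt2 Y x y : Kt Y x -> Kt Y y -> exists2 M, M != 0 & forall f (f' : hom), fixF f -> fixF f' ->
  (forall y, y \in Y -> f y = f' y) -> (forall z, act Cm M z = 0 -> f z = f' z) ->
  f x = f' x /\ f y = f' y.
Proof.
move=> [M1 n1 H1] [M2 n2 H2]; exists (M1 * M2); first by rewrite mulf_neq0.
move=> f f' fF fF' hY hM; split; [apply: H1|apply: H2] => // z zM; apply: hM.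
  by rewrite mulrC actM zM act0r.
by rewrite actM zM act0r.
Qed.

Lemma Kt_inF Y x : inF x -> Kt Y x.
Proof. by move=> Fx; exists 1; rewrite ?oner_neq0 // => f f' fF fF' _ _; rewrite fF // fF'. Qed.

Lemma Kt_mem Y x : x \in Y -> Kt Y x.
Proof. by move=> xY; exists 1; rewrite ?oner_neq0 // => f f' fF fF' h _; apply: h. Qed.

Lemma Kt_carl Y M x : M != 0 -> act Cm M x = 0 -> Kt Y x.
Proof. by move=> M0 xM; exists M => // f f' fF fF' _ h; apply: h. Qed.

Lemma KtB Y x y : Kt Y x -> Kt Y y -> Kt Y (x - y).
Proof.
move=> Kx Ky; have [M M0 H] := Kt2 Kx Ky; exists M => // f f' fF fF' h1 h2.
by have [E1 E2] := H f f' fF fF' h1 h2; rewrite !rmorphB E1 E2.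
Qed.

Lemma KtM Y x y : Kt Y x -> Kt Y y -> Kt Y (x * y).
Proof.
move=> Kx Ky; have [M M0 H] := Kt2 Kx Ky; exists M => // f f' fF fF' h1 h2.
by have [E1 E2] := H f f' fF fF' h1 h2; rewrite !rmorphM E1 E2.
Qed.

Lemma Kt_subr Y : subr (Kt Y).
Proof.
split; [apply: Kt_inF|exact: KtB|exact: KtM|exact: Kt_inF].
exact: (sb1 (subr_inF X)).
Qed.

Definition fixY Y f := fixF f /\ forall y, y \in Y -> f y = y.

Lemma fixY_comp Y f (f' : hom) : fixY Y f -> fixY Y f' -> fixY Y (hcomp f f').
Proof.
move=> [F1 y1] [F2 y2]; split; first exact: fixes_hcomp.
by move=> y yY; rewrite hcompE y2 // y1.
Qed.

Lemma fixY_hit Y f n : fixY Y f -> fixY Y (hit n f).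
Proof.
by move=> fY; elim: n => [|n IH] /=; [split => //|exact: fixY_comp].
Qed.

Lemma KM_fixY Y M f x : fixY Y f -> KM Y M x -> KM Y M (f x).
Proof.
move=> [fF fY] H g g' gF gF' h1 h2.
have := H (hcomp g f) (hcomp g' f); rewrite !hcompE; apply.
- exact: fixes_hcomp.
- exact: fixes_hcomp.
- by move=> y yY; rewrite !hcompE fY // h1.
by move=> z zM; rewrite !hcompE h2 // -act_Cm // zM rmorph0.
Qed.

Lemma Kt_fixY Y f x : fixY Y f -> Kt Y x -> Kt Y (f x).
Proof. by move=> fY [M M0 H]; exists M => //; apply: KM_fixY. Qed.

(** The two composites agree on Y and, by [carl_comm], on Carlitz torsion, and these data determine
    the image of x. *)
Lemma Kt_comm Y f (f' : hom) x : fixY Y f -> fixY Y f' -> Kt Y x -> f (f' x) = f' (f x).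
Proof.
move=> [fF fY] [fF' fY'] [M M0 H]; have := H (hcomp f f') (hcomp f' f); rewrite !hcompE; apply.
- exact: fixes_hcomp.
- exact: fixes_hcomp.
- by move=> y yY; rewrite !hcompE fY' // !fY // fY'.
by move=> z zM; rewrite !hcompE; exact: (carl_comm _ _ M0 zM).
Qed.
End Lifts.

(** * Local structure of torsion *)

Section Local.
Variable X : setting.
Local Notation Fq := (sFq X).
Local Notation L := (sL X).
Local Notation iota := (siota X).
Local Notation theta := (stheta X).
Local Notation pc := (spc X).
Local Notation q := (qq X).
Local Notation inF := (inF iota theta).
Local Notation gamma := (gammaA iota theta).
Local Notation hom := {rmorphism L -> L}.
Local Notation Cm := (Cm X).
Implicit Types (D : dmodule L) (a M v : {poly Fq}) (f : hom) (x y z : L) (Y Z : seq L).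

(** The isomorphic module k^-1 phi k, used to reach semistable models. *)
Definition twist k D := Dmod (dth D) (dg1 D * k ^+ (q.-1)) (dg2 D * k ^+ ((q ^ 2).-1)).

Lemma dt_twist k D x : k * dt (twist k D) x = dt D (k * x).
Proof.
have E1 : k ^+ q = k * k ^+ q.-1 by rewrite -exprS prednK // q_gt0.
have E2 : k ^+ (q ^ 2) = k * k ^+ (q ^ 2).-1 by rewrite -exprS prednK // qX_gt0.
rewrite !dtE /= !exprMn E1 E2; ring.
Qed.

Lemma act_twist k D a x : k * act (twist k D) a x = act D a (k * x).
Proof.
rewrite /act /phi_act mulr_sumr; apply: eq_bigr => i _; rewrite mulrCA; congr (_ * _).
by elim: (nat_of_ord i) => //= n IH; rewrite dt_twist IH.
Qed.

Lemma ca_twist k D a i : k != 0 -> k * ca (twist k D) a i = ca D a i * k ^+ (q ^ i).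
Proof.
move=> k0; have kc j : forall l, k * cf (twist k D) j l = cf D j l * k ^+ (q ^ l).
  elim: j => [|j IH] l /=.
    by case: l => [|l] /=; rewrite ?mulr0 ?mul0r // expr1 mulr1 mul1r.
  rewrite !mulrDr !mulrDl; congr (_ + _ + _).
  - by rewrite mulrCA IH mulrA.
  - case: l => [|l] /=; first by rewrite expr0n eqn0Ngt q_gt0 !mulr0 !mul0r.
    have := IH l => /(congr1 (fun z => z ^+ q)); rewrite !exprMn -exprM -expnSr => E.
    rewrite -[RHS]mulrA -E -[in k ^+ q](prednK (q_gt0 X)) [in k ^+ _.+1]exprS; ring.
  - case: l => [|[|l]] /=; try by rewrite expr0q !mulr0 !mul0r.
    have := IH l => /(congr1 (fun z => z ^+ (q ^ 2))); rewrite !exprMn -exprM -expnD addn2 => E.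
    rewrite -[RHS]mulrA -E -[in k ^+ (q ^ 2)](prednK (qX_gt0 X 2)) [in k ^+ _.+1]exprS; ring.
rewrite /ca mulr_sumr mulr_suml; apply: eq_bigr => j _.
by rewrite mulrCA kc mulrA.
Qed.

Lemma Pa_prod D a (s : seq L) : a != 0 -> dg2 D != 0 -> ga D a != 0 -> tlist D a s ->
  size s = (q ^ (2 * (size a).-1))%N /\ Pa D a = lead_coef (Pa D a) *: \prod_(x <- s) ('X - x%:P).
Proof.
move=> a0 g20 ga0 [us sE].
have [|s' [us' ss' sE']] := tors_ex a0 ga0; first by rewrite g20.
have ss : size s = (q ^ (2 * (size a).-1))%N.
  rewrite -[2%N]/(if false then 1%N else 2%N) -(negbTE g20) -/(rk D) -ss'; apply/eqP.
  by rewrite -(uniq_size_uniq us') // => x; rewrite sE sE'.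
split => //; apply: all_roots_prod_XsubC.
- by rewrite size_Pa2 // ss.
- by apply/allP => x; rewrite sE rootE horner_Pa.
- by rewrite uniq_rootsE.
Qed.

Section OnePlace.
Variables (b : {poly Fq}) (ib : irreducible_poly b) (w : place b).
Local Notation vint := (vint w).
Local Notation ml := (ml w).
Local Notation vge := (vge w).
Local Notation vgt := (vgt w).
Local Notation red := (red ib w).
Local Notation redp := (redp ib w).
Local Notation d := (size b).-1.
Local Notation Q := (q ^ d)%N.

Definition inert Z f := forall z, z \in Z -> vint z -> vint (f z) /\ ml (f z - z).

Lemma inert_hit Z f n : closed Z -> fixF f -> inert Z f -> inert Z (hit n f).
Proof.
move=> cZ fF H; elim: n => [|n IH] z zZ iz /=; first by rewrite subrr /ml vgt0.
have [i1 m1] := IH z zZ iz.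
have zZ' : hit n f z \in Z by apply: cZ => //; apply: fixes_hit.
have [i2 m2] := H _ zZ' i1; split => //.
by rewrite -[f _](subrK (hit n f z)) -addrA; apply: mlD.
Qed.

(* A product of powers of [x] and of the uniformizer on which [w] vanishes. *)
Definition uw x := x ^+ `|denq (w x)| * gamma b ^ (- numq (w x)).

(** Inertia keeps [uw x] a unit and fixes gamma(b), which forces the value of f x. *)
Lemma inert_w Z f x : fixF f -> inert Z f -> uw x \in Z -> x != 0 -> w (f x) = w x.
Proof.
move=> fF H uZ x0; have g0 := gb0 ib.
have dn0 : `|denq (w x)|%N%:R = (denq (w x))%:~R :> rat.
  by rewrite -[in RHS](gez0_abs (ltW (denq_gt0 (w x)))).
have wg (n : int) : w (gamma b ^ n) = n%:~R.
  by case: n => n; rewrite ?NegzE -?exprnP -?invr_expz -?exprnP ?wV ?expf_neq0 // wX // pwb mulr1 // mulrNz.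
have wu y : y != 0 -> w (y ^+ `|denq (w x)| * gamma b ^ (- numq (w x))) = (denq (w x))%:~R * w y - (numq (w x))%:~R.
  by move=> y0; rewrite pwM ?expf_neq0 ?expfz_neq0 // wX // wg dn0 mulrNz.
have dq0 : (denq (w x))%:~R != 0 :> rat by rewrite intr_eq0 denq_eq0.
have E0 : (denq (w x))%:~R * w x = (numq (w x))%:~R by rewrite -{2}(divq_num_den (w x)) mulrC mulfVK.
have u0 y : y != 0 -> y ^+ `|denq (w x)| * gamma b ^ (- numq (w x)) != 0.
  by move=> y0; rewrite mulf_neq0 ?expf_neq0 ?expfz_neq0.
have iu : vint (uw x) by rewrite /vint vgeE ?u0 // wu // E0 subrr.
have [i1 m1] := H _ uZ iu.
have fE : f (uw x) = f x ^+ `|denq (w x)| * gamma b ^ (- numq (w x)).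
  by rewrite rmorphM rmorphXn rmorphXz ?unitfE // fix_gamma.
have fx0 : f x != 0 by rewrite fmorph_eq0.
have : w (f (uw x)) = 0.
  have [|_ ->] // := unit_w (w := w) i1; apply/negP => mf.
  have : ml (uw x) by rewrite -[uw x](subKr (f (uw x))); apply: mlB.
  by rewrite /ml vgtE ?u0 // wu // E0 subrr ltxx.
rewrite fE wu // => /eqP; rewrite subr_eq0 -E0 => /eqP; exact: mulfI.
Qed.

Lemma inert_id D a Z f x : intD w D -> ~~ ml (ga D a) -> inert Z f -> x \in Z -> vint x ->
  f (act D a x) = act D a (f x) -> act D a x = 0 -> f x = x.
Proof.
move=> iD ga0 H xZ ix fE ax; have [_ m] := H x xZ ix.
apply/eqP; rewrite -subr_eq0; apply/eqP; apply: (ml_tors0 ib iD ga0) => //.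
by rewrite actBr -fE ax rmorph0 subr0.
Qed.

(** A nonintegral root contributes a constant times 1 - X/x, which reduces to 1; the degree of the
    reduction thus counts the integral roots. *)
Lemma red_factor (s : seq L) : exists C (G : {poly L}), [/\ C != 0, intp w G,
  \prod_(x <- s) ('X - x%:P) = C *: G & redp G = \prod_(x <- s | vint x) ('X - (red x)%:P)].
Proof.
have rX y : vint y -> redp ('X - y%:P) = 'X - (red y)%:P.
  move=> iy; apply/polyP => i; rewrite coef_redp !coefB coefX !coefC.
  by case: i => [|[|i]] /=; rewrite ?subr0 ?sub0r ?red0 ?red1 // redN.
elim: s => [|x s [C [G [C0 iG E rG]]]].
  by exists 1, 1; rewrite !big_nil scale1r redp1 oner_neq0; split => //; apply: intp1.
rewrite !big_cons E; case: ifP => ix.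
  have iX : intp w ('X - x%:P).
    by move=> i; rewrite coefB coefX coefC; apply: vintB; case: eqP => // _; exact: vint1 || exact: vint0.
  exists C, (('X - x%:P) * G); split => //; [exact: intpM|by rewrite scalerAr|].
  by rewrite redpM // rX // rG.
have x0 : x != 0 by apply: contraFneq ix => ->; exact: vint0.
have mx : ml x^-1 by apply: vintNV; rewrite ix.
pose H : {poly L} := 1 - x^-1 *: 'X.
have iH : intp w H.
  move=> i; rewrite coefB coefZ coef1 coefX; apply: vintB; first by case: eqP => _; [exact: vint1|exact: vint0].
  by case: eqP => _; rewrite ?mulr1 ?mulr0; [exact: ml_int|exact: vint0].
have rH : redp H = 1.
  apply/polyP => i; rewrite coef_redp coefB coefZ coef1 coefX.
  case: i => [|[|i]] /=; rewrite ?mulr0 ?mulr1 ?subr0 ?sub0r ?red1 ?red0 //.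
  by apply/eqP; rewrite red_eq0 ?vintN ?mlN // ml_int.
exists (- x * C), (H * G); split.
- by rewrite mulf_neq0 // oppr_eq0.
- exact: intpM.
- have HX : - x *: H = 'X - x%:P.
    by rewrite /H scalerBr scalerA mulNr divff // scaleN1r opprK scaleNr alg_polyC addrC.
  by rewrite -scalerAr -HX -scalerAl scalerA [C * _]mulrC.
- by rewrite redpM // rH mul1r rG.
Qed.
End OnePlace.
End Local.

(** * Torsion under reduction, and isotropic submodules *)

Section Reduction.
Variable X : setting.
Local Notation Fq := (sFq X).
Local Notation L := (sL X).
Local Notation iota := (siota X).
Local Notation theta := (stheta X).
Local Notation pc := (spc X).
Local Notation q := (qq X).
Local Notation inF := (inF iota theta).
Local Notation gamma := (gammaA iota theta).
Local Notation hom := {rmorphism L -> L}.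
Local Notation Cm := (Cm X).
Implicit Types (D : dmodule L) (a M v : {poly Fq}) (f : hom) (x y z c : L) (Y Z : seq L).

Lemma fixed_iota y : y ^+ q = y -> exists c : Fq, y = iota c.
Proof.
move=> yq; have := finField_genPoly Fq => /(congr1 (map_poly iota)).
rewrite rmorphB /= map_polyXn map_polyX rmorph_prod /= => /(congr1 (fun p => p.[y])).
rewrite !hornerE -/(qq X) yq subrr horner_prod => /esym/eqP.
move=> /prodf_eq0 [c _]; rewrite rmorphB /= map_polyX map_polyC /= !hornerE subr_eq0 => /eqP ->.
by exists c.
Qed.

Lemma seq_argmax (s : seq L) (g : L -> rat) : s != [::] -> exists2 x, x \in s & forall y, y \in s -> g y <= g x.
Proof.
elim: s => // x s IH _; have [->|s0] := eqVneq s [::].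
  by exists x; rewrite ?inE // => y; rewrite inE => /eqP ->.
have [x' xs H] := IH s0; case: (leP (g x') (g x)) => le.
  exists x; rewrite ?inE ?eqxx // => y; rewrite inE => /orP [/eqP -> //|/H h].
  exact: le_trans le.
exists x'; rewrite ?inE ?xs ?orbT // => y; rewrite inE => /orP [/eqP ->|/H //].
exact: ltW.
Qed.

Section Isotropy.
Variables (D : dmodule L) (v : {poly Fq}) (iv : irreducible_poly v).

Lemma ex_order k x : x != 0 -> act D (v ^+ k) x = 0 ->
  exists j, [/\ (j < k)%N, act D (v ^+ j.+1) x = 0 & act D (v ^+ j) x != 0].
Proof.
move=> x0; elim: k => [|k IH]; first by rewrite expr0 act1 => E; rewrite E eqxx in x0.
have [/IH [j [lj H1 H2]] _|nz E] := eqVneq (act D (v ^+ k) x) 0.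
  by exists j; split => //; apply: ltnW.
by exists k.
Qed.

Variable U : L -> Prop.
Hypotheses (UB : forall x y, U x -> U y -> U (x - y)) (UA : forall a x, U x -> U (act D a x)).
Hypothesis U1 : forall x y, U x -> U y -> act D v x = 0 -> act D v y = 0 -> x != 0 -> exists a, y = act D a x.

(** Cyclicity lifts from level v: phi_v(y) is a multiple by induction, and y differs from the
    corresponding multiple of x by v-torsion of [U]. *)
Lemma U_cyclic j x : U x -> act D (v ^+ j.+1) x = 0 -> act D (v ^+ j) x != 0 ->
  forall m y, (m <= j.+1)%N -> U y -> act D (v ^+ m) y = 0 -> exists a, y = act D (a * v ^+ (j.+1 - m)) x.
Proof.
move=> Ux x1 x0; elim=> [|m IH] y le Uy ym.
  by exists 0; rewrite mul0r act0l; move: ym; rewrite expr0 act1.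
have [|||a aE] := IH (act D v y).
- exact: ltnW.
- exact: UA.
- by rewrite -actM -exprSr.
have sE : (j.+1 - m = (j.+1 - m.+1).+1)%N by rewrite subSS subSn.
rewrite sE exprSr mulrA [_ * v]mulrC actM in aE.
have [|||||a' aE'] := @U1 (act D (v ^+ j) x) (y - act D (a * v ^+ (j.+1 - m.+1)) x).
- exact: UA.
- by apply: UB => //; apply: UA.
- by rewrite -actM -exprS.
- by rewrite actBr aE subrr.
- exact: x0.
exists (a + a' * v ^+ m).
rewrite subSS in aE' *; rewrite mulrDl actDl -[a' * _ * _]mulrA -exprD subnKC // (actM D a') -aE'.
by rewrite addrC subrK.
Qed.

(** One of the two points is a multiple of the other, and the pairing is alternating. *)
Lemma U_iso k : forall x y, U x -> U y -> act D (v ^+ k) x = 0 -> act D (v ^+ k) y = 0 ->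
  weil D (v ^+ k) x y = 0.
Proof.
move=> x y Ux Uy xk yk; have [->|x0] := eqVneq x 0; first by rewrite weil0l.
have [->|y0] := eqVneq y 0; first by rewrite weil0r.
have [i [li xi xi0]] := ex_order x0 xk; have [j [lj yj yj0]] := ex_order y0 yk.
case: (leqP j i) => ij.
  by have [a ->] := U_cyclic Ux xi xi0 (m := j.+1) ij Uy yj; apply: weil_self.
have [a ->] := U_cyclic Uy yj yj0 (m := i.+1) (ltnW ij) Ux xi.
by rewrite weilC weil_self ?oppr0.
Qed.

(** For y in [U] and any x, W(x, f y) = W(f x, f y), as f x - x lies in the isotropic [U]; and W(f
    x, f y) = f W(x, y) = W(x, a y). Nondegeneracy then gives f y = a y. *)
Lemma U_char k c a f : dg2 D != 0 -> ga D v != 0 -> c != 0 -> dg2 D * c ^+ q = - c -> dth D = theta ->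
  fixF f -> f (dg1 D) = dg1 D -> f (dg2 D) = dg2 D -> f c = c ->
  (forall z, act Cm (v ^+ k) z = 0 -> f z = act Cm a z) ->
  (forall x, act D (v ^+ k) x = 0 -> U (f x - x)) ->
  forall y, U y -> act D (v ^+ k) y = 0 -> f y = act D a y.
Proof.
move=> g20 gv c0 cE Et fF f1 f2 fc fC fU y Uy yk.
have f0 : f (dth D) = dth D by rewrite Et fix_theta.
have fA e x : f (act D e x) = act D e (f x) by apply: act_fix.
case: k fC fU yk => [|k] fC fU yk.
  by move: yk; rewrite expr0 act1 => ->; rewrite rmorph0 act0r.
have CE : CD D = Cm by rewrite /CD Et.
have fk x : act D (v ^+ k.+1) x = 0 -> act D (v ^+ k.+1) (f x) = 0 by move=> xk; rewrite -fA xk rmorph0.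
have Ufy : U (f y).
  have U0 : U 0 by rewrite -(subrr y); apply: UB.
  have -> : f y = (f y - y) - (0 - y) by ring.
  by apply: (UB) (fU y yk) _; apply: UB.
apply/eqP; rewrite -subr_eq0; apply/eqP; apply: contrapT => /eqP nz.
have [||x xk] := @weil_nondeg _ D (v ^+ k.+1) _ (size_vk_gt1 k iv) g20 _ _ nz.
- by rewrite gaX expf_neq0.
- by rewrite actBr fk // sub0r actCA yk act0r oppr0.
apply/negP; rewrite negbK weilDr weilNr.
have E1 : weil D (v ^+ k.+1) x (f y) = f (weil D (v ^+ k.+1) x y).
  have fi e : f (iota e) = iota e by apply: fix_iota.
  rewrite (weil_hom _ _ _ fi) // -[f x](subrK x) weilDl.
  rewrite (U_iso (k := k.+1) (fU x xk) Ufy) ?add0r ?fk //.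
  by rewrite actBr fk // xk subrr.
have E2 : f (weil D (v ^+ k.+1) x y / c) = weil D (v ^+ k.+1) x (act D a y) / c.
  rewrite fC; first by rewrite -CE (weil_carl a c0 cE xk yk) weil_act.
  by rewrite -CE (weil_carl _ c0 cE xk yk) xk weil0l mul0r.
rewrite E1 subr_eq0; apply/eqP; apply: (mulIf (x := c^-1)); first by rewrite invr_eq0.
by rewrite -E2 fmorph_div fc.
Qed.
End Isotropy.

Section OnePlace.
Variables (b : {poly Fq}) (ib : irreducible_poly b) (w : place b).
Local Notation vint := (vint w).
Local Notation ml := (ml w).
Local Notation vge := (vge w).
Local Notation vgt := (vgt w).
Local Notation red := (red ib w).
Local Notation redp := (redp ib w).
Local Notation redd := (redd ib w).
Local Notation d := (size b).-1.
Local Notation Q := (q ^ d)%N.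

Lemma redp_Pa D a : intD w D -> redp (Pa D a) = Pa (redd D) a.
Proof.
move=> iD; apply/polyP => i; rewrite coef_redp !coef_sum red_sum.
  by apply: eq_bigr => k _; rewrite !coefZ coefXn redM ?ca_int // ?red_ca //; case: eqP; rewrite ?red1 ?red0 ?vint1 ?vint0.
by move=> k; rewrite coefZ coefXn; apply: vintM; [exact: ca_int|case: eqP; rewrite ?vint1 ?vint0].
Qed.

Lemma count_int D a (s : seq L) : a != 0 -> dg2 D != 0 -> ga D a != 0 -> tlist D a s -> intD w D ->
  redp (Pa D a) != 0 -> exists2 r, r != 0 & redp (Pa D a) = r *: \prod_(x <- s | vint x) ('X - (red x)%:P).
Proof.
move=> a0 g20 ga0 sE iD r0; have [_ E] := Pa_prod a0 g20 ga0 sE.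
have [C [G [C0 iG EG rG]]] := red_factor ib w s.
have ip := intp_Pa ib a iD.
set P := \prod_(x <- s | vint x) _ in rG *.
have mP : P \is monic by apply: monic_prod => x _; exact: monicXsubC.
rewrite EG scalerA in E; move: (_ * C) E => C' E.
have c1 : G`_(size P).-1 != 0 /\ w G`_(size P).-1 = 0.
  apply: unit_w; first exact: iG.
  by rewrite -(red_eq0 ib) // -coef_redp rG -lead_coefE (monicP mP) oner_neq0.
have C'0 : C' != 0.
  by apply: contraNneq r0 => h; rewrite E h scale0r; apply/eqP; apply: redp_eq0 => i; rewrite coef0 /ml vgt0.
have iC : vint C'.
  have := ip (size P).-1; rewrite E coefZ /vint !vgeE ?mulf_neq0 ?c1.1 //.
  by rewrite pwM ?c1.1 // c1.2 addr0.
have rE : redp (Pa D a) = red C' *: P.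
  by apply/polyP => i; rewrite coef_redp [RHS]coefZ E coefZ redM ?iG // -coef_redp rG.
exists (red C') => //; apply: contraNneq r0 => h; by rewrite rE h scale0r.
Qed.

Lemma prod_X_size (P : pred L) (s : seq L) : size (\prod_(x <- s | P x) ('X - (red x)%:P)) = (count P s).+1.
Proof.
rewrite -big_filter -size_filter size_prod_seq; last by move=> x _; rewrite polyXsubC_eq0.
rewrite (eq_bigr (fun=> 2%N)) => [|x _]; last exact: size_XsubC.
by rewrite big_const_seq count_predT iter_addn_0 mul2n -addnn subSn ?leq_addr // addnK.
Qed.

(** The torsion points in the maximal ideal make up the multiplicity of the root 0 of the
    reduction. *)
Lemma count_ml D a (s : seq L) j : a != 0 -> dg2 D != 0 -> ga D a != 0 -> tlist D a s -> intD w D ->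
  (redp (Pa D a))`_j != 0 -> (count ml s <= j)%N.
Proof.
move=> a0 g20 ga0 sE iD rj; have rP0 : redp (Pa D a) != 0 by apply: contraNneq rj => ->; rewrite coef0.
have [r r0 E] := count_int a0 g20 ga0 sE iD rP0.
rewrite leqNgt; apply: contra rj => lt; rewrite E (bigID ml) /=.
rewrite (eq_bigr (fun=> 'X)); last first.
  move=> x /andP [ix mx]; have /eqP -> : red x == 0 by rewrite red_eq0.
  by rewrite polyC0 subr0.
rewrite big_const_seq iter_mulr_1 (eq_count (a2 := ml)); last first.
  by move=> x /=; case: (boolP (ml x)) => [/ml_int ->|]; rewrite ?andbT ?andbF.
by rewrite coefZ coefXnM lt mulr0.
Qed.

(** A unit coefficient of tau^d leaves at most Q points of b-torsion in the maximal ideal, which is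
    the number of multiples of x. *)
Lemma ml_cyclic D : dg2 D != 0 -> dth D = theta -> intD w D -> ~~ ml (ca D b d) ->
  forall x y, ml x -> ml y -> act D b x = 0 -> act D b y = 0 -> x != 0 -> exists a, y = act D a x.
Proof.
move=> g20 Et iD nc x y mx my bx by_ x0.
have b0 := irr_neq0 ib; have gb : ga D b != 0 by rewrite ga_theta // gb0.
have [|s [us ss sE]] := tors_ex b0 gb; first by rewrite g20.
have cnt : (count ml s <= Q)%N.
  apply: (@count_ml D b) => //.
  rewrite coef_redp red_eq0; last exact: intp_Pa.
  have dl : (d < (2 * size b).+1)%N.
    by rewrite ltnS; apply: leq_trans (leq_pred _) _; rewrite mul2n -addnn leq_addr.
  rewrite coef_sum (bigD1 (Ordinal dl)) //= coefZ coefXn eqxx mulr1 big1 ?addr0 // => i ni.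
  rewrite coefZ coefXn [_ == _]eqn_exp2l ?q_gt1 // eq_sym; move: ni; rewrite -(inj_eq val_inj) /= => /negbTE ->.
  by rewrite mulr0.
apply: (@cyclic_of_size X D b 0 x [seq z <- s | ml z] ib).
- by rewrite expr1.
- by rewrite expr0 act1.
- by rewrite size_filter mul1n.
- by move=> a; rewrite mem_filter sE act_ml //= actCA bx act0r.
- by rewrite mem_filter my sE by_ eqxx.
Qed.

End OnePlace.
End Reduction.

(** * Inertia at a place of multiplicative reduction *)

Section LocalAction.
Variable X : setting.
Local Notation Fq := (sFq X).
Local Notation L := (sL X).
Local Notation iota := (siota X).
Local Notation theta := (stheta X).
Local Notation pc := (spc X).
Local Notation q := (qq X).
Local Notation inF := (inF iota theta).
Local Notation gamma := (gammaA iota theta).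
Local Notation hom := {rmorphism L -> L}.
Local Notation Cm := (Cm X).
Implicit Types (D : dmodule L) (a M v : {poly Fq}) (f : hom) (x y z c : L) (Y Z : seq L).

Definition fixD D c f := [/\ fixF f, f (dg1 D) = dg1 D, f (dg2 D) = dg2 D & f c = c].

(* [c] identifies the target of the Weil pairing with Carlitz torsion. *)
Definition weil_const D c := c != 0 /\ dg2 D * c ^+ q = - c.

Lemma fixD_act D c f a x : dth D = theta -> fixD D c f -> f (act D a x) = act D a (f x).
Proof. by move=> Et [fF f1 f2 _]; apply: act_fix => //; rewrite Et fix_theta. Qed.

Lemma fixD_hit D c f n : fixD D c f -> fixD D c (hit n f).
Proof.
move=> [fF f1 f2 fc]; elim: n => [|n [IF I1 I2 I3]] //.
by split; rewrite /= ?I1 ?I2 ?I3 //; exact: fixes_hcomp.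
Qed.

Section OnePlace.
Variables (b : {poly Fq}) (ib : irreducible_poly b) (w : place b).
Local Notation vint := (vint w).
Local Notation ml := (ml w).
Local Notation vge := (vge w).
Local Notation vgt := (vgt w).
Local Notation red := (red ib w).
Local Notation redp := (redp ib w).
Local Notation redd := (redd ib w).
Local Notation d := (size b).-1.
Local Notation Q := (q ^ d)%N.

Lemma ndvd_exp v k : ~~ (b %| v) -> ~~ (b %| v ^+ k).
Proof.
move=> bv; have cp := coprimep_expr k (irr_coprime ib bv).
apply/negP => bd; have := dvdp_gcd_idl bd; move: cp; rewrite /coprimep => /eqP E /eqp_size.
by rewrite E => sb; case: ib; rewrite -sb.
Qed.

Section Mult.
Variable D : dmodule L.
Hypotheses (Et : dth D = theta) (g20 : dg2 D != 0) (iD : intD w D) (m2 : ml (dg2 D)) (n1 : ~~ ml (dg1 D)).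

Let rg2 : dg2 (redd D) = 0.
Proof. by case: iD => _ _ i2; apply/eqP; rewrite /= red_eq0. Qed.
Let rg1 : dg1 (redd D) != 0.
Proof. by case: iD => _ i1 _; rewrite /= red_eq0. Qed.

Lemma mult_count_int a s : a != 0 -> tlist D a s -> count vint s = (q ^ (size a).-1)%N.
Proof.
move=> a0 sE; have ga0 : ga D a != 0 by rewrite ga_theta // gamma_neq0.
have sz : size (redp (Pa D a)) = (q ^ (size a).-1).+1 by rewrite redp_Pa // size_Pa1.
have [|r r0 E] := count_int (ib := ib) a0 g20 ga0 sE iD; first by rewrite -size_poly_gt0 sz.
by move: sz; rewrite E size_scale // prod_X_size => -[].
Qed.

Lemma mult_int_exact v k : irreducible_poly v ->
  exists x, [/\ vint x, act D (v ^+ k.+1) x = 0 & act D (v ^+ k) x != 0].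
Proof.
move=> iv; have v0 := irr_neq0 iv; have gv0 : ga D v != 0 by rewrite ga_theta // gamma_neq0.
have tl j : exists s, tlist D (v ^+ j) s.
  have [|||s [us _ sE]] := @tors_ex _ D (v ^+ j); rewrite ?expf_neq0 ?gaX ?expf_neq0 ?g20 //.
  by exists s.
have [s sE] := tl k.+1; have [s' sE'] := tl k.
have lt : (size [seq x <- s' | vint x] < size [seq x <- s | vint x])%N.
  rewrite !size_filter (mult_count_int _ sE) ?expf_neq0 // (mult_count_int _ sE') ?expf_neq0 //.
  by rewrite !size_exp_pred // ltn_exp2l ?q_gt1 // ltn_mul2r ltnSn (d_gt0 iv).
have /allPn [x] : ~~ all (mem [seq x <- s' | vint x]) [seq x <- s | vint x].
  apply: contraTN lt => /allP sub; rewrite -leqNgt; apply: uniq_leq_size => //.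
  by apply: filter_uniq; case: sE.
rewrite /= !mem_filter (proj2 sE) (proj2 sE') => /andP [ix /eqP xk]; rewrite ix /= => nx.
by exists x.
Qed.

(** An integral point [x0] of full order is fixed by inertia. As f is trivial on the Carlitz torsion
    of this level, f x - x pairs to zero with [x0], so it is one of its multiples. *)
Lemma mult_away v k c Z f : irreducible_poly v -> ~~ (b %| v) -> weil_const D c -> fixD D c f -> inert w Z f ->
  (forall x, act D (v ^+ k.+1) x = 0 -> x \in Z) ->
  (forall z, act Cm (v ^+ k.+1) z = 0 -> f z = z) ->
  forall x, act D (v ^+ k.+1) x = 0 -> f (f x - x) = f x - x.
Proof.
move=> iv bv [c0 cE] fD H HZ fC x xk; have [fF f1 f2 fc] := fD.
have gv0 : ga D v != 0 by rewrite ga_theta // gamma_neq0 // irr_neq0.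
have [x0 [ix0 xk0 xk1]] := mult_int_exact k iv.
have fA a y : f (act D a y) = act D a (f y) by apply: (fixD_act _ _ Et fD).
have f0 : f (dth D) = dth D by rewrite Et fix_theta.
have fx0 : f x0 = x0.
  apply: (inert_id ib (a := v ^+ k.+1) iD _ H) => //; last exact: HZ.
  by rewrite ga_theta // ml_gamma // ndvd_exp.
have CE : CD D = Cm by rewrite /CD Et.
have fxk : act D (v ^+ k.+1) (f x) = 0 by rewrite -fA xk rmorph0.
have yk : act D (v ^+ k.+1) (f x - x) = 0 by rewrite actBr fxk xk subrr.
have [|a aE] := weil_perp iv g20 gv0 c0 cE xk0 xk1 yk.
  have fi e : f (iota e) = iota e by apply: fix_iota.
  rewrite weilDr weilNr -{1}fx0 -(weil_hom _ _ _ fi) //.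
  suff E : f (weil D (v ^+ k.+1) x0 x / c) = weil D (v ^+ k.+1) x0 x / c.
    by apply/eqP; rewrite subr_eq0; apply/eqP; apply: (mulIf (x := c^-1)); rewrite ?invr_eq0 // -E fmorph_div fc.
  by apply: fC; rewrite -CE (weil_carl _ c0 cE) // xk0 weil0l mul0r.
by rewrite aE fA fx0.
Qed.

Lemma mult_ca_unit : ~~ ml (ca D b d).
Proof.
rewrite -(red_eq0 ib) ?ca_int // red_ca //.
have [e ->] := ca_rk1_top (irr_neq0 ib) rg2.
by rewrite mulf_neq0 ?iota_inj0 ?lead_coef_eq0 ?irr_neq0 // expf_neq0.
Qed.

(** The reduction has rank one, so phi_b reduces to a nonzero constant times tau^d and has no
    nonzero torsion. *)
Lemma mult_int_ml k x : act D (b ^+ k) x = 0 -> vint x -> ml x.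
Proof.
move=> xk ix; rewrite -(red_eq0 ib) //.
have : act (redd D) (b ^+ k) (red x) = 0 by rewrite -red_act // xk red0.
elim: k (red x) {xk ix} => [|k IH] y; first by rewrite expr0 act1 => ->.
rewrite exprSr actM => /IH; rewrite (@actE _ (redd D) b y (2 * size b)) ?leqnSn //.
have dl : (d < 2 * size b)%N.
  by rewrite mul2n -addnn; apply: leq_trans (leq_addr _ _); rewrite -(Sd ib).
rewrite (bigD1 (Ordinal dl)) //= big1 ?addr0; last first.
  move=> i ni; case: (ltngtP i d) => [lt|gt|E].
  - have [_ _ _] := iD; have := @ca_small _ _ ib w D i Et iD lt.
    move=> h; have /eqP : red (ca D b i) == 0 by rewrite red_eq0 ?ca_int //; apply: vgt_lt h.
    by rewrite red_ca // => ->; rewrite mul0r.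
  - by rewrite ca_rk1_big ?mul0r //; apply: leq_trans gt; rewrite -(Sd ib).
  - by case/eqP: ni; apply: val_inj.
move=> E; case: (eqVneq y 0) => // y0; exfalso.
have nc : ca (redd D) b d != 0 by have := mult_ca_unit; rewrite -(red_eq0 ib) ?ca_int // red_ca.
by have := mulf_neq0 nc (expf_neq0 Q y0); rewrite E ?eqxx.
Qed.

Section Tate.
Variables (a : {poly Fq}) (a0 : a != 0).
Local Notation V x := (act D a x = 0).
Let gam := w (dg2 D).
(** At valuation -S the terms g1 x^q and g2 x^(q^2) balance. Nonintegral torsion turns out to sit at
    the values -S / q^i. *)
Let S := gam / (q ^ 2 - q)%N%:R.

Let q2 : (q < q ^ 2)%N. Proof. by rewrite -{1}(expn1 q) ltn_exp2l ?q_gt1. Qed.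
Let w1 : dg1 D != 0 /\ w (dg1 D) = 0. Proof. by apply: unit_w => //; case: iD. Qed.
Let gam0 : 0 < gam. Proof. by move: m2; rewrite /ml vgtE. Qed.
Let qr : (2%:R : rat) <= q%:R. Proof. by rewrite ler_nat q_gt1. Qed.
Let SE : S * ((q ^ 2)%:R - q%:R) = gam.
Proof.
by rewrite -natrB ?(ltnW q2) // /S mulfVK // pnatr_eq0 -lt0n subn_gt0.
Qed.
Let S0 : 0 < S. Proof. by rewrite divr_gt0 ?ltr0n ?subn_gt0. Qed.
Let q2r : (q%:R : rat) * q%:R = (q ^ 2)%:R. Proof. by rewrite -natrM mulnn. Qed.

Let Vdt x : V x -> V (dt D x). Proof. by move=> xa; rewrite -(actX D) actCA xa act0r. Qed.

Let wg1 x : x != 0 -> w (dg1 D * x ^+ q) = q%:R * w x.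
Proof. by move=> x0; rewrite pwM ?w1.1 ?expf_neq0 // w1.2 wX // add0r. Qed.
Let wg2 x : x != 0 -> w (dg2 D * x ^+ (q ^ 2)) = gam + (q ^ 2)%:R * w x.
Proof. by move=> x0; rewrite pwM ?expf_neq0 // wX. Qed.
Let vth x : vge (w x) (theta * x).
Proof. by rewrite -[w x]add0r; apply: vgeM; [exact: vint_theta|exact: vge_w]. Qed.

Let dt_mid x : x != 0 -> w x < 0 -> - S < w x -> dt D x != 0 /\ w (dt D x) = q%:R * w x.
Proof.
have qr' := qr; have S0' := S0; have gam0' := gam0.
move=> x0 wx wS; have gx0 : dg1 D * x ^+ q != 0 by rewrite mulf_neq0 ?w1.1 ?expf_neq0.
have -> : dt D x = dg1 D * x ^+ q + (dg2 D * x ^+ (q ^ 2) + theta * x) by rewrite dtE Et; ring.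
rewrite -wg1 //; apply: w_dom => //.
rewrite wg1 //; apply: vgtD; last by apply: (vgt_lt _ (vth x)); nra.
have gx2 : dg2 D * x ^+ (q ^ 2) != 0 by rewrite mulf_neq0 ?expf_neq0.
rewrite vgtE // wg2 // -SE -q2r; have : 0 < q%:R * (q%:R - 1) * (w x + S) by rewrite !mulr_gt0 //; lra.
lra.
Qed.

Let dt_low x : x != 0 -> w x < - S -> dt D x != 0 /\ w (dt D x) < w x.
Proof.
have qr' := qr; have S0' := S0; have gam0' := gam0.
move=> x0 wS; have gx0 : dg2 D * x ^+ (q ^ 2) != 0 by rewrite mulf_neq0 ?expf_neq0.
have gx1 : dg1 D * x ^+ q != 0 by rewrite mulf_neq0 ?w1.1 ?expf_neq0.
have lt1 : gam + (q ^ 2)%:R * w x < q%:R * w x.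
  rewrite -SE -q2r; have : 0 < q%:R * (q%:R - 1) * (- S - w x) by rewrite !mulr_gt0 //; lra.
  lra.
have lt2 : q%:R * w x < w x by nra.
have [n0 E] : dg2 D * x ^+ (q ^ 2) + (dth D * x + dg1 D * x ^+ q) != 0 /\
    w (dg2 D * x ^+ (q ^ 2) + (dth D * x + dg1 D * x ^+ q)) = w (dg2 D * x ^+ (q ^ 2)).
  apply: w_dom => //; rewrite wg2 // Et; apply: vgtD.
    by apply: (vgt_lt _ (vth x)); lra.
  by rewrite vgtE // wg1.
by rewrite dtE [_ + dg2 D * _]addrC E wg2 //; split => //; lra.
Qed.

(** Below -S the map phi_t lowers valuations strictly, which a finite torsion module does not
    allow. *)
Let V_ge x : V x -> vge (- S) x.
Proof.
move=> xa; apply: contraT => nx.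
have ga0 : ga D a != 0 by rewrite ga_theta // gamma_neq0.
have [|s [us _ sE]] := tors_ex a0 ga0; first by rewrite g20.
have mem y : (y \in [seq y <- s | ~~ vge (- S) y]) = ~~ vge (- S) y && (act D a y == 0).
  by rewrite mem_filter sE.
have [|y ys H] := @seq_argmax _ [seq y <- s | ~~ vge (- S) y] (fun y => - w y).
  by apply: contraTneq isT => e; have := mem x; rewrite e nx xa eqxx.
move: ys; rewrite mem => /andP [ny /eqP ya].
have y0 : y != 0 by apply: contraNneq ny => ->; exact: vge0.
have wy : w y < - S by rewrite ltNge -vgeE.
have [d0 wd] := dt_low y0 wy; have := H (dt D y); rewrite mem Vdt // eqxx andbT vgeE // -ltNge.
by rewrite lerN2 => h; exfalso; move: (h (lt_trans wd wy)); rewrite leNgt wd.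
Qed.

(** Strictly between -S and 0, phi_t multiplies the valuation by q; as nothing lies below -S,
    iteration must land on it exactly. *)
Let V_form x : V x -> ~~ vint x -> exists i, w x * (q ^ i)%:R = - S.
Proof.
have qr' := qr; have S0' := S0; have gam0' := gam0.
move=> xa nx; have [n] : exists n, S < - w x * (q ^ n)%:R.
  have [m Hm] := nat_above (S / - w x).
  have x0 : x != 0 by apply: contraNneq nx => ->; exact: vint0.
  have wx : 0 < - w x by move: nx; rewrite /vint vgeE // -ltNge oppr_gt0.
  exists m; move: Hm; rewrite ltr_pdivrMr // mulrC => h; apply: lt_le_trans h _.
  by rewrite ler_pM2l // ler_nat; apply: ltnW; apply: ltn_expl; exact: q_gt1.
elim: n x xa nx => [|n IH] x xa nx.
  have x0 : x != 0 by apply: contraNneq nx => ->; exact: vint0.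
  by rewrite expn0 mulr1; have := V_ge xa; rewrite vgeE //; lra.
have x0 : x != 0 by apply: contraNneq nx => ->; exact: vint0.
have wx : w x < 0 by move: nx; rewrite /vint vgeE // -ltNge.
have [E|wS] := eqVneq (w x) (- S); first by exists 0%N; rewrite expn0 mulr1.
have {wS} wS : - S < w x by rewrite lt_neqAle eq_sym wS -vgeE // V_ge.
have [d0 wd] := dt_mid x0 wx wS => lt.
have [|||i iE] := IH (dt D x).
- exact: Vdt.
- by rewrite /vint vgeE // wd -ltNge; nra.
- by rewrite wd -mulrN -mulrA mulrCA -natrM -expnS.
by exists i.+1; rewrite expnS natrM mulrA [w x * _]mulrC -wd.
Qed.

Let nint0 x : ~~ vint x -> x != 0 /\ w x < 0.
Proof.
move=> nx; have x0 : x != 0 by apply: contraNneq nx => ->; exact: vint0.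
by split => //; move: nx; rewrite /vint vgeE // -ltNge.
Qed.

Let V_dt x : V x -> vge (- S) (dt D x). Proof. by move=> xa; apply: V_ge; apply: Vdt. Qed.

(** The images under phi_t have value at least -S, so the two dominant terms must nearly cancel for
    both points. Hence the residue r of x/y satisfies r^(q^2) = r^q and lies in [Fq]. *)
Let V_base x y : x != 0 -> y != 0 -> V x -> V y -> w x = - S -> w y = - S ->
  exists2 e : Fq, e != 0 & vgt (w x) (x - iota e * y).
Proof.
have qr' := qr; have S0' := S0; have gam0' := gam0.
move=> x0 y0 xa ya wx wy; pose r := x / y.
have r0 : r != 0 by rewrite mulf_neq0 ?invr_eq0.
have wr : w r = 0 by rewrite wdiv // wx wy subrr.
have xE : x = r * y by rewrite mulfVK.
have ir : vint r by rewrite /vint vgeE // wr.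
have vE z : V z -> w z = - S -> vge (- S) (dg1 D * z ^+ q + dg2 D * z ^+ (q ^ 2)).
  move=> za wz; have -> : dg1 D * z ^+ q + dg2 D * z ^+ (q ^ 2) = dt D z - theta * z.
    by rewrite dtE Et; ring.
  by apply: vgeB; [exact: V_dt|rewrite -wz].
have mr : ml (r ^+ (q ^ 2) - r ^+ q).
  have v1 : vge (- S) ((dg2 D * y ^+ (q ^ 2)) * (r ^+ (q ^ 2) - r ^+ q)).
    have -> : (dg2 D * y ^+ (q ^ 2)) * (r ^+ (q ^ 2) - r ^+ q) =
       (dg1 D * x ^+ q + dg2 D * x ^+ (q ^ 2)) - r ^+ q * (dg1 D * y ^+ q + dg2 D * y ^+ (q ^ 2)).
      by rewrite xE !exprMn; ring.
    apply: vgeB; first exact: vE.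
    by rewrite -[- S]add0r; apply: vgeM; [exact: vintX|exact: vE].
  have [->|n0] := eqVneq (r ^+ (q ^ 2) - r ^+ q) 0; first exact: vgt0.
  move: v1; rewrite /ml vgtE // vgeE; last by rewrite !mulf_neq0 // expf_neq0.
  rewrite pwM ?mulf_neq0 ?expf_neq0 // wg2 // wy -SE -q2r.
  by have : 0 < (q%:R - 1) * S by [rewrite mulr_gt0 //; lra]; lra.
have : red r ^+ q = red r.
  apply/eqP; rewrite -subr_eq0 -[_ == 0]andTb -(qX_gt0 X 1) expn1 -expf_eq0.
  have := @exprBq X 1 (red r ^+ q) (red r); rewrite expn1 => ->.
  by rewrite -exprM mulnn -!redX // -redB ?vintX // red_eq0 // vintB ?vintX.
move=> /fixed_iota [e eE]; have mre : ml (r - iota e).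
  by rewrite -(red_eq ib) ?vint_iota // red_iota eE.
exists e.
  apply: contraTneq mre => ->; by rewrite rmorph0 subr0 /ml vgtE // wr.
rewrite wx xE -mulrBl; have [->|n0] := eqVneq (r - iota e) 0; first by rewrite mul0r vgt0.
by rewrite vgtE ?mulf_neq0 // pwM // wy; move: mre; rewrite /ml vgtE //; lra.
Qed.

(** Iterating phi_t, which is [Fq]-linear and multiplies these values by q, reduces to [V_base] with
    the same scalar. *)
Let V_rel x y : V x -> V y -> ~~ vint x -> ~~ vint y -> w x = w y -> exists2 e : Fq, e != 0 & vgt (w x) (x - iota e * y).
Proof.
have qr' := qr; have S0' := S0; have gam0' := gam0.
move=> xa ya nx ny wxy; have [i iE] := V_form xa nx.
have [x0 wx] := nint0 nx.
have [y0 _] := nint0 ny.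
elim: i x y xa ya {nx ny} wxy iE x0 y0 wx => [|i IH] x y xa ya wxy iE x0 y0 wx.
  by apply: V_base => //; [rewrite -iE expn0 mulr1|rewrite -wxy -iE expn0 mulr1].
have wS : - S < w x.
  rewrite -iE; have : (1 : rat) < (q ^ i.+1)%:R; last by nra.
  by rewrite (ltr_nat _ 1) -[X in (X < _)%N](exp1n i.+1) ltn_exp2r ?q_gt1.
have [dx0 wdx] := dt_mid x0 wx wS.
have [dy0 wdy] : dt D y != 0 /\ w (dt D y) = q%:R * w y by apply: dt_mid; rewrite -?wxy.
have wdx0 : w (dt D x) < 0 by rewrite wdx; nra.
have iE' : w (dt D x) * (q ^ i)%:R = - S by rewrite wdx -iE expnS natrM; ring.
have wd : w (dt D x) = w (dt D y) by rewrite wdx wdy wxy.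
have [e e0 H] := IH _ _ (Vdt xa) (Vdt ya) wd iE' dx0 dy0 wdx0.
exists e => //; set z := x - iota e * y.
have za : V z by rewrite /z actBr actZr xa ya mulr0 subrr.
have [->|z0] := eqVneq z 0; first exact: vgt0.
have vz : vge (w x) z.
  by apply: vgeB; [exact: vge_w|rewrite wxy -[w y]add0r; apply: vgeM; [exact: vint_iota|exact: vge_w]].
rewrite vgtE // lt_neqAle -vgeE // vz andbT; apply/eqP => E.
have [dz0 wdz] : dt D z != 0 /\ w (dt D z) = q%:R * w z by apply: dt_mid; rewrite -?E.
move: H; rewrite (_ : dt D x - _ = dt D z); last first.
  by rewrite /z -[- (iota e * y)]mulNr -rmorphN dtD dtZ rmorphN mulNr.
by rewrite vgtE // wdx wdz E ltxx.
Qed.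

Let w_mono (r r1 : rat) i j : r * (q ^ i)%:R = - S -> r1 * (q ^ j)%:R = - S -> r1 < 0 -> r <= r1 -> (i <= j)%N.
Proof.
move=> iE jE n1' le; rewrite leqNgt; apply/negP => lt; have S0' := S0; have qr' := qr.
have h1 : r * (q ^ i)%:R <= r1 * (q ^ i)%:R by rewrite ler_pM2r // ltr0n qX_gt0.
have h2 : r1 * (q ^ i)%:R <= r1 * (q ^ j.+1)%:R by rewrite ler_nM2l // ler_nat leq_exp2l // q_gt1.
have h3 : 0 < S * (q%:R - 1) by rewrite mulr_gt0 //; lra.
move: h1 h2; rewrite iE expnSr natrM mulrA jE; lra.
Qed.

(* The nonintegral torsion element closest to the integral ones generates the torsion
   modulo integral elements, and inertia multiplies it by a scalar of [Fq]. *)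
Let V_gen x1 : V x1 -> ~~ vint x1 -> (forall y, V y -> ~~ vint y -> w y <= w x1) ->
  forall x, V x -> exists e, vint (x - act D e x1).
Proof.
move=> xa1 nx1 mx1; have [i1 iE1] := V_form xa1 nx1; have S0' := S0; have qr' := qr.
have [x10 wx1] := nint0 nx1.
have qi j : (0 : rat) < (q ^ j)%:R by rewrite ltr0n qX_gt0.
have qm j k : (j <= k)%N -> ((q ^ j)%:R : rat) <= (q ^ k)%:R by move=> jk; rewrite ler_nat leq_exp2l // q_gt1.
have pw_ j : (j <= i1)%N -> let y := act D ('X ^+ j) x1 in [/\ V y, ~~ vint y & w y = w x1 * (q ^ j)%:R].
  elim: j => [|j IH] lj; first by rewrite /= expr0 act1 expn0 mulr1.
  have [ya ny wy] := IH (ltnW lj); set y := act D _ x1 in ya ny wy.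
  rewrite /= exprS actXM -/y; have [y0 wy0] := nint0 ny.
  have wS : - S < w y by rewrite wy -iE1 ltr_nM2l // ltr_nat ltn_exp2l ?q_gt1.
  have [d0 wd] := dt_mid y0 wy0 wS; split; first exact: Vdt.
    by rewrite /vint vgeE // -ltNge wd pmulr_rlt0 // ltr0n q_gt0.
  by rewrite wd wy expnS natrM; ring.
suff main n : forall x, V x -> ~~ vint x -> forall i, w x * (q ^ i)%:R = - S -> (i1 - i < n)%N ->
    exists e, vint (x - act D e x1).
  move=> x xa; have [ix|nx] := boolP (vint x); first by exists 0; rewrite act0l subr0.
  by have [i iE] := V_form xa nx; apply: (main (i1 - i).+1 x xa nx i iE).
elim: n => // n IH x xa nx i iE lt; have [x0 wx] := nint0 nx.
have le : (i <= i1)%N := w_mono iE iE1 wx1 (mx1 x xa nx).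
have [ya ny wy] := pw_ (i1 - i)%N (leq_subr _ _); set y := act D _ x1 in ya ny wy.
have wxy : w x = w y.
  apply: (mulIf (x := (q ^ i)%:R)); first by rewrite gt_eqF.
  by rewrite iE wy -mulrA -natrM -expnD subnK.
have [e e0 H] := V_rel xa ya nx ny wxy; set z := x - _ in H.
have za : V z by rewrite /z actBr actZr xa ya mulr0 subrr.
have zE e' : z - act D e' x1 = x - act D (e *: 'X ^+ (i1 - i) + e') x1.
  by rewrite actDl actZl /z opprD addrA.
have [iz|nz] := boolP (vint z); first by exists (e *: 'X ^+ (i1 - i) + 0); rewrite -zE act0l subr0.
have [z0 wz] := nint0 nz; have [i' iE'] := V_form za nz.
have li : (i < i')%N.
  move: H; rewrite vgtE // => H; rewrite ltn_neqAle (w_mono iE iE' wz (ltW H)) andbT.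
  apply: contraTneq H => E; rewrite -leNgt -E in iE' *; rewrite le_eqVlt; apply/orP; left; apply/eqP.
  by apply: (mulIf (x := (q ^ i)%:R)); [rewrite gt_eqF|rewrite iE iE'].
have le' : (i' <= i1)%N := w_mono iE' iE1 wx1 (mx1 z za nz).
have [|e' He] := IH z za nz i' iE'.
  by rewrite -ltnS; apply: leq_trans lt; rewrite ltnS ltn_sub2l // (leq_trans li).
by exists (e *: 'X ^+ (i1 - i) + e'); rewrite -zE.
Qed.

(** Modulo integral elements inertia multiplies the generator [x1] by a nonzero c of [Fq], and
    c^(q-1) = 1. By [V_gen] the same power then moves every torsion point by an integral amount. *)
Lemma mult_inert f Z : fixF f -> (forall e y, f (act D e y) = act D e (f y)) -> closed Z -> inert w Z f ->
  (forall x, V x -> x \in Z /\ uw w x \in Z) ->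
  forall x, V x -> vint (iter q.-1 f x - x).
Proof.
move=> fF fA cZ H HZ x xa; have ga0 : ga D a != 0 by rewrite ga_theta // gamma_neq0.
have Vf y : V y -> V (f y) by move=> ya; rewrite -fA ya rmorph0.
have [|s [us _ sE]] := tors_ex a0 ga0; first by rewrite g20.
pose s' := [seq y <- s | ~~ vint y].
have fi y : V y -> vint y -> vint (f y) by move=> ya iy; case: (H y (HZ y ya).1 iy).
have fiti n y : V y -> vint y -> vint (iter n f y).
  move=> ya iy; have [] : V (iter n f y) /\ vint (iter n f y); last by [].
  by elim: n => //= n [V1 i1]; split; [exact: Vf|exact: fi].
have [e0|ne] := eqVneq s' [::].
  have ix : vint x.
    by apply: contraT => nx; have : x \in s' by [rewrite mem_filter nx sE xa eqxx]; rewrite e0.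
  by apply: vintB => //; apply: fiti.
have [x1] := seq_argmax (pw w) ne; rewrite mem_filter sE => /andP [nx1 /eqP xa1] mx.
have mx1 y : V y -> ~~ vint y -> w y <= w x1.
  by move=> ya ny; apply: mx; rewrite mem_filter ny sE ya eqxx.
have [x10 wx1] := nint0 nx1.
have wf : w (f x1) = w x1 by apply: (inert_w ib fF H (HZ _ xa1).2).
have nf : ~~ vint (f x1) by rewrite /vint vgeE ?fmorph_eq0 // wf -ltNge.
have [c c0 Hc] := V_rel (Vf _ xa1) xa1 nf nx1 wf.
have i0 : vint (f x1 - iota c * x1).
  apply: contraT => nu; have Vu : V (f x1 - iota c * x1) by rewrite actBr actZr Vf // xa1 mulr0 subrr.
  have [u0 _] := nint0 nu; have := mx1 _ Vu nu; move: Hc; rewrite vgtE // wf => l1 l2.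
  by move: (lt_le_trans l1 l2); rewrite ltxx.
have Vu : V (f x1 - iota c * x1) by rewrite actBr actZr Vf // xa1 mulr0 subrr.
have it j : vint (iter j f x1 - iota c ^+ j * x1) /\ V (iter j f x1 - iota c ^+ j * x1).
  elim: j => [|j [i1 V1]] /=; first by rewrite expr0 mul1r subrr vint0 act0r.
  have -> : f (iter j f x1) - iota c ^+ j.+1 * x1 =
      f (iter j f x1 - iota c ^+ j * x1) + iota c ^+ j * (f x1 - iota c * x1).
    rewrite rmorphB rmorphM rmorphXn fix_iota // exprSr; ring.
  split; first by apply: vintD; [exact: fi|apply: vintM => //; apply: vintX; exact: vint_iota].
  by rewrite actDr Vf // -rmorphXn actZr Vu mulr0 addr0.
have c1 : iota c ^+ q.-1 = 1.
  apply: (mulfI (x := iota c)); first by rewrite iota_inj0.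
  by rewrite -exprS prednK ?q_gt0 // mulr1; have := iota_q c 1; rewrite expn1.
have [iu Vu1] := it q.-1; rewrite c1 mul1r in iu Vu1.
have [e ie] := V_gen xa1 nx1 mx1 xa.
have V2 : V (x - act D e x1) by rewrite actBr xa actCA xa1 act0r subr0.
have itB y z n : iter n f (y - z) = iter n f y - iter n f z.
  by elim: n => //= n ->; rewrite rmorphB.
have itA y n : iter n f (act D e y) = act D e (iter n f y).
  by elim: n => //= n ->; rewrite fA.
have -> : iter q.-1 f x - x = (iter q.-1 f (x - act D e x1) - (x - act D e x1)) + act D e (iter q.-1 f x1 - x1).
  by rewrite itB itA actBr; ring.
apply: vintD; last exact: act_int.
by apply: vintB => //; apply: fiti.
Qed.
End Tate.
End Mult.
End OnePlace.
End LocalAction.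

(** * Inertia relations at one place *)

Section LocalSummary.
Variable X : setting.
Local Notation Fq := (sFq X).
Local Notation L := (sL X).
Local Notation iota := (siota X).
Local Notation theta := (stheta X).
Local Notation pc := (spc X).
Local Notation q := (qq X).
Local Notation inF := (inF iota theta).
Local Notation gamma := (gammaA iota theta).
Local Notation hom := {rmorphism L -> L}.
Local Notation Cm := (Cm X).
Implicit Types (D : dmodule L) (a M v : {poly Fq}) (f : hom) (x y z c : L) (Y Z : seq L).

Section OnePlace.
Variables (b : {poly Fq}) (ib : irreducible_poly b) (w : place b).
Local Notation vint := (vint w).
Local Notation ml := (ml w).
Local Notation red := (red ib w).
Local Notation redd := (redd ib w).
Local Notation d := (size b).-1.
Local Notation Q := (q ^ d)%N.
Variable D : dmodule L.
Hypotheses (Et : dth D = theta) (g20 : dg2 D != 0) (iD : intD w D).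

Definition semistable := ~~ ml (dg2 D) || ~~ ml (dg1 D).

(** This is [U_char] with the maximal ideal as [U], cyclic by [ml_cyclic]. The power q - 1 serves
    the multiplicative case, where it makes differences integral and so, for b-power torsion,
    elements of the maximal ideal. *)
Lemma at_nonss k c a Z f : semistable -> ~~ ml (ca D b d) -> weil_const D c -> fixD D c f -> closed Z -> inert w Z f ->
  (forall x, act D (b ^+ k) x = 0 -> x \in Z /\ uw w x \in Z) ->
  (forall z, act Cm (b ^+ k) z = 0 -> hit q.-1 f z = act Cm a z) ->
  forall x, act D (b ^+ k) x = 0 ->
  hit q.-1 f (hit q.-1 f x - x) = act D a (hit q.-1 f x - x).
Proof.
move=> ss nss [c0 cE] fD cZ H HZ HC x xk; set g := hit q.-1 f in HC *.
have gD : fixD D c g by apply: fixD_hit.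
have [gF gg1 gg2 gc] := gD.
have b0 := irr_neq0 ib; have bk0 := expf_neq0 k b0.
have fF : fixF f by case: fD.
have gU y : act D (b ^+ k) y = 0 -> ml (g y - y).
  move=> yk; have [m2|n2] := boolP (ml (dg2 D)).
    have n1 : ~~ ml (dg1 D) by move: ss; rewrite /semistable m2.
    apply: (mult_int_ml ib Et iD m2 n1 (k := k)); first by rewrite actBr -(fixD_act _ _ Et gD) yk rmorph0 subrr.
    by rewrite /g hitE; apply: (mult_inert ib Et g20 iD m2 n1 bk0 fF _ cZ H HZ yk) => e z; apply: (fixD_act _ _ Et fD).
  have iy := tors_int ib iD n2 bk0 yk.
  by case: (inert_hit q.-1 cZ fF H (HZ y yk).1 iy).
have gV y : act D (b ^+ k) y = 0 -> act D (b ^+ k) (g y) = 0.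
  by move=> yk; rewrite -(fixD_act _ _ Et gD) yk rmorph0.
apply: (@U_char _ D b ib (fun z => ml z) _ _ _ k c a g g20) => //.
- by move=> u1 u2; apply: mlB.
- by move=> e u; apply: act_ml.
- exact: ml_cyclic.
- by rewrite ga_theta // gb0.
- exact: gU.
- by rewrite actBr gV // xk subrr.
Qed.

Lemma hom_unip f (n : nat) x : f (f x - x) = f x - x -> hit n f x = x + (f x - x) *+ n.
Proof.
move=> E; elim: n => [|n IH]; first by rewrite mulr0n addr0.
rewrite /= IH rmorphD rmorphMn E mulrS addrA; congr (_ + _).
by rewrite addrC subrK.
Qed.

Lemma pc_mul0 x : x *+ pc = 0.
Proof. by rewrite -mulr_natr (pcharf0 (pcharL X)) mulr0. Qed.

(** On v-power torsion inertia is trivial at a good place and satisfies (f - 1)^2 = 0 at a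
    multiplicative one; a p-th power kills such unipotent maps in characteristic p. *)
Lemma at_away v k c Z f : semistable -> irreducible_poly v -> ~~ (b %| v) -> weil_const D c -> fixD D c f ->
  inert w Z f -> (forall x, act D (v ^+ k) x = 0 -> x \in Z) ->
  (forall z, act Cm (v ^+ k) z = 0 -> f z = z) ->
  forall x, act D (v ^+ k) x = 0 -> hit pc f x = x.
Proof.
move=> ss iv bv cc fD H HZ HC x xk.
have E : f (f x - x) = f x - x.
  have [m2|n2] := boolP (ml (dg2 D)).
    have n1 : ~~ ml (dg1 D) by move: ss; rewrite /semistable m2.
    case: k HZ HC xk => [|k] HZ HC xk; last exact: (mult_away ib Et g20 iD m2 n1 iv bv cc fD H HZ HC xk).
    by move: xk; rewrite expr0 act1 => ->; rewrite !(rmorph0, subrr).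
  suff fx : f x = x by rewrite fx subrr rmorph0.
  have vk0 : v ^+ k != 0 by rewrite expf_neq0 // irr_neq0.
  apply: (inert_id ib (a := v ^+ k) iD _ H) => //.
  - by rewrite ga_theta // ml_gamma // ndvd_exp.
  - exact: HZ.
  - exact: (tors_int ib iD n2 vk0 xk).
  - exact: (fixD_act _ _ Et fD).
by rewrite (hom_unip _ E) pc_mul0 addr0.
Qed.
End OnePlace.
End LocalSummary.

(** * Torsion of prime level at a good place *)

Section GoodLevelOne.
Variable X : setting.
Local Notation Fq := (sFq X).
Local Notation L := (sL X).
Local Notation iota := (siota X).
Local Notation theta := (stheta X).
Local Notation pc := (spc X).
Local Notation q := (qq X).
Local Notation inF := (inF iota theta).
Local Notation gamma := (gammaA iota theta).
Local Notation hom := {rmorphism L -> L}.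
Local Notation Cm := (Cm X).
Implicit Types (a M v : {poly Fq}) (f : hom) (x y z c : L) (Y Z : seq L).

Lemma act_eqmod (D : dmodule L) v a a' x : v %| a - a' -> act D v x = 0 -> act D a x = act D a' x.
Proof. by move=> va xv; apply/eqP; rewrite -subr_eq0 -actBl (act_dvd va xv). Qed.

Lemma coef_Pa (D : dmodule L) a j : (Pa D a)`_(q ^ j) = ca D a j.
Proof.
rewrite coef_sum; case: (ltnP j (2 * size a).+1) => lj.
  rewrite (bigD1 (Ordinal lj)) //= coefZ coefXn eqxx mulr1 big1 ?addr0 // => i ni.
  rewrite coefZ coefXn [_ == _]eqn_exp2l ?q_gt1 // eq_sym; move: ni; rewrite -(inj_eq val_inj) /= => /negbTE ->.
  by rewrite mulr0.
rewrite ca_big; last exact: leqW (ltnW lj).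
rewrite big1 // => i _; rewrite coefZ coefXn [_ == _]eqn_exp2l ?q_gt1 // gtn_eqF ?mulr0 //.
exact: leq_trans (ltn_ord i) lj.
Qed.

Section OnePlace.
Variables (b : {poly Fq}) (ib : irreducible_poly b) (w : place b).
Local Notation vint := (vint w).
Local Notation ml := (ml w).
Local Notation vge := (vge w).
Local Notation vgt := (vgt w).
Local Notation red := (red ib w).
Local Notation redp := (redp ib w).
Local Notation d := (size b).-1.
Local Notation Q := (q ^ d)%N.

Lemma act_ratio D a x : intD w D -> dth D = theta -> ml x -> x != 0 -> ml (act D a x / x - gamma a).
Proof.
move=> iD Et mx x0; have le2 : (2 * size a <= (2 * size a).+2)%N by exact: leqW (leqnSn _).
rewrite (actE D x le2) big_ord_recl expn0 expr1 ca0 Et -gammaE mulrDl mulfK // addrC addrA addNr add0r.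
rewrite mulr_suml; apply: ml_sum => i _; rewrite /= -mulrA; apply: mlM; first exact: ca_int.
have qi : (1 < q ^ (bump 0 i))%N by rewrite -[X in (X < _)%N](exp1n (bump 0 i)) ltn_exp2r ?q_gt1.
rewrite -(prednK (ltnW qi)) exprSr mulfK // ml_exp // -ltnS prednK // ltnW //.
Qed.

Variables (D : dmodule L) (c : L).
Hypotheses (Et : dth D = theta) (iD : intD w D) (n2 : ~~ ml (dg2 D)) (cc : weil_const D c).
Local Notation V x := (act D b x = 0).

Let g20 : dg2 D != 0. Proof. by case: iD => _ _ i2; case: (unit_w i2 n2). Qed.
Let b0 := irr_neq0 ib.
Let gb : ga D b != 0. Proof. by rewrite ga_theta // gb0. Qed.
Let b1 : b ^+ 1 = b. Proof. by rewrite expr1. Qed.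
Let CE : CD D = Cm. Proof. by rewrite /CD Et. Qed.

(** If x pairs nontrivially with [x1], some multiple of x pairs with [x1] as y does, and [weil_perp]
    places the difference in A x1. *)
Let line_or x1 x y : x1 != 0 -> V x1 -> V x -> V y -> (exists a, x = act D a x1) \/
  exists a a', y = act D a x + act D a' x1.
Proof.
move=> x10 v1 vx vy; have [c0 cE] := cc; rewrite -b1 in v1 vx vy.
have x1' : act D (b ^+ 0) x1 != 0 by rewrite expr0 act1.
have [E|n0] := eqVneq (weil D (b ^+ 1) x1 x) 0.
  by left; apply: (weil_perp ib g20 gb c0 cE v1 x1' vx E).
have pl : primt b 0 (weil D (b ^+ 1) x1 x / c).
  split; first by rewrite -CE (weil_carl _ c0 cE) // v1 weil0l mul0r.
  by rewrite expr0 act1 mulf_neq0 ?invr_eq0.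
have yl : act Cm (b ^+ 1) (weil D (b ^+ 1) x1 y / c) = 0.
  by rewrite -CE (weil_carl _ c0 cE) // v1 weil0l mul0r.
right; have [a aE] := prim_gen ib pl yl.
move: aE; rewrite -CE (weil_carl _ c0 cE) // weil_act // => /(mulIf _) E.
have vz : act D (b ^+ 1) (y - act D a x) = 0 by rewrite actBr vy actCA vx act0r subrr.
have [|a' a'E] := weil_perp ib g20 gb c0 cE v1 x1' vz.
  by rewrite weilDr weilNr E ?subrr // invr_eq0.
by exists a, a'; rewrite -a'E addrC subrK.
Qed.

Let w_act a x : vint x -> V x -> vge (w x) (act D a x).
Proof.
move=> ix xv; have le2 : (2 * size a <= (2 * size a).+2)%N by exact: leqW (leqnSn _).
rewrite (actE D x le2); apply: vge_sum => i _; have [->|x0] := eqVneq x 0.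
  by rewrite expr0q mulr0 vge0.
rewrite -[w x]add0r; apply: vgeM; first exact: ca_int.
apply: vge_le (vge_exp _ (vge_w w x)).
have : 0 <= w x by move: ix; rewrite /vint vgeE.
have : (1 : rat) <= (q ^ i)%:R by rewrite (ler_nat _ 1) qX_gt0.
by nra.
Qed.

(** The Newton polygon of phi_b. Rescaling by a point [x1] of largest value turns the points of that
    value into the nonzero integral roots; with 0 they number Q^2 or Q, and the coefficient of that
    degree determines the value. For Q^2 it is the leading one, a unit; for Q it is that of tau^d,
    and m is e minus e times its valuation. *)
Lemma level_one_shape (e : nat) : (0 < e)%N -> (ca D b d != 0 -> exists n : int, e%:R * w (ca D b d) = n%:~R) ->
  (forall x, V x -> x != 0 -> w x * (Q * Q - 1)%N%:R = 1) \/
  exists x1 m, [/\ x1 != 0 /\ 0 < w x1, V x1, (m <= e)%N, e%:R * w x1 * Q.-1%:R = m%:R &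
    forall x, V x -> w x = w x1 -> exists a, x = act D a x1].
Proof.
move=> e0 eZ; have [|s [us ss sE]] := tors_ex b0 gb; first by rewrite g20.
have Vi x : V x -> vint x := tors_int ib iD n2 b0.
have s0 : 0 \in s by rewrite sE act0r.
have ss2 : size s = (Q * Q)%N by rewrite ss /rk (negbTE g20) mul2n -addnn expnD.
have Q1 := Q_gt1 ib.
have nz : [seq x <- s | x != 0] != [::].
  apply/negP => /eqP E; have : (size s <= 1)%N; last by rewrite ss2 leqNgt; case/negP; rewrite (leq_trans Q1) // leq_pmulr // ltnW.
  apply: (@uniq_leq_size _ s [:: 0] us) => x xs; rewrite inE; apply: contraT => x0.
  by have : x \in [seq x <- s | x != 0] by [rewrite mem_filter x0]; rewrite E.
have [x1] := seq_argmax (pw w) nz; rewrite mem_filter sE => /andP [x10 /eqP v1] mx.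
have {}mx x : V x -> x != 0 -> w x <= w x1.
  by move=> vx x0; apply: mx; rewrite mem_filter x0 sE vx eqxx.
pose D1 := twist x1 D; pose s1 := [seq x / x1 | x <- s].
have g21 : dg2 D1 != 0 by rewrite /= mulf_neq0 // expf_neq0.
have gb1 : ga D1 b != 0 by rewrite ga_theta // gb0.
have ts1 : tlist D1 b s1.
  split; first by rewrite map_inj_uniq //; apply: mulIf; rewrite invr_eq0.
  move=> x; have -> : (act D1 b x == 0) = (act D b (x1 * x) == 0).
    by rewrite -act_twist mulf_eq0 (negbTE x10).
  rewrite -sE; apply/mapP/idP => [[y ys ->]|h]; first by rewrite mulrC divfK.
  by exists (x1 * x) => //; rewrite mulrAC divff // mul1r.
have [_ PE] := Pa_prod b0 g21 gb1 ts1.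
have [C [G [C0 iG EG rG]]] := red_factor ib w s1.
rewrite EG scalerA in PE; move: (_ * C) PE => C' PE.
set n := count vint s1.
have Gn : ~~ ml G`_n.
  rewrite -(red_eq0 ib) // -coef_redp rG.
  have <- : (size (\prod_(x <- s1 | vint x) ('X - (red x)%:P))).-1 = n by rewrite prod_X_size.
  rewrite -lead_coefE; have /monicP -> : \prod_(x <- s1 | vint x) ('X - (red x)%:P) \is monic.
    by apply: monic_prod => x _; exact: monicXsubC.
  exact: oner_neq0.
have z1 : 0 \in s1 by apply/mapP; exists 0 => //; rewrite mul0r.
have G1 : ~~ ml G`_1.
  rewrite -(red_eq0 ib) // -coef_redp rG (perm_big _ (perm_to_rem z1)) /= big_cons vint0 red0 polyC0 subr0.
  rewrite coefXM /= -horner_coef0 horner_prod prodf_seq_neq0; apply/allP => x.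
  rewrite mem_rem_uniq ?(proj1 ts1) // inE /= => /andP [x0 /mapP [y ys xE]]; apply/implyP => ix.
  rewrite !hornerE oppr_eq0 red_eq0 //; have y0 : y != 0 by apply: contraNneq x0 => h; rewrite xE h mul0r.
  rewrite /ml vgtE // xE wdiv // -leNgt subr_le0; apply: mx => //.
  by apply/eqP; rewrite -sE.
have [Gn0 wGn] := unit_w (iG n) Gn; have [G10 wG1] := unit_w (iG 1%N) G1.
have wC : C' != 0 /\ w C' = 1.
  have := coef_Pa D1 b 0; rewrite ca0 [dth D1]Et -gammaE expn0 PE coefZ => E.
  have C'0 : C' != 0 by apply: contraNneq (gb0 ib) => h; rewrite -E h mul0r.
  by split => //; have := congr1 (pw w) E; rewrite pwM // wG1 addr0 pwb.
have coefn j : n = (q ^ j)%N -> ca D b j != 0 /\ w (ca D b j) + ((q ^ j)%:R - 1) * w x1 = 1.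
  move=> nE; have E1 := coef_Pa D1 b j; rewrite -nE PE coefZ in E1.
  have E2 := ca_twist D b j x10; rewrite -/D1 -E1 in E2.
  have l0 : x1 * (C' * G`_n) != 0 by rewrite !mulf_neq0 // wC.1.
  have c0 : ca D b j != 0 by apply: contraNneq l0 => h; rewrite E2 h mul0r.
  split => //; have := congr1 (pw w) E2; rewrite !pwM ?wC.1 ?mulf_neq0 ?wC.1 ?expf_neq0 // wX // wGn wC.2.
  lra.
have vi1 x : V x -> vint (x / x1) = (x == 0) || (w x == w x1).
  move=> vx; have [->|x0] := eqVneq x 0; first by rewrite mul0r vint0.
  rewrite /vint vgeE ?mulf_neq0 ?invr_eq0 // wdiv // subr_ge0 /= eq_le andbC.
  by rewrite mx // andbT.
case: (pselect (exists x2, [/\ V x2, x2 != 0 & w x2 != w x1])) => [[x2 [v2 x20 w2]]|allx]; last first.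
  left => x vx x0; have wE y : V y -> y != 0 -> w y = w x1.
    by move=> vy y0; apply/eqP; apply: contraT => ne; case: allx; exists y.
  have nE : n = (q ^ (2 * d))%N.
    rewrite mul2n -addnn expnD -ss2 -(size_map (fun y => y / x1) s); apply/eqP; rewrite -all_count.
    apply/allP => _ /mapP [y ys ->]; rewrite vi1; last by apply/eqP; rewrite -sE.
    have [//|y0] := eqVneq y 0; rewrite wE // ?eqxx //; by apply/eqP; rewrite -sE.
  have [ca0' H] := coefn _ nE; have [ee E] := ca_top D b0.
  have wl : w (ca D b (2 * d)) = 0.
    have [_ wg] : dg2 D != 0 /\ w (dg2 D) = 0 by case: iD => _ _ i2; apply: unit_w.
    rewrite E pwM ?expf_neq0 ?iota_inj0 ?lead_coef_eq0 // wX // wg mulr0 addr0 const_w //; first exact: const_iota.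
    by rewrite iota_inj0 lead_coef_eq0.
  have QQ : (1 <= Q * Q)%N by rewrite muln_gt0 qX_gt0.
  by move: H; rewrite wl add0r mul2n -addnn expnD => H; rewrite wE // mulrC natrB.
right; have V1 y : V y -> w y = w x1 -> exists a, y = act D a x1.
  move=> vy wy; have [//|[a [a' E]]] := line_or x10 v1 vy v2; exfalso.
  have : vge (w x1) x2.
    by rewrite E; apply: vgeD; [rewrite -wy; apply: w_act => //; exact: Vi|apply: w_act => //; exact: Vi].
  by rewrite vgeE // => h; case/eqP: w2; apply/eqP; rewrite eq_le h mx.
have nE : n = Q.
  rewrite -(size_polys X d) -(size_map (fun a => act D a x1)) /n -size_filter.
  apply/eqP; rewrite -(size_map (fun y => y / x1)); apply/eqP; apply/perm_size; apply: uniq_perm.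
  - by rewrite filter_uniq //; case: ts1.
  - rewrite map_inj_uniq; last by apply: mulIf; rewrite invr_eq0.
    have := @multiples_uniq X D b 0 x1 ib; rewrite expr1 expr0 act1 mul1n => H.
    by rewrite map_inj_in_uniq ?uniq_polys //; apply: H.
  move=> x; rewrite mem_filter; apply/andP/mapP.
    move=> [ix /mapP [y ys xE]]; exists y => //; move: ys; rewrite sE => /eqP vy.
    move: ix; rewrite xE vi1 // => /orP [/eqP ->|/eqP wy].
      by apply/mapP; exists 0; rewrite ?act0l // mem_polys size_poly0.
    have [a ->] := V1 y vy wy; have vk : act D (b ^+ 1) x1 = 0 by rewrite b1.
    by have [a' ] := act_mod a b0 vk; rewrite mul1n => ma ->; apply/mapP; exists a'.
  move=> [y /mapP [a _ ->] ->]; have va : V (act D a x1) by rewrite actCA v1 act0r.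
  split; last by apply/mapP; exists (act D a x1) => //; rewrite sE va.
  have := w_act a (Vi _ v1) v1; have [->|a0] := eqVneq (act D a x1) 0; first by rewrite mul0r vint0.
  by rewrite vgeE // /vint vgeE ?mulf_neq0 ?invr_eq0 // wdiv // subr_ge0.
have [cd0 H] := coefn _ nE.
have QE : (Q.-1)%:R = Q%:R - 1 :> rat by have := natrB rat (ltnW Q1); rewrite subn1.
have [z zE] := eZ cd0.
have i1 : 0 <= w x1 by have := Vi x1 v1; rewrite /vint vgeE.
have ic : 0 <= w (ca D b d) by have := ca_int ib b d iD; rewrite /vint vgeE.
have Qr : (1 : rat) < Q%:R by rewrite (ltr_nat _ 1).
have er : (0 : rat) < e%:R by rewrite ltr0n.
have Hm : e%:R * w x1 * (Q.-1)%:R = e%:R - z%:~R by rewrite QE -zE; have := congr1 (fun r => e%:R * r) H; lra.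
have z0 : (0 <= z)%R by rewrite -(ler0z rat) -zE mulr_ge0 // ltW.
have ze : (z <= e%:Z)%R.
  rewrite -(ler_int rat) -[(e%:Z)%:~R]/(e%:R) -subr_ge0 -Hm; apply: mulr_ge0; last exact: ler0n.
  by apply: mulr_ge0 => //; exact: ltW.
exists x1, (e - `|z|)%N; split => //.
- split => //; have := Vi x2 v2; rewrite /vint vgeE // => h2; apply: le_lt_trans h2 _.
  by rewrite lt_neqAle w2 mx.
- exact: leq_subr.
have ze' : (`|z| <= e)%N by rewrite -lez_nat gez0_abs.
by rewrite Hm natrB //; congr (_ - _); rewrite -[in LHS](gez0_abs z0).
Qed.

Section Tame.
Variables (f : hom) (a : {poly Fq}) (Z : seq L) (e : nat).
Hypotheses (fD : fixD D c f) (ba : ~~ (b %| a)) (cZ : closed Z) (H : inert w Z f).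
Hypothesis fC : forall z, act Cm b z = 0 -> f z = act Cm a z.
Hypotheses (e0 : (0 < e)%N) (eZ : ca D b d != 0 -> exists n : int, e%:R * w (ca D b d) = n%:~R).
Hypothesis uZ : forall x, V x -> uw w x \in Z.
Hypothesis rZ : forall x y, V x -> V y -> x / y \in Z.
Hypothesis lZ : forall x l i j, V x -> act Cm b l = 0 -> (i <= e + Q.+1)%N -> (j <= e)%N -> x ^+ i / l ^+ j \in Z.

Let fF : fixF f. Proof. by case: fD. Qed.
Let fA g x : f (act D g x) = act D g (f x). Proof. exact: (fixD_act _ _ Et fD). Qed.
Let fV x : V x -> V (f x). Proof. by move=> vx; rewrite -fA vx rmorph0. Qed.
Let hitA n g x : hit n f (act D g x) = act D g (hit n f x).
Proof. by elim: n => //= n ->; rewrite fA. Qed.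
Let ml_act_eq g g' : ml (gamma g - gamma g') -> b %| g - g'.
Proof. by rewrite -gammaB ml_gamma. Qed.
Let unit_red z : z \in Z -> z != 0 -> w z = 0 -> [/\ vint z, red z != 0, vint (f z) & red (f z) = red z].
Proof.
move=> zZ z0 wz; have iz : vint z by rewrite /vint vgeE // wz.
have [i1 m1] := H zZ iz; split => //; first by rewrite red_eq0 // /ml vgtE // wz ltxx.
by apply/eqP; rewrite red_eq.
Qed.
Let ratio_carl l : l != 0 -> act Cm b l = 0 -> ml l -> vint (f l / l) /\ red (f l / l) = red (gamma a).
Proof.
move=> l0 lb ml_; rewrite fC //; have m := act_ratio a (intD_Cm ib w) erefl ml_ l0.
have i : vint (act Cm a l / l) by rewrite -[_ / _](subrK (gamma a)); apply: vintD; [exact: ml_int|exact: vint_gamma].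
by split => //; apply/eqP; rewrite red_eq ?vint_gamma.
Qed.

Let ratio x : x != 0 -> V x -> vint (f x / x) /\ w (f x) = w x.
Proof.
move=> x0 vx; have wf := inert_w ib fF H (uZ vx) x0; split => //.
by rewrite /vint vgeE ?mulf_neq0 ?invr_eq0 ?fmorph_eq0 // wdiv ?fmorph_eq0 // wf subrr.
Qed.

(** The exponents make x^i / l^j a unit, whose residue inertia fixes; comparing it with its image
    relates the two tame characters. *)
Let key x l i j : x != 0 -> V x -> act Cm b l = 0 -> l != 0 -> ml l -> (i <= e + Q.+1)%N -> (j <= e)%N ->
  i%:R * w x = j%:R * w l -> red (f x / x) ^+ i = red (gamma a) ^+ j.
Proof.
move=> x0 vx lb l0 ml_ ii jj E; pose z := x ^+ i / l ^+ j.
have z0 : z != 0 by rewrite mulf_neq0 ?invr_eq0 ?expf_neq0.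
have wz : w z = 0 by rewrite wdiv ?expf_neq0 // !wX // E subrr.
have [iz rz ifz rfz] := unit_red (lZ vx lb ii jj) z0 wz.
have [iu _] := ratio x0 vx; have [il rl] := ratio_carl l0 lb ml_.
have : f z * (f l / l) ^+ j = z * (f x / x) ^+ i.
  have fl0 : f l != 0 by rewrite fmorph_eq0.
  rewrite /z fmorph_div !rmorphXn !expr_div_n; field.
  by rewrite !expf_neq0.
move/(congr1 red); rewrite (redM ib ifz (vintX j il)) (redM ib iz (vintX i iu)) !redX // rfz rl => E1.
by rewrite -(mulfI rz E1).
Qed.

(** If all values are 1/(Q^2 - 1), inertia acts through a fundamental character u of level two, with
    u^(Q+1) = a. Otherwise it is triangular with diagonal [a1], [a2], where a1^e = a^m by [key] and
    a1 a2 = a by the Weil pairing. *)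
Lemma tame_relation x i : V x -> iter (Q.-1 * Q ^ i) f x = x ->
  f (f x) = act D a x \/ exists2 m, (m <= e)%N &
    let y := hit e f x - act D (a ^+ (e - m)) x in hit e f y = act D (a ^+ m) y.
Proof.
move=> vx Tx; have [->|x0] := eqVneq x 0.
  by left; rewrite !rmorph0 act0r.
have [l pl] := prim_ex ib 0; have [l0 wl] := w_prim ib w pl.
have lb : act Cm b l = 0 by case: pl; rewrite expr1.
rewrite expn0 mul1n in wl; have Q1 := Q_gt1 ib.
have Qp : (0 : rat) < (Q.-1)%:R by rewrite ltr0n -subn1 subn_gt0.
have mll : ml l by rewrite /ml vgtE // wl invr_gt0.
have Vi y : V y -> vint y := tors_int ib iD n2 b0.
have QE : (Q.-1)%:R = Q%:R - 1 :> rat by have := natrB rat (ltnW Q1); rewrite subn1.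
have [SA|[x1 [m [[x10 wx1] v1 le rm V1]]]] := level_one_shape e0 eZ.
  left; set u := red (f x / x); have [iu wf] := ratio x0 vx.
  have key1 : u ^+ Q.+1 = red (gamma a).
    rewrite -[RHS]expr1; apply: (key (l := l)) => //; first exact: leq_addl.
    rewrite mul1r wl; apply: (mulIf (x := (Q.-1)%:R)); first by rewrite gt_eqF.
    rewrite mulVf ?gt_eqF // mulrAC -natrM mulrC.
    have -> : (Q.+1 * Q.-1 = Q * Q - 1)%N.
      by rewrite -(prednK (ltnW Q1)) /=; move: (Q.-1) => n; rewrite !mulSn !mulnS; rewrite addSn subn1 /=; ring.
    exact: SA.
  have it n : vint (iter n f x / x) /\ red (iter n f x / x) = u ^+ n.
    elim: n => [|n [i1 r1]] /=; first by rewrite divff // red1 vint1.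
    have vn : V (iter n f x) by elim: (n) => //= n' vn'; apply: fV.
    have [i2 m2] := H (rZ vn vx) i1.
    have -> : f (iter n f x) / x = f (iter n f x / x) * (f x / x).
      by rewrite fmorph_div mulrA divfK // fmorph_eq0.
    split; first exact: vintM.
    rewrite redM // -/u exprSr -r1; congr (_ * _); apply/eqP; by rewrite red_eq.
  (* The hypothesis on iterates gives u^((Q-1) Q^i) = 1, and Frobenius is injective. Hence u is a
     residue of A and u^(Q+1) = u^2. *)
  have u1 : u ^+ Q.-1 = 1.
    have [_] := it (Q.-1 * Q ^ i)%N; rewrite Tx divff // red1 exprM => E.
    have Qi : (Q ^ i = q ^ (d * i))%N by rewrite expnM.
    rewrite Qi in E; apply/eqP; rewrite -subr_eq0.
    have := exprBq (d * i) (u ^+ Q.-1) 1; rewrite -E expr1n subrr => /eqP.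
    by rewrite expf_eq0 => /andP [].
  have uQ : u ^+ Q = u by rewrite -(prednK (ltnW Q1)) exprSr u1 mul1r.
  have [S [uS sS S1 S2]] := res_list ib w.
  have uS' : u \in S.
    have sp : size ('X^Q - 'X : {poly L}) = Q.+1 by rewrite size_polyDl size_polyXn // size_polyN size_polyX.
    apply: contraT => nu; have p0 : 'X^Q - 'X != 0 :> {poly L} by rewrite -size_poly_gt0 sp.
    have := @max_poly_roots _ _ (u :: S) p0 _ _; rewrite sp /= sS ltnS ltnn nu uS => ->//.
    rewrite rootE !hornerE uQ subrr eqxx /=; apply/allP => y /S2 [g ->].
    by rewrite rootE !hornerE res_frob subrr.
  have [g gE] := S2 u uS'.
  have fx : f x = act D g x.
    apply/eqP; rewrite -subr_eq0; apply: contraT => y0.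
    have vy : V (f x - act D g x) by rewrite actBr fV // actCA vx act0r subrr.
    have xw : w x * (Q * Q - 1)%N%:R = 1 := SA x vx x0.
    have wx0 : 0 < w x.
      have QQ : (0 : rat) < (Q * Q - 1)%N%:R by rewrite ltr0n subn_gt0 (leq_trans Q1) // leq_pmulr // ltnW.
      by rewrite -(pmulr_lgt0 _ QQ) xw.
    have mlx : ml x by rewrite /ml vgtE.
    have wy : w (f x - act D g x) = w x.
      have QQ : (Q * Q - 1)%N%:R != 0 :> rat by apply: contraTneq isT => h; move: xw; rewrite h mulr0 => /eqP; rewrite eq_sym oner_eq0.
      by apply: (mulIf QQ); rewrite xw SA.
    have ma := act_ratio g iD Et mlx x0.
    have : ml ((f x - act D g x) / x).
      rewrite mulrBl (_ : _ - _ = (f x / x - gamma g) - (act D g x / x - gamma g)); last by ring.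
      by apply: mlB => //; rewrite -(red_eq ib) ?vint_gamma // -/u gE.
    by rewrite /ml vgtE ?mulf_neq0 ?invr_eq0 // wdiv // wy subrr ltxx.
  rewrite fx fA fx -actM; apply: (act_eqmod (v := b)) => //; apply: ml_act_eq.
  rewrite -(red_eq ib) ?vint_gamma // gammaM redM ?vint_gamma // -gE -key1 exprSr uQ //.
right; exists m => //.
have wl' : e%:R * w x1 = m%:R * w l.
  by apply: (mulIf (x := (Q.-1)%:R)); rewrite ?gt_eqF // rm wl mulfVK ?gt_eqF.
have k1 : red (f x1 / x1) ^+ e = red (gamma a) ^+ m by apply: (key (l := l)) => //; exact: leq_addr.
have [iu1 wf1] := ratio x10 v1; have [a1 a1E] := V1 (f x1) (fV v1) wf1.
have ml1 : ml x1 by rewrite /ml vgtE.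
have r1 : red (f x1 / x1) = red (gamma a1).
  by rewrite a1E; apply/eqP; rewrite red_eq ?vint_gamma //; [exact: act_ratio|rewrite -a1E].
have d1 : b %| a1 ^+ e - a ^+ m.
  by apply: ml_act_eq; rewrite -(red_eq ib) ?vint_gamma // !gammaXn !redX ?vint_gamma // -r1 k1.
have itA n x' g : f x' = act D g x' -> hit n f x' = act D (g ^+ n) x'.
  by move=> E; elim: n => [|n IH] /=; rewrite ?expr0 ?act1 // IH fA E -actM exprSr.
have fx1 : hit e f x1 = act D (a ^+ m) x1 by rewrite (itA e x1 a1 a1E); apply: act_eqmod d1 v1.
suff [g gE] : exists g, hit e f x - act D (a ^+ (e - m)) x = act D g x1.
  by rewrite /= gE hitA fx1 actCA.
have [[g gE]|[a2 [g gE]]] := line_or x10 v1 vx (fV vx).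
  exists (g * a ^+ m - g * a ^+ (e - m)).
  by rewrite gE hitA fx1 actBl !actM -!(actCA D g).
have [[g' gE']|ne] := pselect (exists g', x = act D g' x1).
  exists (g' * a ^+ m - g' * a ^+ (e - m)).
  by rewrite gE' hitA fx1 actBl !actM -!(actCA D g').
have [c0 cE] := cc.
have v1' : act D (b ^+ 1) x1 = 0 by rewrite b1.
have vx' : act D (b ^+ 1) x = 0 by rewrite b1.
have x1' : act D (b ^+ 0) x1 != 0 by rewrite expr0 act1.
have W0 : weil D (b ^+ 1) x1 x != 0.
  by apply: contra_notN ne => /eqP E; apply: (weil_perp ib g20 gb c0 cE v1' x1' vx' E).
have [_ f1 f2 fc] := fD.
have fi h : f (iota h) = iota h by apply: fix_iota.
have Et' : f (dth D) = dth D by rewrite Et fix_theta.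
pose om := weil D (b ^+ 1) x1 x / c.
have C1 g' : act Cm g' om = weil D (b ^+ 1) x1 (act D g' x) / c.
  by rewrite -CE (weil_carl g' c0 cE v1' vx') weil_act.
have om1 : act Cm (b ^+ 1) om = 0 by rewrite C1 vx' weil0r mul0r.
have om0 : act Cm (b ^+ 0) om != 0 by rewrite expr0 act1 mulf_neq0 // invr_eq0.
have vg g' y : V y -> act D (b ^+ 1) (act D g' y) = 0 by move=> vy; rewrite b1 actCA vy act0r.
(* The pairing of [x1] and x is multiplied by a1 a2 under f, and by a because it is a Carlitz
   point. *)
have E1 : act Cm (a1 * a2) om = act Cm a om.
  have omb : act Cm b om = 0 by rewrite -om1 b1.
  rewrite -(fC omb) fmorph_div fc (weil_hom _ _ _ fi Et' f1 f2) a1E gE weilDr.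
  rewrite !(weil_act a1) //; try exact: vg.
  by rewrite -(actM D a1 g) weil_self // addr0 -actM C1.
have d2 : b %| a1 * a2 - a.
  rewrite -b1; apply: (order_dvd (D := Cm) ib om1 om0).
  by rewrite actBl E1 subrr.
have d3 : b %| a2 ^+ e - a ^+ (e - m).
  have h1 : b %| (a1 * a2) ^+ e - a ^+ e by rewrite subrXX dvdp_mulr.
  have h2 : b %| a ^+ m * (a2 ^+ e - a ^+ (e - m)).
    have -> : a ^+ m * (a2 ^+ e - a ^+ (e - m)) = ((a1 * a2) ^+ e - a ^+ e) - a2 ^+ e * (a1 ^+ e - a ^+ m).
      by rewrite mulrBr -exprD subnKC // exprMn; ring.
    by rewrite dvdp_sub // dvdp_mull.
  by move: h2; rewrite Gauss_dvdpr // irr_coprime // ndvd_exp.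
have [g' g'E] : exists g', hit e f x = act D (a2 ^+ e) x + act D g' x1.
  elim: (e) => [|n [g' IH]]; first by exists 0; rewrite expr0 act1 act0l addr0.
  exists (a2 ^+ n * g + g' * a1); rewrite /= IH rmorphD !fA gE a1E actDr actDl !actM exprSr actM.
  by rewrite addrA.
exists g'; rewrite g'E (act_eqmod d3 vx) addrC addKr //.
Qed.
End Tame.
End OnePlace.
End GoodLevelOne.

(** * Transfer from Frobenius to inertia *)

Section Global.
Variable X : setting.
Local Notation Fq := (sFq X).
Local Notation L := (sL X).
Local Notation iota := (siota X).
Local Notation theta := (stheta X).
Local Notation pc := (spc X).
Local Notation q := (qq X).
Local Notation inF := (inF iota theta).
Local Notation gamma := (gammaA iota theta).
Local Notation hom := {rmorphism L -> L}.
Local Notation Cm := (Cm X).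
Implicit Types (a b v M : {poly Fq}) (f s : hom) (x y z : L) (Z : seq L).

Lemma hitM m n f x : hit m (hit n f) x = hit (m * n) f x.
Proof. by rewrite !hitE iterM; elim: m => //= m ->; rewrite hitE. Qed.

Lemma hit_id n f x : f x = x -> hit n f x = x.
Proof. by move=> E; elim: n => //= n ->. Qed.

Lemma hit_carl v m n f a : fixF f -> (forall z, act Cm (v ^+ m) z = 0 -> f z = act Cm a z) ->
  forall z, act Cm (v ^+ m) z = 0 -> hit n f z = act Cm (a ^+ n) z.
Proof.
move=> fF fa z zv; elim: n => [|n IH] /=; first by rewrite act1.
by rewrite IH act_Cm // fa // exprSr actM.
Qed.

Lemma tors_split (D : dmodule L) a b x : coprimep a b -> act D (a * b) x = 0 ->
  exists y z, [/\ x = y + z, act D a y = 0 & act D b z = 0].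
Proof.
move=> /bezout1 [u [v uv]] xab; exists (act D (v * b) x), (act D (u * a) x); split.
- by rewrite addrC -actDl uv act1.
- by rewrite -actM mulrCA actM xab act0r.
- by rewrite -actM mulrCA [b * a]mulrC actM xab act0r.
Qed.

Lemma ndvd_mul b a a' : irreducible_poly b -> ~~ (b %| a) -> ~~ (b %| a') -> ~~ (b %| a * a').
Proof. by move=> ib h1 h2; rewrite Gauss_dvdpr // irr_coprime. Qed.

(** Fermat gives the exponent Q - 1 modulo v; raising to the Q^m-th power is additive and Q^m is at
    least m, which lifts the congruence to v^m. *)
Lemma expr_unip v a m : irreducible_poly v -> ~~ (v %| a) ->
  v ^+ m %| a ^+ ((q ^ (size v).-1).-1 * (q ^ (size v).-1) ^ m) - 1.
Proof.
move=> iv va; pose w := place_ex iv.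
have Qp : (0 < q ^ (size v).-1)%N := qX_gt0 X _.
have v1 : v %| a ^+ (q ^ (size v).-1).-1 - 1.
  rewrite -(ml_gamma iv w) gammaB gammaXn gamma1.
  have := gamma_frob iv w a; rewrite -{1}(prednK Qp) exprS -{3}[gamma a]mulr1 -mulrBr => /ml_prime.
  rewrite vint_gamma // => /(_ isT) H; have /orP [] // : ml w (gamma a) || ml w (gamma a ^+ (q ^ (size v).-1).-1 - 1).
    by apply: H; apply: vintB; [apply: vintX; exact: vint_gamma|exact: vint1].
  by rewrite ml_gamma // (negbTE va).
have pcp : pc \in [pchar {poly Fq}] by apply: (rmorph_pchar (@polyC Fq)); exact: spcP.
have frob (g : {poly Fq}) n : g ^+ (q ^ n) - 1 = (g - 1) ^+ (q ^ n).
  have pn : [pchar {poly Fq}].-nat (q ^ n)%N.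
    by rewrite (eq_pnat _ (pcharf_eq pcp)) -(eq_pnat _ (pcharf_eq (pcharL X))) qq_ppart.
  by rewrite exprDn_pchar // exprNn_pchar // expr1n.
rewrite exprM -expnM frob; apply: dvdp_trans (dvdp_exp2r _ v1).
by apply: dvdp_exp2l; rewrite expnM; apply: ltnW; apply: ltn_expl; exact: Q_gt1.
Qed.

Variables (g1 g2 c : L) (Y : seq L) (N0 : nat).
Local Notation D0 := (Dmod theta g1 g2).
Hypotheses (g20 : g2 != 0) (cc : weil_const D0 c) (Yg1 : g1 \in Y) (Yg2 : g2 \in Y) (Yc : c \in Y).
Hypothesis N0Y : forall f, fixF f -> fixY Y (hit N0 f).

(** Invariance of the twisting constant lets relations found on the twist be carried back to
    [D0]. *)
Definition model b (w : place b) (k : L) := [/\ k != 0, forall f, fixY Y f -> f k = k,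
  intD w (twist k D0) & semistable w (twist k D0)].
Hypothesis Hmod : forall b, irreducible_poly b -> exists w : place b, exists k, model w k.

Definition NN := (pc * (q.-1 * N0))%N.
Local Notation N := NN.

Lemma NNE f x : hit N f x = hit pc (hit q.-1 (hit N0 f)) x.
Proof. by rewrite !hitM /NN mulnA. Qed.

Lemma fixYN f : fixF f -> fixY Y (hit N f).
Proof.
move=> fF; have fY := N0Y fF; have := fixY_hit (pc * q.-1) fY => -[h1 h2].
by split; [exact: fixes_hit|move=> y yY; rewrite -[in RHS](h2 y yY) hitM /NN mulnA].
Qed.

Lemma fix_act_D0 f a x : fixY Y f -> f (act D0 a x) = act D0 a (f x).
Proof. by move=> [fF fY]; apply: act_fix => //=; rewrite ?fix_theta ?fY. Qed.

Lemma twist_weil k : k != 0 -> weil_const (twist k D0) (c / k ^+ q.+1).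
Proof.
move=> k0; have [c0 cE] := cc; split; first by rewrite mulf_neq0 ?invr_eq0 ?expf_neq0.
rewrite /= expr_div_n mulrA -[(g2 * _) * _]mulrAC cE -[in RHS]mulNr -mulrA; congr (_ * _).
have kq : k ^+ q != 0 by rewrite expf_neq0.
have -> : (k ^+ q.+1) ^+ q = k ^+ (q ^ 2) * k ^+ q by rewrite -exprM mulSn exprD mulrC mulnn.
have -> : k ^+ (q ^ 2) = k ^+ (q ^ 2).-1 * k by rewrite -exprSr prednK // qX_gt0.
have k2 : k ^+ (q ^ 2).-1 != 0 by rewrite expf_neq0.
by rewrite exprS; field; rewrite k2 k0 kq.
Qed.

Lemma twist_fixD b (w : place b) k f : model w k -> fixY Y f -> fixD (twist k D0) (c / k ^+ q.+1) f.
Proof.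
move=> [k0 fk _ _] fY; have [fF fy] := fY; have E := fk f fY.
by split; rewrite //= ?rmorphM ?fmorphV ?rmorphXn ?E ?fy.
Qed.

Lemma twist_tors k a x : k != 0 -> act D0 a x = 0 -> act (twist k D0) a (x / k) = 0.
Proof.
move=> k0 xa; apply: (mulfI k0); rewrite act_twist mulrC divfK // xa mulr0 //.
Qed.

Lemma tors_list a : a != 0 -> exists t, tlist D0 a t.
Proof.
move=> a0; have [||t [ut _ tE]] := @tors_ex _ D0 a a0; last by exists t.
- by rewrite ga_theta // gamma_neq0.
- by rewrite /= g20.
Qed.

(** Built prime by prime: at each b dividing M1, take the N-th power of an inertia element with the
    Carlitz character of g on the b-part. By [at_away] it is trivial on the v^k-torsion of [D0]. So
    the action on Carlitz torsion prime to v can be altered at will among N-th powers without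
    affecting that torsion. *)
Lemma outer v k g : irreducible_poly v -> fixF g -> forall M1 M2, M1 != 0 -> M2 != 0 -> coprimep M1 (v * M2) ->
  exists o : hom, [/\ fixY Y o, forall x, act Cm M1 x = 0 -> o x = hit N g x,
    forall x, act Cm M2 x = 0 -> o x = x & forall x, act D0 (v ^+ k) x = 0 -> o x = x].
Proof.
move=> iv gF M1; have [n] := ubnP (size M1); elim: n M1 => // n IH M1 le M2 M10 M20 cp.
case: (leqP (size M1) 1) => sM.
  exists (hid X); split; [by split| |by []|by []].
  have E := size1_polyC sM; have c0 : M1`_0 != 0 by rewrite -polyC_eq0 -E.
  move=> x; rewrite E actC => /eqP; rewrite mulf_eq0 iota_inj0 (negbTE c0) /= => /eqP ->.
  by rewrite !rmorph0.
have [b [m [M' [ib E nb lt]]]] := factor_split sM.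
have b0 := irr_neq0 ib; have M'0 : M' != 0 by apply: contraNneq nb => ->; rewrite dvdp0.
have bM1 : b %| M1 by rewrite E exprS -mulrA dvdp_mulr.
have nbv : ~~ (b %| v * M2).
  apply/negP => bd; have := coprimep_dvdl bd (coprimep_dvdr bM1 cp); rewrite coprimepp => /eqP sb.
  by case: ib; rewrite sb.
have nv : ~~ (b %| v) by apply: contra nbv => h; rewrite dvdp_mulr.
have n2 : ~~ (b %| M2) by apply: contra nbv => h; rewrite dvdp_mull.
(* The extra factor keeps the map obtained by induction trivial at b, where the new inertia element
   is to act. *)
have [|||o [oY o1 o2 o3]] := IH M' _ (M2 * b ^+ m.+1) M'0.
- exact: leq_trans lt le.
- by rewrite mulf_neq0 // expf_neq0.
- rewrite mulrA coprimepMr (coprimep_dvdr _ cp) /=; last by rewrite E dvdp_mull.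
  by apply: coprimep_expr; rewrite coprimep_sym irr_coprime.
have [a [ba aE]] := hom_carl ib m.+1 gF.
have [w [k' mod]] := Hmod ib; have [k'0 fk' iD ss] := mod.
have [t [ut tE]] := tors_list (expf_neq0 k (irr_neq0 iv)).
have [Z cZ sZ] := clos_ex [seq x / k' | x <- t].
have nM : ~~ (b %| M' * M2 * v ^+ k) by rewrite !ndvd_mul // ndvd_exp.
have [sg [sF s1 s2 s3]] := inertia (b := b) ib w m.+1 nM ba cZ.
pose tau := hit N sg; have tY : fixY Y tau := fixYN sF.
have sI M x : M %| M' * M2 * v ^+ k -> act Cm M x = 0 -> sg x = x by move=> dM xM; apply: s2; apply: act_dvd dM xM.
have t3 x : act D0 (v ^+ k) x = 0 -> tau x = x.
  move=> xv; pose f := hit q.-1 (hit N0 sg).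
  have fY : fixY Y f by apply: fixY_hit; apply: N0Y.
  have cZ' : inert w Z f by apply: inert_hit => //; [exact: fixes_hit|apply: inert_hit].
  have : hit pc f (x / k') = x / k'.
    apply: (at_away ib (D := twist k' D0) erefl _ iD ss iv nv (twist_weil k'0) (twist_fixD mod fY) cZ' (k := k)).
    - by rewrite /= mulf_neq0 // expf_neq0.
    - move=> y yv; apply: sZ; apply/mapP; exists (k' * y); last by rewrite mulrAC divff // mul1r.
      by rewrite tE -act_twist yv mulr0.
    - move=> z zv; rewrite /f; do 2!apply: hit_id; apply: (sI (v ^+ k)) => //; exact: dvdp_mull.
    exact: twist_tors.
  rewrite /tau NNE -/f fmorph_div => /(congr1 (fun z => z * k')).
  have fpY : fixY Y (hit pc f) by apply: fixY_hit.
  by rewrite (fk' _ fpY) !divfK.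
exists (hcomp tau o); split.
- exact: fixY_comp.
- move=> x; rewrite E => xM; have cp' : coprimep (b ^+ m.+1) M' by apply: coprimep_expl; apply: irr_coprime.
  have [y [z [-> yb zM]]] := tors_split cp' xM; rewrite !rmorphD !hcompE; congr (_ + _).
    rewrite o2; last by rewrite actM yb act0r.
    by rewrite /tau (hit_carl N sF s1) // (hit_carl N gF aE).
  rewrite o1 //; apply: hit_id; apply: (sI M'); first by rewrite -mulrA dvdp_mulr.
  by rewrite -act_Cm ?zM ?rmorph0 //; exact: fixes_hit.
- move=> x xM; rewrite hcompE o2; last by rewrite mulrC actM xM act0r.
  apply: hit_id; apply: (sI M2) => //; by rewrite [M' * _]mulrC -mulrA dvdp_mulr.
- by move=> x xv; rewrite hcompE o3 // t3.
Qed.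

Lemma KM_D M x y : KM Y M x -> KM Y M y -> KM Y M (x - y).
Proof. by move=> hx hy f f' fF fF' h1 h2; rewrite !rmorphB (hx f f') // (hy f f'). Qed.

(** On the v-part of C[M] the inertia element t has the character of [sg]; on the rest the two are
    matched by a map o from [outer], trivial on the points considered. The final clause holds
    because t^N acts on C[M] through a^N modulo v^j, whose order divides (Q - 1) Q^j. *)
Lemma link v (w : place v) k sg a M Z m : irreducible_poly v -> fixF sg -> M != 0 -> ~~ (v %| a) ->
  (forall j z, v ^+ j %| M -> act Cm (v ^+ j) z = 0 -> sg z = act Cm a z) -> closed Z ->
  exists t : hom, [/\ fixF t, inert w Z t, forall z, act Cm (v ^+ m) z = 0 -> t z = act Cm a z,
    forall x, KM Y M x -> act D0 (v ^+ k) x = 0 -> hit N sg x = hit N t x &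
    exists i, forall x, KM Y M x ->
      iter ((q ^ (size v).-1).-1 * (q ^ (size v).-1) ^ i) (hit N t) x = x].
Proof.
move=> iv sF M0 va sa cZ; have v0 := irr_neq0 iv.
have [j [M1 [E nv]]] := vpart iv M0.
have sj z : act Cm (v ^+ j) z = 0 -> sg z = act Cm a z by apply: sa; rewrite E dvdp_mulr.
have M10 : M1 != 0 by apply: contraNneq nv => ->; rewrite dvdp0.
(* Level j + m covers both the v-part of M and the requested C[v^m]. *)
have [t [tF t1 t2 t3]] := inertia iv w (j + m) nv va cZ.
have cp : coprimep (v ^+ j) M1 by apply: coprimep_expl; apply: irr_coprime.
have cp' : coprimep M1 (v * v ^+ j).
  by rewrite -exprS coprimep_sym; apply: coprimep_expl; apply: irr_coprime.
have [o [oY o1 o2 o3]] := outer k iv sF M10 (expf_neq0 j v0) cp'.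
have tj z : act Cm (v ^+ j) z = 0 -> t z = act Cm a z.
  by move=> zj; apply: t1; rewrite addnC exprD actM zj act0r.
have tY := fixYN tF; have sY := fixYN sF.
exists t; split => //.
- by move=> z zm; apply: t1; rewrite exprD actM zm act0r.
- move=> x Kx xk; have := Kx (hit N sg) (hcomp (hit N t) o); rewrite hcompE o3 //; apply.
  + by case: sY.
  + by apply: fixes_hcomp; [case: tY|case: oY].
  + by move=> y yY; rewrite hcompE (oY.2 y yY) (tY.2 y yY) (sY.2 y yY).
  move=> z; rewrite E => zM; have [y [z' [-> yj zM1]]] := tors_split cp zM.
  rewrite !rmorphD !hcompE; congr (_ + _).
    by rewrite o2 // (hit_carl N sF sj) // (hit_carl N tF tj).
  by rewrite o1 //; apply: esym; apply: hit_id; apply: t2; rewrite -act_Cm ?zM1 ?rmorph0 //; exact: fixes_hit.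
exists j => x Kx; set n := (_ * _)%N; rewrite -hitE.
have := Kx (hit n (hit N t)) (hid X); apply.
- by apply: fixes_hit; case: tY.
- by [].
- by move=> y yY; apply: hit_id; exact: tY.2.
move=> z; rewrite E => zM; have [y [z' [-> yj zM1]]] := tors_split cp zM.
rewrite !rmorphD; congr (_ + _); last by do 2!apply: hit_id; apply: t2.
have tN z0 : act Cm (v ^+ j) z0 = 0 -> hit N t z0 = act Cm (a ^+ N) z0 by exact: hit_carl.
have tYF : fixF (hit N t) by case: tY.
rewrite (hit_carl n tYF tN) // -[RHS](act1 Cm); apply: act_eqmod yj.
by apply: expr_unip => //; apply: ndvd_exp.
Qed.

(** On u = f x - x the map f is multiplication by g, and each f^n x - x is a multiple of u. *)
Lemma hit_geom f (D : dmodule L) g x : (forall e y, f (act D e y) = act D e (f y)) ->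
  f (f x - x) = act D g (f x - x) ->
  forall n, hit n f (hit n f x - x) = act D (g ^+ n) (hit n f x - x).
Proof.
move=> fA H; set u := f x - x in H.
have hu n : hit n f u = act D (g ^+ n) u.
  by elim: n => [|n IH] /=; rewrite ?expr0 ?act1 // IH fA H exprSr actM.
have hA n e y : hit n f (act D e y) = act D e (hit n f y).
  by elim: n => //= n ->; rewrite fA.
have hx n : exists B, hit n f x - x = act D B u.
  elim: n => [|n [B IH]] /=; first by exists 0; rewrite act0l subrr.
  exists (B * g + 1); rewrite -[hit n f x](subrK x) IH rmorphD fA H actDl act1 actM.
  by rewrite -addrA.
by move=> n; have [B ->] := hx n; rewrite hA hu actCA.
Qed.

Section AtV.
Variables (v : {poly Fq}) (w : place v) (kap : L) (sg : hom) (a M : {poly Fq}).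
Hypotheses (iv : irreducible_poly v) (mod : model w kap) (sF : fixF sg) (va : ~~ (v %| a)) (M0 : M != 0).
Hypothesis sa : forall j z, v ^+ j %| M -> act Cm (v ^+ j) z = 0 -> sg z = act Cm a z.
Local Notation S := (hit N sg).
Local Notation Dt := (twist kap D0).

Let v0 := irr_neq0 iv.
Let k0 : kap != 0. Proof. by case: mod. Qed.
Let iD : intD w Dt. Proof. by case: mod. Qed.
Let g2t : dg2 Dt != 0. Proof. by rewrite /= mulf_neq0 // expf_neq0. Qed.

Let tlistt k : exists t : seq L, forall x, act Dt (v ^+ k) x = 0 -> x \in t.
Proof.
have [|||t [ut _ tE]] := @tors_ex _ Dt (v ^+ k); rewrite ?expf_neq0 ?g2t //.
  by rewrite ga_theta // gamma_neq0 // expf_neq0.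
by exists t => x xk; rewrite tE xk.
Qed.

Let scale f x y : fixY Y f -> f (x / kap) = y / kap -> f x = y.
Proof.
case: mod => _ fk _ _ fY E; have := congr1 (fun z => z * kap) E.
by rewrite fmorph_div fk // !divfK.
Qed.

Lemma T_nonss k x : ~~ ml w (ca Dt v (size v).-1) -> KM Y M x -> act D0 (v ^+ k) x = 0 ->
  S (S x - x) = act D0 (a ^+ N) (S x - x).
Proof.
move=> nss Kx xk; have [t tE] := tlistt k.
have [Z cZ sZ] := clos_ex (t ++ [seq uw w y | y <- t]).
have [h [hF hi hC hS _]] := link w k k iv sF M0 va sa cZ.
pose f := hit N0 h; pose g := hit q.-1 f.
have fY : fixY Y f := N0Y hF.
have gY : fixY Y g by apply: fixY_hit.
have gC z : act Cm (v ^+ k) z = 0 -> g z = act Cm (a ^+ N0 ^+ q.-1) z.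
  by apply: hit_carl; [case: fY|exact: hit_carl].
have [_ fk _ ss] := mod.
have rel y : act D0 (v ^+ k) y = 0 -> g (g y - y) = act D0 (a ^+ N0 ^+ q.-1) (g y - y).
  move=> yk; have yt := twist_tors k0 yk.
  have := at_nonss iv (D := Dt) erefl g2t iD ss nss (twist_weil k0) (twist_fixD mod fY) cZ
    (inert_hit N0 cZ hF hi) _ gC yt.
  rewrite -/f -/g => H; have {H} := H _; have gk : g kap = kap by apply: fk.
  rewrite fmorph_div gk -mulrBl => H.
  have {H} H : g ((g y - y) / kap) = act Dt (a ^+ N0 ^+ q.-1) ((g y - y) / kap).
    apply: H => z zk; split; apply: sZ; rewrite mem_cat; first by rewrite tE.
    apply/orP; right.
    by apply/mapP; exists z => //; apply: tE.
  have := congr1 (fun z => kap * z) H; rewrite act_twist fmorph_div gk ![kap * _]mulrC !divfK //.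
have tE' y : KM Y M y -> act D0 (v ^+ k) y = 0 -> S y = hit pc g y by move=> Ky yk; rewrite hS // NNE.
have SY := fixYN sF.
have Sk y : act D0 (v ^+ k) y = 0 -> act D0 (v ^+ k) (S y) = 0 by move=> yk; rewrite -fix_act_D0 // yk rmorph0.
rewrite (tE' (S x - x)); first last.
- by rewrite actBr Sk // xk subrr.
- by apply: KM_D => //; apply: KM_fixY.
have H := @hit_geom g D0 _ x (fun e y => fix_act_D0 e y gY) (rel x xk) pc.
rewrite tE' // H; congr (act D0 _ _); rewrite -!exprM; congr (_ ^+ _).
by rewrite /NN; ring.
Qed.

Lemma T_level1 (e : nat) x : ~~ ml w (dg2 Dt) -> (0 < e)%N ->
  (ca Dt v (size v).-1 != 0 -> exists n : int, e%:R * w (ca Dt v (size v).-1) = n%:~R) ->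
  KM Y M x -> act D0 v x = 0 ->
  S (S x) = act D0 (a ^+ N) x \/ exists2 m, (m <= e)%N &
    let y := hit e S x - act D0 ((a ^+ N) ^+ (e - m)) x in hit e S y = act D0 ((a ^+ N) ^+ m) y.
Proof.
move=> n2 e0 eZ Kx xk; have [t tE] := tlistt 1; rewrite expr1 in tE.
have [lc [ulc lcE] _] := carl_tors v0.
pose B := (e + (q ^ (size v).-1).+1).+1.
(* The closed list must contain every element whose residue [tame_relation] compares, including all
   quotients x^i / l^j in its range of exponents. *)
pose big := [seq xl.1 ^+ ij.1 / xl.2 ^+ ij.2 | xl <- [seq (y, l) | y <- t, l <- lc],
   ij <- [seq (i, j) | i <- seq.iota 0 B, j <- seq.iota 0 e.+1]].
have [Z cZ sZ] := clos_ex ([seq uw w y | y <- t] ++ [seq y / z | y <- t, z <- t] ++ big).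
have [h [hF hi hC hS [i hT]]] := link w 1 1 iv sF M0 va sa cZ.
rewrite expr1 in hC hS; pose f := hit N h; have fY : fixY Y f := fixYN hF.
have [_ fk _ ss] := mod; have kf : f kap = kap by apply: fk.
have itk n y : iter n f (y / kap) = iter n f y / kap.
  by elim: n => //= n ->; rewrite fmorph_div kf.
have xt := twist_tors k0 xk.
have fC z : act Cm v z = 0 -> f z = act Cm (a ^+ N) z.
  by have := @hit_carl v 1 N h a hF; rewrite expr1; apply.
have SY := fixYN sF.
have KS_ y : KM Y M y -> KM Y M (S y) by apply: KM_fixY.
have VS y : act D0 v y = 0 -> act D0 v (S y) = 0 by move=> yk; rewrite -fix_act_D0 // yk rmorph0.
have Sf n y : KM Y M y -> act D0 v y = 0 -> [/\ hit n S y = hit n f y, KM Y M (hit n S y) & act D0 v (hit n S y) = 0].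
  move=> Ky yk; elim: n => // n [E K1 V1] /=; split; [|exact: KS_|exact: VS].
  by rewrite (hS _ K1 V1) -E.
have := tame_relation iv (D := Dt) erefl iD n2 (twist_weil k0) (twist_fixD mod fY) (ndvd_exp iv N va)
  (inert_hit N cZ hF hi) fC e0 eZ.
have C1 : forall y, act Dt v y = 0 -> uw w y \in Z.
  by move=> y yk; apply: sZ; rewrite mem_cat; apply/orP; left; apply/mapP; exists y => //; apply: tE.
have C2 : forall y z, act Dt v y = 0 -> act Dt v z = 0 -> y / z \in Z.
  move=> y z yk zk; apply: sZ; rewrite !mem_cat; apply/orP; right; apply/orP; left.
  by apply/allpairsP; exists (y, z); split => //=; apply: tE.
have C3 : forall y l i j, act Dt v y = 0 -> act Cm v l = 0 -> (i <= e + (q ^ (size v).-1).+1)%N -> (j <= e)%N -> y ^+ i / l ^+ j \in Z.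
  move=> y l i' j' yk lk ib jb; apply: sZ; rewrite !mem_cat; apply/orP; right; apply/orP; right.
  apply/allpairsP; exists ((y, l), (i', j')); split; [| |by []].
    by apply: (@allpairs_f _ _ _ (fun y l => (y, l))); [exact: tE|rewrite lcE lk].
  by apply: (@allpairs_f _ _ _ (fun i j => (i, j))); rewrite mem_iota add0n.
move=> /(_ C1 C2 C3 (x / kap) i xt) [|H1|[m le H2]].
- by rewrite itk hT.
- left; have [E K1 V1] := Sf 2%N x Kx xk; rewrite -[S (S x)]/(hit 2 S x) E /=.
  have := congr1 (fun z => kap * z) H1; rewrite act_twist.
  by rewrite !(fmorph_div, kf) ![kap * _]mulrC !divfK.
right; exists m => //=; have [E K1 V1] := Sf e x Kx xk.
set y := hit e S x - _; have Ky : KM Y M y /\ act D0 v y = 0.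
  have KA g z : KM Y M z -> KM Y M (act D0 g z).
    move=> Kz f1 f2 f1F f2F h1 h2; have fA f3 : fixF f3 -> f3 (act D0 g z) = act (Dmod theta (f3 g1) (f3 g2)) g (f3 z).
      by move=> f3F; rewrite act_hom /= ?fix_theta // => e'; apply: fix_iota.
    by rewrite !fA // (Kz f1 f2) // !(h1 _ Yg1) !(h1 _ Yg2).
  split; first by apply: KM_D => //; apply: KA.
  by rewrite actBr V1 actCA xk act0r subrr.
have [E' _ _] := Sf e y Ky.1 Ky.2; rewrite E'.
have yE : y / kap = hit e f (x / kap) - act Dt ((a ^+ N) ^+ (e - m)) (x / kap).
  rewrite hitE itk -hitE -E /y mulrBl; congr (_ - _).
  by apply: (mulfI k0); rewrite act_twist ![kap * _]mulrC !divfK.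
move: H2; rewrite /= -yE hitE itk -hitE => H2.
by have := congr1 (fun z => kap * z) H2; rewrite act_twist ![kap * _]mulrC !divfK.
Qed.
End AtV.
End Global.

(** * Supersingular places *)

Section Supersingular.
Variable X : setting.
Local Notation Fq := (sFq X).
Local Notation L := (sL X).
Local Notation iota := (siota X).
Local Notation theta := (stheta X).
Local Notation pc := (spc X).
Local Notation q := (qq X).
Local Notation inF := (inF iota theta).
Local Notation gamma := (gammaA iota theta).
Local Notation hom := {rmorphism L -> L}.
Local Notation Cm := (Cm X).
Implicit Types (a M v : {poly Fq}) (f : hom) (x y z c : L) (Y Z : seq L).

Lemma not_uniq_dup (r : seq L) : ~~ uniq r -> exists2 z, z \in r & z \in rem z r.
Proof.
elim: r => //= x r IH; rewrite negb_and negbK => /orP [xr|/IH [z zr zr']].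
  by exists x; rewrite ?inE ?eqxx.
have [e|ne] := eqVneq x z.
  by exists x; rewrite ?inE eqxx //= e.
by exists z; rewrite /= ?inE ?zr ?orbT // (negbTE ne) inE zr' orbT.
Qed.

Section OnePlace.
Variables (b : {poly Fq}) (ib : irreducible_poly b) (w : place b).
Local Notation vint := (vint w).
Local Notation ml := (ml w).
Local Notation vge := (vge w).
Local Notation vgt := (vgt w).
Local Notation d := (size b).-1.
Local Notation Q := (q ^ d)%N.
Variable D : dmodule L.
Hypotheses (Et : dth D = theta) (iD : intD w D) (n2 : ~~ ml (dg2 D)) (ss : ml (ca D b d)).

Let b0 := irr_neq0 ib.
Let g20 : dg2 D != 0. Proof. by case: iD => _ _ i2; case: (unit_w i2 n2). Qed.
Let gb : ga D b != 0. Proof. by rewrite ga_theta // gb0. Qed.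

(** Between d and 2d the factor theta^(q^k) - theta is congruent to theta^(q^(k-d)) - theta, again a
    unit, so [ca_comm] propagates the vanishing past tau^d. *)
Lemma ss_ca k : (k < 2 * d)%N -> ml (ca D b k).
Proof.
have [k'] := ubnP k; elim: k' k => // k' IH k lk kd.
case: (ltngtP k d) => [lt|gt|-> //].
  by apply: (@vgt_lt _ _ w _ 1) => //; exact: (ca_small ib Et iD lt).
have k0 : (0 < k)%N by apply: leq_ltn_trans gt.
have IH' j : (j < k)%N -> ml (ca D b j).
  by move=> jk; apply: IH; [apply: leq_trans jk _|apply: ltn_trans jk kd].
have sh (u : nat -> L) : (forall j, (j < k)%N -> ml (u j)) -> forall j, (j <= k)%N -> ml (shift u j).
  by move=> H [|j] //= jk; [exact: vgt0|exact: H].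
have s1 : ml (shift (ca D b) k) by apply: sh.
have s2 : ml (shift (shift (ca D b)) k).
  by apply: (sh) => // j jk; apply: (sh) => //; apply: ltnW.
have [i0 i1 i2] := iD.
have s3 : ml (shift (fun j => ca D b j * dg1 D ^+ (q ^ j)) k).
  by apply: sh => // j jk; rewrite mulrC; apply: mlM; [exact: vintX|exact: IH'].
have s4 : ml (shift (shift (fun j => ca D b j * dg2 D ^+ (q ^ j))) k).
  apply: (sh) => // j jk; apply: (sh); last exact: ltnW.
  by move=> j' jk'; rewrite mulrC; apply: mlM; [exact: vintX|exact: IH'].
have M : ml ((theta ^+ (q ^ k) - theta) * ca D b k).
  rewrite -Et ca_comm; do 2?apply: mlB => //; apply: mlD; apply: mlM => //; rewrite ml_exp ?q_gt0 ?qX_gt0 //.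
have kE : (k = d + (k - d))%N by rewrite subnKC // ltnW.
have U : ~~ ml (theta ^+ (q ^ k) - theta).
  have kd' : (0 < k - d < d)%N by apply/andP; split; [rewrite subn_gt0|rewrite -(ltn_add2r d) (subnK (ltnW gt)) addnn -mul2n].
  have := theta_unit ib w kd'; apply: contra => m1.
  rewrite kE expnD exprM in m1.
  have -> : theta ^+ (q ^ (k - d)) - theta = (theta ^+ Q ^+ (q ^ (k - d)) - theta) - (theta ^+ Q - theta) ^+ (q ^ (k - d)).
    by rewrite exprBq; ring.
  apply: mlB => //; rewrite ml_exp ?qX_gt0 //.
  by have := gamma_frob ib w 'X; rewrite gammaXt.
have := ml_prime _ _ M; rewrite (negbTE U) /=; apply; last exact: ca_int.
by apply: vintB; [apply: vintX|]; exact: vint_theta.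
Qed.

Let eps_ex : exists2 eps : rat, 0 < eps <= 1 & forall k, (k < 2 * d)%N -> vge eps (ca D b k).
Proof.
elim: (2 * d)%N ss_ca => [|n IH] H; first by exists 1.
have [|e /andP [e0 e1] He] := IH; first by move=> k kn; apply: H; apply: ltnW.
have Hn := H n (ltnSn n); have [E|cn] := eqVneq (ca D b n) 0.
  exists e; first by rewrite e0 e1.
  by move=> k; rewrite ltnS leq_eqVlt => /orP [/eqP ->|/He //]; rewrite E vge0.
have wn : 0 < w (ca D b n) by move: Hn; rewrite /ml vgtE.
exists (Num.min e (w (ca D b n))); first by rewrite lt_min e0 wn ge_min e1.
move=> k; rewrite ltnS leq_eqVlt => /orP [/eqP ->|/He h].
  by rewrite vgeE // ge_min lexx orbT.
by apply: vge_le h; rewrite ge_min lexx.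
Qed.

Let act_split x : act D b x = \sum_(k < 2 * d) ca D b k * x ^+ (q ^ k) + ca D b (2 * d) * x ^+ (Q ^ 2).
Proof.
have h : (2 * size b <= (2 * d).+2)%N by rewrite (Sd ib) mulnS.
by rewrite (actE D x h) big_ord_recr /= -expnM [(d * 2)%N]mulnC.
Qed.

Let top : ca D b (2 * d) != 0 /\ w (ca D b (2 * d)) = 0.
Proof.
have [e E] := ca_top D b0; have [_ wg] : dg2 D != 0 /\ w (dg2 D) = 0 by case: iD => _ _ i2; apply: unit_w.
have l0 : iota (lead_coef b) != 0 by rewrite iota_inj0 lead_coef_eq0.
by rewrite E mulf_neq0 ?expf_neq0 // pwM ?expf_neq0 // wX // wg mulr0 addr0 const_w //; exact: const_iota.
Qed.

Let Qr : (1 : rat) < (Q ^ 2)%N%:R.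
Proof. by rewrite (ltr_nat _ 1) -expnM -[X in (X < _)%N](exp1n (d * 2)) ltn_exp2r ?q_gt1 // muln_gt0 (d_gt0 ib). Qed.

Let qge k : (1 : rat) <= (q ^ k)%:R. Proof. by rewrite (ler_nat _ 1) qX_gt0. Qed.

(* Either [b] multiplies the valuation by [Q^2], or the valuation is bounded below. *)
Let step eps x : 0 < eps <= 1 -> (forall k, (k < 2 * d)%N -> vge eps (ca D b k)) -> x != 0 -> vint x ->
  (act D b x != 0 /\ w (act D b x) = (Q ^ 2)%N%:R * w x) \/
  (eps <= (Q ^ 2)%N%:R * w x /\ vge (w x + eps / (Q ^ 2)%N%:R) (act D b x)).
Proof.
move=> /andP [e0 e1] He x0 ix; have [t0 wt] := top; have Qr' := Qr.
have wx : 0 <= w x by move: ix; rewrite /vint vgeE.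
set A := (Q ^ 2)%N%:R in Qr' *; rewrite act_split; set T := \sum_(k < _) _.
have vT : vge (eps + w x) T.
  apply: vge_sum => k _; apply: vge_le (vgeM (He k (ltn_ord k)) (vge_exp (q ^ k) (vge_w w x))).
  by have := qge k; nra.
have lx : ca D b (2 * d) * x ^+ (Q ^ 2) != 0 by rewrite mulf_neq0 // expf_neq0.
have wl : w (ca D b (2 * d) * x ^+ (Q ^ 2)) = A * w x by rewrite pwM ?expf_neq0 // wt wX // add0r.
case: (ltP (A * w x) eps) => h; [left|right; split => //].
  rewrite addrC -wl; apply: w_dom => //; rewrite wl; apply: vgt_lt vT; lra.
have A0 : 0 < A by lra.
have eA : eps / A <= w x by rewrite ler_pdivrMr // mulrC.
have eA0 : 0 < eps / A by rewrite divr_gt0.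
have eA1 : eps / A * A = eps by rewrite divfK // gt_eqF.
apply: vgeD; first by apply: vge_le vT; nra.
by rewrite vgeE // wl; have A2 : (2%:R : rat) <= A by [rewrite ler_nat -(ltr_nat rat)]; nra.
Qed.

Let lvl1 x : x != 0 -> vint x -> act D b x = 0 -> w x <= 1.
Proof.
move=> x0 ix; rewrite leNgt => xb; apply/negP => wx; move/eqP: xb; apply/negP.
have le2 : (2 * size b <= (2 * size b).+2)%N by exact: leqW (leqnSn _).
rewrite (actE D x le2) big_ord_recl expn0 expr1 ca0 Et -gammaE.
have gx : gamma b * x != 0 by rewrite mulf_neq0 // gb0.
apply: (proj1 (@w_dom _ b w _ _ gx _)); apply: vgt_sum => k _; rewrite pwM ?gb0 // pwb.
apply: (@vgt_lt _ _ w _ (0 + (q ^ (bump 0 k))%:R * w x)); last first.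
  by apply: vgeM; [exact: ca_int|apply: vge_exp; exact: vge_w].
have : (2%:R : rat) <= (q ^ (bump 0 k))%:R; last by nra.
by rewrite ler_nat -[X in (X < _)%N](exp1n (bump 0 k)) ltn_exp2r ?q_gt1.
Qed.

(** Modulo the place phi_b is a unit times tau^(2d), which is injective. *)
Lemma ss_ml k x : act D (b ^+ k) x = 0 -> ml x.
Proof.
have Vi j y : act D (b ^+ j) y = 0 -> vint y by apply: tors_int => //; rewrite expf_neq0.
elim: k x => [|k IH] x xk; first by move: xk; rewrite expr0 act1 => ->; rewrite /ml vgt0.
have ix := Vi _ _ xk; apply: contraT => nx; have [x0 wx] := unit_w ix nx.
have [t0 wt] := top; rewrite exprSr actM in xk; have := IH _ xk.
rewrite act_split; set T := \sum_(k < _) _.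
have mT : ml T by apply: ml_sum => j _; rewrite mulrC; apply: mlM; [exact: vintX|apply: ss_ca; exact: ltn_ord].
have lx : ca D b (2 * d) * x ^+ (Q ^ 2) != 0 by rewrite mulf_neq0 // expf_neq0.
have wl : w (ca D b (2 * d) * x ^+ (Q ^ 2)) = 0 by rewrite pwM ?expf_neq0 // wt wX // wx mulr0 addr0.
move=> m; have := mlB m mT; rewrite addrAC subrr add0r /ml vgtE // wl ltxx //.
Qed.

(** By [step], passing up a level divides a small valuation by exactly Q^2. A point above the
    threshold gains at least e' at each multiplication by b, yet no value exceeds 1, so it has level
    less than [K0], whence B = Q^(2 K0). *)
Lemma ss_growth : exists B : nat, forall k x, act D (b ^+ k.+1) x = 0 -> act D (b ^+ k) x != 0 ->
  w x * ((Q ^ 2) ^ k)%N%:R <= B%:R.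
Proof.
have [eps epsP He] := eps_ex; have [e0 e1] := andP epsP; have Qr' := Qr; set A := (Q ^ 2)%N in Qr' *.
have A0 : (0 : rat) < A%:R by lra.
have Vi k x : act D (b ^+ k) x = 0 -> vint x by apply: tors_int => //; rewrite expf_neq0.
pose e' := eps / A%:R; have e'0 : 0 < e' by rewrite divr_gt0.
have [K0 HK] := nat_above (1 / e'); rewrite ltr_pdivrMr // in HK.
have c1 k x : act D (b ^+ k.+1) x = 0 -> act D (b ^+ k) x != 0 -> w x <= 1.
  elim: k x => [|k IH] x xk xk0.
    have x0 : x != 0 by apply: contraNneq xk0 => ->; rewrite act0r.
    by apply: lvl1 => //; exact: (Vi _ _ xk).
  have x0 : x != 0 by apply: contraNneq xk0 => ->; rewrite act0r.
  rewrite exprSr actM in xk; rewrite exprSr actM in xk0; have le := IH _ xk xk0.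
  have y0 : act D b x != 0 by apply: contraNneq xk0 => ->; rewrite act0r.
  have ix : vint x by apply: (Vi k.+2); rewrite exprSr actM.
  have wx : 0 <= w x by move: ix; rewrite /vint vgeE.
  case: (step epsP He x0 ix) => [[_ E]|[_]]; first by rewrite E -/A in le; nra.
  by rewrite vgeE // -[eps / _]/e' => h; lra.
have c2 k x : act D (b ^+ k.+1) x = 0 -> act D (b ^+ k) x != 0 -> eps <= A%:R * w x ->
    k%:R * e' <= w (act D (b ^+ k) x).
  elim: k x => [|k IH] x xk xk0 h.
    by rewrite mul0r expr0 act1; have := Vi _ _ xk; rewrite /vint vgeE // -(act1 D x) -(expr0 b).
  have x0 : x != 0 by apply: contraNneq xk0 => ->; rewrite act0r.
  have ix : vint x := Vi _ _ xk.
  have main n : (n <= k.+1)%N -> act D (b ^+ n) x != 0 /\ w x + n%:R * e' <= w (act D (b ^+ n) x).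
    elim: n => [|n IHn] ln; first by rewrite expr0 act1 mul0r addr0.
    have [n0 le] := IHn (ltnW ln); set y := act D (b ^+ n) x in n0 le.
    have y1 : act D b y != 0.
      apply: contraNneq xk0 => E; rewrite -(subnK ln) exprD actM exprS actM -/y E act0r //.
    rewrite exprS actM -/y; split => //.
    have iy : vint y by apply: act_int.
    have wx : 0 <= w x by move: ix; rewrite /vint vgeE.
    case: (step epsP He n0 iy) => [[_ E]|[_]]; last by rewrite vgeE // -[eps / _]/e' -natr1; lra.
    have eA : e' * A%:R = eps by rewrite divfK // gt_eqF.
    have n0' : (0 : rat) <= n%:R * e' by rewrite mulr_ge0 ?ler0n // ltW.
    rewrite E -natr1 -/A; have A2 : (2%:R : rat) <= A%:R by rewrite ler_nat -(ltr_nat rat).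
    have : e' <= w x by nra.
    by nra.
  have [_ h2] := main k.+1 (leqnn _); have := Vi _ _ xk; rewrite /vint vgeE // => h1; lra.
exists (A ^ K0)%N; elim=> [|k IH] x xk xk0.
  rewrite expn0 mulr1; apply: le_trans (c1 _ _ xk xk0) _.
  by rewrite (ler_nat _ 1) expn_gt0 -(ltr_nat rat) A0.
have An j : (0 : rat) < (A ^ j)%N%:R by rewrite ltr0n expn_gt0 -(ltr_nat rat) A0.
case: (leqP k.+1 K0) => lk.
  apply: le_trans (_ : 1 * (A ^ k.+1)%N%:R <= _).
    by rewrite ler_pM2r //; apply: c1 xk xk0.
  by rewrite mul1r ler_nat leq_exp2l // -(ltr_nat rat).
have x0 : x != 0 by apply: contraNneq xk0 => ->; rewrite act0r.
have h : A%:R * w x < eps.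
  rewrite ltNge; apply/negP => h; have := c2 _ _ xk xk0 h.
  have := c1 0%N (act D (b ^+ k.+1) x); rewrite -actM -exprD add1n expr0 act1 => /(_ xk xk0).
  have : K0%:R * e' <= k.+1%:R * e' by rewrite ler_pM2r // ler_nat ltnW.
  lra.
case: (step epsP He x0 (Vi _ _ xk)) => [[y0 E]|[h' _]]; last by move: (le_lt_trans h' h); rewrite ltxx.
rewrite exprSr actM in xk; rewrite exprSr actM in xk0; have := IH _ xk xk0.
by rewrite E -/A expnS natrM mulrA [w x * _]mulrC.
Qed.
End OnePlace.
End Supersingular.

(** * Large Galois orbits and the supersingular relation *)

Section Supersingular2.
Variable X : setting.
Local Notation Fq := (sFq X).
Local Notation L := (sL X).
Local Notation iota := (siota X).
Local Notation theta := (stheta X).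
Local Notation pc := (spc X).
Local Notation q := (qq X).
Local Notation inF := (inF iota theta).
Local Notation gamma := (gammaA iota theta).
Local Notation hom := {rmorphism L -> L}.
Local Notation Cm := (Cm X).
Implicit Types (a b v M : {poly Fq}) (f g s : hom) (x y z : L) (Z : seq L).

Variables (g1 g2 c : L) (Y : seq L) (N0 : nat).
Local Notation D0 := (Dmod theta g1 g2).
Hypotheses (g20 : g2 != 0) (cc : weil_const D0 c) (Yg1 : g1 \in Y) (Yg2 : g2 \in Y) (Yc : c \in Y).
Hypothesis N0Y : forall f, fixF f -> fixY Y (hit N0 f).

Hypothesis Hmod : forall b, irreducible_poly b -> exists w : place b, exists k, model g1 g2 Y w k.
Local Notation N := (NN X N0).

Let fixYN' f : fixF f -> fixY Y (hit N f) := fixYN N0Y (f := f).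
Let fixD0 f a x : fixY Y f -> f (act D0 a x) = act D0 a (f x) := fix_act_D0 Yg1 Yg2 a x (f := f).

Variables (v : {poly Fq}) (w : place v) (kap : L) (e : nat).
Hypotheses (iv : irreducible_poly v) (mod : model g1 g2 Y w kap) (kY : KS Y kap).
Local Notation Dt := (twist kap D0).
Local Notation d := (size v).-1.
Local Notation Q := (q ^ d)%N.
Hypotheses (n2 : ~~ ml w (dg2 Dt)) (ss : ml w (ca Dt v d)) (e0 : (0 < e)%N).
Hypothesis eZ : forall z, KS Y z -> z != 0 -> exists n : int, e%:R * w z = n%:~R.

Let v0 := irr_neq0 iv.
Let k0 : kap != 0. Proof. by case: mod. Qed.
Let iD : intD w Dt. Proof. by case: mod. Qed.
Let g2t : dg2 Dt != 0. Proof. by rewrite /= mulf_neq0 // expf_neq0. Qed.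
Let fk f : fixY Y f -> f kap = kap. Proof. by case: mod => _ H _ _; apply: H. Qed.

Definition exact k x := act D0 (v ^+ k.+1) x = 0 /\ act D0 (v ^+ k) x != 0.

Let exact_hom f k x : fixY Y f -> exact k x -> exact k (f x).
Proof. by move=> fY [x1 x2]; split; rewrite -fixD0 // ?x1 ?rmorph0 // fmorph_eq0. Qed.

(** The conjugates of x over F(Y) multiply, up to sign, to an element of F(Y) of positive value,
    hence at least 1/e, while each has value at most B / Q^(2k) by [ss_growth]. So they number at
    least Q^(2k) / (e B). *)
Lemma orbit : exists2 C : nat, (0 < C)%N & forall k x, exact k x -> exists O : seq L,
  [/\ uniq O, forall y, y \in O -> exists2 g : hom, fixY Y g & y = g x &
    ((Q ^ 2) ^ k <= C * size O)%N].
Proof.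
have [B HB] := ss_growth iv (D := Dt) erefl iD n2 ss; exists (e * B.+1)%N; first by rewrite muln_gt0 e0.
move=> k x [xk xk0]; have kS := KS_subr Y; set x' := x / kap.
have [m [km mm mx sm mdiv]] := minpoly_ex kS x'.
have vk0 j : v ^+ j != 0 by rewrite expf_neq0.
have xE : x = kap * x' by rewrite mulrC divfK.
have xt : act Dt (v ^+ k.+1) x' = 0 := twist_tors k0 xk.
have xt0 : act Dt (v ^+ k) x' != 0 by apply: contraNneq xk0 => E; rewrite xE -act_twist E mulr0.
have kP : over (KS Y) (Pa Dt (v ^+ k.+1)).
  apply: Pa_over => //=.
  - by apply: (sbF kS); exact: inF_theta.
  - by apply: (sbM kS); [exact: KS_mem|exact: sbX].
  - by apply: (sbM kS); [exact: KS_mem|exact: sbX].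
have [|h kh PE] := mdiv _ kP; first by rewrite horner_Pa.
have [r rE] := closed_field_poly_normal m; rewrite (monicP mm) scale1r in rE.
have mz z : z \in r -> m.[z] = 0 by move=> zr; apply/eqP; rewrite rE -rootE root_prod_XsubC.
(* The minimal polynomial divides a torsion polynomial, whose derivative is a nonzero constant. *)
have ur : uniq r.
  apply: contraT => /not_uniq_dup [z zr zr']; exfalso.
  have := deriv_Pa Dt (v ^+ k.+1) => /(congr1 (fun p => p.[z])).
  rewrite PE rE (perm_big _ (perm_to_rem zr)) big_cons /=; set R := \prod_(j <- rem z r) _.
  have Rz : R.[z] = 0 by apply/eqP; rewrite -rootE root_prod_XsubC.
  rewrite mulrCA derivM derivXsubC mul1r hornerD !hornerM hornerXsubC hornerC Rz subrr mulr0 mul0r addr0.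
  by move=> /esym /eqP; rewrite ga_theta // (negbTE (gamma_neq0 (vk0 _))).
have conj z : z \in r -> exists2 g : hom, fixY Y g & z = g x'.
  move=> zr; have [|g [gk gx]] := extend_hom (z := x') (z' := z) kS.
    by move=> p kp px; have [h' _ ->] := mdiv p kp px; rewrite hornerM mz // mulr0.
  by exists g => //; split; [exact: fixes_subr gk|move=> y yY; apply: gk; apply: KS_mem].
have zt z : z \in r -> act Dt (v ^+ k.+1) z = 0 /\ act Dt (v ^+ k) z != 0.
  move=> /conj [g gY ->].
  have fA b y : g (act Dt b y) = act Dt b (g y).
    have [gF gy] := gY; apply: act_fix => //=; first by rewrite fix_theta.
      by rewrite rmorphM rmorphXn fk // gy.
    by rewrite rmorphM rmorphXn fk // gy.
  by rewrite -!fA xt rmorph0 fmorph_eq0.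
have z0 z : z \in r -> z != 0 by move=> /zt [_]; apply: contraNneq => ->; rewrite act0r.
have wz z : z \in r -> 0 < w z /\ w z * ((Q ^ 2) ^ k)%N%:R <= B%:R.
  move=> zr; have [z1 z2] := zt z zr; split; last exact: HB z1 z2.
  by have := ss_ml iv (D := Dt) erefl iD n2 ss z1; rewrite /ml vgtE // z0.
have sr : (0 < size r)%N.
  have : m.[x'] = 0 by []; rewrite rE; case: (r) => // /eqP; by rewrite big_nil hornerC oner_eq0.
have wm (t : seq L) : {subset t <= r} -> (\prod_(z <- t) ('X - z%:P)).[0] != 0 /\
    w (\prod_(z <- t) ('X - z%:P)).[0] = \sum_(z <- t) w z.
  elim: t => [|z t IH] sub; first by rewrite !big_nil hornerC oner_neq0 w1.
  have [|n0 E] := IH; first by move=> y yt; apply: sub; rewrite inE yt orbT.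
  have zr : z \in r by apply: sub; rewrite inE eqxx.
  have nz : - z != 0 by rewrite oppr_eq0 z0.
  rewrite !big_cons hornerM hornerXsubC sub0r; split; first exact: mulf_neq0.
  by rewrite (pwM w nz n0) wN E.
have [m0 mE] := wm r (fun _ h => h); rewrite -rE in m0 mE.
have [|n nE] := eZ _ m0; first by rewrite horner_coef0.
have A0 : (0 : rat) < ((Q ^ 2) ^ k)%N%:R by rewrite ltr0n !expn_gt0 q_gt0.
have er : (0 : rat) < e%:R by rewrite ltr0n.
have pos (t : seq L) : {subset t <= r} -> t != [::] -> 0 < \sum_(z <- t) w z.
  elim: t => // z t IH sub _; rewrite big_cons.
  have [wz0 _] : 0 < w z /\ _ := wz z (sub z (mem_head _ _)).
  have [->|tn] := eqVneq t [::]; first by rewrite big_nil addr0.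
  by apply: addr_gt0 => //; apply: IH => // y yt; apply: sub; rewrite inE yt orbT.
have bnd (t : seq L) : {subset t <= r} -> (\sum_(z <- t) w z) * ((Q ^ 2) ^ k)%N%:R <= (size t)%:R * B%:R.
  elim: t => [|z t IH] sub; first by rewrite big_nil !mul0r.
  rewrite big_cons /= mulrDl -natr1 mulrDl mul1r addrC lerD //.
    by apply: IH => y yt; apply: sub; rewrite inE yt orbT.
  by case: (wz z (sub z (mem_head _ _))).
have rn : r != [::] by rewrite -size_eq0 -lt0n.
have n1 : (1 : rat) <= e%:R * w m.[0].
  have : 0 < e%:R * w m.[0] by rewrite mulr_gt0 // mE pos.
  by rewrite nE ltr0z => n0; rewrite -[1]/(1%:~R) ler_int.
exists [seq kap * z | z <- r]; split.
- by rewrite map_inj_uniq //; exact: mulfI.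
- move=> y /mapP [z /conj [g gY ->] ->]; exists g => //.
  by rewrite xE rmorphM fk.
rewrite size_map -(ler_nat rat) -mulnA natrM; have := bnd r (fun _ h => h); rewrite -mE => H.
apply: le_trans (_ : e%:R * ((size r)%:R * B%:R) <= _); last first.
  by rewrite ler_pM2l // -natrM ler_nat mulnC leq_mul.
apply: le_trans (_ : e%:R * (w m.[0] * ((Q ^ 2) ^ k)%N%:R) <= _); last by rewrite ler_pM2l.
by rewrite mulrA -{1}[_%:R]mul1r ler_pM2r.
Qed.

Let gv : ga D0 v != 0. Proof. by rewrite ga_theta // gamma_neq0. Qed.
Let CE : CD D0 = Cm. Proof. by []. Qed.

Let Tlist k : exists2 t, tlist D0 (v ^+ k) t & size t = ((Q ^ 2) ^ k)%N.
Proof.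
have vk : v ^+ k != 0 by rewrite expf_neq0.
have [||t [ut st tE]] := @tors_ex _ D0 (v ^+ k) vk.
- by rewrite ga_theta // gamma_neq0.
- by rewrite /= g20.
exists t => //; rewrite st /rk /= (negbTE g20) size_exp_pred // -!expnM; congr (_ ^ _)%N; ring.
Qed.

(* Few elements of [phi[v^(k+1)]] pair with [x] into a small subgroup. *)
Let far_conj C : (0 < C)%N -> (forall k x, exact k x -> exists O : seq L,
  [/\ uniq O, forall y, y \in O -> exists2 g : hom, fixY Y g & y = g x &
    ((Q ^ 2) ^ k <= C * size O)%N]) ->
  let r := (C * Q ^ 2)%N in forall k x, (r <= k.+1)%N -> exact k x -> exists2 g : hom, fixY Y g &
    weil D0 (v ^+ k.+1) x (act D0 (v ^+ (k.+1 - r)) (g x)) != 0.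
Proof.
move=> C0 HO r k x rk [xk xk0]; have [O [uO Og sO]] := HO k x (conj xk xk0).
have [c0 cE] := cc.
apply: contrapT => H; have H' y : y \in O -> weil D0 (v ^+ k.+1) x (act D0 (v ^+ (k.+1 - r)) y) = 0.
  by move=> /Og [g gY ->]; apply/eqP; apply: contrapT => /negP ne; apply: H; exists g.
have [t [ut tE] st] := Tlist (k.+1 - r).
have sub : {subset O <= [seq act D0 h x + u | h <- polys X (r * d), u <- t]}.
  move=> y yO; have [g gY yE] := Og y yO.
  have yk : act D0 (v ^+ k.+1) y = 0 by rewrite yE -fixD0 // xk rmorph0.
  have zk : act D0 (v ^+ k.+1) (act D0 (v ^+ (k.+1 - r)) y) = 0 by rewrite actCA yk act0r.
  have [e' e'E] := weil_perp (D := D0) iv g20 gv c0 cE xk xk0 zk (H' y yO).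
  have : act D0 (v ^+ r * e') x = 0.
    by rewrite actM -e'E -actM -exprD subnKC.
  move=> /(order_dvd iv xk xk0); rewrite -{1}(subnKC rk) exprD dvdp_mul2l ?expf_neq0 // => /dvdpP [h hE].
  pose h' := h %% v ^+ r.
  apply/allpairsP; exists (h', y - act D0 h' x); split => /=; last by rewrite addrC subrK.
    by rewrite mem_polys -ltnS -size_vk // ltn_modp expf_neq0.
  rewrite tE actBr e'E hE actM actCA -actBr -actBl actCA -(actM D0 _ (v ^+ _)).
  have -> : h - h' = (h %/ v ^+ r) * v ^+ r by rewrite {1}(divp_eq h (v ^+ r)) addrK.
  by rewrite -mulrA -exprD subnKC // actM xk act0r.
have := uniq_leq_size uO sub; rewrite size_allpairs size_polys st => le.
have Q1 : (1 < Q)%N := Q_gt1 iv.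
have Q2 : (0 < Q ^ 2)%N by rewrite expn_gt0 qX_gt0.
have h1 : ((Q ^ 2) ^ k.+1 <= r * size O)%N.
  by rewrite /r expnS mulnC -mulnA [(Q ^ 2 * size O)%N]mulnC mulnA leq_mul2r (leq_trans sO) ?orbT.
have h2 : ((Q ^ 2) ^ k.+1 = q ^ (r * d) * (q ^ (r * d) * (Q ^ 2) ^ (k.+1 - r)))%N.
  rewrite -{1}(subnKC rk) expnD mulnA; congr (_ * _)%N.
  by rewrite -!expnM -expnD; congr (_ ^ _)%N; ring.
have A0 : (0 < q ^ (r * d) * (Q ^ 2) ^ (k.+1 - r))%N by rewrite muln_gt0 qX_gt0 expn_gt0 Q2.
have : (q ^ (r * d) * (q ^ (r * d) * (Q ^ 2) ^ (k.+1 - r)) <= r * (q ^ (r * d) * (Q ^ 2) ^ (k.+1 - r)))%N.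
  by rewrite -h2; apply: leq_trans h1 _; rewrite leq_mul2l le orbT.
rewrite leq_pmul2r // => h3; have := ltn_expl r Q1; rewrite -expnM [(d * r)%N]mulnC => h4.
by move: (leq_trans h4 h3); rewrite ltnn.
Qed.

(** The torsion of one level is finite, so a single Carlitz level serves all its points in
    [Kt Y]. *)
Let KM_uniform k : exists2 M, M != 0 & forall x, Kt Y x -> act D0 (v ^+ k) x = 0 -> KM Y M x.
Proof.
have [t [ut tE] _] := Tlist k.
suff [M M0 H] : exists2 M, M != 0 & forall x, x \in t -> Kt Y x -> KM Y M x.
  by exists M => // x Kx xk; apply: H => //; rewrite tE xk.
elim: {ut tE} t => [|x t [M M0 IH]]; first by exists 1; rewrite ?oner_neq0.
case: (pselect (Kt Y x)) => [[M' M'0 H']|nK]; last first.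
  by exists M => // y; rewrite inE => /orP [/eqP -> //|yt]; apply: IH.
exists (M * M'); first by rewrite mulf_neq0.
move=> y; rewrite inE => /orP [/eqP -> _|yt Ky] f f' fF fF' h1 h2.
  by apply: H' => // z zM; apply: h2; rewrite actM zM act0r.
by apply: (IH y yt Ky) => // z zM; apply: h2; rewrite mulrC actM zM act0r.
Qed.

Lemma Kt_act h x : Kt Y x -> Kt Y (act D0 h x).
Proof.
move=> [M M0 Kx]; exists M => // f1 f2 f1F f2F h1 h2.
have fA f3 : fixF f3 -> f3 (act D0 h x) = act (Dmod theta (f3 g1) (f3 g2)) h (f3 x).
  by move=> f3F; rewrite act_hom /= ?fix_theta // => e'; apply: fix_iota.
by rewrite !fA // (Kx f1 f2) // !(h1 _ Yg1) !(h1 _ Yg2).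
Qed.

Let hit_commA f n h y : fixY Y f -> hit n f (act D0 h y) = act D0 h (hit n f y).
Proof. by move=> fY; apply: fixD0; apply: fixY_hit. Qed.

(** The r + 1 images of the orbit under A^(r-l) S^(2l) lie in a module of at most r times its size,
    so two of them meet: A^l g x = S^(2l) g' x with 0 < l <= r. It remains to remove g and g', by
    showing that their N-th powers agree on a multiple of x. *)
Lemma T_ss : exists lm : nat, (forall k, exists2 x, Kt Y x & exact k x) -> forall j, exists K, exists2 x, Kt Y x &
  exact j x /\ forall (sg : hom) a, fixF sg -> ~~ (v %| a) -> (forall z, act Cm (v ^+ K) z = 0 -> sg z = act Cm a z) ->
  exists l, [/\ (0 < l)%N, (l <= lm)%N & hit (2 * l * N) (hit N sg) x = act D0 ((a ^+ N) ^+ (l * N)) x].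
Proof.
have [C C0 HO] := orbit; pose r := (C * Q ^ 2)%N; exists r => Hall j.
have [M M0 HM] := KM_uniform j.+1; have [m [M1 [ME nM1]]] := vpart iv M0.
have M10 : M1 != 0 by apply: contraNneq nM1 => ->; rewrite dvdp0.
(* The summand r absorbs the loss in [far_conj] and m the v-part of the Carlitz level M; the
   multiple [x0] of x then has the wanted level j. *)
pose k := (r + m + j)%N; have [x Kx ex] := Hall k; have [xk xk0] := ex.
pose x0 := act D0 (v ^+ (k - j)) x; have jk : (j <= k)%N by rewrite leq_addl.
have Kx0 : Kt Y x0 by apply: Kt_act.
have ex0 : exact j x0.
  by rewrite /exact /x0 -!actM -!exprD addSn subnKC.
exists k.+1, x0 => //; split => // sg a sF va sa.
have SY : fixY Y (hit N sg) := fixYN' sF.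
have rk : (r <= k.+1)%N by rewrite /k -addnA -addnS leq_addr.
have [g0 g0Y W0] := far_conj C0 HO rk ex.
have [c0 cE] := cc; have vk0 : v ^+ k.+1 != 0 by rewrite expf_neq0.
have [O [uO Og sO]] := HO k x ex.
set A := a ^+ N; have vA : ~~ (v %| A) by apply: ndvd_exp.
have A_inj i y : act D0 (v ^+ k.+1) y = 0 -> act D0 (A ^+ i) y = 0 -> y = 0.
  apply: act_coprime0; apply: coprimep_expl; apply: irr_coprime => //; exact: ndvd_exp.
pose phi (l : nat) y := act D0 (A ^+ (r - l)) (hit (2 * l) (hit N sg) y).
have Vh f y n : fixY Y f -> act D0 (v ^+ k.+1) y = 0 -> act D0 (v ^+ k.+1) (hit n f y) = 0.
  by move=> fY yk; rewrite -hit_commA // yk rmorph0.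
have Ok y : y \in O -> act D0 (v ^+ k.+1) y = 0 by move=> /Og [g gY ->]; rewrite -fixD0 // xk rmorph0.
have phi_inj l : {in O &, injective (phi l)}.
  move=> y y' yO yO' E; apply/eqP; rewrite -subr_eq0; apply/eqP; apply: (fmorph_inj (hit (2 * l) (hit N sg))).
  rewrite rmorph0; apply: (A_inj (r - l)%N); first by apply: (Vh) => //; rewrite actBr !Ok // subrr.
  by rewrite rmorphB actBr -/(phi l y) E subrr.
have [t [ut tE] st] := Tlist k.+1.
have [l [y1 [y2 [l0 lr y1O y2O Ey]]]] : exists l y1 y2, [/\ (0 < l)%N, (l <= r)%N, y1 \in O, y2 \in O &
    act D0 (A ^+ l) y1 = hit (2 * l) (hit N sg) y2].
  pose big := [seq phi l y | l <- seq.iota 0 r.+1, y <- O].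
  have sz : size big = (r.+1 * size O)%N by rewrite size_allpairs size_iota.
  have nub : ~~ uniq big.
    apply/negP => ub; have sub : {subset big <= t}.
      move=> z /allpairsP [[l y] [_ yO ->]]; rewrite tE /phi actCA Vh ?act0r //; exact: Ok.
    have := uniq_leq_size ub sub; rewrite sz st; apply/negP; rewrite -ltnNge.
    have Ogt : (0 < size O)%N.
      by rewrite lt0n; apply: contraTneq sO => ->; rewrite muln0 leqNgt expn_gt0 expn_gt0 qX_gt0.
    have h1 : ((Q ^ 2) ^ k.+1 <= r * size O)%N.
      by rewrite /r expnS mulnC -mulnA [(Q ^ 2 * size O)%N]mulnC mulnA leq_mul2r (leq_trans sO) ?orbT.
    by apply: leq_ltn_trans h1 _; rewrite ltn_pmul2r.
  have main l1 l2 z1 z2 : (l1 < l2)%N -> (l2 <= r)%N -> z1 \in O -> z2 \in O -> phi l1 z1 = phi l2 z2 ->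
      act D0 (A ^+ (l2 - l1)) z1 = hit (2 * (l2 - l1)) (hit N sg) z2.
    move=> l12 l2r z1O z2O E; apply/eqP; rewrite -subr_eq0; apply/eqP; apply: (fmorph_inj (hit (2 * l1) (hit N sg))).
    rewrite rmorph0; have e1 : (2 * l1 + 2 * (l2 - l1) = 2 * l2)%N by rewrite -mulnDr subnKC // ltnW.
    have e2 : hit (2 * l1) (hit N sg) (hit (2 * (l2 - l1)) (hit N sg) z2) = hit (2 * l2) (hit N sg) z2.
      by rewrite !hitE -iterD e1.
    apply: (A_inj (r - l2)%N).
      by apply: (Vh) => //; rewrite actBr actCA Ok // act0r Vh ?subrr //; apply: Ok.
    rewrite rmorphB actBr e2 -/(phi l2 z2) -E /phi hit_commA // -actM -exprD.
    by rewrite addnBA ?(ltnW l12) // subnK // subrr.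
  case: (pselect (exists l1 l2 z1 z2, [/\ (l1 < l2)%N, (l2 <= r)%N, z1 \in O, z2 \in O & phi l1 z1 = phi l2 z2])).
    move=> [l1 [l2 [z1 [z2 [l12 l2r z1O z2O E]]]]]; exists (l2 - l1)%N, z1, z2; split => //.
    - by rewrite subn_gt0.
    - by rewrite (leq_trans (leq_subr _ _)).
    - exact: main.
  move=> no; case/negP: nub; apply: allpairs_uniq => //; first exact: iota_uniq.
  move=> [l1' z1'] [l2' z2'] /allpairsP [[l1 z1] [l1r z1O [-> ->]]] /allpairsP [[l2 z2] [l2r z2O [-> ->]]].
  have {}l1r : (l1 <= r)%N by move: l1r; rewrite mem_iota.
  have {}l2r : (l2 <= r)%N by move: l2r; rewrite mem_iota.
  move=> E; have {}E : phi l1 z1 = phi l2 z2 := E.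
  case: (ltngtP l1 l2) => [lt|gt|E'].
  - by case: no; do 4!eexists; split; [exact: lt|exact: l2r|exact: z1O|exact: z2O|exact: E].
  - by case: no; do 4!eexists; split; [exact: gt|exact: l1r|exact: z2O|exact: z1O|exact: (esym E)].
  by rewrite E' in E *; have <- : z1 = z2 by exact: (phi_inj l2).
have [g gY y1E] := Og y1 y1O; have [g' g'Y y2E] := Og y2 y2O.
have [gF _] := gY; have [g'F _] := g'Y; have [SF _] := SY.
have [b1 [_ b1E]] := hom_carl iv k.+1 gF; have [b2 [_ b2E]] := hom_carl iv k.+1 g'F.
have SE n z : act Cm (v ^+ k.+1) z = 0 -> hit n (hit N sg) z = act Cm (A ^+ n) z.
  have SC z' (zk : act Cm (v ^+ k.+1) z' = 0) : (hit N sg) z' = act Cm A z' := hit_carl N sF sa zk.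
  exact: (hit_carl n SF SC).
have comm f f' y : fixY Y f -> fixY Y f' -> Kt Y y -> f (f' y) = f' (f y) by apply: Kt_comm.
pose W := weil D0 (v ^+ k.+1); pose om := W x (g0 x) / c.
have g0x : act D0 (v ^+ k.+1) (g0 x) = 0 by rewrite -fixD0 // xk rmorph0.
have omA h : act Cm h om = W x (act D0 h (g0 x)) / c.
  by rewrite -CE /om (weil_carl h c0 cE xk g0x) weil_act.
have om1 : act Cm (v ^+ k.+1) om = 0 by rewrite omA g0x /W weil0r mul0r.
have homW f : fixY Y f -> f om = W (f x) (f (g0 x)) / c.
  move=> [fF fy]; rewrite /om fmorph_div (fy c) // (weil_hom _ _ _ (fun e => fix_iota e fF)) //=.
  - exact: fix_theta.
  - exact: fy.
  - exact: fy.
(* Pairing the collision with its translate by [g0] gives A^(2l) g' om = A^(2l) g om, since S^(2l)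
   is A^(2l) on this Carlitz torsion. By [far_conj] the order of [om] is at least v^m, so g and g'
   have the same character on C[v^m]. *)
have agree : forall z, act Cm (v ^+ m) z = 0 -> g z = g' z.
  pose f1 := hcomp (hit (2 * l) (hit N sg)) g'; have f1Y : fixY Y f1 by apply: fixY_comp => //; apply: fixY_hit.
  have f1x : f1 x = act D0 (A ^+ l) (g x) by rewrite hcompE -y2E -Ey y1E.
  have f1g0 : f1 (g0 x) = act D0 (A ^+ l) (g (g0 x)).
    by rewrite (comm f1 g0 x f1Y g0Y Kx) f1x fixD0 // (comm g g0 x gY g0Y Kx).
  have gxk : act D0 (v ^+ k.+1) (g x) = 0 by rewrite -fixD0 // xk rmorph0.
  have gg0k : act D0 (v ^+ k.+1) (g (g0 x)) = 0 by rewrite -fixD0 // g0x rmorph0.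
  have E1 : f1 om = act Cm (A ^+ (2 * l)) (g om).
    rewrite (homW f1 f1Y) (homW g gY) f1x f1g0 -CE (weil_carl _ c0 cE gxk gg0k).
    rewrite mul2n -addnn exprD actM; congr (_ / _); rewrite /W.
    by symmetry; apply: weil_act => //; rewrite actCA gxk act0r.
  have gom : act Cm (v ^+ k.+1) (g om) = 0 by rewrite -act_Cm // om1 rmorph0.
  have g'om : act Cm (v ^+ k.+1) (g' om) = 0 by rewrite -act_Cm // om1 rmorph0.
  have E2 : act Cm (b1 - b2) om = 0.
    rewrite actBl -b1E // -b2E //.
    have vA2 : coprimep (v ^+ k.+1) (A ^+ (2 * l)).
      by apply: coprimep_expl; apply: irr_coprime => //; exact: ndvd_exp.
    apply: (act_coprime0 (D := Cm) vA2); first by rewrite actBr gom g'om subrr.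
    by rewrite actBr -E1 hcompE SE // subrr.
  have om0 : om != 0.
    apply: contraNneq W0 => E; have := omA (v ^+ (k.+1 - r)); rewrite E act0r => /esym /eqP.
    by rewrite mulf_eq0 invr_eq0 (negbTE c0) orbF.
  have [i [ik i1 i0]] := ex_order om0 om1.
  have mi : (m <= i.+1)%N.
    rewrite leqNgt; apply/negP => lt; move/eqP: W0; apply.
    have : act Cm (v ^+ (k.+1 - r)) om = 0.
      have ki : (i.+1 <= k.+1 - r)%N by apply: leq_trans (ltnW lt) _; rewrite leq_subRL // ltnW // ltnS /k leq_addr.
      by rewrite -(subnK ki) exprD actM i1 act0r.
    by rewrite omA => /eqP; rewrite mulf_eq0 invr_eq0 (negbTE c0) orbF => /eqP h; exact: h.
  have dv : v ^+ m %| b1 - b2.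
    by apply: dvdp_trans (order_dvd iv i1 i0 E2); apply: dvdp_exp2l.
  have mk : (m <= k.+1)%N by rewrite /k; apply: leqW; rewrite -addnA addnCA leq_addr.
  move=> z zm; have zk : act Cm (v ^+ k.+1) z = 0 by rewrite -(subnK mk) exprD actM zm act0r.
  by rewrite b1E // b2E //; apply: act_eqmod dv zm.
have Kx0M := HM x0 Kx0 ex0.1.
have cpM : coprimep M1 (v * v ^+ m).
  by rewrite -exprS coprimep_sym; apply: coprimep_expl; apply: irr_coprime.
have out f : fixF f -> _ := fun fF => outer g20 cc Yg1 Yg2 Yc N0Y Hmod j.+1 iv fF M10 (expf_neq0 m v0) cpM.
have [o [oY o1 o2 o3]] := out g gF; have [o' [o'Y o'1 o'2 o'3]] := out g' g'F.
(* On Carlitz torsion prime to v the two N-th powers are equalised by composing with maps from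
   [outer], which fix [x0]. *)
have Ngg : hit N g x0 = hit N g' x0.
  have := Kx0M (hcomp (hit N g) o') (hcomp (hit N g') o); rewrite !hcompE o3 ?o'3 ?(proj1 ex0) //; apply.
  - by apply: fixes_hcomp; [apply: fixes_hit|case: o'Y].
  - by apply: fixes_hcomp; [apply: fixes_hit|case: oY].
  - by move=> y yY; rewrite !hcompE (oY.2 y yY) (o'Y.2 y yY) (fixY_hit N gY).2 // (fixY_hit N g'Y).2.
  move=> z; rewrite ME => zM.
  have cp2 : coprimep (v ^+ m) M1 by apply: coprimep_expl; apply: irr_coprime.
  have [z1 [z2 [-> z1m z2M]]] := tors_split cp2 zM; rewrite !rmorphD !hcompE; congr (_ + _).
    rewrite o2 // o'2 //; elim: (N) => //= n ->.
    by apply: agree; rewrite -act_Cm ?z1m ?rmorph0 //; exact: fixes_hit.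
  rewrite o1 // o'1 //; apply: (carl_comm _ _ M10 z2M); exact: fixes_hit.
have rel0 : act D0 (A ^+ l) (g x0) = hit (2 * l) (hit N sg) (g' x0).
  by rewrite /x0 (fixD0 _ _ gY) (fixD0 _ _ g'Y) hit_commA // -y2E -Ey y1E actCA.
(* All these maps commute on [Kt Y], so the relation can be iterated; at n = N the powers of g and
   g' cancel. *)
have reln n : act D0 (A ^+ (l * n)) (hit n g x0) = hit (2 * l * n) (hit N sg) (hit n g' x0).
  elim: n => [|n IH]; first by rewrite !muln0 expr0 act1.
  have hS2 n' : fixY Y (hit n' (hit N sg)) by apply: fixY_hit.
  have hg' : fixY Y (hit n g') by apply: fixY_hit.
  rewrite mulnS exprD actM /= -(fixD0 _ _ gY) IH (comm g (hit (2 * l * n) (hit N sg))) //; last exact: Kt_fixY.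
  rewrite (comm g (hit n g')) // -(hit_commA _ _ _ SY) -(hit_commA _ _ _ g'Y) rel0.
  rewrite -(comm (hit (2 * l) (hit N sg)) (hit n g')) //; last exact: Kt_fixY.
  rewrite -(comm g' (hit n g')) // mulnS !hitE iterD -!hitE.
  by apply: comm => //; do 2!apply: Kt_fixY => //.
exists l; split => //; have := reln N; rewrite Ngg => E.
have hN : fixY Y (hit N g') by apply: fixY_hit.
apply: (fmorph_inj (hit N g')); rewrite (hit_commA N _ _ g'Y) [RHS]E.
by rewrite (comm (hit N g') (hit (2 * l * N) (hit N sg))) //; apply: fixY_hit.
Qed.
End Supersingular2.

(** * Existence of ordinary places *)

Section Ordinary.
Variable X : setting.
Local Notation Fq := (sFq X).
Local Notation L := (sL X).
Local Notation iota := (siota X).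
Local Notation theta := (stheta X).
Local Notation pc := (spc X).
Local Notation q := (qq X).
Local Notation inF := (inF iota theta).
Local Notation gamma := (gammaA iota theta).
Local Notation hom := {rmorphism L -> L}.
Implicit Types (a M : {poly Fq}) (x y z : L) (Y Z : seq L).

Lemma place_pull b (w : place b) (f : hom) : fixF f -> {w' : place b | forall x, w' x = w (f x)}.
Proof.
move=> fF; unshelve eexists (@Place X b (fun x => w (f x)) _ _ _ _); last by [].
- by move=> x y x0 y0 /=; rewrite rmorphM pwM ?fmorph_eq0.
- by move=> x y x0 y0 xy0 /=; rewrite rmorphD; apply: pwU; rewrite -?rmorphD fmorph_eq0.
- by rewrite /= fix_gamma // pwb.
- by move=> a ba /=; rewrite fix_gamma // pwA.
Qed.

Lemma avoid (T : eqType) (g : nat -> T) (R : seq T) : injective g -> exists n, g n \notin R.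
Proof.
move=> ginj; apply: contrapT => H.
have sub : {subset [seq g n | n <- seq.iota 0 (size R).+1] <= R}.
  by move=> y /mapP [n _ ->]; apply: contraT => h; case: H; exists n.
have u : uniq [seq g n | n <- seq.iota 0 (size R).+1] by rewrite map_inj_uniq // iota_uniq.
by have := uniq_leq_size u sub; rewrite size_map size_iota ltnn.
Qed.

Lemma theta_pow_inj : injective (fun n => theta ^+ n).
Proof.
move=> m n /= E; have : gamma ('X^m - 'X^n) = 0 by rewrite gammaB !gammaXn gammaXt E subrr.
move/strans => /eqP; rewrite subr_eq0 => /eqP /(congr1 (fun p : {poly Fq} => size p)).
by rewrite !size_polyXn => -[].
Qed.

(** The primitive element argument, phrased through homomorphisms so that inseparability does no
    harm: some power of theta avoids the finitely many ratios of differences of conjugates. *)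
Lemma primitive_ex (zs : seq L) : exists al, forall f g : hom, fixF f -> fixF g -> f al = g al ->
  forall z, z \in zs -> f z = g z.
Proof.
elim: zs => [|z zs [al IH]]; first by exists 0.
have [Z cZ sZ] := clos_ex [:: al; z].
pose R := [seq (u.1 - u.2) / (v.1 - v.2) | u <- [seq (y, y') | y <- Z, y' <- Z], v <- [seq (y, y') | y <- Z, y' <- Z]].
have [n nR] := avoid R theta_pow_inj.
exists (al + theta ^+ n * z) => f g fF gF; rewrite !rmorphD !rmorphM !rmorphXn !fix_theta // => E.
have [alZ zZ] : al \in Z /\ z \in Z by split; apply: sZ; rewrite !inE eqxx ?orbT.
have fz : f z = g z.
  apply/eqP; apply: contraNT nR => ne; have d0 : g z - f z != 0 by rewrite subr_eq0 eq_sym.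
  have -> : theta ^+ n = (f al - g al) / (g z - f z).
    apply: (mulIf d0); rewrite divfK // mulrBr; apply/eqP; rewrite subr_eq addrAC eq_sym subr_eq.
    by rewrite E addrC.
  apply/allpairsP; exists ((f al, g al), (g z, f z)); split => //;
    by apply: (@allpairs_f _ _ _ (fun y y' => (y, y'))); apply: cZ.
have fal : f al = g al by move: E; rewrite fz => /addIr.
by move=> y; rewrite inE => /orP [/eqP ->|/IH]; [|apply].
Qed.

Lemma denominator (g : {poly L}) : over inF g -> exists2 D : {poly Fq}, D != 0 &
  forall b (ib : irreducible_poly b) (w : place b), ~~ (b %| D) -> intp w g.
Proof.
move=> kg; have H n : exists2 D : {poly Fq}, D != 0 &
    forall b (ib : irreducible_poly b) (w : place b), ~~ (b %| D) -> forall i, (i < n)%N -> vint w g`_i.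
  elim: n => [|n [D D0 IH]]; first by exists 1; rewrite ?oner_neq0.
  have [a1 [a2 [a20 E]]] := kg n; exists (D * a2); first by rewrite mulf_neq0.
  move=> b ib w nb i; rewrite ltnS leq_eqVlt => /orP [/eqP ->|]; last first.
    by apply: (IH b ib w); apply: contra nb => h; rewrite dvdp_mulr.
  have n2 : ~~ (b %| a2) by apply: contra nb => h; rewrite dvdp_mull.
  by rewrite E; apply: vintM; [exact: vint_gamma|apply: vintV; rewrite ?vint_gamma ?ml_gamma].
have [D D0 HD] := H (size g); exists D => // b ib w nb i.
by have [l|l] := ltnP i (size g); [exact: (HD b ib w)|rewrite nth_default // vint0].
Qed.

(** Euclid's argument: at a = N_0 B X^(s+1) the value is N_0 times a polynomial congruent to 1
    modulo B, any prime factor of which will do. The exponent s avoids the roots of (N - N_0)/X,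
    which makes that polynomial nonconstant. If N_0 = 0, take a = 0. *)
Lemma prime_value (N : {poly {poly Fq}}) (B : {poly Fq}) : (1 < size N)%N -> B != 0 ->
  exists b a, [/\ irreducible_poly b, ~~ (b %| B) & b %| N.[a]].
Proof.
move=> sN B0; pose N' := \poly_(i < (size N).-1) N`_i.+1 : {poly {poly Fq}}.
have sN' : N' != 0.
  apply/eqP => E; have := congr1 (fun p : {poly {poly Fq}} => p`_(size N).-2) E; rewrite coef_poly coef0.
  have -> : ((size N).-2 < (size N).-1)%N by case: (size N) sN => [|[]].
  have -> : ((size N).-2.+1 = (size N).-1)%N by case: (size N) sN => [|[]].
  by rewrite -lead_coefE => /eqP; rewrite lead_coef_eq0 -size_poly_eq0; case: (size N) sN.
have NE a : N.[a] = N'.[a] * a + N`_0.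
  rewrite !horner_coef (_ : size N = (size N).-1.+1); last by rewrite prednK // ltnW.
  rewrite big_ord_recl expr0 mulr1 addrC /=; congr (_ + _).
  rewrite -horner_coef horner_poly mulr_suml; apply: eq_bigr => i _.
  by rewrite /bump /= add1n exprSr mulrA.
have [n00|n00] := eqVneq (N`_0) 0.
  have [b ib bB] : exists2 b, irreducible_poly b & b %| 'X * B + 1.
    apply: irr_factor; rewrite size_polyDl mulrC size_mulX // ?size_poly1 ltnS size_poly_gt0 //.
  exists b, 0; split => //; last by rewrite NE n00 mulr0 addr0 dvdp0.
  apply/negP => bd; have : b %| 1 by rewrite -(addKr ('X * B) 1) addrC dvdp_sub ?dvdp_mull // addrC.
  by rewrite dvdp1 => /eqP sb; case: ib; rewrite sb.
have ainj : injective (fun s => N`_0 * B * 'X^(s.+1) : {poly Fq}).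
  move=> s s' /= E; have /(congr1 (fun p : {poly Fq} => size p)) := mulfI (mulf_neq0 n00 B0) E.
  by rewrite !size_polyXn => -[].
have [s0 Hs] : exists s0 : seq {poly Fq}, forall y : {poly Fq}, N'.[y] = 0 -> y \in s0.
  have [n le] : exists n, forall s : seq {poly Fq}, uniq s -> all (root N') s -> (size s < n)%N.
    by exists (size N') => s us rs; apply: max_poly_roots.
  apply: contrapT => H.
  have build k : exists s : seq {poly Fq}, [/\ uniq s, all (root N') s & size s = k].
    elim: k => [|k [s [us rs ss]]]; first by exists [::].
    have /existsNP [y /not_implyP [y0 ys]] : ~ forall y : {poly Fq}, N'.[y] = 0 -> y \in s by move=> h; apply: H; exists s.
    by exists (y :: s); split; rewrite /= ?us ?rs ?ss ?andbT ?rootE ?y0 ?eqxx //; apply/negP.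
  by have [s [us rs ss]] := build n; have := le s us rs; rewrite ss ltnn.
have [s ns] := avoid s0 ainj; set a := N`_0 * B * 'X^(s.+1) in ns.
have N'a : N'.[a] != 0 by apply: contra ns => /eqP /Hs.
pose U := B * 'X^(s.+1) * N'.[a] + 1.
have U1 : N.[a] = N`_0 * U by rewrite NE /U /a; ring.
have sU : (1 < size U)%N.
  have p0 : B * N'.[a] * 'X^s != 0 by rewrite !mulf_neq0 // -size_poly_gt0 size_polyXn.
  rewrite /U (_ : B * _ * _ = (B * N'.[a] * 'X^s) * 'X); last by rewrite exprSr; ring.
  by rewrite size_polyDl size_mulX // ?size_poly1 ltnS size_poly_gt0 //.
have [b ib bU] := irr_factor sU; exists b, a; split => //; last by rewrite U1 dvdp_mull.
apply/negP => bB; have : b %| 1.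
  by rewrite (_ : 1 = U - B * 'X^(s.+1) * N'.[a]) ?dvdp_sub // ?dvdp_mulr // /U addrC addKr.
by rewrite dvdp1 => /eqP sb; case: ib; rewrite sb.
Qed.

Lemma monic_irr (b : {poly Fq}) : irreducible_poly b -> exists b' : {poly Fq}, [/\ irreducible_poly b', b' \is monic & b' %= b].
Proof.
move=> ib; have b0 := irr_neq0 ib; have l0 : (lead_coef b)^-1 != 0 by rewrite invr_eq0 lead_coef_eq0.
exists ((lead_coef b)^-1 *: b); split; last exact: eqp_scale.
- split; first by rewrite size_scale //; case: ib.
  move=> c sc; rewrite dvdpZr // => cb; have [_ H] := ib; rewrite eqp_sym.
  by apply: eqp_trans (eqp_scale _ l0) _; rewrite eqp_sym; apply: H.
- by rewrite monicE lead_coefZ mulVf // lead_coef_eq0.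
Qed.

(** Let b divide a value at a in A of the minimal polynomial of a primitive element [al],
    denominators cleared. Some conjugate of [al] is then congruent to a, and pulling a place back
    along the corresponding map gives [al] a residue in A/b. The elements z are radicial over F(al),
    hence the passage through p^j-th powers. *)
Lemma residual (zs : seq L) (bad : {poly Fq}) : bad != 0 -> exists b (ib : irreducible_poly b) (w : place b),
  [/\ b \is monic, ~~ (b %| bad) & forall z, z \in zs -> vint w z ->
    red ib w z ^+ (q ^ (size b).-1) = red ib w z].
Proof.
move=> bad0; have [al alP] := primitive_ex zs; have kS := subr_inF X; have kS' := adj_subr kS al.
have [m [km mm ma sm mdiv]] := minpoly_ex kS al.
have [Dm Dm0 HDm] := denominator km.
have [Dz Dz0 HDz] : exists2 Dz : {poly Fq}, Dz != 0 & forall z, z \in zs -> exists j (g : {poly L}),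
    [/\ over inF g, z ^+ (pc ^ j) = g.[al] & forall b (ib : irreducible_poly b) (w : place b), ~~ (b %| Dz) -> intp w g].
  have : forall z, z \in zs -> exists j (g : {poly L}), over inF g /\ z ^+ (pc ^ j) = g.[al].
    move=> z zz; have [|j [g kg E]] := fix_pinsep (c := z) kS'.
      move=> f fk; apply: (alP f (hid X)) => //; first exact: (fixes_subr kS').
      by apply: fk; apply: (adj_z kS).
    by exists j, g.
  elim: (zs) => [|z zs' IH] H; first by exists 1; rewrite ?oner_neq0.
  have [|D D0 HD] := IH; first by move=> y yz; apply: H; rewrite inE yz orbT.
  have [j [g [kg E]]] := H z (mem_head _ _); have [D' D'0 HD'] := denominator kg.
  exists (D * D'); first by rewrite mulf_neq0.
  move=> y; rewrite inE => /orP [/eqP ->|/HD [j' [g' [kg' E' H']]]].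
    by exists j, g; split => // b ib w nb; apply: (HD' b ib); apply: contra nb => h; rewrite dvdp_mull.
  by exists j', g'; split => // b ib w nb; apply: (H' b ib); apply: contra nb => h; rewrite dvdp_mulr.
have [DD DD0 [N NE]] : exists2 DD : {poly Fq}, DD != 0 & exists N : {poly {poly Fq}}, size N = size m /\ forall a, gamma N.[a] = gamma DD * m.[gamma a].
  have Hn n : exists2 DD : {poly Fq}, DD != 0 & exists nn : nat -> {poly Fq}, forall i, (i < n)%N -> gamma (nn i) = gamma DD * m`_i.
    elim: n => [|n [D D0 [nn Hnn]]]; first by exists 1; rewrite ?oner_neq0 //; exists (fun=> 0).
    have [a1 [a2 [a20 E]]] := km n; exists (D * a2); first by rewrite mulf_neq0.
    exists (fun i => if (i == n)%N then D * a1 else nn i * a2) => i; rewrite ltnS leq_eqVlt.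
    case: eqP => [-> _|_ /= l]; last by rewrite !gammaM Hnn // mulrAC.
    by rewrite E !gammaM -mulrA [_ * (_ / _)]mulrC divfK // gamma_neq0.
  have [DD DD0 [nn Hnn]] := Hn (size m); exists DD => //; exists (\poly_(i < size m) nn i); split.
    apply: size_poly_eq; apply/eqP => E; have := Hnn (size m).-1; rewrite E gamma0 -lead_coefE (monicP mm) mulr1.
    have l : ((size m).-1 < size m)%N by rewrite prednK // ltnW.
    by move/(_ l)/esym/eqP; apply/negP; apply: gamma_neq0.
  move=> a; rewrite horner_poly horner_coef mulr_sumr.
  rewrite (big_morph gamma (@gammaD X) (gamma0 X)); apply: eq_bigr => i _.
  by rewrite gammaM gammaXn Hnn // mulrA.
have [||b0 [a [ib0 nb0 bN0]]] := @prime_value N (bad * Dm * Dz * DD).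
- by rewrite NE.1.
- by rewrite !mulf_neq0.
have [b [ib mb eb]] := monic_irr ib0.
have nb : ~~ (b %| bad * Dm * Dz * DD) by rewrite (eqp_dvdl _ eb).
have bN : b %| N.[a] by rewrite (eqp_dvdl _ eb).
have [n1 n2 n3 n4] : [/\ ~~ (b %| bad), ~~ (b %| Dm), ~~ (b %| Dz) & ~~ (b %| DD)].
  by split; apply: contra nb => h; [do 3! apply: dvdp_mulr|do 2! apply: dvdp_mulr; apply: dvdp_mull|apply: dvdp_mulr; apply: dvdp_mull|apply: dvdp_mull].
pose w0 := place_ex ib.
have im := HDm b ib w0 n2; have iga : vint w0 (gamma a) := vint_gamma ib w0 a.
have mla : ml w0 m.[gamma a].
  have : ml w0 (gamma DD * m.[gamma a]) by rewrite -NE.2 ml_gamma.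
  apply: unitM_ml; [exact: vint_gamma| |by rewrite ml_gamma].
  by rewrite horner_coef; apply: vint_sum => i _; apply: vintM => //; apply: vintX.
have [r rE] := closed_field_poly_normal m; rewrite (monicP mm) scale1r in rE.
have rm z : z \in r -> m.[z] = 0 by move=> zr; apply/eqP; rewrite rE -rootE root_prod_XsubC.
have [|al' al'r mal'] := @ml_prod _ _ w0 r (gamma a) iga (fun z zr => root_vint mm im (rm z zr)).
  by move: mla; rewrite rE horner_prod; under eq_bigr do rewrite hornerXsubC.
have [|f [ff fal]] := extend_hom (z := al) (z' := al') kS.
  by move=> p kp px; have [h' _ ->] := mdiv p kp px; rewrite hornerM rm // mulr0.
have [w wE] := place_pull w0 (ff : fixF f).
exists b, ib, w; split => // z zz iz.
have mlE x : ml w x = ml w0 (f x) by rewrite /ml /vgt wE fmorph_eq0.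
have ial : vint w al by apply: (root_vint mm (HDm b ib w n2)); rewrite ma.
have ral : red ib w al = red ib w (gamma a).
  apply/eqP; rewrite red_eq ?vint_gamma // mlE rmorphB fal fix_gamma // -mlN opprB //.
have [j [g [kg E Hg]]] := HDz z zz; have ig := Hg b ib w n3.
have rg : red ib w g.[al] ^+ (q ^ (size b).-1) = red ib w g.[al].
  rewrite redp_horner // !horner_coef expr_sumq; apply: eq_bigr => i _.
  rewrite exprMn coef_redp; congr (_ * _).
    by apply/eqP; rewrite -redX // red_eq ?vintX //; apply: inF_frob.
  by rewrite exprAC ral res_frob.
have rz : red ib w z ^+ (pc ^ j) = red ib w g.[al] by rewrite -redX // E.
have rz' : (red ib w z ^+ (q ^ (size b).-1)) ^+ (pc ^ j) = red ib w g.[al] by rewrite -exprM mulnC exprM rz rg.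
apply/eqP; rewrite -subr_eq0; have := exprBp j (red ib w z ^+ (q ^ (size b).-1)) (red ib w z).
by rewrite rz rz' subrr => /eqP; rewrite expf_eq0 => /andP [].
Qed.
End Ordinary.

Section Ordinary2.
Variable X : setting.
Local Notation Fq := (sFq X).
Local Notation L := (sL X).
Local Notation iota := (siota X).
Local Notation theta := (stheta X).
Local Notation pc := (spc X).
Local Notation q := (qq X).
Local Notation inF := (inF iota theta).
Local Notation gamma := (gammaA iota theta).
Local Notation hom := {rmorphism L -> L}.
Implicit Types (a : {poly Fq}) (x y z : L).

Lemma pred_double_gt (n : nat) : (1 < (n + n).-1)%N -> n = (n + n).-1 -> False.
Proof. lia. Qed.

(* If [P] were supersingular, [P/P(0)] would act as the square of the residual Frobenius [pi],
   which is trivial on the [t]-torsion; comparing [pi] on [t^k]-torsion with a square root of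
   [P/P(0)] congruent to [1] makes [P/P(0)] a square. *)
Lemma ordinary (D : dmodule L) (bad : {poly Fq}) : dth D = theta -> dg2 D != 0 -> bad != 0 ->
  (forall b (ib : irreducible_poly b) (w : place b), ~~ (b %| bad) -> intD w D /\ ~~ ml w (dg2 D)) ->
  exists b (ib : irreducible_poly b) (w : place b), [/\ b \is monic, ~~ (b %| bad) & ~~ ml w (ca D b (size b).-1)].
Proof.
move=> Et g20 bad0 Hgood.
have X0 : 'X != 0 :> {poly Fq} by rewrite polyX_eq0.
have iX : irreducible_poly ('X : {poly Fq}) by have := irredp_XsubC (0 : Fq); rewrite polyC0 subr0.
have gX : ga D 'X != 0 by rewrite ga_theta // gamma_neq0.
have [|t [ut st tE]] := tors_ex X0 gX; first by rewrite g20.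
(* Listing the coefficients makes the residual Frobenius commute with the reduced module; listing
   the t-torsion makes it trivial there. *)
have [b [ib [w [mb nbX H]]]] := @residual X (dg1 D :: dg2 D :: t) (bad * 'X) (mulf_neq0 bad0 X0).
have nb : ~~ (b %| bad) by apply: contra nbX => h; rewrite dvdp_mulr.
have nX : ~~ (b %| 'X) by apply: contra nbX => h; rewrite dvdp_mull.
have [iD n2] := Hgood b ib w nb; exists b, ib, w; split => //; apply/negP => ss.
set d := (size b).-1 in H ss; set Db := redd ib w D.
have [i0 i1 i2] := iD.
have rg2 : dg2 Db != 0 by rewrite /= red_eq0.
have rth : dth Db = red ib w theta by rewrite /= Et.
have gaD a : ga Db a = red ib w (gamma a) by rewrite /ga -ca0 -red_ca // ca0 Et gammaE.
have gX' : ga Db 'X != 0 by rewrite gaD red_eq0 ?vint_gamma // ml_gamma.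
have gXk k : ga Db ('X ^+ k) != 0 by rewrite gaX expf_neq0.
pose pi (y : L) := y ^+ (q ^ d).
have piA a y : pi (act Db a y) = act Db a (pi y).
  have [f fE] := frq_exists X d; have fc e : f (iota e) = iota e by rewrite fE iota_q.
  rewrite /pi -!fE act_hom //; congr (act _ a _); rewrite !fE /Db /redd /=.
  rewrite (H (dg1 D)) ?inE ?eqxx // (H (dg2 D)) ?inE ?eqxx ?orbT // Et.
  by have := res_frob ib w 'X; rewrite gammaXt => ->.
have piD x y : pi (x + y) = pi x + pi y by rewrite /pi exprDq.
have piN x : pi (- x) = - pi x by rewrite /pi exprNq.
have [|t' [ut' st' tE']] := tors_ex X0 gX'; first by rewrite rg2.
have pi1 y : act Db 'X y = 0 -> pi y = y.
  have ti x : x \in t -> vint w x by rewrite tE => /eqP; apply: (tors_int ib iD n2 X0).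
  have sub : {subset [seq red ib w x | x <- t] <= t'}.
    move=> z /mapP [x xt ->]; rewrite tE' -red_act ?ti //; move: xt; rewrite tE => /eqP ->.
    by rewrite red0.
  have inj : {in t &, injective (red ib w)}.
    move=> x x' xt xt' /eqP; rewrite red_eq ?ti // => m; apply/eqP; rewrite -subr_eq0; apply/eqP.
    apply: (ml_tors0 ib (a := 'X) iD _ _ m); first by rewrite ga_theta // ml_gamma.
    by rewrite actBr; move: xt xt'; rewrite !tE => /eqP -> /eqP ->; rewrite subrr.
  have u1 : uniq [seq red ib w x | x <- t] by rewrite map_inj_in_uniq.
  have := uniq_sub_eq u1 sub; rewrite size_map st st' /rk (negbTE g20) (negbTE rg2) => /(_ (leqnn _)) E yX.
  have : y \in [seq red ib w x | x <- t] by rewrite E tE' yX.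
  by move=> /mapP [x xt ->]; rewrite /pi; apply: H; rewrite ?ti // !inE xt !orbT.
have bE y : act Db b y = ca Db b (2 * d) * pi (pi y).
  have h : (2 * size b <= (2 * d).+2)%N by rewrite (Sd ib) mulnS.
  rewrite (actE Db y h) big_ord_recr /= big1 ?add0r; last first.
    move=> k _; have m := ss_ca ib Et iD ss (ltn_ord k).
  have e0 : ca Db b k = 0 by apply/eqP; rewrite /Db -red_ca // red_eq0 //; exact: ca_int.
  by rewrite e0 mul0r.
  by rewrite /pi -exprM -expnD mul2n addnn.
have [y0 y0X y0n] : exists2 y, act Db 'X y = 0 & y != 0.
  have : (1 < size t')%N by rewrite st' /rk (negbTE rg2) size_polyX -[X in (X < _)%N](exp1n (2 * 2.-1)) ltn_exp2r ?q_gt1.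
  case: (t') (tE') (ut') => [|x1 [|x2 s]] // E /= /andP [n12 _] _.
  have [z|n] := eqVneq x1 0; last by exists x1 => //; apply/eqP; rewrite -E mem_head.
  exists x2; first by apply/eqP; rewrite -E !inE eqxx orbT.
  by apply: contraNneq n12 => e; rewrite z e mem_head.
have b00 : b`_0 != 0.
  apply: contraNneq nX => e; have /factor_theorem [h hE] : root b 0 by rewrite rootE horner_coef0 e.
  rewrite polyC0 subr0 in hE; have [_ H1] := ib.
  have := H1 'X; rewrite size_polyX hE dvdp_mull // => /(_ isT isT) /eqp_dvdl <-; exact: dvdpp.
(* Evaluate at a nonzero t-torsion point, where phi_b acts as b(0) and [pi] as the identity. *)
have uE : ca Db b (2 * d) = iota b`_0.
  have E1 : act Db b y0 = iota b`_0 * y0.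
    have [h hE] : exists h, b = h * 'X + (b`_0)%:P.
      have /factor_theorem [h hE] : root (b - (b`_0)%:P) 0 by rewrite rootE !hornerE horner_coef0 subrr.
      by exists h; rewrite polyC0 subr0 in hE; rewrite -hE subrK.
    by rewrite {1}hE actDl actM y0X act0r add0r actC.
  by move: E1; rewrite bE !pi1 // => /(mulIf y0n).
pose be := (b`_0)^-1 *: b.
have beE y : act Db be y = pi (pi y).
  by rewrite actZl bE uE mulrA -rmorphM mulVf // rmorph1 mul1r.
have be1 : 'X %| be - 1.
  have : root (be - 1) 0 by rewrite rootE !hornerE horner_coef0 mulVf // subrr.
  by rewrite -dvdp_XsubCl polyC0 subr0.
have pcp : pc \in [pchar {poly Fq}] by apply: (rmorph_pchar (@polyC Fq)); exact: spcP.
have frob (g : {poly Fq}) n : g ^+ (q ^ n) - 1 = (g - 1) ^+ (q ^ n).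
  have pn : [pchar {poly Fq}].-nat (q ^ n)%N.
    by rewrite (eq_pnat _ (pcharf_eq pcp)) -(eq_pnat _ (pcharf_eq (pcharL X))) qq_ppart.
  by rewrite exprDn_pchar // exprNn_pchar // expr1n.
(* As [be] is 1 modulo X, its q^k-th power is 1 modulo X^k, so be^h is a square root of [be] modulo
   X^k. With k = d + 1 the X^k-torsion outnumbers the degrees compared below. *)
pose k := d.+1; pose h := (q ^ k).+1./2.
have oddq : odd (q ^ k).
  apply: contraT => ev; have := qq_ppart X k; rewrite (eq_pnat _ (pcharf_eq (pcharL X))) => pn.
  have := pnatP _ (qX_gt0 X k) pn 2 isT; rewrite dvdn2 ev => /(_ isT); rewrite inE => /eqP e2.
  by have := spc2 X; rewrite -e2.
have hE : (h + h = (q ^ k).+1)%N.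
  by rewrite /h addnn -[RHS]odd_double_half /= oddq.
have dXk : 'X ^+ k %| be ^+ h * be ^+ h - be.
  rewrite -exprD hE exprS -{3}[be]mulr1 -mulrBr dvdp_mull // frob.
  by apply: dvdp_trans (dvdp_exp2r _ be1); apply: dvdp_exp2l; apply: ltnW; apply: ltn_expl; exact: q_gt1.
pose g := be ^+ h %% 'X ^+ k.
have gh : 'X ^+ k %| be ^+ h - g by rewrite {1}(divp_eq (be ^+ h) ('X ^+ k)) addrK dvdp_mull.
have sg : (size g <= k)%N by rewrite -ltnS -[k.+1](size_polyXn Fq) ltn_modp expf_neq0.
have g1 : 'X %| g - 1.
  have -> : g - 1 = (be ^+ h - 1) - (be ^+ h - g) by ring.
  apply: dvdp_sub; first by rewrite -[in X in _ - X](expr1n _ h) subrXX dvdp_mulr.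
  by apply: dvdp_trans gh; rewrite -{1}(expr1 'X) dvdp_exp2l.
have two : (2%:R : L) != 0.
  apply/eqP => e; have /eqP : (1 : L) = 0.
    apply: (eq_opp_eq0 (X := X)); apply/eqP; rewrite -subr_eq0 opprK; apply/eqP; exact: e.
  by rewrite oner_eq0.
(* The two maps have the same square and commute, so [pi] equals minus phi_g on their difference z.
   A nonzero multiple of z in the t-torsion, where both act as the identity, would be its own
   opposite. *)
have key y : act Db ('X ^+ k) y = 0 -> pi y = act Db g y.
  move=> yk; have gg z : act Db ('X ^+ k) z = 0 -> act Db g (act Db g z) = pi (pi z).
    move=> zk; rewrite -beE -actM; apply: (act_eqmod (v := 'X ^+ k)) => //.
    have -> : g * g - be = (be ^+ h * be ^+ h - be) - (be ^+ h - g) * (be ^+ h + g) by ring.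
    by rewrite dvdp_sub // dvdp_mulr.
  set z := pi y - act Db g y; have zk : act Db ('X ^+ k) z = 0.
    by rewrite actBr -piA yk actCA yk act0r /pi expr0q subrr.
  have z1 : pi z = - act Db g z.
    by rewrite /z piD piN !piA actBr gg // opprB addrC.
  apply/eqP; rewrite -subr_eq0 -/z; apply: contraT => zn.
  have [j [_ j1 j0]] := ex_order zn zk; set u := act Db ('X ^+ j) z in j0.
  have uX : act Db 'X u = 0 by rewrite -actM -exprS.
  have : pi u = - act Db g u by rewrite /u piA z1 actNr actCA.
  rewrite pi1 // (act_eqmod g1 uX) act1 => /eq_opp_eq0 e; by rewrite e eqxx in j0.
have Xk0 : 'X ^+ k != 0 :> {poly Fq} by rewrite expf_neq0.
have [|tk [utk stk tkE]] := tors_ex Xk0 (gXk k); first by rewrite rg2.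
have sz : (size ('X^(q ^ d) - Pa Db g)%R <= q ^ (2 * d).+1)%N.
  apply: leq_trans (size_polyD _ _) _; rewrite size_polyN geq_max size_polyXn; apply/andP; split.
    by rewrite ltn_exp2l ?q_gt1 // ltnS mul2n -addnn leq_addr.
  have [->|g0] := eqVneq g 0; first by rewrite /Pa size_poly0 big_ord_recl big_ord0 /ca size_poly0 big_ord0 scale0r addr0 size_poly0.
  rewrite size_Pa2 // ltn_exp2l ?q_gt1 // ltnS leq_mul2l /=.
  by rewrite -ltnS prednK ?size_poly_gt0.
have pol0 : 'X^(q ^ d) - Pa Db g = 0.
  apply/eqP; apply: contraT => n0; have := @max_poly_roots _ _ tk n0 _ utk.
  rewrite stk /rk (negbTE rg2) size_polyXn /= => HH; have : (q ^ (2 * k) < q ^ (2 * d).+1)%N.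
    apply: leq_trans sz; apply: HH; apply/allP => y; rewrite tkE => /eqP yk.
    by rewrite rootE !hornerE horner_Pa -key // subrr.
  by rewrite ltn_exp2l ?q_gt1 // /k mulnS ltnS add2n ltnNge leqnSn.
have piG y : pi y = act Db g y.
  by have := congr1 (fun p => p.[y]) pol0; rewrite !hornerE horner_Pa => /eqP; rewrite subr_eq0 => /eqP.
have gb : g * g = be.
  apply/eqP; rewrite -subr_eq0; apply: contraT => n0.
  have P0 : Pa Db (g * g - be) != 0 by rewrite -size_poly_gt0 size_Pa2.
  have zero y : (Pa Db (g * g - be)).[y] = 0 by rewrite horner_Pa actBl actM beE -!piG subrr.
  have := size_Pa2 n0 rg2; have -> : Pa Db (g * g - be) = 0; last by rewrite size_poly0.
  apply/eqP; apply: contraT => _; have [f fE] := closed_field_poly_normal (Pa Db (g * g - be) * 'X + 1).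
  have sQ : size (Pa Db (g * g - be) * 'X + 1) = (size (Pa Db (g * g - be))).+1.
    by rewrite size_polyDl size_mulX // size_poly1 ltnS size_poly_gt0.
  have lQ : lead_coef (Pa Db (g * g - be) * 'X + 1) != 0 by rewrite lead_coef_eq0 -size_poly_gt0 sQ.
  case: f fE => [|x f] E.
    by move: sQ; rewrite E big_nil size_scale // size_poly1 => -[] /esym /eqP; rewrite size_poly_eq0 (negbTE P0).
  have := congr1 (fun p => p.[x]) E; rewrite big_cons hornerZ hornerM hornerXsubC subrr mul0r mulr0.
  by rewrite hornerD hornerM zero mul0r add0r hornerC => /eqP; rewrite oner_eq0.
have [sb irr] := ib; have ebe : be %= b by apply: eqp_scale; rewrite invr_eq0.
have sgg : size be = (size g + size g).-1.
  have g0 : g != 0 by apply: contraTneq sb => e; rewrite -(eqp_size ebe) -gb e mul0r size_poly0.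
  by rewrite -gb size_mul.
have gdiv : g %| b by rewrite -(eqp_dvdr _ ebe) -gb dvdp_mulr.
have [s1|s1] := eqVneq (size g) 1%N.
  by move: sb; rewrite -(eqp_size ebe) sgg s1.
have := irr g s1 gdiv => /eqp_size; rewrite -(eqp_size ebe) sgg.
have lb : (1 < (size g + size g).-1)%N by rewrite -sgg (eqp_size ebe).
exact: pred_double_gt lb.
Qed.
End Ordinary2.

(** * Finiteness *)

Section Assembly.
Variable X : setting.
Local Notation Fq := (sFq X).
Local Notation L := (sL X).
Local Notation iota := (siota X).
Local Notation theta := (stheta X).
Local Notation pc := (spc X).
Local Notation q := (qq X).
Local Notation inF := (inF iota theta).
Local Notation gamma := (gammaA iota theta).
Local Notation hom := {rmorphism L -> L}.
Implicit Types (a M v : {poly Fq}) (x y z : L) (Y Z : seq L).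

(** A denominator uniform in the place, so that [level1_none] can fix its polynomial before v. The
    characteristic polynomial of multiplication by x on k[y] has degree n, and two of its terms must
    tie in value; the difference of their indices divides n!. *)
Lemma KS_disc (s : seq L) : exists2 e : nat, (0 < e)%N & forall b (ib : irreducible_poly b) (w : place b) z,
  KS s z -> z != 0 -> exists n : int, e%:R * w z = n%:~R.
Proof.
elim: s => [|y s [e e0 He]].
  exists 1%N => // b ib w z kz z0; have [n E] := w_inF ib w kz z0; by exists n; rewrite mul1r.
have kS := KS_subr s; have [m [km mm my sm mdiv]] := minpoly_ex kS y.
have m0 : m != 0 by rewrite -size_poly_gt0 ltnW.
pose n := (size m).-1; have nE : size m = n.+1 by rewrite /n prednK // ltnW.
exists (e * n`!)%N; first by rewrite muln_gt0 e0 fact_gt0.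
move=> b ib w x [g kg xE] x0.
have /choice [r Hr] : forall j : 'I_n, exists r : {poly L}, [/\ over (KS s) r, (size r <= n)%N & r.[y] = x * y ^+ j].
  move=> j; have kgX : over (KS s) (g * 'X^j) by apply: overM => //; exact: overXn.
  have [u [r [ku kr E sr]]] := over_divmod kS kgX km m0.
  exists r; split => //; first by rewrite -ltnS -nE.
  have h : (g * 'X^j).[y] = (u * m + r).[y] by rewrite -E.
  by move: h; rewrite hornerD !hornerM my mulr0 add0r hornerXn -xE => ->.
pose M := \matrix_(i < n, j < n) (r j)`_i; pose p := char_poly M.
have krj j : over (KS s) (r j) by have [] := Hr j.
have kn1 : over (KS s) (-1) by rewrite -(sub0r 1); apply: overB; [|exact: over0|exact: over1].
have kp : over (KS s) p.
  rewrite /p /char_poly /determinant; apply: (over_sum kS) => sg _; apply: (overM kS); first exact: over_exp.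
  apply: (over_prod kS) => i _; rewrite !mxE; apply: (overB kS).
    by case: (i == _); rewrite ?mulr1n ?mulr0n; [exact: overX|exact: over0].
  by apply: (overC kS); exact: krj.
have px : p.[x] = 0.
  apply/eqP; rewrite -/(root p x) -eigenvalue_root_char; apply/eigenvalueP.
  have n0 : (0 < n)%N by rewrite -ltnS -nE.
  exists (\row_i y ^+ i); last first.
    by apply/eqP => /rowP /(_ (Ordinal n0)); rewrite !mxE expr0 => /eqP; rewrite oner_eq0.
  apply/rowP => j; rewrite !mxE; have [_ sr <-] := Hr j; rewrite (horner_coef_wide _ sr).
  by apply: eq_bigr => i _; rewrite !mxE mulrC.
have sp : size p = n.+1 by exact: size_char_poly.
pose F i := p`_i * x ^+ i.
have tie : exists i j, [/\ (i < j)%N, (j <= n)%N, p`_i != 0, p`_j != 0 & w (F i) = w (F j)].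
  apply: contrapT => H.
  have F0 i : (F i != 0) = (p`_i != 0) by rewrite mulf_eq0 expf_eq0 (negbTE x0) andbF orbF.
  have H1 i j : i \in seq.iota 0 n.+1 -> j \in seq.iota 0 n.+1 -> F i != 0 -> F j != 0 -> w (F i) = w (F j) -> i = j.
    rewrite !mem_iota !add0n !ltnS !F0 => /andP [_ li] /andP [_ lj] fi fj E.
    by case: (ltngtP i j) => // l; case: H; [exists i, j|exists j, i].
  have [A|[S0 _ _]] := w_sum_distinct (iota_uniq 0 n.+1) H1.
    have := A n; rewrite mem_iota leq0n add0n ltnSn => /(_ isT) /eqP; apply/negP; rewrite F0.
    have := char_poly_monic M; rewrite monicE lead_coefE -/p sp /= => /eqP ->; exact: oner_neq0.
  have sF : \sum_(i <- seq.iota 0 n.+1) F i = \sum_(i < n.+1) F i.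
    by rewrite -(big_mkord xpredT F) /index_iota subn0.
  by move/eqP: S0; apply; rewrite sF; apply: etrans px; rewrite horner_coef sp.
have [i [j [lij ljn pi pj E]]] := tie.
have [u uE] := He b ib w _ (kp i) pi; have [u' u'E] := He b ib w _ (kp j) pj.
have /dvdnP [k kE] : (j - i %| n`!)%N by apply: dvdn_fact; rewrite subn_gt0 lij /= (leq_trans _ ljn) // leq_subr.
exists (k%:Z * (u - u')).
have Ew : (j - i)%:R * w x = w p`_i - w p`_j.
  move: E; rewrite /F !pwM ?expf_neq0 // !wX // natrB ?(ltnW lij) // mulrBl => E; lra.
rewrite intrM rmorphB /= -uE -u'E kE !natrM -mulrBr -Ew -pmulrn; ring.
Qed.

Lemma int_almost (g : L) : exists2 D : {poly Fq}, D != 0 &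
  forall b (ib : irreducible_poly b) (w : place b), ~~ (b %| D) -> vint w g.
Proof.
have [m [km mm mg _ _]] := minpoly_ex (subr_inF X) g; have [D D0 H] := denominator km.
by exists D => // b ib w nb; apply: (root_vint mm (H b ib w nb)).
Qed.

Lemma good_almost (g1 g2 : L) : g2 != 0 -> exists2 B : {poly Fq}, B != 0 &
  forall b (ib : irreducible_poly b) (w : place b), ~~ (b %| B) ->
    intD w (Dmod theta g1 g2) /\ ~~ ml w (dg2 (Dmod theta g1 g2)).
Proof.
move=> g20; have [D1 D10 H1] := int_almost g1; have [D2 D20 H2] := int_almost g2.
have [D3 D30 H3] := int_almost g2^-1; exists (D1 * D2 * D3); first by rewrite !mulf_neq0.
move=> b ib w nb.
have n1 : ~~ (b %| D1) by apply: contra nb => h; do 2! apply: dvdp_mulr.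
have n2 : ~~ (b %| D2) by apply: contra nb => h; apply: dvdp_mulr; apply: dvdp_mull.
have n3 : ~~ (b %| D3) by apply: contra nb => h; apply: dvdp_mull.
split; first by split; [exact: vint_theta|exact: (H1 b ib w)|exact: (H2 b ib w)].
apply/negP => /= m; have := mlM (H3 b ib w n3) m; by rewrite mulVf // ml1.
Qed.

Lemma nth_root (n : nat) (u : L) : (0 < n)%N -> exists k : L, k ^+ n = u.
Proof.
move=> n0; have /closed_rootP [k] : size ('X^n - u%:P) != 1%N by rewrite size_XnsubC //; case: n n0.
by rewrite rootE hornerD hornerN hornerC hornerXn subr_eq0 => /eqP; exists k.
Qed.

(** Twisting normalises g1 to 1 when (q + 1) w(g1) is at most w(g2), and g2 to 1 otherwise. The
    comparison concerns the integrality of the j-invariant g1^(q+1) / g2. *)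
Lemma model_ex (D : dmodule L) b : dth D = theta -> dg2 D != 0 -> irreducible_poly b ->
  exists (w : place b) k, [/\ k != 0, intD w (twist k D) & semistable w (twist k D)].
Proof.
move=> Et g20 ib; pose w := place_ex ib; exists w.
have q1 : (0 < q.-1)%N by rewrite -subn1 subn_gt0 q_gt1.
have q2 : ((q ^ 2).-1 = q.-1 * q.+1)%N.
  have gen m : ((m.+1 ^ 2).-1 = m * m.+2)%N by rewrite -mulnn; nia.
  by have := gen q.-1; rewrite (prednK (q_gt0 X)).
have iT k : vint w (dth (twist k D)) by rewrite /= Et; exact: vint_theta.
have [/andP [h1 h2]|nh] := boolP ((dg1 D != 0) && (w (dg1 D) * (q.+1)%:R <= w (dg2 D))).
  have [k kE] := nth_root (dg1 D)^-1 q1.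
  have k0 : k != 0.
    by apply/eqP => k0; move: kE; rewrite k0 expr0n eqn0Ngt q1 => /esym/eqP; rewrite invr_eq0 (negbTE h1).
  have e1 : dg1 (twist k D) = 1 by rewrite /= kE mulfV.
  have e2 : vint w (dg2 (twist k D)).
    rewrite /= q2 exprM kE /vint vgeE ?mulf_neq0 ?expf_neq0 ?invr_eq0 //.
    by rewrite pwM ?expf_neq0 ?invr_eq0 // wX ?invr_eq0 // wV // mulrN subr_ge0 mulrC.
  exists k; split => //; first by split => //; rewrite e1 vint1.
  by rewrite /semistable e1 ml1 orbT.
have [|k kE] := nth_root (n := (q ^ 2).-1) (dg2 D)^-1; first by rewrite q2 muln_gt0 q1.
have k0 : k != 0.
  apply/eqP => k0; move: kE; rewrite k0 expr0n eqn0Ngt q2 muln_gt0 q1 => /esym/eqP.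
  by rewrite invr_eq0 (negbTE g20).
have e2 : dg2 (twist k D) = 1 by rewrite /= kE mulfV.
have e1 : vint w (dg1 (twist k D)).
  rewrite /=; have [->|h1] := eqVneq (dg1 D) 0; first by rewrite mul0r vint0.
  move: nh; rewrite h1 /= -ltNge => lt.
  rewrite -(@vint_exp X b w _ q.+1) // exprMn -exprM -q2 kE /vint vgeE ?mulf_neq0 ?expf_neq0 ?invr_eq0 //.
  by rewrite pwM ?expf_neq0 ?invr_eq0 // wX // wV // subr_ge0 mulrC ltW.
exists k; split => //; first by split => //; rewrite e2 vint1.
by rewrite /semistable e2 ml1.
Qed.

Lemma irr_ndvd (v b : {poly Fq}) : irreducible_poly v -> irreducible_poly b -> ~~ (b %| v) -> ~~ (v %| b).
Proof.
move=> [sv _] [_ ib]; apply: contra => vb; have s1 : size v != 1%N by case: (size v) sv => [|[]].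
by rewrite (eqp_dvdr _ (ib v s1 vb)).
Qed.

Lemma dvdp_primary n a M : (size a <= n)%N -> a != 0 ->
  (forall v j, irreducible_poly v -> v ^+ j.+1 %| a -> v ^+ j.+1 %| M) -> a %| M.
Proof.
elim: n a => [|n IH] a; first by rewrite leqn0 size_poly_eq0 => /eqP ->; rewrite eqxx.
move=> sa a0 H; have [s1|s1] := leqP (size a) 1.
  have : a %= 1 by rewrite -size_poly_eq1 eqn_leq s1 size_poly_gt0.
  by move=> /eqp_dvdl ->; exact: dvd1p.
have [b [m [a' [ib aE nb sa']]]] := factor_split s1.
have a'0 : a' != 0 by apply: contraNneq a0 => e; rewrite aE e mulr0.
rewrite aE Gauss_dvdp; last by apply: coprimep_expl; exact: irr_coprime.
apply/andP; split; first by apply: H => //; rewrite aE dvdp_mulr.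
apply: IH => //; first by rewrite -ltnS (leq_trans sa').
by move=> v j iv d; apply: H => //; rewrite aE dvdp_mull.
Qed.

(** With F the Q-power, this is F^n - phi_(b^i) on the reduction; relations between S and P^N become
    products and composites of such polynomials. *)
Definition rel (D : dmodule L) (b : {poly Fq}) n i : {poly L} := 'X^((q ^ (size b).-1) ^ n) - Pa D (b ^+ i).

Lemma horner_rel D b n i y : (rel D b n i).[y] = y ^+ ((q ^ (size b).-1) ^ n) - act D (b ^+ i) y.
Proof. by rewrite /rel hornerD hornerN hornerXn horner_Pa. Qed.

(** Ordinarity enters here: for i > 0 a nonzero b-torsion point is killed by phi_(b^i) but by no
    power of Frobenius. For i = 0 it suffices that no positive power of Frobenius fixes theta. *)
Lemma rel_size D b n i : irreducible_poly b -> (0 < n)%N -> (exists2 y, act D b y = 0 & y != 0) ->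
  (1 < size (rel D b n i))%N.
Proof.
move=> ib n0 [y y0 yn]; set R := rel D b n i.
have Qn : (1 < (q ^ (size b).-1) ^ n)%N.
  by rewrite -expnM -{1}(expn0 q) ltn_exp2l ?q_gt1 // muln_gt0 d_gt0.
have r0 : R.[0] = 0 by rewrite horner_rel act0r subr0 expr0n eqn0Ngt (ltnW Qn).
have rn : R != 0.
  apply/eqP => E; rewrite {}/R in E r0; case: i E r0 => [|i] E _.
    have h : (rel D b n 0).[theta] = 0 by rewrite E horner0.
    move/eqP: h; rewrite horner_rel expr0 act1 subr_eq0 -[X in _ == X](expr1 theta) => /eqP /theta_pow_inj e.
    by rewrite e in Qn.
  have h : (rel D b n i.+1).[y] = 0 by rewrite E horner0.
  by move/eqP: h; rewrite horner_rel exprSr actM y0 act0r subr0 expf_eq0 (negbTE yn) andbF.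
rewrite ltnNge; apply/negP => le; have E := size1_polyC le.
by move: r0 rn; rewrite E hornerC => ->; rewrite polyC0 eqxx.
Qed.

Lemma comp_neq0 (f g : {poly L}) : (1 < size f)%N -> (1 < size g)%N -> f \Po g != 0.
Proof.
move=> sf sg; apply/eqP => E; have := size_comp_poly f g; rewrite E size_poly0 /= => /esym/eqP.
by rewrite muln_eq0; move: sf sg; case: (size f) => [|[|?]] //; case: (size g) => [|[|?]].
Qed.

(** * Counting torsion points at a prime of good reduction *)

Section AtPrime.
Variables (b : {poly Fq}) (ib : irreducible_poly b) (w : place b) (D : dmodule L).
Hypotheses (Et : dth D = theta) (iD : intD w D) (n2 : ~~ ml w (dg2 D)).
Local Notation Dr := (redd ib w D).

(** The multiples of x have distinct residues, all roots of G; the bound uses only that q^n exceeds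
    n. *)
Lemma count_bound v k x (G : {poly L}) : G != 0 -> irreducible_poly v -> ~~ (b %| v) ->
  act D (v ^+ k.+1) x = 0 -> act D (v ^+ k) x != 0 -> (forall h, G.[red ib w (act D h x)] = 0) ->
  (k.+1 * (size v).-1 < size G)%N.
Proof.
move=> G0 iv nv x0 x1 HG.
have vk0 : v ^+ k.+1 != 0 by rewrite expf_neq0 ?irr_neq0.
have tx h : act D (v ^+ k.+1) (act D h x) = 0 by rewrite actCA x0 act0r.
have ti h : vint w (act D h x) by exact: (tors_int ib iD n2 vk0 (tx h)).
pose r := [seq red ib w (act D h x) | h <- polys X (k.+1 * (size v).-1)].
have ur : uniq r.
  rewrite map_inj_in_uniq ?uniq_polys // => h h' ph ph' /eqP; rewrite red_eq // -actBl => m.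
  apply: (multiples_uniq iv x0 x1 ph ph'); apply/eqP; rewrite /= -subr_eq0 -actBl; apply/eqP.
  apply: (ml_tors0 ib (a := v ^+ k.+1) iD _ (tx _) m).
  by rewrite ga_theta // ml_gamma //; apply: ndvd_exp.
have ar : all (root G) r by apply/allP => _ /mapP [h _ ->]; rewrite rootE HG.
have := max_poly_roots G0 ar ur; rewrite size_map size_polys; apply: leq_ltn_trans.
by apply: ltnW; apply: ltn_expl; exact: q_gt1.
Qed.

Lemma frob_at v k M : b \is monic -> irreducible_poly v -> ~~ (b %| v) -> M != 0 ->
  exists s : hom, [/\ fixF s, (forall j z, v ^+ j %| M -> act (Cm X) (v ^+ j) z = 0 -> s z = act (Cm X) b z) &
    forall y n i, act D (v ^+ k) y = 0 ->
      (rel Dr b n i).[red ib w y] = red ib w (hit n s y - act D (b ^+ i) y)].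
Proof.
move=> mb iv nv M0.
have g20 : dg2 D != 0 by apply: contra n2 => /eqP ->; rewrite /ml vgt0.
have vk0 : v ^+ k != 0 by rewrite expf_neq0 // irr_neq0.
have gv : ga D (v ^+ k) != 0 by rewrite ga_theta // gamma_neq0.
have [|t [_ _ tE]] := tors_ex vk0 gv; first by rewrite g20.
have [tc [_ tcE] _] := carl_tors M0.
have [Z cZ sZ] := clos_ex (t ++ tc).
have [s [sF sP]] := frobenius ib w cZ; exists s; split => //.
  move=> j z vM z0; apply: (frob_carl ib sF sP mb (M := v ^+ j)) => //; first exact: ndvd_exp.
  by apply: sZ; rewrite mem_cat tcE (act_dvd vM z0) eqxx orbT.
move=> y n i y0.
have yZ : y \in Z by apply: sZ; rewrite mem_cat tE y0 eqxx.
have yi : vint w y := tors_int ib iD n2 vk0 y0.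
have [_ hi hr] : [/\ hit n s y \in Z, vint w (hit n s y) & red ib w (hit n s y) = red ib w y ^+ ((q ^ (size b).-1) ^ n)].
  elim: n => [|n [hZ hi hr]]; first by rewrite expn0 expr1.
  rewrite hitE iterS -hitE; have [i' m] := sP _ hZ hi; split => //; first exact: cZ.
  by rewrite expnSr exprM -hr -redX //; apply/eqP; rewrite red_eq ?vintX.
by rewrite horner_rel redB ?act_int // red_act // hr.
Qed.

(** With 0 as its only root, the reduction of phi_b would be a monomial of degree q^(2d), against
    its nonzero coefficient at tau^d. *)
Lemma ord_tors : ~~ ml w (ca D b (size b).-1) -> exists2 y, act Dr b y = 0 & y != 0.
Proof.
move=> oc; have b0 := irr_neq0 ib; have [_ _ i2] := iD.
have rg2 : dg2 Dr != 0 by rewrite /= red_eq0.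
have cd : ca Dr b (size b).-1 != 0 by rewrite -red_ca // red_eq0 // ca_int.
apply: contrapT => H.
have allz y : act Dr b y = 0 -> y = 0 by move=> y0; apply/eqP; apply: contraT => yn; case: H; exists y.
have [r rE] := closed_field_poly_normal (Pa Dr b); have sP := size_Pa2 b0 rg2.
have lc : lead_coef (Pa Dr b) != 0 by rewrite lead_coef_eq0 -size_poly_gt0 sP.
have rz z : z \in r -> z = 0.
  by move=> zr; apply: allz; apply/eqP; rewrite -horner_Pa rE -rootE rootZ // root_prod_XsubC.
have E : Pa Dr b = lead_coef (Pa Dr b) *: 'X^(size r).
  rewrite {1}rE; congr (_ *: _); rewrite (eq_big_seq (fun=> 'X)).
    by rewrite big_const_seq count_predT iter_mulr_1.
  by move=> z zr; rewrite (rz z zr) polyC0 subr0.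
have sr : size r = (q ^ (2 * (size b).-1))%N by move: sP; rewrite E size_scale // size_polyXn => -[].
move: cd; rewrite -coef_Pa E coefZ coefXn sr eqn_exp2l ?q_gt1 // -{1}(mul1n (size b).-1) eqn_pmul2r ?d_gt0 //.
by rewrite mulr0 eqxx.
Qed.
End AtPrime.

Section Final.
Variables (g1 g2 c : L) (Y : seq L) (N0 : nat) (bad : {poly Fq}).
Local Notation D0 := (Dmod theta g1 g2).
Hypotheses (g20 : g2 != 0) (cc : weil_const D0 c) (Yg1 : g1 \in Y) (Yg2 : g2 \in Y) (Yc : c \in Y).
Hypotheses (N0Y : forall f, fixF f -> fixY Y (hit N0 f)) (N00 : (0 < N0)%N).
Hypothesis HmodK : forall b, irreducible_poly b -> exists (w : place b) k, model g1 g2 Y w k /\ KS Y k.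
Hypotheses (bad0 : bad != 0) (Hgood : forall b (ib : irreducible_poly b) (w : place b), ~~ (b %| bad) ->
  intD w D0 /\ ~~ ml w (dg2 D0)).
Local Notation N := (NN X N0).

Lemma Hmod0 b : irreducible_poly b -> exists (w : place b) k, model g1 g2 Y w k.
Proof. by move=> ib; have [w [k [m _]]] := HmodK ib; exists w, k. Qed.

Lemma NN_gt0 : (0 < N)%N.
Proof. by rewrite /NN !muln_gt0 N00 (prime_gt0 (pc_prime X)) -subn1 subn_gt0 q_gt1. Qed.

Lemma ord_prime (B : {poly Fq}) : B != 0 -> exists b (ib : irreducible_poly b) (w : place b),
  [/\ b \is monic, ~~ (b %| B), intD w D0, ~~ ml w (dg2 D0) & exists2 y, act (redd ib w D0) b y = 0 & y != 0].
Proof.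
move=> B0; have [|b [ib [w [mb nb ob]]]] := @ordinary X D0 (bad * B) erefl g20 (mulf_neq0 bad0 B0).
  by move=> b ib w nb; apply: Hgood => //; apply: contra nb => h; rewrite dvdp_mulr.
have nb1 : ~~ (b %| bad) by apply: contra nb => h; rewrite dvdp_mulr.
have [iD n2] := Hgood ib w nb1; exists b, ib, w; split => //; last exact: ord_tors.
by apply: contra nb => h; rewrite dvdp_mull.
Qed.

Lemma too_many v (G : {poly L}) : irreducible_poly v -> ~~ ((size G).+1 * (size v).-1 < size G)%N.
Proof. by move=> iv; rewrite -leqNgt; apply: leq_trans (leqnSn _) _; rewrite leq_pmulr // d_gt0. Qed.

Lemma nonss_none v (w : place v) kap : irreducible_poly v -> model g1 g2 Y w kap ->
  ~~ ml w (ca (twist kap D0) v (size v).-1) -> exists k, forall x, Kt Y x -> ~ exact g1 g2 v k x.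
Proof.
move=> iv mv ord; have [b [ib [wb [mb nb iD n2 yb]]]] := ord_prime (irr_neq0 iv).
(* The composite (F^N - P^N)(F^N - 1): the relation of [T_nonss] read modulo P. *)
pose G := rel (redd ib wb D0) b N N \Po rel (redd ib wb D0) b N 0.
have G0 : G != 0 by apply: comp_neq0; apply: rel_size => //; exact: NN_gt0.
exists (size G) => x kx [x0 x1]; have := too_many G iv; move/negP; apply.
apply: (@count_bound b ib wb D0 erefl iD n2 v _ x G G0 iv nb x0 x1) => h.
have [M M0 KMy] := Kt_act Yg1 Yg2 h kx; set y := act D0 h x in KMy *.
have y0 : act D0 (v ^+ (size G).+1) y = 0 by rewrite actCA x0 act0r.
have [s [sF sa sr]] := @frob_at b ib wb D0 erefl iD n2 v (size G).+1 M mb iv nb M0.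
have T := T_nonss g20 cc Yg1 Yg2 Yc N0Y Hmod0 iv mv sF (irr_ndvd iv ib nb) M0 sa ord KMy y0.
rewrite horner_comp (sr y N 0%N y0) expr0 act1 sr; first by rewrite T subrr red0.
by rewrite actBr y0 -(fix_act_D0 Yg1 Yg2 _ _ (fixYN N0Y sF)) y0 rmorph0 subrr.
Qed.

Lemma ss_none v (w : place v) kap : irreducible_poly v -> model g1 g2 Y w kap -> KS Y kap ->
  ~~ ml w (dg2 (twist kap D0)) -> ml w (ca (twist kap D0) v (size v).-1) ->
  exists k, forall x, Kt Y x -> ~ exact g1 g2 v k x.
Proof.
move=> iv mv kk n2v ss; apply: contrapT => H.
have ex k : exists2 x, Kt Y x & exact g1 g2 v k x.
  by apply: contrapT => H'; apply: H; exists k => x kx xx; apply: H'; exists x.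
have [e e0 eZ] := KS_disc Y.
have [lm /(_ ex) T] := T_ss g20 cc Yg1 Yg2 Yc N0Y Hmod0 iv mv kk n2v ss e0 (eZ v iv w).
have [b [ib [wb [mb nb iD n2 yb]]]] := ord_prime (irr_neq0 iv).
pose F i := rel (redd ib wb D0) b (2 * i.+1 * N * N) (N * (i.+1 * N)).
have F1 i : (1 < size (F i))%N by apply: rel_size => //; rewrite muln_gt0 NN_gt0 andbT muln_gt0 NN_gt0.
(* The l given by [T_ss] depends on the point and is only bounded by [lm], hence one factor for each
   possible value. *)
pose G := \prod_(i < lm) F i.
have G0 : G != 0 by apply/prodf_neq0 => i _; rewrite -size_poly_gt0 ltnW.
have [K [x kx [[x0 x1] Tx]]] := T (size G).
have := too_many G iv; move/negP; apply.
apply: (@count_bound b ib wb D0 erefl iD n2 v _ x G G0 iv nb x0 x1) => h; set y := act D0 h x.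
have y0 : act D0 (v ^+ (size G).+1) y = 0 by rewrite actCA x0 act0r.
have vK0 : v ^+ K != 0 by rewrite expf_neq0 // irr_neq0.
have [s [sF sa sr]] := @frob_at b ib wb D0 erefl iD n2 v (size G).+1 (v ^+ K) mb iv nb vK0.
have [[|l] [l0 ll El]] := Tx s b sF (irr_ndvd iv ib nb) (fun z => sa K z (dvdpp _)); first by [].
have Ey : hit (2 * l.+1 * N * N) s y = act D0 (b ^+ (N * (l.+1 * N))) y.
  have fS : fixY Y (hit (2 * l.+1 * N) (hit N s)) by apply: fixY_hit; exact: (fixYN N0Y sF).
  by rewrite -hitM /y exprM (fix_act_D0 Yg1 Yg2 h x fS) El actCA.
rewrite horner_prod (bigD1 (Ordinal ll)) //= sr // Ey subrr red0 mul0r //.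
Qed.

Lemma level_none v : irreducible_poly v -> exists k, forall x, Kt Y x -> ~ exact g1 g2 v k x.
Proof.
move=> iv; have [w [kap [mv kk]]] := HmodK iv.
have [ss|] := boolP (ml w (ca (twist kap D0) v (size v).-1)); last exact: nonss_none.
apply: (ss_none iv mv kk) => //; apply/negP => m2; have [_ _ iD st] := mv.
move: st; rewrite /semistable m2 /= => n1.
by have := mult_ca_unit iv iD m2 n1; rewrite ss.
Qed.

(** The polynomial [G] depends on e and one ordinary prime b but not on v, so [count_bound] bounds
    the degree of every v, apart from b and divisors of [bad], that has a v-torsion point in
    [Kt Y]. *)
Lemma level1_none : exists n, forall v, irreducible_poly v -> (n < size v)%N ->
  forall x, Kt Y x -> ~ exact g1 g2 v 0 x.
Proof.
have [e e0 eZ] := KS_disc Y.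
have [b [ib [wb [mb _ iD n2 yb]]]] := ord_prime (oner_neq0 _).
pose F i := rel (redd ib wb D0) b (e * N) (N * i) \Po rel (redd ib wb D0) b (e * N) (N * (e - i)).
pose G1 := rel (redd ib wb D0) b (2 * N) N; pose G := G1 * \prod_(i < e.+1) F i.
have G10 : G1 != 0.
  by rewrite -size_poly_gt0 ltnW //; apply: rel_size => //; rewrite muln_gt0 NN_gt0.
have G0 : G != 0.
  rewrite mulf_neq0 //; apply/prodf_neq0 => i _; apply: comp_neq0; apply: rel_size => //;
  by rewrite muln_gt0 e0 NN_gt0.
exists (size bad + size b + size G).+1 => v iv lv x kx [x0 x1].
have vbad : ~~ (v %| bad).
  apply/negP => /(dvdp_leq bad0); rewrite leqNgt (leq_ltn_trans _ lv) //.
  by apply: leqW; rewrite -addnA leq_addr.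
have vb : ~~ (v %| b).
  apply/negP => /(dvdp_leq (irr_neq0 ib)) le; have := leq_trans lv le.
  by rewrite ltnNge leqW // -addnA addnCA leq_addr.
have nb := irr_ndvd ib iv vb.
pose w := place_ex iv; have [iDw n2w] := Hgood iv w vbad.
have tw : twist 1 D0 = D0 by rewrite /twist /= !expr1n !mulr1.
have mv : model g1 g2 Y w 1.
  by split; rewrite ?oner_neq0 ?tw // /semistable ?n2w // => f _; rewrite rmorph1.
have k1 : act D0 (v ^+ 1) x = 0 by [].
have := @count_bound b ib wb D0 erefl iD n2 v 0 x G G0 iv nb x0 x1.
move=> HH; have : ((size v).-1 < size G)%N; last first.
  apply/negP; rewrite -leqNgt -ltnS prednK ?size_poly_gt0 ?irr_neq0 //.
  by apply: leq_trans lv; rewrite ltnS; apply: leqW; rewrite leq_addl.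
rewrite mul1n in HH; apply: HH => h.
have [M M0 KMy] := Kt_act Yg1 Yg2 h kx; set y := act D0 h x in KMy *.
have y0 : act D0 (v ^+ 1) y = 0 by rewrite actCA k1 act0r.
have y1 : act D0 v y = 0 by rewrite -(expr1 v).
have [s [sF sa sr]] := @frob_at b ib wb D0 erefl iD n2 v 1 M mb iv nb M0.
have n2w' : ~~ ml w (dg2 (twist 1 D0)) by rewrite tw.
have eca : ca (twist 1 D0) v (size v).-1 != 0 -> exists n : int, e%:R * w (ca (twist 1 D0) v (size v).-1) = n%:~R.
  move=> c0; apply: eZ => //; rewrite tw; apply: ca_sub; rewrite /=; [exact: KS_subr| |exact: KS_mem|exact: KS_mem].
  by apply: (sbF (KS_subr Y)); exact: inF_theta.
have fS := fixYN N0Y sF.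
have [T|[m lm T]] := T_level1 g20 cc Yg1 Yg2 Yc N0Y Hmod0 iv mv sF vb M0 sa n2w' e0 eca KMy y1.
  have E : hit (2 * N) s y = act D0 (b ^+ N) y by rewrite -hitM.
  by rewrite /G hornerM sr // E subrr red0 mul0r.
rewrite /G hornerM horner_prod (bigD1 (Ordinal (lm : (m < e.+1)%N))) //= /F horner_comp.
pose z := hit (e * N) s y - act D0 (b ^+ (N * (e - m))) y.
rewrite (sr y (e * N)%N (N * (e - m))%N y0) -/z.
have zE : z = hit e (hit N s) y - act D0 ((b ^+ N) ^+ (e - m)) y by rewrite hitM -exprM.
have z0 : act D0 (v ^+ 1) z = 0.
  rewrite zE actBr -(fix_act_D0 Yg1 Yg2 _ _ (fixY_hit e fS)) y0 rmorph0 sub0r actCA y0 act0r oppr0 //.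
have Tz : hit (e * N) s z = act D0 (b ^+ (N * m)) z by rewrite -hitM exprM zE; exact: T.
by rewrite (sr z (e * N)%N (N * m)%N z0) Tz subrr red0 mul0r mulr0.
Qed.

(** Only primes of bounded degree occur, each to a bounded power, so M is a finite product. In an
    annihilator of x of least degree, every prime power factor v^(j+1) is the exact order of a
    multiple of x, and hence divides M. *)
Lemma annihilator : exists2 M, M != 0 & forall x a, Kt Y x -> a != 0 -> act D0 a x = 0 -> act D0 M x = 0.
Proof.
have [n Hn] := level1_none.
have /choice [kv Hkv] : forall v, exists k, irreducible_poly v -> forall x, Kt Y x -> ~ exact g1 g2 v k x.
  by move=> v; have [iv|niv] := pselect (irreducible_poly v); [have [k Hk] := level_none iv; exists k|exists 0%N].
pose M := \prod_(v <- polys X n | v != 0) v ^+ kv v.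
have M0 : M != 0 by rewrite prodf_seq_neq0; apply/allP => v _; apply/implyP => v0; rewrite expf_neq0.
exists M => //.
have key v j x : irreducible_poly v -> Kt Y x -> exact g1 g2 v j x -> v ^+ j.+1 %| M.
  move=> iv kx [x0 x1].
  have sv : (size v <= n)%N.
    rewrite leqNgt; apply/negP => lt; apply: (Hn v iv lt (act D0 (v ^+ j) x)); first exact: Kt_act.
    by split; [rewrite -actM -exprD add1n|rewrite expr0 act1].
  have lt : (j < kv v)%N.
    rewrite ltnNge; apply/negP => le; apply: (Hkv v iv (act D0 (v ^+ (j - kv v)) x)); first exact: Kt_act.
    by split; rewrite -actM -exprD ?addSn subnKC.
  rewrite /M (big_rem v) ?mem_polys //= (irr_neq0 iv) dvdp_mulr //; exact: dvdp_exp2l.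
move=> x a kx; have [m] := ubnP (size a); elim: m a => [|m IH] a // lm a0 ax.
have [[a' [a'0 sa' a'x]]|nmin] := pselect (exists a', [/\ a' != 0, (size a' < size a)%N & act D0 a' x = 0]).
  by apply: (IH a') => //; apply: leq_trans sa' _; rewrite -ltnS.
apply: (act_dvd _ ax); apply: (dvdp_primary (leqnn _) a0) => v j iv va.
have [u uE] : exists u, a = u * v ^+ j.+1 by exists (a %/ v ^+ j.+1); rewrite divpK.
have aE : a = v * (v ^+ j * u) by rewrite uE exprS; ring.
apply: (key v j (act D0 u x) iv); first exact: Kt_act.
split; first by rewrite -actM mulrC -uE.
apply/eqP => e; apply: nmin; exists (v ^+ j * u); split => //; last by rewrite actM.
  by apply: contraNneq a0 => e'; rewrite aE e' mulr0.
have e0 : v ^+ j * u != 0 by apply: contraNneq a0 => e'; rewrite aE e' mulr0.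
rewrite aE (size_mul (irr_neq0 iv) e0).
by have [sv _] := iv; move: sv; case: (size v) => [|[|k]] // _; rewrite !addSn /= ltnS leq_addl.
Qed.
End Final.
End Assembly.

Theorem mainTheorem15
  (p q : nat) (Fq : finFieldType) (L : closedFieldType)
  (iota : {rmorphism Fq -> L}) (theta : L)
  (Hp : p \in [pchar Fq]) (Hq : #|Fq| = q)
  (Htransc : forall a : {poly Fq}, gammaA iota theta a = 0 -> a = 0)
  (Halg : forall x : L, algebraic_over_F iota theta x)
  (K : L -> Prop) (HK : finite_ext_of_F iota theta K)
  (g1 g2 : L) (Hg1 : K g1) (Hg2 : K g2) (Hg2nz : g2 != 0)
  (Hp2 : p != 2%N) :
  exists s : seq L, forall x : L,
    Ktilde iota theta q K x ->
    is_torsion iota (rank2_t theta q g1 g2) x -> x \in s.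
Proof.
pose X := @Setting Fq L iota theta p Hp Hp2 Htransc Halg.
have qE : q = qq X by rewrite -Hq.
rewrite qE; have [_ [KF [n [s [_ Kspan]]]]] := HK.
pose D0 := Dmod theta g1 g2.
have q1 : (0 < (qq X).-1)%N by rewrite -subn1 subn_gt0 q_gt1.
have [c cE] := @nth_root X _ (- g2^-1) q1.
have cc : weil_const (X := X) D0 c.
  have c0 : c != 0.
    by apply/eqP => c0; move: cE; rewrite c0 expr0n eqn0Ngt q1 => /esym/eqP; rewrite oppr_eq0 invr_eq0 (negbTE Hg2nz).
  split => //=; rewrite -(prednK (q_gt0 X)) exprS [_.-1]/= cE mulrN mulrN mulrCA mulfV // mulr1 //.
have [bad bad0 Hgood] := @good_almost X g1 g2 Hg2nz.
have /choice [kap Hkap] : forall b : {poly sFq X}, exists k : sL X, irreducible_poly b ->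
    exists w : place b, [/\ k != 0, intD w (twist k D0) & semistable w (twist k D0)].
  move=> b; have [ib|nib] := pselect (irreducible_poly b); last by exists 0.
  by have [w [k Hk]] := @model_ex X D0 b erefl Hg2nz ib; exists k => _; exists w.
(* A finite list suffices: twisting constants are only taken for polynomials of size at most
   [size bad], hence at all primes dividing [bad], and the constant 1 serves the other places. *)
pose Y := g1 :: g2 :: c :: ([seq s i | i <- enum 'I_n] ++ [seq kap b | b <- polys X (size bad)]) : seq (sL X).
have [Zc cZ sZ] := @clos_ex X Y.
pose N0 := (size Zc)`!.
have N0Y f : fixF f -> fixY Y (hit N0 f).
  move=> fF; split; first exact: fixes_hit.
  by move=> y yY; rewrite hitE; apply: closed_order => //; exact: sZ.
have Hmod (b : {poly sFq X}) : irreducible_poly b -> exists (w : place b) (k : sL X), model (X := X) g1 g2 Y w k /\ KS (X := X) Y k.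
  move=> ib; have [bb|nb] := boolP (b %| bad).
    have [w [k0 iw st]] := Hkap b ib; exists w, (kap b).
    have kY : kap b \in Y.
      by rewrite !inE mem_cat map_f ?orbT // mem_polys dvdp_leq.
    split; last exact: KS_mem.
    by split => // f [_]; apply.
  have tw : twist (X := X) 1 D0 = D0 by rewrite /twist /= !expr1n !mulr1.
  exists (place_ex ib), 1; have [iD n2] := Hgood b ib (place_ex ib) nb.
  split; last by apply: sb1; exact: KS_subr.
  by split; rewrite ?oner_neq0 ?tw // /semistable ?n2 // => f _; rewrite rmorph1.
have Yg1 : g1 \in Y by rewrite !inE eqxx.
have Yg2 : g2 \in Y by rewrite !inE eqxx orbT.
have Yc : c \in Y by rewrite !inE eqxx !orbT.
have [M M0 HM] := @annihilator X g1 g2 c Y N0 bad Hg2nz cc Yg1 Yg2 Yc N0Y (fact_gt0 _) Hmod bad0 Hgood.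
have gM : ga (X := X) D0 M != 0 by apply: (@gamma_neq0 X).
have [|t [_ _ tE]] := @tors_ex X D0 M M0 gM; first by rewrite Hg2nz.
exists t => x Hx [a [a0 ax]]; rewrite tE; apply/eqP; apply: (HM x a) => //.
have kS := Kt_subr Y; have kF := subr_subfield kS.
(* The field [Ktilde] is the smallest one with the given generators, so it is enough that the
   subfield [Kt Y] contains K and the Carlitz torsion. *)
apply: Hx => // y [/Kspan [cf [cF ->]]|Fy].
  apply: (sb_sum kS) => i _; apply: (sbM kS); first exact: (sbF kS).
  by apply: Kt_mem; rewrite !inE mem_cat map_f ?orbT // mem_enum.
apply: Fy => // z [iz|[_ [u [u0 uz]]]]; first exact: (sbF kS).
have dtC : dt (Cm X) = carlitz_t theta (qq X).
  by apply/funext => z'; rewrite dtE /carlitz_t /= mul1r mul0r addr0.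
apply: (@Kt_carl X Y u z u0).
by rewrite /act dtC.
Qed.
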